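(* (a) Let $\eta>0$ be such that $\sqrt[3]{c\eta}>1000\max(\nu^{-1/2},1)$, and let $k_2=\bigl\lfloor\frac1{10}\sqrt[3]{c\eta\pi/2}\bigr\rfloor$. Then the solution $(\theta,G)$ of the wave perturbation system at $y$-frequency $\eta$ with initial data $\theta_l(0)=\delta_{lk_2}$, $G_l(0)=0$ satisfies, for all $t>2\eta$, \[ \exp\bigl(\sqrt[3]{c\eta}\bigr)\|\theta(0)\|_X\le\|\theta(t)\|_X\le\|\theta(t)\|_X+\|G(t)\|_X\le\exp\bigl(50\sqrt[3]{c\eta}\bigr)\|\theta(0)\|_X, \] and $\theta(t)$ converges in $X$ as $t\to\infty$. (b) For every $\sigma\in\mathbb R$ there exist $C'>0$ and a measurable family of initial data $(\theta_0(\eta))_{\eta\in\mathbb R}\subset X$, with $G_0(\eta)=0$ for all $\eta$, such that $\int_{\mathbb R}\exp(C'|\eta|^{1/3})\|\theta_0(\eta)\|_X^2d\eta<\infty$ and such that the corresponding solutions $\theta(t,\eta)$ (solving for each $\eta$ the wave perturbation system at $y$-frequency $\eta$) converge in $H^sX$ as $t\to\infty$ for every $s<\sigma$, while $\|\theta(t)\|_{H^sX}\to\infty$ as $t\to\infty$ for every $s>\sigma$.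
   Context: Standing assumptions: fix $\nu>0$, $0<c<0.001$, and a continuous $f:[0,\infty)\to\mathbb R$ with $|f(t)|\le \frac{2c}{1+t^2}$. For a real parameter $\eta$ (the frequency in $y$), $l\in\mathbb Z$ and $t\ge0$ put, when $l\pm1\neq0$, \[ c_l^{\pm}(t)=\frac{c\eta}{(l\pm1)^3}\frac{1}{\bigl(1+(\frac{\eta}{l\pm1}-t)^2\bigr)^2},\qquad d_l^{\pm}(t)=\frac{c\eta}{(l\pm1)^3}\frac{1}{1+(\frac{\eta}{l\pm1}-t)^2}, \] and $c_l^\pm=d_l^\pm=0$ if $l\pm1=0$. The wave perturbation system at $y$-frequency $\eta$ is the linear system for complex sequences $(\theta_l(t))_{l\in\mathbb Z\setminus\{0\}}$, $(G_l(t))_{l\in\mathbb Z\setminus\{0\}}$ (with $\theta_0\equiv G_0\equiv0$): \[ \dot\theta_l=c_l^+\theta_{l+1}+c_l^-\theta_{l-1}+d_l^+G_{l+1}+d_l^-G_{l-1}, \] \[ \dot G_l=-\nu\bigl(l^2+(\eta-lt)^2\bigr)G_l+\frac{f(t)}{2c}\,i l\bigl(d_l^+G_{l+1}+d_l^-G_{l-1}+c_l^+\theta_{l+1}+c_l^-\theta_{l-1}\bigr)+\frac{2(\frac{\eta}{l}-t)}{(1+(\frac{\eta}{l}-t)^2)^2}\theta_l+\frac{c_l^+\theta_{l+1}+c_l^-\theta_{l-1}+d_l^+G_{l+1}+d_l^-G_{l-1}}{1+(\frac{\eta}{l}-t)^2}. \] (This is the Fourier representation, in coordinates $(x-ty,y)$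 and at $x$-frequency $l$, $y$-frequency $\eta$, of the Boussinesq equations without thermal diffusion linearized around the wave $\omega_*=-1+f(t)\cos(x-ty)$, $\theta_*=2c\nu\sin(x-ty)$.) The space $X$: fix a weight $\lambda:\mathbb Z\to(0,\infty)$ with $\sup_{l}\lambda(l\pm1)/\lambda(l)<2$; $X$ is the Hilbert space of sequences $u=(u_l)$ with $\|u\|_X^2=\sum_l\lambda(l)^2|u_l|^2<\infty$. For a family $u=(u(\eta))_{\eta\in\mathbb R}\subset X$, $\|u\|_{H^sX}^2=\int_{\mathbb R}(1+|\eta|^2)^s\|u(\eta)\|_X^2\,d\eta$. *)

(* Defs.v *)
From Stdlib Require Import Reals ZArith.
From Coquelicot Require Import Coquelicot.

Open Scope R_scope.

Definition cbrt (x : R) : R :=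
  if Rlt_dec 0 x then Rpower x (1/3)
  else if Rlt_dec x 0 then - Rpower (- x) (1/3) else 0.

(** c^{pm}_l(t) with m = l +- 1 (zero when m = 0) *)
Definition ccoef (c eta : R) (m : Z) (t : R) : R :=
  if Z.eq_dec m 0 then 0
  else c * eta / (IZR m) ^ 3 / (1 + (eta / IZR m - t) ^ 2) ^ 2.

(** d^{pm}_l(t) with m = l +- 1 (zero when m = 0) *)
Definition dcoef (c eta : R) (m : Z) (t : R) : R :=
  if Z.eq_dec m 0 then 0
  else c * eta / (IZR m) ^ 3 / (1 + (eta / IZR m - t) ^ 2).

Definition coupling (c eta : R) (th G : Z -> C) (l : Z) (t : R) : C :=
  Cplus (Cplus (Cmult (RtoC (ccoef c eta (l + 1) t)) (th (l + 1)%Z))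
               (Cmult (RtoC (ccoef c eta (l - 1) t)) (th (l - 1)%Z)))
        (Cplus (Cmult (RtoC (dcoef c eta (l + 1) t)) (G (l + 1)%Z))
               (Cmult (RtoC (dcoef c eta (l - 1) t)) (G (l - 1)%Z))).

Definition rhs_theta (c eta : R) (th G : Z -> C) (l : Z) (t : R) : C :=
  coupling c eta th G l t.

Definition rhs_G (nu c : R) (f : R -> R) (eta : R) (th G : Z -> C)
    (l : Z) (t : R) : C :=
  let A := coupling c eta th G l t in
  let q := eta / IZR l - t in
  Cplus
   (Cplus (Cmult (RtoC (- nu * ((IZR l) ^ 2 + (eta - IZR l * t) ^ 2))) (G l))
          (Cmult (Cmult (RtoC (f t / (2 * c))) (Cmult Ci (RtoC (IZR l)))) A))
   (Cplus (Cmult (RtoC (2 * q / (1 + q ^ 2) ^ 2)) (th l))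
          (Cmult (RtoC (/ (1 + q ^ 2))) A)).

(** sums over Z of (nonnegative) real families *)
Definition Zterm (a : Z -> R) (n : nat) : R :=
  a (Z.of_nat n) + a (- Z.of_nat n - 1)%Z.

Definition Xterm (lam : Z -> R) (u : Z -> C) (l : Z) : R :=
  (lam l) ^ 2 * (Cmod (u l)) ^ 2.
Definition inX (lam : Z -> R) (u : Z -> C) : Prop :=
  ex_series (Zterm (Xterm lam u)).
Definition normX2 (lam : Z -> R) (u : Z -> C) : R :=
  Series (Zterm (Xterm lam u)).
Definition normX (lam : Z -> R) (u : Z -> C) : R := sqrt (normX2 lam u).

Definition diffseq (u v : Z -> C) : Z -> C := fun l => Cminus (u l) (v l).

Definition is_solution (nu c : R) (f : R -> R) (lam : Z -> R) (eta : R)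
    (th G : R -> Z -> C) : Prop :=
  (forall t, 0 <= t -> th t 0%Z = RtoC 0 /\ G t 0%Z = RtoC 0) /\
  (forall t l, 0 < t -> l <> 0%Z ->
     is_derive (fun s => th s l) t (rhs_theta c eta (th t) (G t) l t) /\
     is_derive (fun s => G s l) t (rhs_G nu c f eta (th t) (G t) l t)) /\
  (forall l, filterlim (fun s => th s l) (at_right 0) (locally (th 0 l)) /\
             filterlim (fun s => G s l) (at_right 0) (locally (G 0 l))) /\
  (forall t, 0 <= t -> inX lam (th t) /\ inX lam (G t)) /\
  (forall T, 0 <= T -> exists M, forall t, 0 <= t <= T ->
     normX lam (th t) + normX lam (G t) <= M).

Definition X_converges (lam : Z -> R) (u : R -> Z -> C) : Prop :=
  exists v, inX lam v /\
    is_lim (fun t => normX lam (diffseq (u t) v)) p_infty 0.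

Definition delta_seq (k : Z) : Z -> C :=
  fun l => if Z.eq_dec l k then RtoC 1 else RtoC 0.

Definition standing (nu c : R) (f : R -> R) (lam : Z -> R) : Prop :=
  0 < nu /\ 0 < c < 0.001 /\
  (forall t, 0 < t -> continuous f t) /\
  filterlim f (at_right 0) (locally (f 0)) /\
  (forall t, 0 <= t -> Rabs (f t) <= 2 * c / (1 + t ^ 2)) /\
  (forall l, 0 < lam l) /\
  (exists q, q < 2 /\ forall l, lam (l + 1)%Z <= q * lam l /\
                                lam (l - 1)%Z <= q * lam l).

Definition ReC (z : C) : R := Re z.
Definition ImC (z : C) : R := Im z.

From mathcomp Require Import all_boot all_order all_algebra.
From mathcomp Require Import all_classical all_reals all_analysis.
From mathcomp Require Import Rstruct Rstruct_topology.

Definition RR : realType := R.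

Definition measR (F : R -> R) : Prop :=
  measurable_fun [set: RR] (F : RR -> RR).

Definition intR (F : R -> R) : \bar RR :=
  (\int[@lebesgue_measure RR]_x (F x)%:E)%E.

Definition int_finite (F : R -> R) : Prop := (intR F < +oo)%E.
Definition int_lt (F : R -> R) (e : R) : Prop := (intR F < e%:E)%E.
Definition int_gt (F : R -> R) (M : R) : Prop := (M%:E < intR F)%E.

Definition meas_family (u : R -> Z -> C) : Prop :=
  forall l, measR (fun eta => ReC (u eta l)) /\ measR (fun eta => ImC (u eta l)).

Definition HsX_integrand (lam : Z -> R) (s : R) (u : R -> Z -> C) : R -> R :=
  fun eta => Rmult (Rpower (Rplus 1 (pow eta 2)) s) (normX2 lam (u eta)).

Definition HsX_converges (lam : Z -> R) (s : R) (U : R -> R -> Z -> C) : Prop :=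
  exists V : R -> Z -> C,
    (forall eta, inX lam (V eta)) /\ meas_family V /\
    int_finite (HsX_integrand lam s V) /\
    forall e, Rlt 0 e -> exists T, forall t, Rlt T t ->
      int_lt (HsX_integrand lam s (fun eta => diffseq (U t eta) (V eta))) e.

Definition HsX_diverges (lam : Z -> R) (s : R) (U : R -> R -> Z -> C) : Prop :=
  forall M, exists T, forall t, Rlt T t -> int_gt (HsX_integrand lam s (U t)) M.

(* Main.v *)
Require Import Defs.
From Stdlib Require Import Reals ZArith Lra Lia Psatz FunctionalExtensionality.
From Coquelicot Require Import Coquelicot.
Open Scope R_scope.

(* Put p_l = 1 / (1 + (eta/l - t)^2) and H_l = G_l - p_l theta_l.  The resonant forcing of G_l then
   disappears: theta_l' is a sum over j = l - 1, l + 1 of d_j (2 p_j theta_j + H_j), while H_l is damped at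
   rate nu l^2 / p_l and driven by - nu l^2 theta_l, so that it relaxes towards - p_l theta_l.
   Around the time eta/m only the mode m is resonant.  A bootstrap in a cone |theta_l| <~ 4^-|l-m| |theta_m|
   shows that theta_m is almost frozen there, that its reaction H_m cancels only a fraction of the forcing,
   because a relaxation lags behind the resonance, and that theta_{m-1} leaves the window with size
   comparable to kappa_m |theta_m|, where kappa_m = c eta pi / (2 m^3).  Starting from the mode
   k = floor (x / 10), x^3 = c eta pi / 2, the chain of resonances k, k - 1, ..., 1 multiplies the amplitude
   by about x^{3k} / (k!)^3, which lies between two exponentials of (c eta)^{1/3}.  After the last resonance
   theta converges, at rate O(eta / t).
   For the second part, the solutions are superposed over eta with the mode 2 normalised so that its limit
   has modulus squared (1 + eta^2)^{-sigma} / eta; the data are then exponentially small in eta^{1/3}.  The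
   rate O(eta / t) gives convergence below the exponent sigma by a pointwise bound of the integrand, and
   above sigma the integral up to eta = t / 2 dominates that of 1 / eta.  The limit is measurable in eta as
   a limit of Picard iterates. *)

(** * Calculus for real and complex functions *)

(** The damping is unbounded in l while nu is arbitrary. It is never estimated: it enters only as an
    integrating factor, so that all constants are independent of nu. The divisor 10 makes x/m >= 10
    for every m <= k, hence kappa_m >= 1000: theta_{m-1} leaves the window at least 900 times larger
    than theta_m, and a cone around m turns into a cone around m - 1. The modes above k resonate
    earlier, with kappa_j <= 1000; a much steeper geometric weight keeps them negligible. The ratio
    4 of the cone beats the factor 2 by which the weight of X may vary from one mode to the next,
    and leaves a factor 2 for summation. *)

Lemma le_of_derive (h h' : R -> R) (a b : R) : a <= b ->
  (forall t, a <= t <= b -> continuous h t) ->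
  (forall t, a < t < b -> is_derive h t (h' t)) ->
  (forall t, a < t < b -> 0 <= h' t) -> h a <= h b.
Proof.
intros Hab Hc Hd Hp.
(* The mean value theorem may return an endpoint, where nothing is known about [h']; the extension
   by 0 has the right sign there. *)
pose (df := fun x => if Rlt_dec a x then if Rlt_dec x b then h' x else 0 else 0).
destruct (MVT_gen h a b df) as [x [_ Hx]].
{ intros x; rewrite Rmin_left, Rmax_right by lra; intros Hx.
  unfold df; destruct (Rlt_dec a x); [|lra]; destruct (Rlt_dec x b); [|lra]; apply Hd; lra. }
{ intros x; rewrite Rmin_left, Rmax_right by lra; intros.
  apply continuity_pt_filterlim, Hc; lra. }
assert (0 <= df x).
{ unfold df; destruct (Rlt_dec a x); [|lra]; destruct (Rlt_dec x b); [|lra]; apply Hp; lra. }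
assert (0 <= df x * (b - a)) by (apply Rmult_le_pos; lra). lra.
Qed.

Lemma is_derive_Re (y : R -> C) t (l : C) : is_derive y t l -> is_derive (fun s => Re (y s)) t (Re l).
Proof.
intros H; unfold is_derive in *.
apply (filterdiff_ext_lin _ (fun h : R => Re (scal h l))); [|intros h; reflexivity].
apply (filterdiff_comp' (K := R_AbsRing) y (fun z : C => Re z) t _ (fun z => Re z)); [exact H|].
apply filterdiff_linear; exact is_linear_fst.
Qed.

Lemma is_derive_Im (y : R -> C) t (l : C) : is_derive y t l -> is_derive (fun s => Im (y s)) t (Im l).
Proof.
intros H; unfold is_derive in *.
apply (filterdiff_ext_lin _ (fun h : R => Im (scal h l))); [|intros h; reflexivity].
apply (filterdiff_comp' (K := R_AbsRing) y (fun z : C => Im z) t _ (fun z => Im z)); [exact H|].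
apply filterdiff_linear; exact is_linear_snd.
Qed.

Lemma is_derive_C (u v : R -> R) t a b : is_derive u t a -> is_derive v t b ->
  is_derive (fun s => (u s, v s) : C) t ((a, b) : C).
Proof.
intros Hu Hv.
assert (H1 := is_derive_scal_l (V := prod_NormedModule R_AbsRing R_NormedModule R_NormedModule)
   u t a ((1, 0) : C) Hu).
assert (H2 := is_derive_scal_l (V := prod_NormedModule R_AbsRing R_NormedModule R_NormedModule)
   v t b ((0, 1) : C) Hv).
assert (H := is_derive_plus _ _ _ _ _ H1 H2).
assert (E : forall x y : R, plus (scal x ((1,0) : C)) (scal y ((0,1) : C)) = ((x, y) : C)).
{ intros x y; unfold plus, scal; simpl; unfold prod_plus, prod_scal, plus, scal; simpl.
  unfold mult; simpl; f_equal; ring. }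
eapply is_derive_ext.
2: { replace ((a, b) : C) with (plus (scal a ((1, 0) : C)) (scal b ((0, 1) : C))) by apply E. exact H. }
intros s; apply E.
Qed.

Lemma continuous_Re (y : R -> C) t : continuous y t -> continuous (fun s => Re (y s)) t.
Proof. intros H; apply (continuous_comp y (fun z : C => Re z)); [exact H|]. apply continuous_fst. Qed.

Lemma continuous_Im (y : R -> C) t : continuous y t -> continuous (fun s => Im (y s)) t.
Proof. intros H; apply (continuous_comp y (fun z : C => Im z)); [exact H|]. apply continuous_snd. Qed.

Lemma continuous_C (u v : R -> R) t : continuous u t -> continuous v t ->
  continuous (fun s => (u s, v s) : C) t.
Proof.
intros Hu Hv P [e He]. specialize (Hu _ (locally_ball (u t) e)). specialize (Hv _ (locally_ball (v t) e)).
unfold filtermap in *. generalize (filter_and _ _ Hu Hv). apply filter_imp.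
intros x [H1 H2]; apply He; split; assumption.
Qed.

Lemma Re_Im_le (z : C) x y : x ^ 2 + y ^ 2 <= 1 -> x * Re z + y * Im z <= Cmod z.
Proof.
intros H. destruct z as [p q]; simpl. unfold Cmod; simpl fst; simpl snd.
apply Rle_trans with (Rabs (x * p + y * q)); [apply Rle_abs|].
rewrite <- sqrt_Rsqr_abs; apply sqrt_le_1_alt; unfold Rsqr.
assert (0 <= (x * q - y * p) ^ 2) by apply pow2_ge_0.
assert (0 <= p ^ 2 + q ^ 2) by nra.
apply Rle_trans with ((x ^ 2 + y ^ 2) * (p ^ 2 + q ^ 2)); nra.
Qed.

(** Freezing the real functional that attains the modulus at the final time turns a bound on [Cmod]
    into the monotonicity of a real function; the modulus itself, not differentiable at 0, is never
    differentiated. *)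
Lemma Cmod_dual (z : C) : exists x y, x ^ 2 + y ^ 2 <= 1 /\ x * Re z + y * Im z = Cmod z.
Proof.
destruct (Req_dec (Cmod z) 0) as [H|H].
{ exists 0, 0; split; [lra|rewrite H; ring]. }
assert (E : Cmod z * Cmod z = Re z * Re z + Im z * Im z).
{ unfold Cmod; rewrite sqrt_sqrt; [simpl; unfold Re, Im; ring|]. destruct z; simpl; nra. }
exists (Re z / Cmod z), (Im z / Cmod z); split.
{ right; field_simplify_eq; [nra|exact H]. }
field_simplify_eq; [nra|exact H].
Qed.

Lemma is_derive_value (f : R -> R) (t l l' : R) : is_derive f t l -> l = l' -> is_derive f t l'.
Proof. intros H <-; exact H. Qed.

Lemma continuous_exp_comp (u : R -> R) t : continuous u t -> continuous (fun s => exp (u s)) t.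
Proof.
intros H; apply (continuous_comp u exp); [exact H|].
apply (ex_derive_continuous exp); exists (exp (u t)); apply is_derive_exp.
Qed.

(* Variation of constants: the damping [d] absorbs a forcing of size [d * P]. *)
Lemma duhamel (y v : R -> C) (d D g G : R -> R) (P a b : R) : a <= b ->
  (forall t, a <= t <= b -> continuous y t) ->
  (forall t, a <= t <= b -> continuous G t) ->
  (forall t, a <= t <= b -> continuous D t) ->
  (forall t, a < t < b -> is_derive y t (Cplus (Cmult (RtoC (- d t)) (y t)) (v t))) ->
  (forall t, a < t < b -> is_derive D t (d t)) ->
  (forall t, a < t < b -> is_derive G t (g t)) ->
  (forall t, a < t < b -> 0 <= d t) -> (forall t, a < t < b -> 0 <= g t) ->
  (forall t, a < t < b -> Cmod (v t) <= d t * P + g t) ->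
  Cmod (y b) <= Rmax (Cmod (y a)) P + (G b - G a).
Proof.
intros Hab Hcy HcG HcD Hy HD HG Hd Hg Hv.
set (Q := Rmax (Cmod (y a)) P).
assert (HQ1 : Cmod (y a) <= Q) by apply Rmax_l.
assert (HQ2 : P <= Q) by apply Rmax_r.
assert (HQ0 : 0 <= Q) by (eapply Rle_trans; [apply Cmod_ge_0|exact HQ1]).
assert (Gmon : forall t, a <= t <= b -> G a <= G t).
{ intros t Ht; apply (le_of_derive G g); [lra|intros; apply HcG; lra|intros; apply HG; lra|intros; apply Hg; lra]. }
destruct (Cmod_dual (y b)) as [p [q [Hpq Hb]]].
pose (h := fun t => exp (D t) * (Q + (G t - G a) - (p * Re (y t) + q * Im (y t)))).
assert (Hh : h a <= h b).
{ apply (le_of_derive h (fun t => exp (D t) * (d t * (Q + (G t - G a)) + g t - (p * Re (v t) + q * Im (v t))))).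
  - exact Hab.
  - intros t Ht; unfold h. apply (continuous_mult (fun t => exp (D t))).
    + apply continuous_exp_comp, HcD; lra.
    + apply (continuous_minus (fun t => Q + (G t - G a)) (fun t => p * Re (y t) + q * Im (y t))).
      * apply (continuous_plus (fun _ => Q)); [apply continuous_const|].
        apply (continuous_minus G (fun _ => G a)); [apply HcG; lra|apply continuous_const].
      * apply (continuous_plus (fun t => p * Re (y t)) (fun t => q * Im (y t)));
        [apply (continuous_scal_r p (fun t => Re (y t))), continuous_Re, Hcy; lra
        |apply (continuous_scal_r q (fun t => Im (y t))), continuous_Im, Hcy; lra].
  - intros t Ht; unfold h.
    assert (Hr := is_derive_Re _ _ _ (Hy t Ht)). assert (Hi := is_derive_Im _ _ _ (Hy t Ht)).
    assert (H1 : is_derive (fun t => exp (D t)) t (d t * exp (D t))).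
    { apply (is_derive_comp exp D); [apply is_derive_exp|apply HD; exact Ht]. }
    assert (H2 : is_derive (fun t => Q + (G t - G a) - (p * Re (y t) + q * Im (y t))) t
       (0 + (g t - 0) - (p * Re (Cplus (Cmult (RtoC (- d t)) (y t)) (v t)) + q * Im (Cplus (Cmult (RtoC (- d t)) (y t)) (v t))))).
    { apply (is_derive_minus (fun t => Q + (G t - G a)) (fun t => p * Re (y t) + q * Im (y t))).
      - apply (is_derive_plus (fun _ => Q) (fun t => G t - G a)); [apply (@is_derive_const R_AbsRing R_NormedModule)|].
        apply (is_derive_minus G (fun _ => G a)); [apply HG; exact Ht|apply (@is_derive_const R_AbsRing R_NormedModule)].
      - apply (is_derive_plus (fun t => p * Re (y t)) (fun t => q * Im (y t)));
        [apply (is_derive_scal (fun t => Re (y t))); exact Hr|apply (is_derive_scal (fun t => Im (y t))); exact Hi]. }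
    eapply is_derive_value; [apply (is_derive_mult _ _ _ _ _ H1 H2); intros; apply Rmult_comm|].
    unfold plus, mult; simpl. destruct (y t) as [y1 y2]; destruct (v t) as [v1 v2]; simpl. ring.
  - intros t Ht. apply Rmult_le_pos; [left; apply exp_pos|].
    assert (p * Re (v t) + q * Im (v t) <= Cmod (v t)) by (apply Re_Im_le; exact Hpq).
    specialize (Hv t Ht). specialize (Hd t Ht). specialize (Gmon t ltac:(lra)).
    assert (d t * P <= d t * (Q + (G t - G a))) by (apply Rmult_le_compat_l; lra). lra. }
unfold h in Hh. rewrite Hb in Hh.
assert (H0 : 0 <= exp (D a) * (Q + (G a - G a) - (p * Re (y a) + q * Im (y a)))).
{ apply Rmult_le_pos; [left; apply exp_pos|]. assert (Hle := Re_Im_le (y a) p q Hpq). lra. }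
assert (H1 := exp_pos (D b)).
assert (0 <= Q + (G b - G a) - Cmod (y b)).
{ apply Rmult_le_reg_l with (exp (D b)); [exact H1|]. lra. }
lra.
Qed.

(** The undamped case of [duhamel], applied to y - y(a). *)
Lemma Cmod_incr (y v : R -> C) (g G : R -> R) (a b : R) : a <= b ->
  (forall t, a <= t <= b -> continuous y t) ->
  (forall t, a <= t <= b -> continuous G t) ->
  (forall t, a < t < b -> is_derive y t (v t)) ->
  (forall t, a < t < b -> is_derive G t (g t)) ->
  (forall t, a < t < b -> Cmod (v t) <= g t) ->
  Cmod (Cminus (y b) (y a)) <= G b - G a.
Proof.
intros Hab Hc HcG Hy HG Hv.
assert (H := duhamel (fun t => Cminus (y t) (y a)) v (fun _ => 0) (fun _ => 0) g G 0 a b Hab).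
assert (E : Cmod (Cminus (y a) (y a)) = 0) by (rewrite <- Cmod_0; f_equal; unfold Cminus; ring).
assert (Hcm : forall t, a <= t <= b -> continuous (fun t => Cminus (y t) (y a)) t).
{ intros t Ht. apply (continuous_minus (V := prod_NormedModule R_AbsRing R_NormedModule R_NormedModule) y (fun _ => y a));
  [apply Hc, Ht|apply continuous_const]. }
simpl in H; rewrite E, Rmax_left in H by lra. rewrite Rplus_0_l in H. apply H; clear H; try assumption.
- intros; apply continuous_const.
- intros t Ht.
  assert (H1 : is_derive (fun t => Cminus (y t) (y a)) t (minus (v t) zero)).
  { apply (is_derive_minus (V := prod_NormedModule R_AbsRing R_NormedModule R_NormedModule) y (fun _ => y a));
    [apply Hy; exact Ht|apply (@is_derive_const R_AbsRing (prod_NormedModule R_AbsRing R_NormedModule R_NormedModule))]. }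
  replace (Cplus (Cmult (RtoC (-0)) (Cminus (y t) (y a))) (v t)) with (minus (v t) zero); [exact H1|].
  destruct (v t), (y t), (y a); unfold minus, plus, opp, zero; simpl; unfold prod_plus, prod_opp, prod_zero; simpl.
  unfold plus, opp, zero; simpl. unfold Cplus, Cmult, Cminus, Copp, RtoC; simpl. f_equal; ring.
- intros; apply (@is_derive_const R_AbsRing R_NormedModule).
- intros; lra.
- intros t Ht. eapply Rle_trans; [apply Cmod_ge_0|apply Hv; exact Ht].
- intros t Ht. specialize (Hv t Ht). lra.
Qed.

Lemma derive_plus (u v : R -> R) (t a b : R) : is_derive u t a -> is_derive v t b ->
  is_derive (fun s => u s + v s) t (a + b).
Proof. exact (is_derive_plus (K := R_AbsRing) (V := R_NormedModule) u v t a b). Qed.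

Lemma derive_minus (u v : R -> R) (t a b : R) : is_derive u t a -> is_derive v t b ->
  is_derive (fun s => u s - v s) t (a - b).
Proof. exact (is_derive_minus (K := R_AbsRing) (V := R_NormedModule) u v t a b). Qed.

Lemma derive_mult (u v : R -> R) (t a b : R) : is_derive u t a -> is_derive v t b ->
  is_derive (fun s => u s * v s) t (a * v t + u t * b).
Proof. intros Hu Hv. exact (is_derive_mult (K := R_AbsRing) u v t a b Hu Hv Rmult_comm). Qed.

Lemma derive_const (k t : R) : is_derive (fun _ : R => k) t 0.
Proof. exact (@is_derive_const R_AbsRing R_NormedModule k t). Qed.

Lemma derive_id (t : R) : is_derive (fun s : R => s) t 1.
Proof. exact (is_derive_id (K := R_AbsRing) t). Qed.

(** * Infinite linear systems by Picard iteration *)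

Lemma Cmod_le_abs (z : C) : Cmod z <= Rabs (Re z) + Rabs (Im z).
Proof.
destruct z as [x y]; simpl.
assert (H := Cmod_triangle (RtoC x) (Cmult Ci (RtoC y))).
replace (Cplus (RtoC x) (Cmult Ci (RtoC y))) with ((x, y) : C) in H
  by (unfold Cplus, Cmult, Ci, RtoC; simpl; f_equal; ring).
rewrite Cmod_mult, !Cmod_R in H. replace (Cmod Ci) with 1 in H; [lra|].
unfold Cmod, Ci; simpl. replace (0 * (0 * 1) + 1 * (1 * 1)) with 1 by ring. symmetry; apply sqrt_1.
Qed.

Lemma Re_le_Cmod (z : C) : Rabs (Re z) <= Cmod z.
Proof. eapply Rle_trans; [apply Rmax_l|apply (Rmax_Cmod z)]. Qed.

Lemma Im_le_Cmod (z : C) : Rabs (Im z) <= Cmod z.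
Proof. eapply Rle_trans; [apply Rmax_r|apply (Rmax_Cmod z)]. Qed.

Lemma geometric_cauchy (x : nat -> R) (B : R) :
  (forall n, Rabs (x (S n) - x n) <= B / 2 ^ n) ->
  is_lim_seq x (real (Lim_seq x)) /\ forall n, Rabs (real (Lim_seq x) - x n) <= 2 * B / 2 ^ n.
Proof.
intros H.
assert (HB : 0 <= B) by (specialize (H 0%nat); simpl in H; assert (Hr := Rabs_pos (x 1%nat - x 0%nat)); lra).
assert (P2 : forall n, 0 < 2 ^ n) by (intros; apply pow_lt; lra).
(* The subtracted tail makes the induction on k close; it is dropped just after. *)
assert (Hk : forall k n, Rabs (x (n + k)%nat - x n) <= 2 * B / 2 ^ n - 2 * B / 2 ^ (n + k)).
{ induction k; intros n.
  - rewrite Nat.add_0_r, Rminus_diag, Rabs_R0; lra.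
  - replace (x (n + S k)%nat - x n) with ((x (S (n + k)) - x (n + k)%nat) + (x (n + k)%nat - x n))
      by (rewrite Nat.add_succ_r; ring).
    eapply Rle_trans; [apply Rabs_triang|]. specialize (IHk n). specialize (H (n + k)%nat).
    rewrite Nat.add_succ_r; simpl. assert (Hp := P2 (n + k)%nat).
    replace (2 * B / (2 * 2 ^ (n + k))) with (B / 2 ^ (n + k)) by (field; lra). 
    replace (2 * B / 2 ^ (n + k)) with (B / 2 ^ (n + k) + B / 2 ^ (n + k)) in IHk by (field; lra). lra. }
assert (Hk' : forall k n, Rabs (x (n + k)%nat - x n) <= 2 * B / 2 ^ n).
{ intros k n; eapply Rle_trans; [apply Hk|].
  assert (0 <= 2 * B / 2 ^ (n + k)) by (apply Rdiv_le_0_compat; [lra|apply P2]). lra. }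
assert (Hex : ex_lim_seq_cauchy x).
{ intros eps.
  assert (Hl : is_lim_seq (fun n => 2 * B * (/ 2) ^ n) 0).
  { replace 0 with (2 * B * 0) by ring. apply (is_lim_seq_scal_l _ (2 * B) 0).
    apply is_lim_seq_geom. rewrite Rabs_pos_eq; lra. }
  apply is_lim_seq_spec in Hl. destruct (Hl (mkposreal _ (is_pos_div_2 eps))) as [N HN]. exists N.
  simpl in HN. specialize (HN N (Nat.le_refl N)). rewrite Rminus_0_r, pow_inv in HN.
  assert (HN' : 2 * B / 2 ^ N < eps / 2) by (eapply Rle_lt_trans; [apply Rle_abs|exact HN]).
  intros n m Hn Hm.
  replace n with (N + (n - N))%nat by lia. replace m with (N + (m - N))%nat by lia.
  replace (x (N + (n - N))%nat - x (N + (m - N))%nat) with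
     ((x (N + (n - N))%nat - x N) - (x (N + (m - N))%nat - x N)) by ring.
  eapply Rle_lt_trans; [apply Rabs_triang|]. rewrite Rabs_Ropp.
  assert (H1 := Hk' (n - N)%nat N). assert (H2 := Hk' (m - N)%nat N). lra. }
apply ex_lim_seq_cauchy_corr in Hex. destruct Hex as [l Hl].
assert (El : Lim_seq x = Finite l) by (apply is_lim_seq_unique; exact Hl).
rewrite El; split; [exact Hl|]. intros n; simpl.
assert (Hl2 : is_lim_seq (fun k => Rabs (x (n + k)%nat - x n)) (Rabs (l - x n))).
{ apply (is_lim_seq_abs _ (Finite (l - x n))). apply (is_lim_seq_minus' _ (fun _ => x n)); [|apply is_lim_seq_const].
  apply (is_lim_seq_ext (fun k => x (k + n)%nat)); [intros; f_equal; lia|].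
  apply (is_lim_seq_incr_n x n); exact Hl. }
apply (is_lim_seq_le _ (fun _ => 2 * B / 2 ^ n) _ _ (fun k => Hk' k n) Hl2 (is_lim_seq_const _)).
Qed.

Lemma small_of_geom (C e : R) : 0 < e -> exists n : nat, C / 2 ^ n < e.
Proof.
intros He.
assert (Hl : is_lim_seq (fun n => C * (/ 2) ^ n) 0).
{ replace 0 with (C * 0) by ring. apply (is_lim_seq_scal_l _ C 0). apply is_lim_seq_geom. rewrite Rabs_pos_eq; lra. }
apply is_lim_seq_spec in Hl. destruct (Hl (mkposreal _ He)) as [N HN]. exists N.
simpl in HN; specialize (HN N (Nat.le_refl N)). rewrite Rminus_0_r, pow_inv in HN.
eapply Rle_lt_trans; [apply Rle_abs|exact HN].
Qed.

Lemma continuous_uniform (f : R -> R) (fn : nat -> R -> R) t C :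
  (forall n, continuous (fn n) t) ->
  (forall n s, Rabs (s - t) < 1 -> Rabs (f s - fn n s) <= C / 2 ^ n) -> continuous f t.
Proof.
intros Hc Hb. apply filterlim_locally. intros eps.
destruct (small_of_geom C (eps / 3)) as [n Hn]; [destruct eps; simpl; lra|].
assert (H1 := proj1 (filterlim_locally _ _) (Hc n)).
assert (He : 0 < eps / 3) by (destruct eps; simpl; lra).
specialize (H1 (mkposreal _ He)).
generalize (filter_and _ _ H1 (locally_ball t (mkposreal 1 Rlt_0_1))). apply filter_imp.
intros s [Hs1 Hs2]. change (Rabs (fn n s - fn n t) < eps / 3) in Hs1. change (Rabs (s - t) < 1) in Hs2.
change (Rabs (f s - f t) < eps).
replace (f s - f t) with ((f s - fn n s) + (fn n s - fn n t) - (f t - fn n t)) by ring.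
assert (A1 := Hb n s Hs2). assert (A2 := Hb n t). rewrite Rminus_diag, Rabs_R0 in A2. specialize (A2 Rlt_0_1).
eapply Rle_lt_trans; [apply Rabs_triang|]. rewrite Rabs_Ropp.
assert (A3 := Rabs_triang (f s - fn n s) (fn n s - fn n t)). lra.
Qed.

Lemma continuous_Rmax0 t : continuous (Rmax 0) t.
Proof.
apply (continuous_ext (fun x => (x + Rabs x) / 2)).
{ intros x; unfold Rmax, Rabs; destruct (Rle_dec 0 x), (Rcase_abs x); simpl; lra. }
apply (continuous_mult (fun x => x + Rabs x) (fun _ => / 2)); [|apply continuous_const].
apply (continuous_plus (fun x => x) Rabs); [apply continuous_id|]. apply continuous_Rabs.
Qed.

Lemma locally_pos t : 0 < t -> locally t (fun s => 0 < s).
Proof. intros H. apply (open_gt 0 t H). Qed.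

(** The shear f and the solutions are given on t > 0 with a right limit at 0. After clamping they
    are continuous on the whole line, which is what the integral lemmas ask for. *)
Lemma continuous_clamp {V : UniformSpace} (u : R -> V) t :
  (forall t, 0 < t -> continuous u t) -> filterlim u (at_right 0) (locally (u 0)) ->
  continuous (fun s => u (Rmax 0 s)) t.
Proof.
intros Hu1 Hu2. destruct (Rlt_le_dec 0 t) as [H|H].
{ apply (continuous_comp (Rmax 0) u); [apply continuous_Rmax0|]. rewrite Rmax_right by lra. apply Hu1, H. }
apply filterlim_locally; intros eps.
rewrite (Rmax_left 0 t) by lra.
destruct (proj1 (filterlim_locally _ _) Hu2 eps) as [del Hdel].
exists del. intros s Hs.
destruct (Rle_lt_dec s 0) as [r|r].
{ rewrite Rmax_left by lra. apply ball_center. }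
rewrite Rmax_right by lra. apply Hdel; [|exact r].
change (Rabs (s - t) < del) in Hs. change (Rabs (s - 0) < del).
rewrite Rabs_pos_eq in Hs by lra. rewrite Rabs_pos_eq by lra. lra.
Qed.

Lemma continuous_Cmult (u v : R -> C) t : continuous u t -> continuous v t ->
  continuous (fun s => Cmult (u s) (v s)) t.
Proof.
intros Hu Hv.
assert (H1 := continuous_Re _ _ Hu). assert (H2 := continuous_Im _ _ Hu).
assert (H3 := continuous_Re _ _ Hv). assert (H4 := continuous_Im _ _ Hv).
apply (continuous_C (fun s => Re (u s) * Re (v s) - Im (u s) * Im (v s)) (fun s => Re (u s) * Im (v s) + Im (u s) * Re (v s))).
- apply (continuous_minus (fun s => Re (u s) * Re (v s)) (fun s => Im (u s) * Im (v s)));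
  apply (continuous_mult (K := R_AbsRing)); assumption.
- apply (continuous_plus (fun s => Re (u s) * Im (v s)) (fun s => Im (u s) * Re (v s)));
  apply (continuous_mult (K := R_AbsRing)); assumption.
Qed.

Lemma continuous_Cplus (u v : R -> C) t : continuous u t -> continuous v t ->
  continuous (fun s => Cplus (u s) (v s)) t.
Proof.
intros; apply (continuous_plus (V := prod_NormedModule R_AbsRing R_NormedModule R_NormedModule) u v); assumption.
Qed.

Lemma continuous_Cminus (u v : R -> C) t : continuous u t -> continuous v t ->
  continuous (fun s => Cminus (u s) (v s)) t.
Proof.
intros; apply (continuous_minus (V := prod_NormedModule R_AbsRing R_NormedModule R_NormedModule) u v); assumption.
Qed.

Lemma continuous_RtoC (u : R -> R) t : continuous u t -> continuous (fun s => RtoC (u s)) t.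
Proof. intros; apply (continuous_C u (fun _ => 0)); [assumption|apply continuous_const]. Qed.

Lemma is_derive_Cminus (u v : R -> C) t a b : is_derive u t a -> is_derive v t b ->
  is_derive (fun s => Cminus (u s) (v s)) t (Cminus a b).
Proof.
intros; apply (is_derive_minus (V := prod_NormedModule R_AbsRing R_NormedModule R_NormedModule) u v); assumption.
Qed.

Lemma is_derive_value_C (f : R -> C) t (l l' : C) : is_derive f t l -> l = l' -> is_derive f t l'.
Proof. intros H <-; exact H. Qed.

Lemma continuous_of_derive (f : R -> R) t l : is_derive f t l -> continuous f t.
Proof. intros H; apply (ex_derive_continuous f); exists l; exact H. Qed.

Definition CInt (u : R -> C) (a b : R) : C := (RInt (fun t => Re (u t)) a b, RInt (fun t => Im (u t)) a b).

Lemma ex_RInt_cont (f : R -> R) a b : (forall t, continuous f t) -> ex_RInt f a b.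
Proof. intros H; apply (ex_RInt_continuous (V := R_CompleteNormedModule)); intros; apply H. Qed.

Lemma is_derive_RInt_cont (f : R -> R) a t : (forall t, continuous f t) ->
  is_derive (fun s => RInt f a s) t (f t).
Proof.
intros H. apply (is_derive_RInt f _ a); [|apply H].
exists (mkposreal 1 Rlt_0_1). intros s _. apply (RInt_correct (V := R_CompleteNormedModule)), ex_RInt_cont, H.
Qed.

Lemma is_derive_CInt (u : R -> C) a t : (forall t, continuous u t) ->
  is_derive (fun s => CInt u a s) t (u t).
Proof.
intros H. rewrite (surjective_pairing (u t)).
apply (is_derive_C (fun s => RInt (fun t => Re (u t)) a s) (fun s => RInt (fun t => Im (u t)) a s));
 apply (is_derive_RInt_cont (fun t => _ (u t)));
 intros; [apply continuous_Re|apply continuous_Im]; apply H.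
Qed.

Section Picard.
Variables (I : Type) (d D : I -> R -> R) (Lam : R -> (I -> C) -> I -> C) (y0 : I -> C).

(* Time is clamped to [0, +oo) so that iterates are continuous on the whole line. *)
Definition picard_step (u : R -> I -> C) (t : R) (i : I) : C :=
  Cmult (RtoC (exp (- D i (Rmax 0 t))))
    (Cplus (y0 i) (CInt (fun r => Cmult (RtoC (exp (D i r))) (Lam r (u r) i)) 0 (Rmax 0 t))).

Fixpoint picard_iter (n : nat) : R -> I -> C :=
  match n with O => fun _ i => y0 i | S n => picard_step (picard_iter n) end.

(** An explicit pointwise limit rather than a fixed point given by a theorem: the measurability of
    the solution in the frequency is later read off the iterates. *)
Definition picard_sol (t : R) (i : I) : C :=
  (real (Lim_seq (fun n => Re (picard_iter n t i))), real (Lim_seq (fun n => Im (picard_iter n t i)))).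

Hypothesis HD : forall i t, is_derive (D i) t (d i t).
Hypothesis HD0 : forall i, D i 0 = 0.
Hypothesis Hd : forall i t, 0 <= t -> 0 <= d i t.
Hypothesis Lam_minus : forall t y z i,
  Lam t (fun j => Cminus (y j) (z j)) i = Cminus (Lam t y i) (Lam t z i).
Hypothesis Lam_cont : forall u : R -> I -> C, (forall j t, continuous (fun s => u s j) t) ->
  forall i t, continuous (fun s => Lam s (u s) i) t.

(** The diagonal damping is integrated exactly. This allows [d] to be unbounded in i: only the
    coupling [Lam] has to be bounded in a weighted sup norm. *)
Lemma picard_step_spec u : (forall j t, continuous (fun s => u s j) t) ->
  (forall i t, continuous (fun s => picard_step u s i) t) /\
  (forall i, picard_step u 0 i = y0 i) /\
  (forall i t, 0 < t -> is_derive (fun s => picard_step u s i) t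
     (Cplus (Cmult (RtoC (- d i t)) (picard_step u t i)) (Lam t (u t) i))).
Proof.
intros Hu.
assert (HcD : forall i t, continuous (D i) t) by (intros; eapply continuous_of_derive, HD).
assert (Hc : forall i t, continuous (fun r => Cmult (RtoC (exp (D i r))) (Lam r (u r) i)) t).
{ intros i t. apply (continuous_Cmult (fun r => RtoC (exp (D i r))) (fun r => Lam r (u r) i)).
  - apply (continuous_RtoC (fun r => exp (D i r))), continuous_exp_comp, HcD.
  - apply Lam_cont, Hu. }
split; [|split].
- intros i t.
  apply (continuous_comp (Rmax 0) (fun s => Cmult (RtoC (exp (- D i s)))
    (Cplus (y0 i) (CInt (fun r => Cmult (RtoC (exp (D i r))) (Lam r (u r) i)) 0 s)))); [apply continuous_Rmax0|].
  apply (continuous_Cmult (fun s => RtoC (exp (- D i s)))).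
  + apply (continuous_RtoC (fun r => exp (- D i r))), continuous_exp_comp, (continuous_opp (D i)), HcD.
  + apply (continuous_Cplus (fun _ => y0 i)); [apply continuous_const|].
    apply (ex_derive_continuous (V := prod_NormedModule R_AbsRing R_NormedModule R_NormedModule)).
    eexists; apply is_derive_CInt, Hc.
- intros i; unfold picard_step, CInt. rewrite Rmax_left by lra. rewrite !RInt_point, HD0, Ropp_0, exp_0.
  destruct (y0 i); unfold Cmult, Cplus, RtoC, zero; simpl. f_equal; ring.
- intros i t Ht.
  pose (F := fun s => (RInt (fun r => Re (Cmult (RtoC (exp (D i r))) (Lam r (u r) i))) 0 s)).
  pose (G := fun s => (RInt (fun r => Im (Cmult (RtoC (exp (D i r))) (Lam r (u r) i))) 0 s)).
  assert (HF : is_derive F t (Re (Cmult (RtoC (exp (D i t))) (Lam t (u t) i)))).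
  { apply (is_derive_RInt_cont (fun r => Re (Cmult (RtoC (exp (D i r))) (Lam r (u r) i)))).
    intros; apply (continuous_Re _ _ (Hc i _)). }
  assert (HG : is_derive G t (Im (Cmult (RtoC (exp (D i t))) (Lam t (u t) i)))).
  { apply (is_derive_RInt_cont (fun r => Im (Cmult (RtoC (exp (D i r))) (Lam r (u r) i)))).
    intros; apply (continuous_Im _ _ (Hc i _)). }
  assert (HE : is_derive (fun s => exp (- D i s)) t (- d i t * exp (- D i t))).
  { apply (is_derive_comp exp (fun s => - D i s)); [apply is_derive_exp|apply (is_derive_opp (D i)), HD]. }
  assert (H1 : is_derive (fun s => exp (- D i s) * (Re (y0 i) + F s)) t
     ((- d i t * exp (- D i t)) * (Re (y0 i) + F t) + exp (- D i t) * (0 + Re (Cmult (RtoC (exp (D i t))) (Lam t (u t) i))))).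
  { apply (is_derive_mult (fun s => exp (- D i s)) (fun s => Re (y0 i) + F s)); [exact HE| |intros; apply Rmult_comm].
    apply (is_derive_plus (fun _ => Re (y0 i)) F); [apply (@is_derive_const R_AbsRing R_NormedModule)|exact HF]. }
  assert (H2 : is_derive (fun s => exp (- D i s) * (Im (y0 i) + G s)) t
     ((- d i t * exp (- D i t)) * (Im (y0 i) + G t) + exp (- D i t) * (0 + Im (Cmult (RtoC (exp (D i t))) (Lam t (u t) i))))).
  { apply (is_derive_mult (fun s => exp (- D i s)) (fun s => Im (y0 i) + G s)); [exact HE| |intros; apply Rmult_comm].
    apply (is_derive_plus (fun _ => Im (y0 i)) G); [apply (@is_derive_const R_AbsRing R_NormedModule)|exact HG]. }
  assert (H3 := is_derive_C _ _ _ _ _ H1 H2).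
  assert (Eps : forall s, 0 < s -> picard_step u s i = (exp (- D i s) * (Re (y0 i) + F s), exp (- D i s) * (Im (y0 i) + G s))).
  { intros s Hs; unfold picard_step. rewrite Rmax_right by lra. unfold CInt; fold (F s); fold (G s).
    destruct (y0 i); unfold Cmult, Cplus, RtoC; simpl. f_equal; ring. }
  assert (Eexp : exp (- D i t) * exp (D i t) = 1) by (rewrite <- exp_plus, Rplus_opp_l; apply exp_0).
  apply (is_derive_ext_loc (fun s => (exp (- D i s) * (Re (y0 i) + F s), exp (- D i s) * (Im (y0 i) + G s)) : C)).
  { generalize (locally_pos t Ht). apply filter_imp. intros s Hs; symmetry; apply Eps, Hs. }
  eapply is_derive_value_C; [exact H3|].
  rewrite (Eps t Ht). destruct (Lam t (u t) i) as [p q]. unfold Cmult, Cplus, RtoC; simpl. f_equal.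
  + replace (exp (- D i t) * (0 + (exp (D i t) * p - 0 * q))) with (exp (- D i t) * exp (D i t) * p) by ring.
    rewrite Eexp; ring.
  + replace (exp (- D i t) * (0 + (exp (D i t) * q + 0 * p))) with (exp (- D i t) * exp (D i t) * q) by ring.
    rewrite Eexp; ring.
Qed.

Variables (w : I -> R) (L M0 : R).
Hypothesis HL : 0 < L.
Hypothesis Hw : forall i, 0 < w i.
Hypothesis Lam_bound : forall t M y, 0 <= t -> 0 <= M -> (forall j, Cmod (y j) <= M * w j) ->
  forall i, Cmod (Lam t y i) <= L * M * w i.

Lemma is_derive_expL B t : is_derive (fun s => B / 2 * exp (2 * L * s)) t (L * B * exp (2 * L * t)).
Proof. auto_derive; [exact Logic.I|field]. Qed.

(* One integration of the forcing gains a factor 1/2 in the norm weighted by [exp (-2 L t)]. *)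
Lemma forced_half (y : R -> I -> C) (z : R -> I -> C) (B T : R) i : 0 <= B -> 0 <= T ->
  (forall t, 0 <= t <= T -> continuous (fun s => y s i) t) ->
  (forall t, 0 < t < T -> is_derive (fun s => y s i) t (Cplus (Cmult (RtoC (- d i t)) (y t i)) (Lam t (z t) i))) ->
  (forall t j, 0 <= t <= T -> Cmod (z t j) <= B * w j * exp (2 * L * t)) ->
  Cmod (y T i) <= Cmod (y 0 i) + B / 2 * w i * exp (2 * L * T).
Proof.
intros HB HT Hc Hy Hz.
assert (Hder : forall t, is_derive (fun s => B * w i / 2 * exp (2 * L * s)) t (L * (B * w i) * exp (2 * L * t)))
  by (intros; apply is_derive_expL).
assert (H := duhamel (fun s => y s i) (fun s => Lam s (z s) i) (d i) (D i)
   (fun t => L * (B * w i) * exp (2 * L * t)) (fun s => B * w i / 2 * exp (2 * L * s)) 0 0 T HT Hc).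
rewrite Rmax_left in H by apply Cmod_ge_0.
assert (Hpos : 0 <= B * w i) by (apply Rmult_le_pos; [|left]; auto).
eapply Rle_trans; [apply H; clear H|].
- intros; eapply continuous_of_derive, Hder.
- intros; eapply continuous_of_derive, HD.
- exact Hy.
- intros; apply HD.
- intros; apply Hder.
- intros; apply Hd; lra.
- intros. apply Rmult_le_pos; [apply Rmult_le_pos; lra|left; apply exp_pos].
- intros t Ht. rewrite Rmult_0_r, Rplus_0_l.
  replace (L * (B * w i) * exp (2 * L * t)) with (L * (B * exp (2 * L * t)) * w i) by ring.
  apply Lam_bound; [lra|apply Rmult_le_pos; [lra|left; apply exp_pos]|].
  intros j; replace (B * exp (2 * L * t) * w j) with (B * w j * exp (2 * L * t)) by ring. apply Hz; lra.
- rewrite Rmult_0_r, exp_0. lra.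
Qed.

(** [forced_half] with y as its own forcing halves any a priori bound, and can be repeated
    indefinitely. *)
Lemma linear_ode_unique (y : R -> I -> C) (T M : R) : 0 <= M ->
  (forall t i, 0 <= t <= T -> continuous (fun s => y s i) t) ->
  (forall t i, 0 < t < T -> is_derive (fun s => y s i) t (Cplus (Cmult (RtoC (- d i t)) (y t i)) (Lam t (y t) i))) ->
  (forall i, y 0 i = RtoC 0) ->
  (forall t i, 0 <= t <= T -> Cmod (y t i) <= M * w i) ->
  forall t i, 0 <= t <= T -> y t i = RtoC 0.
Proof.
intros HM Hc Hy H0 Hb.
assert (Hn : forall n t i, 0 <= t <= T -> Cmod (y t i) <= M / 2 ^ n * w i * exp (2 * L * t)).
{ induction n; intros t i Ht.
  - eapply Rle_trans; [apply Hb; exact Ht|]. simpl; rewrite Rdiv_1_r.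
    rewrite <- (Rmult_1_r (M * w i)) at 1. apply Rmult_le_compat_l; [apply Rmult_le_pos; [lra|left; auto]|].
    rewrite <- exp_0. destruct (Req_dec t 0) as [->|Hne]; [rewrite Rmult_0_r; lra|].
    left; apply exp_increasing; apply Rmult_lt_0_compat; lra.
  - assert (HP : 0 < 2 ^ n) by (apply pow_lt; lra).
    replace (M / 2 ^ S n) with (M / 2 ^ n / 2) by (simpl; field; lra).
    assert (H := forced_half y y (M / 2 ^ n) t i).
    rewrite H0, Cmod_0, Rplus_0_l in H. apply H; clear H.
    + apply Rdiv_le_0_compat; lra.
    + lra.
    + intros; apply Hc; lra.
    + intros; apply Hy; lra.
    + intros s j Hs; apply IHn; lra. }
intros t i Ht. apply Cmod_eq_0.
destruct (Rle_lt_or_eq_dec 0 (Cmod (y t i)) (Cmod_ge_0 _)) as [Hlt|E]; [exfalso|symmetry; exact E].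
destruct (small_of_geom (M * w i * exp (2 * L * t)) _ Hlt) as [n Hn'].
specialize (Hn n t i Ht).
replace (M / 2 ^ n * w i * exp (2 * L * t)) with (M * w i * exp (2 * L * t) / 2 ^ n) in Hn
  by (field; apply pow_nonzero; lra). lra.
Qed.

Hypothesis HM0 : 0 <= M0.
Hypothesis Hy0 : forall i, Cmod (y0 i) <= M0 * w i.

Lemma picard_iter_cont n i t : continuous (fun s => picard_iter n s i) t.
Proof.
revert i t; induction n; intros i t; [apply continuous_const|]. simpl. apply picard_step_spec, IHn.
Qed.

Lemma picard_step_half u v B : 0 <= B ->
  (forall j t, continuous (fun s => u s j) t) -> (forall j t, continuous (fun s => v s j) t) ->
  (forall t j, 0 <= t -> Cmod (Cminus (u t j) (v t j)) <= B * w j * exp (2 * L * t)) ->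
  forall t i, 0 <= t -> Cmod (Cminus (picard_step u t i) (picard_step v t i)) <= B / 2 * w i * exp (2 * L * t).
Proof.
intros HB Hu Hv Hb t i Ht.
destruct (picard_step_spec u Hu) as [Cu [Zu Du]]. destruct (picard_step_spec v Hv) as [Cv [Zv Dv]].
assert (H := forced_half (fun t i => Cminus (picard_step u t i) (picard_step v t i))
  (fun t i => Cminus (u t i) (v t i)) B t i HB Ht). simpl in H.
rewrite Zu, Zv in H. replace (Cminus (y0 i) (y0 i)) with (RtoC 0) in H by (unfold Cminus; ring).
rewrite Cmod_0, Rplus_0_l in H. apply H; clear H.
- intros; apply continuous_Cminus; [apply Cu|apply Cv].
- intros s Hs.
  eapply is_derive_value_C; [apply is_derive_Cminus; [apply Du|apply Dv]; lra|].
  rewrite Lam_minus. unfold Cminus; ring.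
- intros; apply Hb; lra.
Qed.

Lemma exp_2L_ge1 t : 0 <= t -> 1 <= exp (2 * L * t).
Proof.
intros Ht. rewrite <- exp_0. destruct (Req_dec t 0) as [->|Hne]; [rewrite Rmult_0_r; lra|].
left; apply exp_increasing; apply Rmult_lt_0_compat; lra.
Qed.

Lemma picard_iter_diff n t i : 0 <= t ->
  Cmod (Cminus (picard_iter (S n) t i) (picard_iter n t i)) <= 3 * M0 / 2 ^ n * w i * exp (2 * L * t).
Proof.
revert t i; induction n; intros t i Ht.
- assert (Hw0 : 0 <= M0 * w i) by (apply Rmult_le_pos; [lra|left; auto]).
  assert (He := exp_2L_ge1 t Ht).
  assert (H := forced_half (picard_iter 1) (picard_iter 0) M0 t i HM0 Ht).
  assert (H1 : Cmod (picard_iter 1 t i) <= Cmod (picard_iter 1 0 i) + M0 / 2 * w i * exp (2 * L * t)).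
  { apply H; clear H.
    - intros; apply picard_iter_cont.
    - intros s Hs. apply picard_step_spec; [intros; apply (picard_iter_cont 0)|lra].
    - intros s j Hs; simpl. eapply Rle_trans; [apply Hy0|].
      assert (Hj : 0 <= M0 * w j) by (apply Rmult_le_pos; [lra|left; auto]).
      assert (He' := exp_2L_ge1 s ltac:(lra)). nra. }
  replace (picard_iter 1 0 i) with (y0 i) in H1.
  2: { symmetry; apply (picard_step_spec (picard_iter 0)); intros; apply (picard_iter_cont 0). }
  eapply Rle_trans; [apply Cmod_triangle|]. rewrite Cmod_opp. simpl (picard_iter 0 t i).
  assert (H2 := Hy0 i). change (2 ^ 0) with 1. rewrite Rdiv_1_r. nra.
- replace (3 * M0 / 2 ^ S n) with (3 * M0 / 2 ^ n / 2) by (simpl; field; apply pow_nonzero; lra).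
  apply (picard_step_half (picard_iter (S n)) (picard_iter n)); try (intros; apply picard_iter_cont).
  + apply Rdiv_le_0_compat; [lra|apply pow_lt; lra].
  + intros; apply IHn; assumption.
  + exact Ht.
Qed.

Lemma picard_iter_clamp n t i : picard_iter n t i = picard_iter n (Rmax 0 t) i.
Proof. destruct n; simpl; [reflexivity|]. unfold picard_step. rewrite (Rmax_right 0 (Rmax 0 t)); [reflexivity|apply Rmax_l]. Qed.

(** The constant 12 is the 3 of [picard_iter_diff], doubled by the geometric sum and doubled again
    by adding real and imaginary parts. *)
Lemma picard_sol_approx n t i :
  is_lim_seq (fun n => Re (picard_iter n t i)) (Re (picard_sol t i)) /\
  is_lim_seq (fun n => Im (picard_iter n t i)) (Im (picard_sol t i)) /\
  Cmod (Cminus (picard_sol t i) (picard_iter n t i)) <= 12 * M0 / 2 ^ n * w i * exp (2 * L * Rmax 0 t).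
Proof.
set (E := w i * exp (2 * L * Rmax 0 t)).
assert (Hdiff : forall m, Cmod (Cminus (picard_iter (S m) t i) (picard_iter m t i)) <= 3 * M0 * E / 2 ^ m).
{ intros m. rewrite (picard_iter_clamp (S m)), (picard_iter_clamp m).
  eapply Rle_trans; [apply picard_iter_diff, Rmax_l|]. unfold E; right; field. apply pow_nonzero; lra. }
destruct (geometric_cauchy (fun n => Re (picard_iter n t i)) (3 * M0 * E)) as [A1 A2].
{ intros m. eapply Rle_trans; [|apply Hdiff]. apply (Re_le_Cmod (Cminus _ _)). }
destruct (geometric_cauchy (fun n => Im (picard_iter n t i)) (3 * M0 * E)) as [B1 B2].
{ intros m. eapply Rle_trans; [|apply Hdiff]. apply (Im_le_Cmod (Cminus _ _)). }
split; [exact A1|split; [exact B1|]].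
eapply Rle_trans; [apply Cmod_le_abs|].
specialize (A2 n). specialize (B2 n).
replace (12 * M0 / 2 ^ n * w i * exp (2 * L * Rmax 0 t)) with (2 * (3 * M0 * E) / 2 ^ n + 2 * (3 * M0 * E) / 2 ^ n)
  by (unfold E; field; apply pow_nonzero; lra).
apply Rplus_le_compat; [apply A2|apply B2].
Qed.

Lemma picard_sol_cont i t : continuous (fun s => picard_sol s i) t.
Proof.
assert (Hb : forall n s, Rabs (s - t) < 1 ->
  Cmod (Cminus (picard_sol s i) (picard_iter n s i)) <= 12 * M0 * w i * exp (2 * L * (Rabs t + 1)) / 2 ^ n).
{ intros n s Hs. eapply Rle_trans; [apply picard_sol_approx|].
  replace (12 * M0 * w i * exp (2 * L * (Rabs t + 1)) / 2 ^ n) with (12 * M0 / 2 ^ n * w i * exp (2 * L * (Rabs t + 1)))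
    by (field; apply pow_nonzero; lra).
  apply Rmult_le_compat_l.
  { apply Rmult_le_pos; [|left; auto]. apply Rdiv_le_0_compat; [lra|apply pow_lt; lra]. }
  assert (Hle : Rmax 0 s <= Rabs t + 1).
  { apply Rmax_lub; [assert (H := Rabs_pos t); lra|].
    assert (H1 := Rle_abs t). assert (H2 := Rle_abs (s - t)). lra. }
  destruct (Rle_lt_or_eq_dec _ _ Hle) as [Hlt| ->]; [|lra].
  left; apply exp_increasing. apply Rmult_lt_compat_l; lra. }
apply (continuous_C (fun s => Re (picard_sol s i)) (fun s => Im (picard_sol s i))).
- apply (continuous_uniform _ (fun n s => Re (picard_iter n s i)) t (12 * M0 * w i * exp (2 * L * (Rabs t + 1)))).
  + intros n; apply (continuous_Re (fun s => picard_iter n s i)), picard_iter_cont.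
  + intros n s Hs. eapply Rle_trans; [|apply Hb; exact Hs]. apply (Re_le_Cmod (Cminus _ _)).
- apply (continuous_uniform _ (fun n s => Im (picard_iter n s i)) t (12 * M0 * w i * exp (2 * L * (Rabs t + 1)))).
  + intros n; apply (continuous_Im (fun s => picard_iter n s i)), picard_iter_cont.
  + intros n s Hs. eapply Rle_trans; [|apply Hb; exact Hs]. apply (Im_le_Cmod (Cminus _ _)).
Qed.

(** Both sides are within a geometric error of iterate n + 1: the left one by convergence, the right
    one because a Picard step halves the distance from the limit to iterate n. Negative times reduce
    to 0 by clamping. *)
Lemma picard_sol_fix t i : picard_sol t i = picard_step picard_sol t i.
Proof.
assert (Hpos : forall s j, 0 <= s -> picard_sol s j = picard_step picard_sol s j).
{ intros s j Hs.
  assert (Hz : Cminus (picard_sol s j) (picard_step picard_sol s j) = RtoC 0).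
  { apply Cmod_eq_0.
    destruct (Rle_lt_or_eq_dec 0 _ (Cmod_ge_0 (Cminus (picard_sol s j) (picard_step picard_sol s j)))) as [Hlt|E];
      [exfalso|symmetry; exact E].
    destruct (small_of_geom (12 * M0 * w j * exp (2 * L * s)) _ Hlt) as [n Hn].
    assert (HP : 0 < 2 ^ n) by (apply pow_lt; lra).
    assert (H1 := proj2 (proj2 (picard_sol_approx (S n) s j))). rewrite Rmax_right in H1 by lra.
    assert (H2 := picard_step_half picard_sol (picard_iter n) (12 * M0 / 2 ^ n)
      ltac:(apply Rdiv_le_0_compat; lra) picard_sol_cont (picard_iter_cont n)).
    specialize (H2 ltac:(intros r k Hr; assert (H3 := proj2 (proj2 (picard_sol_approx n r k)));
      rewrite Rmax_right in H3 by lra; exact H3) s j Hs).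
    change (picard_step (picard_iter n) s j) with (picard_iter (S n) s j) in H2.
    assert (H3 := Cmod_triangle (Cminus (picard_sol s j) (picard_iter (S n) s j))
      (Copp (Cminus (picard_step picard_sol s j) (picard_iter (S n) s j)))).
    rewrite Cmod_opp in H3.
    replace (Cplus (Cminus (picard_sol s j) (picard_iter (S n) s j))
      (Copp (Cminus (picard_step picard_sol s j) (picard_iter (S n) s j))))
      with (Cminus (picard_sol s j) (picard_step picard_sol s j)) in H3 by (unfold Cminus; ring).
    assert (H4 : 12 * M0 / 2 ^ S n * w j * exp (2 * L * s) + 12 * M0 / 2 ^ n / 2 * w j * exp (2 * L * s)
       = 12 * M0 * w j * exp (2 * L * s) / 2 ^ n) by (simpl; field; lra). lra. }
  replace (picard_sol s j) with (Cplus (Cminus (picard_sol s j) (picard_step picard_sol s j)) (picard_step picard_sol s j))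
    by (unfold Cminus; ring). rewrite Hz; ring. }
assert (Hcl : picard_sol t i = picard_sol (Rmax 0 t) i).
{ unfold picard_sol. rewrite (Lim_seq_ext (fun n => Re (picard_iter n t i)) (fun n => Re (picard_iter n (Rmax 0 t) i))),
    (Lim_seq_ext (fun n => Im (picard_iter n t i)) (fun n => Im (picard_iter n (Rmax 0 t) i))); [reflexivity| |];
  intros n; rewrite picard_iter_clamp; reflexivity. }
rewrite Hcl, Hpos by apply Rmax_l. unfold picard_step. rewrite (Rmax_right 0 (Rmax 0 t)); [reflexivity|apply Rmax_l].
Qed.

Lemma picard_sol_spec :
  (forall i t, continuous (fun s => picard_sol s i) t) /\
  (forall i, picard_sol 0 i = y0 i) /\
  (forall i t, 0 < t -> is_derive (fun s => picard_sol s i) t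
     (Cplus (Cmult (RtoC (- d i t)) (picard_sol t i)) (Lam t (picard_sol t) i))) /\
  (forall i t, 0 <= t -> Cmod (picard_sol t i) <= 13 * M0 * w i * exp (2 * L * t)).
Proof.
destruct (picard_step_spec picard_sol picard_sol_cont) as [_ [H2 H3]].
split; [exact picard_sol_cont|split; [|split]].
- intros i; rewrite picard_sol_fix; apply H2.
- intros i t Ht. rewrite (picard_sol_fix t i).
  apply (is_derive_ext (fun s => picard_step picard_sol s i)); [intros; symmetry; apply picard_sol_fix|].
  apply H3, Ht.
- intros i t Ht. assert (H := proj2 (proj2 (picard_sol_approx 0 t i))). rewrite Rmax_right in H by lra. simpl in H.
  assert (Hw0 : 0 <= M0 * w i) by (apply Rmult_le_pos; [lra|left; auto]).
  assert (H4 := Cmod_triangle (Cminus (picard_sol t i) (y0 i)) (y0 i)).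
  replace (Cplus (Cminus (picard_sol t i) (y0 i)) (y0 i)) with (picard_sol t i) in H4 by (unfold Cminus; ring).
  assert (He := exp_2L_ge1 t Ht). assert (H5 := Hy0 i). nra.
Qed.

End Picard.

(** * The wave perturbation system *)

Definition wt (r : R) (k l : Z) : R := (/ r) ^ Z.abs_nat (l - k).

Lemma wt_pos r k l : 0 < r -> 0 < wt r k l.
Proof. intros; apply pow_lt, Rinv_0_lt_compat; assumption. Qed.

Lemma wt_self r k : wt r k k = 1.
Proof. unfold wt; rewrite Z.sub_diag; reflexivity. Qed.

Lemma wt_le1 r k l : 1 <= r -> wt r k l <= 1.
Proof.
intros Hr; unfold wt. rewrite <- (pow1 (Z.abs_nat (l - k))). apply pow_incr. split.
{ left; apply Rinv_0_lt_compat; lra. }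
rewrite <- Rinv_1; apply Rinv_le_contravar; lra.
Qed.

Lemma wt_step r k l l' : 1 <= r -> (Z.abs (l - l') <= 1)%Z -> wt r k l' <= r * wt r k l.
Proof.
intros Hr Hl; unfold wt.
assert (Hi : 0 < / r) by (apply Rinv_0_lt_compat; lra).
assert (Hi1 : / r <= 1) by (rewrite <- Rinv_1; apply Rinv_le_contravar; lra).
assert (Hcase : (Z.abs_nat (l' - k) = Z.abs_nat (l - k) \/ Z.abs_nat (l' - k) = S (Z.abs_nat (l - k))
   \/ S (Z.abs_nat (l' - k)) = Z.abs_nat (l - k))%nat) by lia.
destruct Hcase as [E|[E|E]].
- rewrite E. assert (0 < (/ r) ^ Z.abs_nat (l - k)) by (apply pow_lt; lra). nra.
- rewrite E; simpl. assert (0 < (/ r) ^ Z.abs_nat (l - k)) by (apply pow_lt; lra).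
  apply Rle_trans with (1 * (/ r) ^ Z.abs_nat (l - k)); [apply Rmult_le_compat_r; lra|]. nra.
- rewrite <- E; simpl. rewrite <- Rmult_assoc, Rinv_r, Rmult_1_l by lra. lra.
Qed.

Lemma lam_ratio (lam : Z -> R) q : (forall l, 0 < lam l) -> q < 2 ->
  (forall l, lam (l + 1)%Z <= q * lam l /\ lam (l - 1)%Z <= q * lam l) ->
  forall k l, lam l <= lam k * 2 ^ Z.abs_nat (l - k).
Proof.
intros Hp Hq Hr.
assert (H2 : forall l, lam (l + 1)%Z <= 2 * lam l /\ lam (l - 1)%Z <= 2 * lam l).
{ intros l; specialize (Hr l); specialize (Hp l); split; nra. }
assert (Hn : forall (n : nat) k, lam (k + Z.of_nat n)%Z <= lam k * 2 ^ n /\ lam (k - Z.of_nat n)%Z <= lam k * 2 ^ n).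
{ induction n; intros k.
  - simpl; rewrite Z.add_0_r, Z.sub_0_r; lra.
  - destruct (IHn k) as [H3 H4]. rewrite Nat2Z.inj_succ; simpl.
    destruct (H2 (k + Z.of_nat n)%Z) as [H5 _]. destruct (H2 (k - Z.of_nat n)%Z) as [_ H6].
    replace (k + Z.succ (Z.of_nat n))%Z with (k + Z.of_nat n + 1)%Z by lia.
    replace (k - Z.succ (Z.of_nat n))%Z with (k - Z.of_nat n - 1)%Z by lia. lra. }
intros k l. destruct (Z_le_gt_dec k l).
- replace (lam l) with (lam (k + Z.of_nat (Z.abs_nat (l - k)))%Z) by (f_equal; lia). apply Hn.
- replace (lam l) with (lam (k - Z.of_nat (Z.abs_nat (l - k)))%Z) by (f_equal; lia). apply Hn.
Qed.

Lemma Zterm_nonneg (a : Z -> R) n : (forall l, 0 <= a l) -> 0 <= Zterm a n.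
Proof. intros H; unfold Zterm; assert (H1 := H (Z.of_nat n)); assert (H2 := H (- Z.of_nat n - 1)%Z); lra. Qed.

Lemma Series_term_le (a : nat -> R) n : (forall n, 0 <= a n) -> ex_series a -> a n <= Series a.
Proof.
intros Hp Hex.
assert (H := Series_incr_n a (S n) (Nat.lt_0_succ n) Hex). rewrite H.
assert (H1 : 0 <= Series (fun k => a (S n + k)%nat)).
{ rewrite <- (Rmult_0_l (Series (fun k => a (S n + k)%nat))) at 1. rewrite <- Series_scal_l. apply Series_le.
  - intros k; assert (H0 := Hp (S n + k)%nat); split; lra.
  - apply (ex_series_incr_n a (S n)); exact Hex. }
simpl pred.
assert (H2 : a n <= sum_f_R0 a n).
{ destruct n; simpl; [lra|]. assert (0 <= sum_f_R0 a n) by (apply cond_pos_sum; exact Hp). lra. }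
unfold pred in H. lra.
Qed.

Lemma Zterm_le_Series (a : Z -> R) l : (forall l, 0 <= a l) -> ex_series (Zterm a) -> a l <= Series (Zterm a).
Proof.
intros Hp Hex. destruct (Z_le_gt_dec 0 l).
- eapply Rle_trans; [|apply (Series_term_le (Zterm a) (Z.to_nat l)); [intros; apply Zterm_nonneg, Hp|exact Hex]].
  unfold Zterm. rewrite Z2Nat.id by lia. assert (H := Hp (- l - 1)%Z). lra.
- eapply Rle_trans; [|apply (Series_term_le (Zterm a) (Z.to_nat (- l - 1))); [intros; apply Zterm_nonneg, Hp|exact Hex]].
  unfold Zterm. rewrite Z2Nat.id by lia. replace (- (- l - 1) - 1)%Z with l by lia.
  assert (H := Hp (- l - 1)%Z). lra.
Qed.

Lemma Xterm_nonneg lam u l : 0 <= Xterm lam u l.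
Proof. unfold Xterm; apply Rmult_le_pos; apply pow2_ge_0. Qed.

Lemma normX_term lam u l : inX lam u -> 0 <= lam l -> lam l * Cmod (u l) <= normX lam u.
Proof.
intros Hin Hl. unfold normX, normX2.
assert (Hp : 0 <= lam l * Cmod (u l)) by (apply Rmult_le_pos; [exact Hl|apply Cmod_ge_0]).
rewrite <- (sqrt_pow2 _ Hp). apply sqrt_le_1_alt.
eapply Rle_trans; [|apply (Zterm_le_Series (Xterm lam u) l); [apply Xterm_nonneg|exact Hin]].
unfold Xterm; right; ring.
Qed.

(** * Existence and uniqueness for the system at one frequency *)

Section System.
Variables (nu c : R) (f : R -> R) (eta : R).

(** The index (l, true) stands for theta_l and (l, false) for G_l; only the second kind is damped.
    The mode 0 is kept in the index set, with zero forcing. *)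
Definition damp (i : Z * bool) (t : R) : R :=
  if snd i then 0 else nu * ((IZR (fst i)) ^ 2 + (eta - IZR (fst i) * t) ^ 2).

Definition damp_int (i : Z * bool) (t : R) : R :=
  if snd i then 0 else
  nu * ((IZR (fst i)) ^ 2 * t + (eta ^ 2 * t - eta * IZR (fst i) * t ^ 2 + (IZR (fst i)) ^ 2 * t ^ 3 / 3)).

Definition forcing (t : R) (y : Z * bool -> C) (i : Z * bool) : C :=
  let l := fst i in
  let A := coupling c eta (fun j => y (j, true)) (fun j => y (j, false)) l t in
  let q := eta / IZR l - t in
  if Z.eq_dec l 0 then RtoC 0 else if snd i then A else
   Cplus (Cmult (Cmult (RtoC (f (Rmax 0 t) / (2 * c))) (Cmult Ci (RtoC (IZR l)))) A)
         (Cplus (Cmult (RtoC (2 * q / (1 + q ^ 2) ^ 2)) (y (l, true)))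
                (Cmult (RtoC (/ (1 + q ^ 2))) A)).

Definition init_state (u : Z -> C) (i : Z * bool) : C :=
  if Z.eq_dec (fst i) 0 then RtoC 0 else if snd i then u (fst i) else RtoC 0.

Definition flow (u : Z -> C) : R -> Z * bool -> C := picard_sol _ damp_int forcing (init_state u).

(** The componentwise content of [is_solution], with continuity on the whole line; the conditions in
    X are recovered separately from growth bounds. *)
Record ode_sol (th G : R -> Z -> C) : Prop := {
  ode_cont_th : forall l t, continuous (fun s => th s l) t;
  ode_cont_G : forall l t, continuous (fun s => G s l) t;
  ode_zero : forall t, 0 <= t -> th t 0%Z = RtoC 0 /\ G t 0%Z = RtoC 0;
  ode_th : forall t l, 0 < t -> l <> 0%Z -> is_derive (fun s => th s l) t (rhs_theta c eta (th t) (G t) l t);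
  ode_G : forall t l, 0 < t -> l <> 0%Z -> is_derive (fun s => G s l) t (rhs_G nu c f eta (th t) (G t) l t) }.

Hypothesis Hnu : 0 < nu.
Hypothesis Hc : 0 < c.
Hypothesis Hf1 : forall t, 0 < t -> continuous f t.
Hypothesis Hf2 : filterlim f (at_right 0) (locally (f 0)).
Hypothesis Hf3 : forall t, 0 <= t -> Rabs (f t) <= 2 * c / (1 + t ^ 2).

Lemma f_clamp_cont t : continuous (fun s => f (Rmax 0 s)) t.
Proof. apply continuous_clamp; assumption. Qed.

Lemma coef_den_pos q : 0 < 1 + q ^ 2.
Proof. assert (H := pow2_ge_0 q); lra. Qed.

(** The cube in the denominator leaves a factor |m| to spare, which pays for the factor l of the
    shear term in the equation of G_l. *)
Lemma dcoef_le m t : Rabs (IZR m) * Rabs (dcoef c eta m t) <= c * Rabs eta.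
Proof.
unfold dcoef; destruct (Z.eq_dec m 0) as [->|Hm].
{ rewrite Rabs_R0, Rmult_0_r. apply Rmult_le_pos; [lra|apply Rabs_pos]. }
assert (Hm1 : 1 <= Rabs (IZR m)) by (rewrite <- abs_IZR; apply IZR_le; lia).
assert (Hm0 : IZR m <> 0) by (apply not_0_IZR; exact Hm).
unfold Rdiv. rewrite !Rabs_mult, (Rabs_pos_eq c), !Rabs_inv by lra.
rewrite <- RPow_abs.
assert (H1 := coef_den_pos (eta / IZR m - t)). rewrite (Rabs_pos_eq (1 + _)) by (unfold Rdiv in H1; lra).
assert (Hce : 0 <= c * Rabs eta) by (apply Rmult_le_pos; [lra|apply Rabs_pos]).
assert (H2 : / (1 + (eta * / IZR m - t) ^ 2) <= 1).
{ rewrite <- Rinv_1; apply Rinv_le_contravar; [lra|]. assert (Hq := pow2_ge_0 (eta * / IZR m - t)); lra. }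
assert (H3 : 0 < / (1 + (eta * / IZR m - t) ^ 2)) by (apply Rinv_0_lt_compat; unfold Rdiv in H1; lra).
set (Y := / (1 + (eta * / IZR m - t) ^ 2)) in *. clearbody Y.
set (X := Rabs (IZR m)) in *. clearbody X.
replace (X * (c * Rabs eta * / X ^ 3 * Y)) with (c * Rabs eta * (/ X ^ 2 * Y)) by (field; lra).
rewrite <- (Rmult_1_r (c * Rabs eta)) at 2. apply Rmult_le_compat_l; [exact Hce|].
assert (H4 : / X ^ 2 <= 1) by (rewrite <- Rinv_1; apply Rinv_le_contravar; [lra|nra]).
assert (H5 : 0 < / X ^ 2) by (apply Rinv_0_lt_compat; nra). nra.
Qed.

Lemma ccoef_dcoef m t : ccoef c eta m t = dcoef c eta m t * / (1 + (eta / IZR m - t) ^ 2).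
Proof.
unfold ccoef, dcoef; destruct (Z.eq_dec m 0); [ring|].
assert (H := coef_den_pos (eta / IZR m - t)).
assert (Hm0 : IZR m <> 0) by (apply not_0_IZR; assumption).
set (Q := 1 + (eta / IZR m - t) ^ 2) in *; clearbody Q. field. split; [lra|exact Hm0].
Qed.

Lemma ccoef_le m t : Rabs (ccoef c eta m t) <= Rabs (dcoef c eta m t).
Proof.
rewrite ccoef_dcoef, Rabs_mult. rewrite <- (Rmult_1_r (Rabs (dcoef c eta m t))) at 2.
apply Rmult_le_compat_l; [apply Rabs_pos|].
assert (H := coef_den_pos (eta / IZR m - t)). rewrite Rabs_pos_eq by (left; apply Rinv_0_lt_compat; lra).
rewrite <- Rinv_1; apply Rinv_le_contravar; [lra|]. assert (H1 := pow2_ge_0 (eta / IZR m - t)); lra.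
Qed.

Lemma IZR_neighbor_le l m : m <> 0%Z -> (Z.abs (l - m) <= 1)%Z -> Rabs (IZR l) <= 2 * Rabs (IZR m).
Proof. intros; rewrite <- !abs_IZR, <- mult_IZR; apply IZR_le; lia. Qed.

Lemma dcoef_0 t : dcoef c eta 0 t = 0.
Proof. reflexivity. Qed.
Lemma ccoef_0 t : ccoef c eta 0 t = 0.
Proof. reflexivity. Qed.

Lemma dcoef_cont m t : continuous (dcoef c eta m) t.
Proof.
unfold dcoef; destruct (Z.eq_dec m 0); [apply continuous_const|].
apply (ex_derive_continuous (fun t => c * eta / IZR m ^ 3 / (1 + (eta / IZR m - t) ^ 2))).
auto_derive. assert (H := coef_den_pos (eta / IZR m - t)). 
change (1 + (eta / IZR m + - t) * ((eta / IZR m + - t) * 1)) with (1 + (eta / IZR m - t) ^ 2). lra.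
Qed.

Lemma inv_den_cont q t : continuous (fun t => / (1 + (q - t) ^ 2)) t.
Proof.
apply (ex_derive_continuous (fun t => / (1 + (q - t) ^ 2))).
auto_derive. assert (H := coef_den_pos (q - t)). 
change (1 + (q + - t) * ((q + - t) * 1)) with (1 + (q - t) ^ 2). lra.
Qed.

Lemma ccoef_cont m t : continuous (ccoef c eta m) t.
Proof.
apply (continuous_ext (fun t => dcoef c eta m t * / (1 + (eta / IZR m - t) ^ 2))).
{ intros; symmetry; apply ccoef_dcoef. }
apply (continuous_mult (K := R_AbsRing) (dcoef c eta m) (fun t => / (1 + (eta / IZR m - t) ^ 2)));
 [apply dcoef_cont|apply inv_den_cont].
Qed.

Lemma coupling_cont (th G : R -> Z -> C) l t :
  (forall j t, continuous (fun s => th s j) t) -> (forall j t, continuous (fun s => G s j) t) ->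
  continuous (fun s => coupling c eta (th s) (G s) l s) t.
Proof.
intros H1 H2. unfold coupling.
assert (Ha : forall m, continuous (fun s => RtoC (ccoef c eta m s)) t) by (intros; apply continuous_RtoC, ccoef_cont).
assert (Hb : forall m, continuous (fun s => RtoC (dcoef c eta m s)) t) by (intros; apply continuous_RtoC, dcoef_cont).
apply continuous_Cplus; apply continuous_Cplus.
- exact (continuous_Cmult _ _ t (Ha (l + 1)%Z) (H1 (l + 1)%Z t)).
- exact (continuous_Cmult _ _ t (Ha (l - 1)%Z) (H1 (l - 1)%Z t)).
- exact (continuous_Cmult _ _ t (Hb (l + 1)%Z) (H2 (l + 1)%Z t)).
- exact (continuous_Cmult _ _ t (Hb (l - 1)%Z) (H2 (l - 1)%Z t)).
Qed.

Lemma coupling_minus th G th' G' l t :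
  coupling c eta (fun j => Cminus (th j) (th' j)) (fun j => Cminus (G j) (G' j)) l t
  = Cminus (coupling c eta th G l t) (coupling c eta th' G' l t).
Proof. unfold coupling, Cminus; ring. Qed.

Lemma coupling_bound th G l t B : l <> 0%Z -> 0 <= B ->
  (forall m, (Z.abs (l - m) <= 1)%Z -> Cmod (th m) <= B /\ Cmod (G m) <= B) ->
  Rabs (IZR l) * Cmod (coupling c eta th G l t) <= 8 * (c * Rabs eta) * B /\
  Cmod (coupling c eta th G l t) <= 8 * (c * Rabs eta) * B.
Proof.
intros Hl HB Hb.
assert (Hterm : forall m, (Z.abs (l - m) <= 1)%Z ->
  Rabs (IZR l) * Cmod (Cmult (RtoC (ccoef c eta m t)) (th m)) <= 2 * (c * Rabs eta) * B /\
  Rabs (IZR l) * Cmod (Cmult (RtoC (dcoef c eta m t)) (G m)) <= 2 * (c * Rabs eta) * B).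
{ intros m Hm. destruct (Hb m Hm) as [H1 H2].
  rewrite !Cmod_mult, !Cmod_R.
  destruct (Z.eq_dec m 0) as [->|Hm0].
  { rewrite ccoef_0, dcoef_0, Rabs_R0, !Rmult_0_l, Rmult_0_r.
    assert (0 <= c * Rabs eta) by (apply Rmult_le_pos; [lra|apply Rabs_pos]).
    split; apply Rmult_le_pos; lra. }
  assert (H3 := IZR_neighbor_le l m Hm0 Hm). assert (H4 := dcoef_le m t). assert (H5 := ccoef_le m t).
  assert (H6 := Rabs_pos (ccoef c eta m t)). assert (H7 := Rabs_pos (dcoef c eta m t)).
  assert (H8 := Rabs_pos (IZR l)). assert (H9 := Cmod_ge_0 (th m)). assert (H10 := Cmod_ge_0 (G m)).
  assert (H11 : Rabs (IZR l) * Rabs (dcoef c eta m t) <= 2 * (c * Rabs eta)).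
  { apply Rle_trans with (2 * Rabs (IZR m) * Rabs (dcoef c eta m t)); [apply Rmult_le_compat_r; assumption|lra]. }
  assert (H12 : Rabs (IZR l) * Rabs (ccoef c eta m t) <= 2 * (c * Rabs eta)).
  { eapply Rle_trans; [apply Rmult_le_compat_l; [exact H8|exact H5]|exact H11]. }
  split; rewrite <- (Rmult_assoc (Rabs (IZR l))); apply Rmult_le_compat; try assumption; apply Rmult_le_pos; assumption. }
assert (H1 := Hterm (l + 1)%Z ltac:(lia)). assert (H2 := Hterm (l - 1)%Z ltac:(lia)).
assert (H : Rabs (IZR l) * Cmod (coupling c eta th G l t) <= 8 * (c * Rabs eta) * B).
{ apply Rle_trans with (Rabs (IZR l) * (
    (Cmod (Cmult (RtoC (ccoef c eta (l + 1) t)) (th (l + 1)%Z)) + Cmod (Cmult (RtoC (ccoef c eta (l - 1) t)) (th (l - 1)%Z)))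
   + (Cmod (Cmult (RtoC (dcoef c eta (l + 1) t)) (G (l + 1)%Z)) + Cmod (Cmult (RtoC (dcoef c eta (l - 1) t)) (G (l - 1)%Z))))).
  - apply Rmult_le_compat_l; [apply Rabs_pos|]. unfold coupling.
    eapply Rle_trans; [apply Cmod_triangle|]. apply Rplus_le_compat; apply Cmod_triangle.
  - lra. }
split; [exact H|]. 
assert (H3 : 1 <= Rabs (IZR l)) by (rewrite <- abs_IZR; apply IZR_le; lia).
assert (H4 := Cmod_ge_0 (coupling c eta th G l t)).
eapply Rle_trans; [|exact H]. nra.
Qed.

Lemma hcoef_le q : Rabs (2 * q / (1 + q ^ 2) ^ 2) <= 1.
Proof.
assert (H := coef_den_pos q).
assert (HP : 0 < (1 + q ^ 2) ^ 2) by (apply pow_lt; lra).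
apply Rabs_le; split; apply Rmult_le_reg_r with ((1 + q ^ 2) ^ 2); auto;
  unfold Rdiv; rewrite Rmult_assoc, Rinv_l, Rmult_1_r by lra; nra.
Qed.

Lemma pcoef_le q : 0 <= / (1 + q ^ 2) <= 1.
Proof.
assert (H := coef_den_pos q). split; [left; apply Rinv_0_lt_compat; lra|].
rewrite <- Rinv_1; apply Rinv_le_contravar; [lra|]. assert (H1 := pow2_ge_0 q); lra.
Qed.

(** Bound of the forcing in a weight of ratio r: the 1 accounts for the term in theta_l, the rest
    for the couplings. It does not depend on nu. *)
Definition flow_rate (r : R) := 1 + 24 * (c * Rabs eta) * r.

Lemma forcing_bound (w : Z -> R) r : 1 <= r -> (forall l, 0 < w l) ->
  (forall l m, (Z.abs (l - m) <= 1)%Z -> w m <= r * w l) ->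
  forall t M y, 0 <= t -> 0 <= M -> (forall j, Cmod (y j) <= M * w (fst j)) ->
  forall i, Cmod (forcing t y i) <= flow_rate r * M * w (fst i).
Proof.
intros Hr Hw Hstep t M y Ht HM Hy [l b]; unfold forcing; simpl fst; simpl snd.
assert (Hce : 0 <= c * Rabs eta) by (apply Rmult_le_pos; [lra|apply Rabs_pos]).
assert (HMw : 0 <= M * w l) by (apply Rmult_le_pos; [lra|left; auto]).
unfold flow_rate.
destruct (Z.eq_dec l 0) as [->|Hl].
{ rewrite Cmod_0. rewrite Rmult_assoc. apply Rmult_le_pos; [|lra].
  assert (0 <= c * Rabs eta * r) by (apply Rmult_le_pos; lra). lra. }
destruct (coupling_bound (fun j => y (j, true)) (fun j => y (j, false)) l t (M * (r * w l)) Hl) as [H1 H2].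
{ apply Rmult_le_pos; [lra|]. apply Rmult_le_pos; [lra|left; auto]. }
{ intros m Hm. specialize (Hstep l m Hm).
  assert (H3 : M * w m <= M * (r * w l)) by (apply Rmult_le_compat_l; lra).
  split; (eapply Rle_trans; [apply Hy|exact H3]). }
set (A := coupling c eta _ _ l t) in *.
assert (H0 : 0 <= c * Rabs eta * (M * (r * w l))).
{ apply Rmult_le_pos; [lra|]. apply Rmult_le_pos; [lra|]. apply Rmult_le_pos; [lra|left; auto]. }
replace ((1 + 24 * (c * Rabs eta) * r) * M * w l) with (M * w l + 24 * (c * Rabs eta) * (M * (r * w l))) by ring.
destruct b; [lra|].
assert (Hq1 := hcoef_le (eta / IZR l - t)). assert (Hq2 := pcoef_le (eta / IZR l - t)).
assert (Hff : Rabs (f (Rmax 0 t) / (2 * c)) <= 1).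
{ rewrite Rmax_right by lra. unfold Rdiv; rewrite Rabs_mult, Rabs_inv, (Rabs_pos_eq (2 * c)) by lra.
  apply Rmult_le_reg_r with (2 * c); [lra|]. rewrite Rmult_assoc, Rinv_l, Rmult_1_r, Rmult_1_l by lra.
  eapply Rle_trans; [apply Hf3, Ht|]. unfold Rdiv. rewrite <- (Rmult_1_r (2 * c)) at 2.
  apply Rmult_le_compat_l; [lra|]. apply (pcoef_le t). }
eapply Rle_trans; [apply Cmod_triangle|].
assert (E1 : Cmod (Cmult (Cmult (RtoC (f (Rmax 0 t) / (2 * c))) (Cmult Ci (RtoC (IZR l)))) A)
   <= 8 * (c * Rabs eta) * (M * (r * w l))).
{ rewrite !Cmod_mult, !Cmod_R. replace (Cmod Ci) with 1.
  2: { unfold Cmod, Ci; simpl. replace (0 * (0 * 1) + 1 * (1 * 1)) with 1 by ring. symmetry; apply sqrt_1. }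
  rewrite Rmult_1_l, Rmult_assoc. 
  assert (H4 : 0 <= Rabs (IZR l) * Cmod A) by (apply Rmult_le_pos; [apply Rabs_pos|apply Cmod_ge_0]).
  assert (H5 := Rabs_pos (f (Rmax 0 t) / (2 * c))). nra. }
assert (E2 := Cmod_triangle (Cmult (RtoC (2 * (eta / IZR l - t) / (1 + (eta / IZR l - t) ^ 2) ^ 2)) (y (l, true)))
  (Cmult (RtoC (/ (1 + (eta / IZR l - t) ^ 2))) A)).
rewrite !Cmod_mult, !Cmod_R in E2. rewrite (Rabs_pos_eq (/ _)) in E2 by apply Hq2.
assert (E3 := Hy (l, true)). simpl fst in E3. assert (E4 := Cmod_ge_0 (y (l, true))). assert (E5 := Cmod_ge_0 A).
assert (E6 : Rabs (2 * (eta / IZR l - t) / (1 + (eta / IZR l - t) ^ 2) ^ 2) * Cmod (y (l, true)) <= M * w l).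
{ apply Rle_trans with (1 * Cmod (y (l, true))); [apply Rmult_le_compat_r; assumption|lra]. }
assert (E7 : / (1 + (eta / IZR l - t) ^ 2) * Cmod A <= 1 * Cmod A) by (apply Rmult_le_compat_r; [assumption|apply Hq2]).
lra.
Qed.

Lemma damp_nonneg i t : 0 <= damp i t.
Proof.
unfold damp; destruct (snd i); [lra|]. apply Rmult_le_pos; [lra|].
assert (H1 := pow2_ge_0 (IZR (fst i))). assert (H2 := pow2_ge_0 (eta - IZR (fst i) * t)). lra.
Qed.

Lemma damp_int_derive i t : is_derive (damp_int i) t (damp i t).
Proof.
unfold damp_int, damp; destruct (snd i); [apply (@is_derive_const R_AbsRing R_NormedModule)|].
auto_derive; [exact Logic.I|]. field.
Qed.

Lemma damp_int_0 i : damp_int i 0 = 0.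
Proof. unfold damp_int; destruct (snd i); [reflexivity|field]. Qed.

Lemma forcing_minus t y z i :
  forcing t (fun j => Cminus (y j) (z j)) i = Cminus (forcing t y i) (forcing t z i).
Proof.
unfold forcing. rewrite coupling_minus. destruct (Z.eq_dec (fst i) 0), (snd i); unfold Cminus; ring.
Qed.

Lemma forcing_cont (u : R -> Z * bool -> C) : (forall j t, continuous (fun s => u s j) t) ->
  forall i t, continuous (fun s => forcing s (u s) i) t.
Proof.
intros Hu [l b] t; unfold forcing; simpl fst; simpl snd.
assert (HA : continuous (fun s => coupling c eta (fun j => u s (j, true)) (fun j => u s (j, false)) l s) t).
{ apply (coupling_cont (fun s j => u s (j, true)) (fun s j => u s (j, false))); intros; apply Hu. }
destruct (Z.eq_dec l 0); [apply continuous_const|]. destruct b; [exact HA|].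
assert (Hp := inv_den_cont (eta / IZR l) t).
apply continuous_Cplus; [|apply continuous_Cplus].
- apply continuous_Cmult; [|exact HA]. apply continuous_Cmult; [|apply continuous_const].
  apply continuous_RtoC. apply (continuous_mult (K := R_AbsRing) (fun s => f (Rmax 0 s)) (fun _ => / (2 * c)));
  [apply f_clamp_cont|apply continuous_const].
- apply continuous_Cmult; [|apply Hu]. apply continuous_RtoC.
  apply (ex_derive_continuous (fun s => 2 * (eta / IZR l - s) / (1 + (eta / IZR l - s) ^ 2) ^ 2)).
  assert (H := coef_den_pos (eta / IZR l - t)). auto_derive.
  assert (HH : 0 < (1 + (eta / IZR l - t) ^ 2) ^ 2) by (apply pow_lt; lra).
  change ((1 + (eta / IZR l + - t) * ((eta / IZR l + - t) * 1)) * ((1 + (eta / IZR l + - t) * ((eta / IZR l + - t) * 1)) * 1))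
    with ((1 + (eta / IZR l - t) ^ 2) ^ 2). lra.
- apply continuous_Cmult; [|exact HA]. apply continuous_RtoC. exact Hp.
Qed.

Lemma flow_rate_pos r : 1 <= r -> 0 < flow_rate r.
Proof.
intros; unfold flow_rate. assert (0 <= c * Rabs eta) by (apply Rmult_le_pos; [lra|apply Rabs_pos]).
assert (0 <= c * Rabs eta * r) by (apply Rmult_le_pos; lra). lra.
Qed.

Lemma system_eq (y : R -> Z * bool -> C) t l : 0 < t -> l <> 0%Z ->
  Cplus (Cmult (RtoC (- damp (l, true) t)) (y t (l, true))) (forcing t (y t) (l, true))
   = rhs_theta c eta (fun j => y t (j, true)) (fun j => y t (j, false)) l t /\
  Cplus (Cmult (RtoC (- damp (l, false) t)) (y t (l, false))) (forcing t (y t) (l, false))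
   = rhs_G nu c f eta (fun j => y t (j, true)) (fun j => y t (j, false)) l t.
Proof.
intros Ht Hl; unfold damp, forcing, rhs_theta, rhs_G; simpl fst; simpl snd.
destruct (Z.eq_dec l 0); [contradiction|]. rewrite Rmax_right by lra. split.
- rewrite Ropp_0. ring.
- replace (- (nu * (IZR l ^ 2 + (eta - IZR l * t) ^ 2))) with (- nu * (IZR l ^ 2 + (eta - IZR l * t) ^ 2)) by ring.
  ring.
Qed.

Lemma flow_spec u (w : Z -> R) r M0 : 1 <= r -> (forall l, 0 < w l) ->
  (forall l m, (Z.abs (l - m) <= 1)%Z -> w m <= r * w l) -> 0 <= M0 ->
  u 0%Z = RtoC 0 -> (forall l, Cmod (u l) <= M0 * w l) ->
  let th := fun t l => flow u t (l, true) in let G := fun t l => flow u t (l, false) in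
  ode_sol th G /\ th 0 = u /\ G 0 = (fun _ => RtoC 0) /\
  forall t l, 0 <= t -> Cmod (th t l) <= 13 * M0 * w l * exp (2 * flow_rate r * t) /\
                        Cmod (G t l) <= 13 * M0 * w l * exp (2 * flow_rate r * t).
Proof.
intros Hr Hw Hstep HM0 Hu0 Hu th G.
assert (Hy0 : forall i, Cmod (init_state u i) <= M0 * w (fst i)).
{ intros [l b]; unfold init_state; simpl. assert (0 <= M0 * w l) by (apply Rmult_le_pos; [lra|left; auto]).
  destruct (Z.eq_dec l 0), b; rewrite ?Cmod_0; auto. }
destruct (picard_sol_spec _ damp damp_int forcing (init_state u) damp_int_derive damp_int_0 (fun i t _ => damp_nonneg i t)
  forcing_minus forcing_cont (fun i => w (fst i)) (flow_rate r) M0 (flow_rate_pos r Hr) (fun i => Hw (fst i))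
  (forcing_bound w r Hr Hw Hstep) HM0 Hy0) as [S1 [S2 [S3 S4]]].
fold (flow u) in *.
(* The mode 0 has neither data nor forcing, so [duhamel] with P = 0 keeps it at 0. *)
assert (Hzero : forall b t, 0 <= t -> flow u t (0%Z, b) = RtoC 0).
{ intros b t Ht. apply Cmod_eq_0.
  assert (H := duhamel (fun s => flow u s (0%Z, b)) (fun _ => RtoC 0) (damp (0%Z, b)) (damp_int (0%Z, b)) (fun _ => 0) (fun _ => 0) 0 0 t Ht).
  cbv beta in H. rewrite S2 in H. replace (init_state u (0%Z, b)) with (RtoC 0) in H
    by (unfold init_state; simpl fst; destruct (Z.eq_dec 0 0); [reflexivity|contradiction]).
  rewrite Cmod_0, Rmax_left in H by lra.
  apply Rle_antisym; [|apply Cmod_ge_0]. eapply Rle_trans; [apply H; clear H|lra].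
  - intros; apply S1.
  - intros; apply continuous_const.
  - intros; eapply continuous_of_derive, damp_int_derive.
  - intros s Hs. apply (S3 (0%Z, b) s); lra.
  - intros; apply damp_int_derive.
  - intros; apply (@is_derive_const R_AbsRing R_NormedModule).
  - intros; apply damp_nonneg.
  - intros; lra.
  - intros; lra. }
split; [constructor|split; [|split]].
- intros l t; apply S1.
- intros l t; apply S1.
- intros t Ht; split; apply Hzero, Ht.
- intros t l Ht Hl. eapply is_derive_value_C; [apply (S3 (l, true) t Ht)|]. apply (system_eq (flow u) t l Ht Hl).
- intros t l Ht Hl. eapply is_derive_value_C; [apply (S3 (l, false) t Ht)|]. apply (system_eq (flow u) t l Ht Hl).
- apply FunctionalExtensionality.functional_extensionality; intros l. unfold th. rewrite S2. unfold init_state; simpl.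
  destruct (Z.eq_dec l 0) as [->|]; [symmetry; exact Hu0|reflexivity].
- apply FunctionalExtensionality.functional_extensionality; intros l. unfold G. rewrite S2. unfold init_state; simpl.
  destruct (Z.eq_dec l 0); reflexivity.
- intros t l Ht; split; [apply (S4 (l, true) t Ht)|apply (S4 (l, false) t Ht)].
Qed.

(** The comparison weight grows like 2^|l| because the weight of X may decay like 2^-|l|: the class
    has to contain every solution that is bounded in X. *)
Lemma ode_unique th G th' G' T M : 0 <= M -> ode_sol th G -> ode_sol th' G' ->
  th 0 = th' 0 -> G 0 = G' 0 ->
  (forall t l, 0 <= t <= T -> Cmod (th t l) <= M * 2 ^ Z.abs_nat l /\ Cmod (G t l) <= M * 2 ^ Z.abs_nat l) ->
  (forall t l, 0 <= t <= T -> Cmod (th' t l) <= M * 2 ^ Z.abs_nat l /\ Cmod (G' t l) <= M * 2 ^ Z.abs_nat l) ->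
  forall t l, 0 <= t <= T -> th t l = th' t l /\ G t l = G' t l.
Proof.
intros HM S S' E1 E2 B B'.
pose (y := fun (t : R) (i : Z * bool) => if snd i then Cminus (th t (fst i)) (th' t (fst i)) else Cminus (G t (fst i)) (G' t (fst i))).
assert (Hd : forall t i, 0 < t -> is_derive (fun s => y s i) t (Cplus (Cmult (RtoC (- damp i t)) (y t i)) (forcing t (y t) i))
   \/ fst i = 0%Z).
{ intros t [l b] Ht. destruct (Z.eq_dec l 0) as [->|Hl]; [right; reflexivity|left].
  destruct (system_eq y t l Ht Hl) as [Q1 Q2]. unfold y in *; simpl fst in *; simpl snd in *.
  destruct b; [rewrite Q1|rewrite Q2].
  - eapply is_derive_value_C; [apply is_derive_Cminus; [apply (ode_th _ _ S)|apply (ode_th _ _ S')]; assumption|].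
    unfold rhs_theta. symmetry; apply coupling_minus.
  - eapply is_derive_value_C; [apply is_derive_Cminus; [apply (ode_G _ _ S)|apply (ode_G _ _ S')]; assumption|].
    unfold rhs_G. rewrite coupling_minus. unfold Cminus; ring. }
assert (Hz : forall t i, 0 <= t <= T -> y t i = RtoC 0).
{ apply (linear_ode_unique _ damp damp_int forcing damp_int_derive (fun i t _ => damp_nonneg i t) (fun i => 2 ^ Z.abs_nat (fst i))
    (flow_rate 2)) with (M := 2 * M).
  - apply flow_rate_pos; lra.
  - intros; apply pow_lt; lra.
  - apply (forcing_bound (fun l => 2 ^ Z.abs_nat l) 2); [lra|intros; apply pow_lt; lra|].
    intros l m Hm. change (2 * 2 ^ Z.abs_nat l) with (2 ^ (Datatypes.S (Z.abs_nat l))). apply Rle_pow; [lra|lia].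
  - lra.
  - intros t [l b] Ht; unfold y; simpl. destruct b; apply continuous_Cminus;
    [apply (ode_cont_th _ _ S)|apply (ode_cont_th _ _ S')|apply (ode_cont_G _ _ S)|apply (ode_cont_G _ _ S')].
  - intros t [l b] Ht. destruct (Hd t (l, b) ltac:(lra)) as [H|H]; [exact H|]. simpl in H; subst l.
    assert (Z0 : forall s, 0 < s -> y s (0%Z, b) = RtoC 0).
    { intros s Hs; unfold y; simpl.
      destruct (ode_zero _ _ S s ltac:(lra)) as [Z1 Z2]. destruct (ode_zero _ _ S' s ltac:(lra)) as [Z3 Z4].
      rewrite Z1, Z2, Z3, Z4. destruct b; unfold Cminus; ring. }
    apply (is_derive_ext_loc (K := R_AbsRing) (V := prod_NormedModule R_AbsRing R_NormedModule R_NormedModule) (fun _ => RtoC 0)).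
    { generalize (locally_pos t ltac:(lra)). apply filter_imp. intros s Hs; symmetry; apply Z0, Hs. }
    eapply is_derive_value_C; [apply (@is_derive_const R_AbsRing (prod_NormedModule R_AbsRing R_NormedModule R_NormedModule))|].
    rewrite (Z0 t) by lra. unfold forcing; simpl fst.
    destruct (Z.eq_dec 0 0); [|contradiction]. transitivity (RtoC 0); [reflexivity|ring].
  - intros [l b]; unfold y; simpl. rewrite E1, E2. destruct b; unfold Cminus; ring.
  - intros t [l b] Ht; unfold y; simpl. destruct (B t l Ht) as [B1 B2]. destruct (B' t l Ht) as [B3 B4].
    destruct b; unfold Cminus; (eapply Rle_trans; [apply Cmod_triangle|rewrite Cmod_opp; lra]). }
intros t l Ht. assert (H1 := Hz t (l, true) Ht). assert (H2 := Hz t (l, false) Ht). unfold y in *; simpl in *.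
split.
- replace (th t l) with (Cplus (Cminus (th t l) (th' t l)) (th' t l)) by (unfold Cminus; ring). rewrite H1; ring.
- replace (G t l) with (Cplus (Cminus (G t l) (G' t l)) (G' t l)) by (unfold Cminus; ring). rewrite H2; ring.
Qed.

End System.

(** * The good unknown *)

(** Fluxes are integrated through explicit primitives only: atan for a Lorentzian, - 1/t for its
    tail. *)
Lemma RInt_le_deriv (F g g' : R -> R) a b : a <= b -> (forall t, continuous F t) ->
  (forall t, a <= t <= b -> is_derive g t (g' t)) ->
  (forall t, a < t < b -> F t <= g' t) -> RInt F a b <= g b - g a.
Proof.
intros Hab HF Hg Hle.
assert (H : g a - RInt F a a <= g b - RInt F a b).
{ apply (le_of_derive (fun t => g t - RInt F a t) (fun t => g' t - F t)); [exact Hab| | |].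
  - intros t Ht. apply (continuous_minus g (fun t => RInt F a t)).
    + eapply continuous_of_derive, Hg, Ht.
    + eapply continuous_of_derive, is_derive_RInt_cont, HF.
  - intros t Ht. apply (is_derive_minus g (fun t => RInt F a t)); [apply Hg; lra|apply is_derive_RInt_cont, HF].
  - intros t Ht. specialize (Hle t Ht). lra. }
rewrite RInt_point in H. change (@zero R_CompleteNormedModule) with 0 in H. lra.
Qed.

Lemma RInt_split (F : R -> R) a b e : (forall t, continuous F t) -> RInt F a b + RInt F b e = RInt F a e.
Proof.
intros HF. apply (RInt_Chasles (V := R_CompleteNormedModule) F); apply ex_RInt_cont, HF.
Qed.

Lemma continuous_Cmod (y : R -> C) t : continuous y t -> continuous (fun s => Cmod (y s)) t.
Proof.
intros H. unfold Cmod. apply (continuous_comp (fun s => (fst (y s)) ^ 2 + (snd (y s)) ^ 2) sqrt).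
- assert (E : forall s, Re (y s) * Re (y s) + Im (y s) * Im (y s) = (fst (y s)) ^ 2 + (snd (y s)) ^ 2)
    by (intros; unfold Re, Im; ring).
  apply (continuous_ext (fun s => Re (y s) * Re (y s) + Im (y s) * Im (y s))); [exact E|].
  assert (H1 := continuous_Re _ _ H). assert (H2 := continuous_Im _ _ H).
  apply (continuous_plus (fun s => Re (y s) * Re (y s)) (fun s => Im (y s) * Im (y s))).
  + exact (continuous_mult (K := R_AbsRing) _ _ _ H1 H1).
  + exact (continuous_mult (K := R_AbsRing) _ _ _ H2 H2).
- apply continuous_sqrt.
Qed.

Lemma is_derive_RtoC_mult (u : R -> R) (y : R -> C) t u' y' :
  is_derive u t u' -> is_derive y t y' ->
  is_derive (fun s => Cmult (RtoC (u s)) (y s)) t (Cplus (Cmult (RtoC u') (y t)) (Cmult (RtoC (u t)) y')).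
Proof.
intros Hu Hy.
assert (Hr := is_derive_Re _ _ _ Hy). assert (Hi := is_derive_Im _ _ _ Hy).
assert (H1 := is_derive_mult _ _ _ _ _ Hu Hr ltac:(intros; apply Rmult_comm)).
assert (H2 := is_derive_mult _ _ _ _ _ Hu Hi ltac:(intros; apply Rmult_comm)).
apply (is_derive_ext (K := R_AbsRing) (V := prod_NormedModule R_AbsRing R_NormedModule R_NormedModule)
  (fun s => (u s * Re (y s), u s * Im (y s)))).
{ intros s. transitivity (Cmult (RtoC (u s)) (y s)); [|reflexivity].
  destruct (y s); unfold Cmult, RtoC; simpl; f_equal; ring. }
eapply is_derive_value_C; [apply (is_derive_C _ _ _ _ _ H1 H2)|].
unfold plus, mult; simpl. destruct (y t), y'; unfold Cmult, Cplus, RtoC; simpl; f_equal; ring.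
Qed.

Section Good.
Variables (nu c : R) (f : R -> R) (eta : R) (th G : R -> Z -> C).
Hypothesis Hnu : 0 < nu.
Hypothesis Hc : 0 < c.
Hypothesis Hf3 : forall t, 0 <= t -> Rabs (f t) <= 2 * c / (1 + t ^ 2).
Hypothesis Hsol : ode_sol nu c f eta th G.

Definition pcf (l : Z) (t : R) : R := / (1 + (eta / IZR l - t) ^ 2).

(* The good unknown: the resonant forcing [2 q / (1 + q ^ 2) ^ 2 * theta_l] of [G_l] is [p' theta_l],
   so that [G_l - p theta_l] is driven by the damping only. *)
Definition good (t : R) (l : Z) : C := Cminus (G t l) (Cmult (RtoC (pcf l t)) (th t l)).

(** Since c_j = d_j p_j and G_j = [good] + p_j theta_j, mode j sends d_j (2 p_j theta_j + [good]) to
    each neighbour; the factor 2 adds the direct coupling to the one through G_j. *)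
Definition input_flux (j : Z) (t : R) : R :=
  Rabs (dcoef c eta j t) * (2 * pcf j t * Cmod (th t j) + Cmod (good t j)).

Lemma pcf_bounds l t : 0 < pcf l t <= 1.
Proof.
unfold pcf; split; [apply Rinv_0_lt_compat; apply coef_den_pos|apply pcoef_le].
Qed.

Lemma pcf_cont l t : continuous (pcf l) t.
Proof. apply inv_den_cont. Qed.

Lemma good_cont l t : continuous (fun s => good s l) t.
Proof.
unfold good; apply continuous_Cminus; [apply (ode_cont_G _ _ _ _ _ _ Hsol)|].
apply continuous_Cmult; [apply continuous_RtoC, pcf_cont|apply (ode_cont_th _ _ _ _ _ _ Hsol)].
Qed.

Lemma flux_cont j t : continuous (input_flux j) t.
Proof.
unfold input_flux. apply (continuous_mult (K := R_AbsRing) (fun t => Rabs (dcoef c eta j t))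
  (fun t => 2 * pcf j t * Cmod (th t j) + Cmod (good t j))).
- apply (continuous_comp (dcoef c eta j) Rabs); [apply dcoef_cont|apply continuous_Rabs].
- apply (continuous_plus (fun t => 2 * pcf j t * Cmod (th t j)) (fun t => Cmod (good t j))).
  + apply (continuous_mult (K := R_AbsRing) (fun t => 2 * pcf j t) (fun t => Cmod (th t j))).
    * apply (continuous_mult (K := R_AbsRing) (fun _ => 2) (pcf j)); [apply continuous_const|apply pcf_cont].
    * apply continuous_Cmod, (ode_cont_th _ _ _ _ _ _ Hsol).
  + apply continuous_Cmod, good_cont.
Qed.

Lemma flux_nonneg j t : 0 <= input_flux j t.
Proof.
unfold input_flux. apply Rmult_le_pos; [apply Rabs_pos|].
assert (H := pcf_bounds j t). assert (H1 := Cmod_ge_0 (th t j)). assert (H2 := Cmod_ge_0 (good t j)).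
assert (0 <= pcf j t * Cmod (th t j)) by (apply Rmult_le_pos; lra). lra.
Qed.

Lemma flux_0 t : input_flux 0 t = 0.
Proof. unfold input_flux. rewrite dcoef_0, Rabs_R0; ring. Qed.

Lemma flux_le j t X Y : Cmod (th t j) <= X -> Cmod (good t j) <= Y ->
  input_flux j t <= Rabs (dcoef c eta j t) * (2 * pcf j t * X + Y).
Proof.
intros H1 H2. apply Rmult_le_compat_l; [apply Rabs_pos|].
assert (H := pcf_bounds j t). assert (pcf j t * Cmod (th t j) <= pcf j t * X) by (apply Rmult_le_compat_l; lra). lra.
Qed.

Lemma coupling_good t l : 0 <= t ->
  coupling c eta (th t) (G t) l t =
  Cplus (Cmult (RtoC (dcoef c eta (l + 1) t)) (Cplus (Cmult (RtoC (2 * pcf (l + 1) t)) (th t (l + 1)%Z)) (good t (l + 1))))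
        (Cmult (RtoC (dcoef c eta (l - 1) t)) (Cplus (Cmult (RtoC (2 * pcf (l - 1) t)) (th t (l - 1)%Z)) (good t (l - 1)))).
Proof.
intros Ht. unfold coupling, good. rewrite !ccoef_dcoef. fold (pcf (l + 1) t). fold (pcf (l - 1) t).
rewrite !RtoC_mult. unfold Cminus. ring.
Qed.

Lemma coupling_flux t l : 0 <= t -> Cmod (coupling c eta (th t) (G t) l t) <= input_flux (l + 1) t + input_flux (l - 1) t.
Proof.
intros Ht. rewrite coupling_good by exact Ht.
assert (H : forall j, Cmod (Cmult (RtoC (dcoef c eta j t)) (Cplus (Cmult (RtoC (2 * pcf j t)) (th t j)) (good t j))) <= input_flux j t).
{ intros j. rewrite Cmod_mult, Cmod_R. apply Rmult_le_compat_l; [apply Rabs_pos|].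
  eapply Rle_trans; [apply Cmod_triangle|]. rewrite Cmod_mult, Cmod_R, Rabs_pos_eq; [lra|].
  assert (H := pcf_bounds j t); lra. }
eapply Rle_trans; [apply Cmod_triangle|]. apply Rplus_le_compat; apply H.
Qed.

Lemma theta_variation l a b : l <> 0%Z -> 0 <= a <= b ->
  Cmod (Cminus (th b l) (th a l)) <= RInt (input_flux (l + 1)) a b + RInt (input_flux (l - 1)) a b.
Proof.
intros Hl Hab.
assert (H := Cmod_incr (fun s => th s l) (fun s => rhs_theta c eta (th s) (G s) l s)
  (fun s => input_flux (l + 1) s + input_flux (l - 1) s) (fun s => RInt (input_flux (l + 1)) a s + RInt (input_flux (l - 1)) a s) a b ltac:(lra)).
cbv beta in H. rewrite !RInt_point in H. change (@zero R_CompleteNormedModule) with 0 in H.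
replace (RInt (input_flux (l + 1)) a b + RInt (input_flux (l - 1)) a b) with
 (RInt (input_flux (l + 1)) a b + RInt (input_flux (l - 1)) a b - (0 + 0)) by ring.
apply H; clear H.
- intros; apply (ode_cont_th _ _ _ _ _ _ Hsol).
- intros t _. apply (continuous_plus (fun s => RInt (input_flux (l + 1)) a s) (fun s => RInt (input_flux (l - 1)) a s));
  eapply continuous_of_derive, is_derive_RInt_cont, flux_cont.
- intros t Ht; apply (ode_th _ _ _ _ _ _ Hsol); [lra|exact Hl].
- intros t Ht. apply (is_derive_plus (fun s => RInt (input_flux (l + 1)) a s) (fun s => RInt (input_flux (l - 1)) a s));
  apply is_derive_RInt_cont, flux_cont.
- intros t Ht. apply coupling_flux; lra.
Qed.

Lemma pcf_derive l t : is_derive (pcf l) t (2 * (eta / IZR l - t) / (1 + (eta / IZR l - t) ^ 2) ^ 2).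
Proof.
unfold pcf. assert (H := coef_den_pos (eta / IZR l - t)). auto_derive.
{ change (1 + (eta / IZR l + - t) * ((eta / IZR l + - t) * 1)) with (1 + (eta / IZR l - t) ^ 2). lra. }
change (eta / IZR l + - t) with (eta / IZR l - t). set (q := eta / IZR l - t) in *. clearbody q. field. 
assert (0 < 1 + q * q) by nra. nra.
Qed.

(** Besides p' theta_l, the last term of the equation of G_l is p theta_l' and cancels too. What
    appears instead is - damp p theta_l, which has the damping as a factor. *)
Lemma good_derive l t : 0 < t -> l <> 0%Z ->
  is_derive (fun s => good s l) t
   (Cplus (Cmult (RtoC (- damp nu eta (l, false) t)) (good t l))
     (Cplus (Cmult (RtoC (- (damp nu eta (l, false) t * pcf l t))) (th t l))
       (Cmult (Cmult (RtoC (f t / (2 * c))) (Cmult Ci (RtoC (IZR l)))) (coupling c eta (th t) (G t) l t)))).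
Proof.
intros Ht Hl. unfold good.
assert (H1 := ode_G _ _ _ _ _ _ Hsol t l Ht Hl). assert (H2 := ode_th _ _ _ _ _ _ Hsol t l Ht Hl).
assert (H3 := is_derive_RtoC_mult _ _ _ _ _ (pcf_derive l t) H2).
eapply is_derive_value_C; [apply (is_derive_Cminus _ _ _ _ _ H1 H3)|].
unfold rhs_G, rhs_theta. change (damp nu eta (l, false) t) with (nu * (IZR l ^ 2 + (eta - IZR l * t) ^ 2)). fold (pcf l t).
replace (- (nu * (IZR l ^ 2 + (eta - IZR l * t) ^ 2) * pcf l t)) with (- nu * (IZR l ^ 2 + (eta - IZR l * t) ^ 2) * pcf l t) by ring.
replace (- (nu * (IZR l ^ 2 + (eta - IZR l * t) ^ 2))) with (- nu * (IZR l ^ 2 + (eta - IZR l * t) ^ 2)) by ring.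
rewrite (RtoC_mult _ (pcf l t)). unfold Cminus. ring.
Qed.

(** The factor |l| / (1 + t^2) bounds the shear coefficient l f / (2c). *)
Definition weighted_flux (l j : Z) (t : R) : R := Rabs (IZR l) / (1 + t ^ 2) * input_flux j t.

Lemma wflux_cont l j t : continuous (weighted_flux l j) t.
Proof.
apply (continuous_mult (K := R_AbsRing) (fun t => Rabs (IZR l) / (1 + t ^ 2)) (input_flux j)); [|apply flux_cont].
apply (ex_derive_continuous (fun t => Rabs (IZR l) / (1 + t ^ 2))). auto_derive.
assert (H := coef_den_pos t). change (1 + t * (t * 1)) with (1 + t ^ 2). lra.
Qed.

Lemma wflux_nonneg l j t : 0 <= weighted_flux l j t.
Proof.
unfold weighted_flux. apply Rmult_le_pos; [|apply flux_nonneg]. apply Rdiv_le_0_compat; [apply Rabs_pos|apply coef_den_pos].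
Qed.

Lemma shear_forcing_le l t : 0 < t ->
  Cmod (Cmult (Cmult (RtoC (f t / (2 * c))) (Cmult Ci (RtoC (IZR l)))) (coupling c eta (th t) (G t) l t))
  <= weighted_flux l (l + 1) t + weighted_flux l (l - 1) t.
Proof.
intros Ht. rewrite !Cmod_mult, !Cmod_R. replace (Cmod Ci) with 1.
2: { unfold Cmod, Ci; simpl. replace (0 * (0 * 1) + 1 * (1 * 1)) with 1 by ring. symmetry; apply sqrt_1. }
rewrite Rmult_1_l. unfold weighted_flux. rewrite <- Rmult_plus_distr_l.
assert (Hff : Rabs (f t / (2 * c)) <= / (1 + t ^ 2)).
{ unfold Rdiv; rewrite Rabs_mult, Rabs_inv, (Rabs_pos_eq (2 * c)) by lra.
  apply Rmult_le_reg_r with (2 * c); [lra|]. rewrite Rmult_assoc, Rinv_l, Rmult_1_r by lra.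
  rewrite Rmult_comm. apply Hf3; lra. }
apply Rmult_le_compat.
- apply Rmult_le_pos; apply Rabs_pos.
- apply Cmod_ge_0.
- unfold Rdiv. rewrite Rmult_comm. apply Rmult_le_compat_l; [apply Rabs_pos|exact Hff].
- apply coupling_flux; lra.
Qed.

(** The forcing is the damping times p theta_l plus the shear term, the very form that [duhamel]
    absorbs: whatever nu is, [good] stays below the supremum P of p theta_l up to the shear flux. *)
Lemma good_bound l a b P : l <> 0%Z -> 0 <= a <= b ->
  (forall t, a < t < b -> pcf l t * Cmod (th t l) <= P) ->
  Cmod (good b l) <= Rmax (Cmod (good a l)) P + (RInt (weighted_flux l (l + 1)) a b + RInt (weighted_flux l (l - 1)) a b).
Proof.
intros Hl Hab HP.
assert (H := duhamel (fun s => good s l) (fun t =>  (Cplus (Cmult (RtoC (- (damp nu eta (l, false) t * pcf l t))) (th t l))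
       (Cmult (Cmult (RtoC (f t / (2 * c))) (Cmult Ci (RtoC (IZR l)))) (coupling c eta (th t) (G t) l t))))
  (damp nu eta (l, false)) (damp_int nu eta (l, false))
  (fun s => weighted_flux l (l + 1) s + weighted_flux l (l - 1) s) (fun s => RInt (weighted_flux l (l + 1)) a s + RInt (weighted_flux l (l - 1)) a s) P a b ltac:(lra)).
cbv beta in H. rewrite !RInt_point in H. change (@zero R_CompleteNormedModule) with 0 in H.
replace (RInt (weighted_flux l (l + 1)) a b + RInt (weighted_flux l (l - 1)) a b) with
 (RInt (weighted_flux l (l + 1)) a b + RInt (weighted_flux l (l - 1)) a b - (0 + 0)) by ring.
apply H; clear H.
- intros; apply good_cont.
- intros t _. apply (continuous_plus (fun s => RInt (weighted_flux l (l + 1)) a s) (fun s => RInt (weighted_flux l (l - 1)) a s));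
  eapply continuous_of_derive, is_derive_RInt_cont, wflux_cont.
- intros; eapply continuous_of_derive, damp_int_derive.
- intros t Ht; apply good_derive; [lra|exact Hl].
- intros; apply damp_int_derive.
- intros t Ht. apply (is_derive_plus (fun s => RInt (weighted_flux l (l + 1)) a s) (fun s => RInt (weighted_flux l (l - 1)) a s));
  apply is_derive_RInt_cont, wflux_cont.
- intros; apply damp_nonneg; exact Hnu.
- intros t Ht. assert (H1 := wflux_nonneg l (l + 1) t). assert (H2 := wflux_nonneg l (l - 1) t). lra.
- intros t Ht. assert (Hd := damp_nonneg nu eta Hnu (l, false) t). assert (Hp := pcf_bounds l t).
  eapply Rle_trans; [apply Cmod_triangle|]. apply Rplus_le_compat; [|apply shear_forcing_le; lra].
  rewrite Cmod_mult, Cmod_R, Rabs_Ropp, Rabs_pos_eq by (apply Rmult_le_pos; lra).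
  rewrite Rmult_assoc. apply Rmult_le_compat_l; [exact Hd|apply HP; exact Ht].
Qed.

Lemma G_le_good t l : Cmod (G t l) <= Cmod (good t l) + pcf l t * Cmod (th t l).
Proof.
assert (H := Cmod_triangle (good t l) (Cmult (RtoC (pcf l t)) (th t l))).
replace (Cplus (good t l) (Cmult (RtoC (pcf l t)) (th t l))) with (G t l) in H by (unfold good, Cminus; ring).
rewrite Cmod_mult, Cmod_R, Rabs_pos_eq in H; [exact H|]. left; apply pcf_bounds.
Qed.

End Good.

(** * Scalar model of one resonance *)

Lemma is_derive_atan_shift x t : is_derive (fun s => atan (s - x)) t (/ (1 + (x - t) ^ 2)).
Proof.
eapply is_derive_value; [apply (is_derive_comp atan (fun s => s - x)); [apply is_derive_atan|]|].
- auto_derive; [exact Logic.I|reflexivity].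
- unfold scal; simpl; unfold mult; simpl. unfold Rdiv. rewrite !Rmult_1_l. f_equal. unfold Rsqr; ring.
Qed.

Lemma atan_diff_le x y : atan x - atan y <= PI.
Proof. assert (H1 := atan_bound x). assert (H2 := atan_bound y). lra. Qed.

Lemma atan_large x : 0 < x -> PI / 2 - / x <= atan x.
Proof.
intros Hx. assert (Hi : 0 < / x) by (apply Rinv_0_lt_compat; exact Hx).
rewrite <- (Rinv_inv x) at 2. rewrite atan_inv by exact Hi.
assert (atan (/ x) <= / x); [|lra].
assert (H := le_of_derive (fun s => s - atan (s - 0)) (fun s => 1 - / (1 + (0 - s) ^ 2)) 0 (/ x) ltac:(lra)).
cbv beta in H. rewrite !Rminus_0_r, atan_0, Rminus_0_r in H.
assert (H1 : forall t, is_derive (fun s => s - atan (s - 0)) t (1 - / (1 + (0 - t) ^ 2))).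
{ intros t. apply derive_minus; [apply derive_id|apply is_derive_atan_shift]. }
specialize (H ltac:(intros; eapply continuous_of_derive, H1) ltac:(intros; apply H1)).
assert (H2 : 0 <= / x - atan (/ x)); [|lra]. apply H. intros t _. assert (Hp := pcoef_le (0 - t)). lra.
Qed.

(* [W] is the response of [- good_m] to a frozen amplitude [theta_m = 1]. *)
Section Model.
Variables (n x0 a : R).
Hypothesis Hn : 0 < n.
Hypothesis Hx0 : a < x0.
Let p (t : R) := / (1 + (x0 - t) ^ 2).
Definition mdamp (t : R) : R := n * (1 + (x0 - t) ^ 2).
Definition mdamp_int (t : R) : R := n * (t + (x0 ^ 2 * t - x0 * t ^ 2 + t ^ 3 / 3)).
Definition W (t : R) : R := exp (- mdamp_int t) * RInt (fun s => n * exp (mdamp_int s)) a t.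
(** Up to the factor c eta / m^3, what a neighbour of m receives when theta_m = 1 and [good] = -
    W. *)
Definition gain (t : R) : R := p t * (2 * p t - W t).
Let d := mdamp.
Let D := mdamp_int.

Lemma mdamp_int_derive t : is_derive D t (d t).
Proof. unfold D, d, mdamp_int, mdamp. auto_derive; [exact Logic.I|field]. Qed.

Lemma mdamp_p t : d t * p t = n.
Proof. unfold d, mdamp, p. field. assert (H := coef_den_pos (x0 - t)). lra. Qed.

Lemma p_pos t : 0 < p t <= 1.
Proof. unfold p. split; [apply Rinv_0_lt_compat, coef_den_pos|apply pcoef_le]. Qed.

Lemma d_pos t : n <= d t.
Proof. unfold d, mdamp. assert (H := pow2_ge_0 (x0 - t)). nra. Qed.

Lemma p_derive t : is_derive p t (2 * (x0 - t) * p t ^ 2).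
Proof.
unfold p. assert (H := coef_den_pos (x0 - t)). auto_derive.
{ change (1 + (x0 + - t) * ((x0 + - t) * 1)) with (1 + (x0 - t) ^ 2). lra. }
change (x0 + - t) with (x0 - t). set (q := x0 - t) in *. clearbody q. field. assert (0 < 1 + q * q) by nra. nra.
Qed.

Lemma W_derive t : is_derive W t (- (d t) * W t + n).
Proof.
assert (H1 : is_derive (fun s => exp (- D s)) t (- d t * exp (- D t))).
{ apply (is_derive_comp exp (fun s => - D s)); [apply is_derive_exp|apply (is_derive_opp D), mdamp_int_derive]. }
assert (Hc : forall s, continuous (fun s => n * exp (D s)) s).
{ intros s. apply (continuous_mult (K := R_AbsRing) (fun _ => n) (fun s => exp (D s))); [apply continuous_const|].
  apply continuous_exp_comp. eapply continuous_of_derive, mdamp_int_derive. }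
assert (H2 := is_derive_RInt_cont (fun s => n * exp (D s)) a t Hc).
assert (H3 := derive_mult _ _ _ _ _ H1 H2).
eapply is_derive_value; [exact H3|]. unfold W. fold D.
assert (E : exp (- D t) * exp (D t) = 1) by (rewrite <- exp_plus, Rplus_opp_l; apply exp_0).
replace (exp (- D t) * (n * exp (D t))) with (n * (exp (- D t) * exp (D t))) by ring. rewrite E. ring.
Qed.

Lemma W_cont t : continuous W t.
Proof. eapply continuous_of_derive, W_derive. Qed.

Lemma W_a : W a = 0.
Proof. unfold W. rewrite RInt_point. change (@zero R_CompleteNormedModule) with 0. ring. Qed.

Lemma weighted_derive (u u' : R -> R) t : is_derive u t (u' t) ->
  is_derive (fun s => exp (D s) * u s) t (exp (D t) * (d t * u t + u' t)).
Proof.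
intros Hu.
assert (H1 : is_derive (fun s => exp (D s)) t (d t * exp (D t))).
{ apply (is_derive_comp exp D); [apply is_derive_exp|apply mdamp_int_derive]. }
eapply is_derive_value; [apply (derive_mult _ _ _ _ _ H1 Hu)|]. ring.
Qed.

Lemma weighted_sign (u u' : R -> R) b : a <= b -> 0 <= u a -> (forall t, a <= t <= b -> is_derive u t (u' t)) ->
  (forall t, a <= t <= b -> 0 <= d t * u t + u' t) -> 0 <= u b.
Proof.
intros Hab Ha Hd Hs.
assert (H := le_of_derive (fun s => exp (D s) * u s) (fun t => exp (D t) * (d t * u t + u' t)) a b Hab).
assert (H1 : exp (D a) * u a <= exp (D b) * u b).
{ apply H.
  - intros; eapply continuous_of_derive, weighted_derive, Hd; lra.
  - intros; apply weighted_derive, Hd; lra.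
  - intros; apply Rmult_le_pos; [left; apply exp_pos|apply Hs; lra]. }
assert (E1 := exp_pos (D a)). assert (E2 := exp_pos (D b)).
apply Rmult_le_reg_l with (exp (D b)); [exact E2|]. rewrite Rmult_0_r.
eapply Rle_trans; [|exact H1]. apply Rmult_le_pos; lra.
Qed.

Lemma W_le_1 t : a <= t -> W t <= 1.
Proof.
intros Ht. assert (H : 0 <= 1 - W t); [|lra].
apply (weighted_sign (fun s => 1 - W s) (fun s => 0 - (- d s * W s + n)) t Ht).
- rewrite W_a; lra.
- intros s _. apply derive_minus; [apply derive_const|apply W_derive].
- intros s _. assert (H := d_pos s). lra.
Qed.

(** As n = d p, the response W relaxes towards p; up to x0 this target increases, and the response
    stays below it. *)
Lemma W_le_p t : a <= t <= x0 -> W t <= p t.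
Proof.
intros Ht. assert (H : 0 <= p t - W t); [|lra].
apply (weighted_sign (fun s => p s - W s) (fun s => 2 * (x0 - s) * p s ^ 2 - (- d s * W s + n)) t ltac:(lra)).
- rewrite W_a. assert (H := p_pos a). lra.
- intros s _. apply derive_minus; [apply p_derive|apply W_derive].
- intros s Hs. assert (H := mdamp_p s).
  assert (0 <= 2 * (x0 - s) * p s ^ 2) by (apply Rmult_le_pos; [lra|apply pow2_ge_0]).
  replace (d s * (p s - W s) + (2 * (x0 - s) * p s ^ 2 - (- d s * W s + n))) with
    (d s * p s - n + 2 * (x0 - s) * p s ^ 2) by ring. lra.
Qed.

Lemma reflect_derive (u : R -> R) (s : R) x l : (s = 1 \/ s = -1) -> is_derive u (x0 + s * x) l ->
  is_derive (fun x => u (x0 + s * x)) x (s * l).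
Proof.
intros Hs Hu. apply (is_derive_comp u (fun x => x0 + s * x)); [exact Hu|].
auto_derive; [exact Logic.I|ring].
Qed.

(* The response lags behind the resonance: [W (x0 + x) >= W (x0 - x)]. *)
Let Zf (x : R) := W (x0 + 1 * x) - W (x0 + -1 * x).
Let Zf' (x : R) := 2 * n - d (x0 + 1 * x) * (W (x0 + 1 * x) + W (x0 + -1 * x)).

Lemma d_even x : d (x0 + -1 * x) = d (x0 + 1 * x).
Proof. unfold d, mdamp. ring. Qed.

Lemma p_even x : p (x0 + -1 * x) = p (x0 + 1 * x).
Proof. unfold p. f_equal. ring. Qed.

Lemma Zf_derive x : is_derive Zf x (Zf' x).
Proof.
eapply is_derive_value.
- apply derive_minus;
  [apply (reflect_derive W 1)|apply (reflect_derive W (-1))]; try apply W_derive; [left|right]; reflexivity.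
- unfold Zf'. rewrite d_even. ring.
Qed.

(** As d is even about x0, d Z + Z' = 2 (n - d W(x0 - x)), which is nonnegative by [W_le_p] and d p
    = n. *)
Lemma Zf_nonneg x : 0 <= x <= x0 - a -> 0 <= Zf x.
Proof.
intros Hx.
assert (Hder : forall y, is_derive (fun y => exp (D (x0 + 1 * y)) * Zf y) y
   (exp (D (x0 + 1 * y)) * (d (x0 + 1 * y) * Zf y + Zf' y))).
{ intros y.
  assert (H1 : is_derive (fun y => exp (D (x0 + 1 * y))) y (1 * d (x0 + 1 * y) * exp (D (x0 + 1 * y)))).
  { apply (is_derive_comp exp (fun y => D (x0 + 1 * y))); [apply is_derive_exp|].
    apply (reflect_derive D 1); [left; reflexivity|apply mdamp_int_derive]. }
  eapply is_derive_value; [apply (derive_mult _ _ _ _ _ H1 (Zf_derive y))|]. ring. }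
assert (H := le_of_derive _ _ 0 x ltac:(lra) (fun t _ => continuous_of_derive _ _ _ (Hder t)) (fun t _ => Hder t)).
assert (E0 : Zf 0 = 0) by (unfold Zf; rewrite !Rmult_0_r; ring).
cbv beta in H. rewrite E0, Rmult_0_r in H.
apply Rmult_le_reg_l with (exp (D (x0 + 1 * x))); [apply exp_pos|]. rewrite Rmult_0_r. apply H.
intros t Ht. apply Rmult_le_pos; [left; apply exp_pos|].
assert (Hw := W_le_p (x0 + -1 * t) ltac:(lra)). rewrite p_even in Hw.
assert (Hp := mdamp_p (x0 + 1 * t)). assert (Hd := d_pos (x0 + 1 * t)). unfold Zf', Zf. nra.
Qed.

Lemma gain_cont t : continuous gain t.
Proof.
assert (Hp : continuous p t) by (eapply continuous_of_derive, p_derive).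
apply (continuous_mult (K := R_AbsRing) p (fun t => 2 * p t - W t)); [exact Hp|].
apply (continuous_minus (fun t => 2 * p t) W); [|apply W_cont].
apply (continuous_mult (K := R_AbsRing) (fun _ => 2) p); [apply continuous_const|exact Hp].
Qed.

Let Y (t : R) := RInt gain a t.

Lemma Y_derive t : is_derive Y t (gain t).
Proof. apply is_derive_RInt_cont, gain_cont. Qed.

(** Let Z be the odd part [Zf] of W about x0, and q = p(x0 + x). From d q = n and the equation of W,
    q (W(x0 + x) + W(x0 - x)) = 2 q^2 - q^2 Z' / n. Integrating by parts, the integral of [gain] is
    x q + atan x plus terms in Z that are nonnegative. The integral of 2 p^2 alone would be twice x
    q + atan x, so the reaction cancels at most half of it, uniformly in n. *)
Lemma gain_core x : 0 <= x <= x0 - a -> atan x <= Y (x0 + 1 * x) - Y (x0 + -1 * x).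
Proof.
intros Hx.
pose (q := fun x => p (x0 + 1 * x)).
assert (Hq : forall x, is_derive q x (- 2 * x * q x ^ 2)).
{ intros y. eapply is_derive_value; [apply (reflect_derive p 1); [left; reflexivity|apply p_derive]|]. unfold q. ring. }
(* The integral minus its explicit part and the boundary term; the derivative [S'] is the remaining
   term of the integration by parts. *)
pose (S := fun x => Y (x0 + 1 * x) - Y (x0 + -1 * x) - (x * q x + atan (x - 0)) - q x ^ 2 * Zf x / n).
pose (S' := fun x => 4 * x * q x ^ 3 * Zf x / n).
assert (HS : forall x, is_derive S x (S' x)).
{ intros y. unfold S.
  assert (H1 : is_derive (fun x => Y (x0 + 1 * x) - Y (x0 + -1 * x)) y (1 * gain (x0 + 1 * y) - -1 * gain (x0 + -1 * y))).
  { apply derive_minus;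
    [apply (reflect_derive Y 1)|apply (reflect_derive Y (-1))]; try apply Y_derive; [left|right]; reflexivity. }
  assert (H2 : is_derive (fun x => x * q x + atan (x - 0)) y ((1 * q y + y * (- 2 * y * q y ^ 2)) + / (1 + (0 - y) ^ 2))).
  { apply derive_plus; [|apply is_derive_atan_shift].
    apply (derive_mult (fun x => x) q); [apply derive_id|apply Hq]. }
  assert (H3 : is_derive (fun x => q x ^ 2 * Zf x / n) y ((2 * (- 2 * y * q y ^ 2) * q y * Zf y + q y ^ 2 * Zf' y) / n)).
  { assert (Hq2 : is_derive (fun x => q x ^ 2) y (2 * (- 2 * y * q y ^ 2) * q y)).
    { eapply is_derive_value; [apply (is_derive_pow q 2 y _ (Hq y))|]. simpl. ring. }
    assert (H5 := derive_mult _ _ _ _ _ (derive_mult _ _ _ _ _ Hq2 (Zf_derive y)) (derive_const (/ n) y)).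
    eapply is_derive_value; [exact H5|cbv beta; unfold Rdiv; ring]. }
  eapply is_derive_value.
  { apply derive_minus; [|exact H3]. apply derive_minus; [exact H1|exact H2]. }
  unfold S', gain. rewrite p_even.
  change (p (x0 + 1 * y)) with (q y).
  assert (Eq : / (1 + (0 - y) ^ 2) = q y) by (unfold q, p; f_equal; ring).
  assert (Ed : d (x0 + 1 * y) * q y = n) by apply mdamp_p.
  assert (Eq2 : y * y * q y = 1 - q y).
  { unfold q, p. assert (Hc := coef_den_pos (x0 - (x0 + 1 * y))). field_simplify_eq; [ring|lra]. }
  rewrite Eq. unfold Zf'.
  set (W1 := W (x0 + 1 * y)) in *. set (W2 := W (x0 + -1 * y)) in *. set (dd := d (x0 + 1 * y)) in *.
  assert (E3 : q y ^ 2 * (2 * n - dd * (W1 + W2)) / n = 2 * q y ^ 2 - q y * (W1 + W2)).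
  { replace (q y ^ 2 * (2 * n - dd * (W1 + W2)) / n) with (2 * q y ^ 2 - q y * (W1 + W2) * (dd * q y) / n) by (field; lra).
    rewrite Ed. field; lra. }
  replace ((2 * (-2 * y * q y ^ 2) * q y * Zf y + q y ^ 2 * (2 * n - dd * (W1 + W2))) / n)
    with (q y ^ 2 * (2 * n - dd * (W1 + W2)) / n - 4 * y * q y ^ 3 * Zf y / n) by (field; lra).
  rewrite E3.
  replace (y * (-2 * y * q y ^ 2)) with (-2 * (y * y * q y) * q y) by ring. rewrite Eq2. ring. }
assert (H := le_of_derive S S' 0 x ltac:(lra) (fun t _ => continuous_of_derive _ _ _ (HS t)) (fun t _ => HS t)).
assert (E0 : S 0 = 0).
{ unfold S, Zf. rewrite !Rmult_0_r, Rminus_0_r, atan_0. field; lra. }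
cbv beta in H. rewrite E0 in H.
assert (Hq0 : forall y, 0 < q y) by (intros; apply p_pos).
assert (HS0 : 0 <= S x).
{ apply H. intros t Ht. unfold S'. apply Rdiv_le_0_compat; [|exact Hn].
  apply Rmult_le_pos; [apply Rmult_le_pos; [lra|left; apply pow_lt, Hq0]|apply Zf_nonneg; lra]. }
unfold S in HS0. rewrite Rminus_0_r in HS0.
assert (0 <= q x ^ 2 * Zf x / n).
{ apply Rdiv_le_0_compat; [|exact Hn]. apply Rmult_le_pos; [apply pow2_ge_0|apply Zf_nonneg; lra]. }
assert (0 <= x * q x) by (apply Rmult_le_pos; [lra|left; apply Hq0]). lra.
Qed.

(** After the symmetric core only W <= 1 is used: [gain] >= - p there, whose tail costs at most 1 /
    (x0 - a). The same amount is missing from atan (x0 - a). *)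
Lemma gain_total t : 2 * x0 - a <= t -> PI / 2 - 2 / (x0 - a) <= RInt gain a t.
Proof.
intros Ht.
assert (H1 := gain_core (x0 - a) ltac:(lra)).
replace (x0 + 1 * (x0 - a)) with (2 * x0 - a) in H1 by ring. replace (x0 + -1 * (x0 - a)) with a in H1 by ring.
unfold Y in H1. rewrite RInt_point in H1. change (@zero R_CompleteNormedModule) with 0 in H1.
assert (H2 := le_of_derive (fun s => Y s + atan (s - x0)) (fun s => gain s + / (1 + (x0 - s) ^ 2)) (2 * x0 - a) t Ht).
assert (H3 : forall s, is_derive (fun s => Y s + atan (s - x0)) s (gain s + / (1 + (x0 - s) ^ 2))).
{ intros s. apply derive_plus; [apply Y_derive|apply is_derive_atan_shift]. }
specialize (H2 (fun s _ => continuous_of_derive _ _ _ (H3 s)) (fun s _ => H3 s)).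
assert (H4 : Y (2 * x0 - a) + atan (2 * x0 - a - x0) <= Y t + atan (t - x0)).
{ apply H2. intros s Hs. unfold gain. fold (p s). assert (Hp := p_pos s). assert (Hw := W_le_1 s ltac:(lra)). nra. }
unfold Y in H4. replace (2 * x0 - a - x0) with (x0 - a) in H4 by ring.
assert (H5 := atan_large (x0 - a) ltac:(lra)). assert (H6 := atan_bound (t - x0)).
unfold Rdiv at 2. lra.
Qed.

End Model.

(** * One resonance of the chain *)

(** The map N -> 1 + N/2 contracts to its fixed point 2, so any finite a priori constant improves to
    2. This replaces a continuity argument in time, which would not be uniform over infinitely many
    modes. *)
Lemma bootstrap (T : Type) (dom : T -> Prop) (X A : T -> R) :
  (forall i, dom i -> 0 <= A i) ->
  (exists M, forall i, dom i -> X i <= M * A i) ->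
  (forall N, 0 <= N -> (forall i, dom i -> X i <= N * A i) -> forall i, dom i -> X i <= (1 + N / 2) * A i) ->
  forall i, dom i -> X i <= 2 * A i.
Proof.
intros HA [M HM] Hstep.
assert (Hn : forall n i, dom i -> X i <= (2 + Rabs M / 2 ^ n) * A i).
{ induction n; intros i Hi.
  - simpl; rewrite Rdiv_1_r. eapply Rle_trans; [apply HM, Hi|].
    apply Rmult_le_compat_r; [apply HA, Hi|]. assert (H := Rle_abs M). lra.
  - assert (HP : 0 < 2 ^ n) by (apply pow_lt; lra).
    replace (2 + Rabs M / 2 ^ S n) with (1 + (2 + Rabs M / 2 ^ n) / 2) by (simpl; field; lra).
    apply Hstep; [|exact IHn|exact Hi].
    assert (0 <= Rabs M / 2 ^ n) by (apply Rdiv_le_0_compat; [apply Rabs_pos|lra]). lra. }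
intros i Hi. apply Rle_plus_epsilon. intros e He.
destruct (small_of_geom (Rabs M * A i) e He) as [n Hn'].
specialize (Hn n i Hi). replace (Rabs M * A i / 2 ^ n) with (Rabs M / 2 ^ n * A i) in Hn' by (field; apply pow_nonzero; lra). lra.
Qed.

(** In the window of m, eta/t is within 1/2 of m, hence at distance at least 1/2 from every other
    integer. For m = 1 the window has no right end, as the mode 0 does not resonate. *)
Lemma nonres_dist (m j : Z) (t eta : R) : (1 <= m)%Z -> j <> m -> j <> 0%Z -> 0 < eta -> 0 < t ->
  eta <= (IZR m + / 2) * t -> (m = 1%Z \/ (IZR m - / 2) * t <= eta) ->
  t <= 2 * Rabs (eta - IZR j * t) /\ Rabs (IZR j) * t <= 2 * (IZR m + 1) * Rabs (eta - IZR j * t).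
Proof.
intros Hm Hjm Hj0 Heta Ht H1 H2.
assert (Hm1 : 1 <= IZR m) by (apply IZR_le; exact Hm).
destruct (Z_lt_le_dec m j) as [Hj|Hj].
- assert (Hj1 : IZR m + 1 <= IZR j) by (rewrite <- plus_IZR; apply IZR_le; lia).
  rewrite (Rabs_minus_sym eta), (Rabs_pos_eq (IZR j)), Rabs_pos_eq by nra. split; [nra|].
  assert (0 <= (2 * IZR m + 1) * (IZR j - IZR m - 1)) by (apply Rmult_le_pos; lra). nra.
- assert (Hj1 : IZR j <= IZR m - 1) by (rewrite <- minus_IZR; apply IZR_le; lia).
  destruct (Z_lt_le_dec j 0) as [Hj2|Hj2].
  + assert (Hj3 : IZR j <= -1) by (apply IZR_le; lia).
    rewrite (Rabs_left (IZR j)), Rabs_pos_eq by nra. split; nra.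
  + assert (Hj3 : 1 <= IZR j) by (apply IZR_le; lia).
    destruct H2 as [->|H2]; [exfalso; lia|].
    rewrite (Rabs_pos_eq (IZR j)), Rabs_pos_eq by nra. split; nra.
Qed.

Lemma pcf_le eta j t X : j <> 0%Z -> 0 <= X -> 0 <= t -> Rabs (IZR j) * t <= X * Rabs (eta - IZR j * t) ->
  pcf eta j t * t ^ 2 <= X ^ 2.
Proof.
intros Hj HX Ht H. unfold pcf. assert (Hm0 : IZR j <> 0) by (apply not_0_IZR; exact Hj).
assert (Hq := coef_den_pos (eta / IZR j - t)).
replace (eta - IZR j * t) with (IZR j * (eta / IZR j - t)) in H by (field; exact Hm0).
set (q := eta / IZR j - t) in *; clearbody q.
rewrite Rabs_mult in H.
assert (Hj1 : 0 < Rabs (IZR j)) by (apply Rabs_pos_lt; exact Hm0).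
assert (H1 : t <= X * Rabs q) by (apply Rmult_le_reg_l with (Rabs (IZR j)); [exact Hj1|lra]).
apply Rmult_le_reg_l with (1 + q ^ 2); [exact Hq|].
rewrite <- Rmult_assoc, Rinv_r, Rmult_1_l by lra.
assert (H2 : t ^ 2 <= (X * Rabs q) ^ 2) by (apply pow_incr; lra).
rewrite Rpow_mult_distr, pow2_abs in H2. assert (0 <= X ^ 2) by (apply pow2_ge_0). lra.
Qed.

Lemma dcoef_pcf c eta j t : 0 < c -> 0 < eta -> j <> 0%Z ->
  Rabs (dcoef c eta j t) = c * eta / Rabs (IZR j) ^ 3 * pcf eta j t.
Proof.
intros Hc Heta Hj. unfold dcoef, pcf. destruct (Z.eq_dec j 0); [contradiction|].
assert (Hm0 : IZR j <> 0) by (apply not_0_IZR; exact Hj).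
assert (Hq := coef_den_pos (eta / IZR j - t)).
unfold Rdiv at 1. rewrite Rabs_mult, Rabs_inv, (Rabs_pos_eq (1 + _)) by lra. f_equal.
unfold Rdiv. rewrite Rabs_mult, Rabs_inv, RPow_abs, Rabs_pos_eq by (apply Rmult_le_pos; lra). reflexivity.
Qed.

Section Step.
Variables (nu c : R) (f : R -> R) (eta : R) (th G : R -> Z -> C).
Hypothesis Hnu : 0 < nu.
Hypothesis Hc : 0 < c < 0.001.
Hypothesis Heta : 0 < eta.
Hypothesis Hf3 : forall t, 0 <= t -> Rabs (f t) <= 2 * c / (1 + t ^ 2).
Hypothesis Hsol : ode_sol nu c f eta th G.
Variables (m : Z) (T : R).
Hypothesis Hm : (1 <= m)%Z.
Let H := good eta th G.
Let flux := input_flux c eta th G.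
Let wflux := weighted_flux c eta th G.
Definition kap (m : Z) : R := c * eta * PI / (2 * IZR m ^ 3).
Definition tm (m : Z) : R := eta / (IZR m + / 2).
(** Bound for p_j, j <> m, throughout the window of m, which starts at [tm m]. *)
Definition epsm (m : Z) : R := 4 * (IZR m + 1) ^ 2 / tm m ^ 2.
Let ka := kap m.
Let a := tm m.
Let eps := epsm m.
Hypothesis HaT : a <= T.
Hypothesis HT : m = 1%Z \/ (IZR m - / 2) * T <= eta.
Hypothesis Hka : 1000 <= ka.
Hypothesis Heps : eps * (1 + ka) <= 1e-6.
Hypothesis Ha2 : 2 / a ^ 2 <= 1e-6.
Hypothesis Hg1 : 2 * IZR m / a ^ 2 * (2 * ka) <= 1e-6.

Lemma IZR_m_ge1 : 1 <= IZR m.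
Proof. apply IZR_le; exact Hm. Qed.

Lemma tm_pos : 0 < a.
Proof. assert (H1 := IZR_m_ge1). unfold a, tm. apply Rdiv_lt_0_compat; lra. Qed.

Lemma step_time t : a <= t <= T -> 0 < t /\ eta <= (IZR m + / 2) * t /\ (m = 1%Z \/ (IZR m - / 2) * t <= eta).
Proof.
intros Ht. assert (H0 := tm_pos). assert (H1 := IZR_m_ge1). split; [lra|split].
- destruct Ht as [Ht _]. unfold a, tm in Ht. 
  apply Rmult_le_compat_r with (r := IZR m + / 2) in Ht; [|lra].
  unfold Rdiv in Ht. rewrite Rmult_assoc, Rinv_l, Rmult_1_r in Ht by lra. lra.
- destruct HT as [E|E]; [left; exact E|right]. eapply Rle_trans; [|exact E]. apply Rmult_le_compat_l; lra.
Qed.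

Lemma step_pcf j t : j <> m -> j <> 0%Z -> a <= t <= T -> pcf eta j t <= eps.
Proof.
intros Hjm Hj Ht. destruct (step_time t Ht) as [H1 [H2 H3]]. assert (H0 := tm_pos). assert (H4 := IZR_m_ge1).
destruct (nonres_dist m j t eta Hm Hjm Hj Heta H1 H2 H3) as [_ H5].
assert (H6 := pcf_le eta j t (2 * (IZR m + 1)) Hj ltac:(lra) ltac:(lra) H5).
unfold eps, epsm. fold a. apply Rmult_le_reg_r with (a ^ 2); [apply pow_lt; lra|].
unfold Rdiv; rewrite Rmult_assoc, Rinv_l, Rmult_1_r by (apply pow_nonzero; lra).
assert (H7 := pcf_bounds eta j t).
assert (H8 : a ^ 2 <= t ^ 2) by (apply pow_incr; lra).
assert (H9 : pcf eta j t * a ^ 2 <= pcf eta j t * t ^ 2) by (apply Rmult_le_compat_l; lra).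
replace (4 * (IZR m + 1) ^ 2) with ((2 * (IZR m + 1)) ^ 2) by ring. lra.
Qed.

Lemma step_dcoef j t : j <> m -> j <> 0%Z -> a <= t <= T ->
  Rabs (IZR j) * Rabs (dcoef c eta j t) <= 4 * c * eta / t ^ 2.
Proof.
intros Hjm Hj Ht. destruct (step_time t Ht) as [H1 [H2 H3]].
destruct (nonres_dist m j t eta Hm Hjm Hj Heta H1 H2 H3) as [H5 _].
rewrite dcoef_pcf by (assumption || lra).
assert (Hm0 : IZR j <> 0) by (apply not_0_IZR; exact Hj).
assert (Hj1 : 0 < Rabs (IZR j)) by (apply Rabs_pos_lt; exact Hm0).
assert (H6 := pcf_le eta j t (2 * Rabs (IZR j)) Hj ltac:(lra) ltac:(lra) ltac:(nra)).
assert (Hce : 0 < c * eta) by (apply Rmult_lt_0_compat; lra).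
set (J := Rabs (IZR j)) in *; clearbody J. set (p := pcf eta j t) in *; clearbody p.
apply Rmult_le_reg_r with (t ^ 2); [apply pow_lt; lra|].
unfold Rdiv at 2; rewrite (Rmult_assoc _ (/ t ^ 2)), Rinv_l, Rmult_1_r by (apply pow_nonzero; lra).
replace (J * (c * eta / J ^ 3 * p) * t ^ 2) with (c * eta * (p * t ^ 2 / J ^ 2)) by (field; lra).
replace (4 * c * eta) with (c * eta * 4) by ring. apply Rmult_le_compat_l; [lra|].
apply Rmult_le_reg_r with (J ^ 2); [apply pow_lt; lra|].
unfold Rdiv; rewrite Rmult_assoc, Rinv_l, Rmult_1_r by (apply pow_nonzero; lra). lra.
Qed.

(** In the variable eta/t the window has length at most 1, or 3/2 when m = 1; hence 6 c = 4 c *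
    3/2. *)
Lemma inv_time_total t : a <= t <= T -> 4 * c * eta * (/ a - / t) <= 6 * c.
Proof.
intros Ht. destruct (step_time t Ht) as [H1 [H2 H3]]. assert (H0 := tm_pos). assert (H4 := IZR_m_ge1).
assert (Ea : / a = (IZR m + / 2) / eta) by (unfold a, tm; field; split; lra).
assert (H5 : eta * / a = IZR m + / 2) by (rewrite Ea; field; lra).
assert (H6 : 0 < eta * / t) by (apply Rmult_lt_0_compat; [lra|apply Rinv_0_lt_compat; lra]).
replace (4 * c * eta * (/ a - / t)) with (4 * c * (eta * / a - eta * / t)) by ring. rewrite H5.
destruct H3 as [E|E].
- subst m. assert (4 * c * (eta * / t) >= 0) by nra. nra.
- assert (H7 : IZR m - / 2 <= eta * / t).
  { apply Rmult_le_reg_r with t; [lra|]. rewrite (Rmult_assoc eta), Rinv_l, Rmult_1_r by lra. lra. }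
  nra.
Qed.

Lemma inv_derive K t : t <> 0 -> is_derive (fun s => - (K * / s)) t (K / t ^ 2).
Proof. intros Ht. auto_derive; [exact Ht|field; exact Ht]. Qed.

(** Over a whole window a nonresonant mode passes on only a fraction O(c) of its size, since |j d_j|
    <= 4 c eta / t^2. The shear version gains 2 / a^2 from the decay of f. *)
Lemma step_flux_nonres j t X Y : j <> m -> a <= t <= T -> 0 <= X -> 0 <= Y ->
  (forall s, a <= s <= t -> Cmod (th s j) <= X /\ Cmod (H s j) <= Y) ->
  RInt (flux j) a t <= 6 * c * (2 * eps * X + Y) /\
  forall l, (Z.abs (l - j) <= 1)%Z -> RInt (wflux l j) a t <= 2 / a ^ 2 * (6 * c * (2 * eps * X + Y)).
Proof.
intros Hjm Ht HX HY Hb. assert (H0 := tm_pos).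
assert (He0 : 0 <= eps) by (unfold eps, epsm; apply Rdiv_le_0_compat; [apply Rmult_le_pos; [lra|apply pow2_ge_0]|apply pow_lt; exact H0]).
assert (Ha0 : 0 < / a ^ 2) by (apply Rinv_0_lt_compat, pow_lt; lra).
set (V := 2 * eps * X + Y). assert (HV : 0 <= V) by (unfold V; assert (0 <= eps * X) by (apply Rmult_le_pos; lra); lra).
destruct (Z.eq_dec j 0) as [Hj|Hj].
{ assert (HV6 : 0 <= 6 * c * V) by (apply Rmult_le_pos; lra). split.
  - eapply Rle_trans; [apply (RInt_le_deriv _ (fun _ => 0) (fun _ => 0))|]; [lra| | | |lra].
    + intros; apply (flux_cont nu c f eta th G); assumption.
    + intros; apply (@is_derive_const R_AbsRing R_NormedModule).
    + intros; unfold flux; rewrite Hj, flux_0; lra.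
  - intros l _. eapply Rle_trans; [apply (RInt_le_deriv _ (fun _ => 0) (fun _ => 0))|]; [lra| | | |].
    + intros; apply (wflux_cont nu c f eta th G); assumption.
    + intros; apply (@is_derive_const R_AbsRing R_NormedModule).
    + intros; unfold wflux, weighted_flux; rewrite Hj, flux_0; lra.
    + unfold Rdiv. assert (0 <= / a ^ 2 * (6 * c * V)) by (apply Rmult_le_pos; lra). lra. }
assert (Hj1 : 1 <= Rabs (IZR j)) by (rewrite <- abs_IZR; apply IZR_le; lia).
assert (Hfl : forall s, a < s < t -> Rabs (IZR j) * flux j s <= 4 * c * eta * V / s ^ 2).
{ intros s Hs. destruct (Hb s ltac:(lra)) as [B1 B2].
  assert (Hp := step_pcf j s Hjm Hj ltac:(lra)). assert (Hd := step_dcoef j s Hjm Hj ltac:(lra)).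
  assert (Hp0 := pcf_bounds eta j s).
  assert (Hfx := flux_le c eta th G j s X Y B1 B2). fold flux in Hfx.
  assert (H1 : 2 * pcf eta j s * X + Y <= V) by (unfold V; assert (pcf eta j s * X <= eps * X) by (apply Rmult_le_compat_r; lra); lra).
  assert (Hdp := Rabs_pos (dcoef c eta j s)).
  apply Rle_trans with (Rabs (IZR j) * (Rabs (dcoef c eta j s) * V)).
  - apply Rmult_le_compat_l; [lra|]. eapply Rle_trans; [exact Hfx|]. apply Rmult_le_compat_l; assumption.
  - rewrite <- Rmult_assoc. replace (4 * c * eta * V / s ^ 2) with (4 * c * eta / s ^ 2 * V) by (field; lra).
    apply Rmult_le_compat_r; assumption. }
assert (Htot := inv_time_total t Ht).
assert (Hint : forall K, - (K * / t) - - (K * / a) = K * (/ a - / t)) by (intros; ring).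
split.
- eapply Rle_trans; [apply (RInt_le_deriv _ (fun s => - (4 * c * eta * V * / s)) (fun s => 4 * c * eta * V / s ^ 2))|].
  + lra.
  + intros; apply (flux_cont nu c f eta th G); assumption.
  + intros; apply inv_derive; lra.
  + intros s Hs. eapply Rle_trans; [|apply Hfl, Hs].
    assert (Hn := flux_nonneg c eta th G j s). fold flux in Hn. nra.
  + rewrite Hint. replace (4 * c * eta * V * (/ a - / t)) with (4 * c * eta * (/ a - / t) * V) by ring.
    apply Rmult_le_compat_r; assumption.
- intros l Hl.
  eapply Rle_trans; [apply (RInt_le_deriv _ (fun s => - (2 / a ^ 2 * (4 * c * eta * V) * / s)) (fun s => 2 / a ^ 2 * (4 * c * eta * V) / s ^ 2))|].
  + lra.
  + intros; apply (wflux_cont nu c f eta th G); assumption.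
  + intros; apply inv_derive; lra.
  + intros s Hs. unfold wflux, weighted_flux. fold flux.
    assert (Hn := flux_nonneg c eta th G j s). fold flux in Hn.
    assert (Hlj := IZR_neighbor_le l j Hj Hl).
    assert (H1 : / (1 + s ^ 2) <= / a ^ 2).
    { apply Rinv_le_contravar; [apply pow_lt; lra|]. assert (a ^ 2 <= s ^ 2) by (apply pow_incr; lra). lra. }
    assert (H2 : 0 < / (1 + s ^ 2)) by (apply Rinv_0_lt_compat, coef_den_pos).
    replace (2 / a ^ 2 * (4 * c * eta * V) / s ^ 2) with (2 * / a ^ 2 * (4 * c * eta * V / s ^ 2)) by (field; split; lra).
    apply Rle_trans with (2 * / a ^ 2 * (Rabs (IZR j) * flux j s)).
    * unfold Rdiv. replace (2 * / a ^ 2 * (Rabs (IZR j) * flux j s)) with ((2 * Rabs (IZR j)) * / a ^ 2 * flux j s) by ring.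
      apply Rmult_le_compat_r; [exact Hn|]. apply Rmult_le_compat; [apply Rabs_pos|lra|exact Hlj|exact H1].
    * apply Rmult_le_compat_l; [lra|apply Hfl, Hs].
  + rewrite Hint. replace (2 / a ^ 2 * (4 * c * eta * V) * (/ a - / t)) with (2 / a ^ 2 * (4 * c * eta * (/ a - / t) * V)) by ring.
    apply Rmult_le_compat_l; [unfold Rdiv; lra|]. apply Rmult_le_compat_r; assumption.
Qed.

(** The Lorentzian has mass PI over the line, and c eta PI / m^3 is 2 [ka]. *)
Lemma step_flux_res t X Y : a <= t <= T -> 0 <= X -> 0 <= Y ->
  (forall s, a <= s <= t -> Cmod (th s m) <= X /\ Cmod (H s m) <= Y) ->
  RInt (flux m) a t <= 2 * ka * (2 * X + Y) /\
  forall l, (Z.abs (l - m) <= 1)%Z -> RInt (wflux l m) a t <= 2 * IZR m / a ^ 2 * (2 * ka * (2 * X + Y)).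
Proof.
intros Ht HX HY Hb. assert (H0 := tm_pos). assert (H1 := IZR_m_ge1).
assert (Hce : 0 < c * eta) by (apply Rmult_lt_0_compat; lra).
assert (Hm3 : 0 < IZR m ^ 3) by (apply pow_lt; lra).
set (V := 2 * X + Y). assert (HV : 0 <= V) by (unfold V; lra).
set (K := c * eta / IZR m ^ 3). assert (HK : 0 < K) by (apply Rdiv_lt_0_compat; assumption).
assert (EK : K * PI = 2 * ka) by (unfold K, ka, kap; field; lra).
assert (Hfl : forall s, a < s < t -> flux m s <= K * V * / (1 + (eta / IZR m - s) ^ 2)).
{ intros s Hs. destruct (Hb s ltac:(lra)) as [B1 B2].
  assert (Hfx := flux_le c eta th G m s X Y B1 B2). fold flux in Hfx.
  assert (Hp0 := pcf_bounds eta m s).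
  rewrite dcoef_pcf, (Rabs_pos_eq (IZR m)) in Hfx by (lra || lia). fold K in Hfx.
  eapply Rle_trans; [exact Hfx|]. fold (pcf eta m s).
  replace (K * V * pcf eta m s) with (K * pcf eta m s * V) by ring.
  apply Rmult_le_compat_l; [apply Rmult_le_pos; lra|]. unfold V. nra. }
assert (Hder : forall K' s, is_derive (fun s => K' * atan (s - eta / IZR m)) s (K' * / (1 + (eta / IZR m - s) ^ 2))).
{ intros; apply (is_derive_scal (fun s => atan (s - eta / IZR m))), is_derive_atan_shift. }
assert (Hat := atan_diff_le (t - eta / IZR m) (a - eta / IZR m)).
split.
- eapply Rle_trans; [apply (RInt_le_deriv _ (fun s => K * V * atan (s - eta / IZR m)) (fun s => K * V * / (1 + (eta / IZR m - s) ^ 2)))|].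
  + lra.
  + intros; apply (flux_cont nu c f eta th G); assumption.
  + intros; apply Hder.
  + exact Hfl.
  + rewrite <- EK. assert (0 <= K * V) by (apply Rmult_le_pos; lra).
    replace (K * PI * V) with (K * V * PI) by ring. rewrite <- Rmult_minus_distr_l. apply Rmult_le_compat_l; lra.
- intros l Hl. set (J := 2 * IZR m / a ^ 2).
  assert (HJ : 0 <= J) by (unfold J; apply Rdiv_le_0_compat; [lra|apply pow_lt; lra]).
  eapply Rle_trans; [apply (RInt_le_deriv _ (fun s => J * (K * V) * atan (s - eta / IZR m)) (fun s => J * (K * V) * / (1 + (eta / IZR m - s) ^ 2)))|].
  + lra.
  + intros; apply (wflux_cont nu c f eta th G); assumption.
  + intros; apply Hder.
  + intros s Hs. unfold wflux, weighted_flux. fold flux.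
    assert (Hn := flux_nonneg c eta th G m s). fold flux in Hn.
    assert (Hlj := IZR_neighbor_le l m ltac:(lia) Hl). rewrite (Rabs_pos_eq (IZR m)) in Hlj by lra.
    assert (H3 : / (1 + s ^ 2) <= / a ^ 2).
    { apply Rinv_le_contravar; [apply pow_lt; lra|]. assert (a ^ 2 <= s ^ 2) by (apply pow_incr; lra). lra. }
    assert (H2 : 0 < / (1 + s ^ 2)) by (apply Rinv_0_lt_compat, coef_den_pos).
    rewrite Rmult_assoc. apply Rmult_le_compat; [|exact Hn| |apply Hfl, Hs].
    * unfold Rdiv; apply Rmult_le_pos; [apply Rabs_pos|lra].
    * unfold J, Rdiv; apply Rmult_le_compat; [apply Rabs_pos|lra|exact Hlj|exact H3].
  + rewrite <- EK. assert (0 <= J * (K * V)) by (apply Rmult_le_pos; [lra|apply Rmult_le_pos; lra]).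
    replace (J * (K * PI * V)) with (J * (K * V) * PI) by ring. rewrite <- Rmult_minus_distr_l. apply Rmult_le_compat_l; lra.
Qed.

Let ze := Cmod (th a m).
(** The height 128 comes from recentring. After the resonance of m, the mode m + 1 exceeds the mode
    m - 1 by a factor at most 6.2 / 0.9; seen from m - 1 it lies at distance 2, where the cone has
    height 128 / 16 = 8. *)
Definition cone_wt (m l : Z) : R := 128 * wt 4 m l.
Hypothesis Hze : 0 < ze.
Hypothesis Hcone : forall l, Cmod (th a l) <= cone_wt m l * ze /\ Cmod (H a l) <= / 8192 * cone_wt m l * ze.
Hypothesis Hprior : exists M, forall t l, a <= t <= T -> Cmod (th t l) <= M * wt 4 m l /\ Cmod (H t l) <= M * wt 4 m l.

(** Bootstrap profile over (time, (mode, component)). The neighbours of m are allowed a resonant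
    input on top of their initial 32, while [good] of mode m may reach the size of theta_m. Inputs
    10 [ka] N and N have to fit below half of N times the profile, whence 24 and 3. *)
Let prof (i : R * (Z * bool)) : R :=
  let l := fst (snd i) in
  (if snd (snd i) then
     if Z.eq_dec l m then 1 else if Z.eq_dec (Z.abs (l - m)) 1 then 32 + 24 * ka else cone_wt m l
   else if Z.eq_dec l m then 3 else / 8192 * cone_wt m l) * ze.
Let val (i : R * (Z * bool)) : R :=
  let l := fst (snd i) in if snd (snd i) then Cmod (th (fst i) l) else Cmod (H (fst i) l).
Let dom (i : R * (Z * bool)) : Prop := a <= fst i <= T.

Lemma cone_wt_pos l : 0 < cone_wt m l.
Proof. unfold cone_wt. assert (H1 := wt_pos 4 m l). lra. Qed.

Lemma cone_wt_self : cone_wt m m = 128.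
Proof. unfold cone_wt. rewrite wt_self. lra. Qed.

Lemma cone_wt_1 l : Z.abs (l - m) = 1%Z -> cone_wt m l = 32.
Proof.
intros E. unfold cone_wt, wt. replace (Z.abs_nat (l - m)) with 1%nat by lia. simpl; lra.
Qed.

Lemma cone_wt_2 l : Z.abs (l - m) = 2%Z -> cone_wt m l = 8.
Proof.
intros E. unfold cone_wt, wt. replace (Z.abs_nat (l - m)) with 2%nat by lia. simpl; lra.
Qed.

Lemma cone_wt_step l j : (Z.abs (l - j) <= 1)%Z -> cone_wt m j <= 4 * cone_wt m l.
Proof. intros E. unfold cone_wt. assert (H1 := wt_step 4 m l j ltac:(lra) E). lra. Qed.

Lemma prof_neighbor t l j : j <> m -> (Z.abs (l - j) = 1)%Z ->
  prof (t, (j, true)) <= 4 * cone_wt m l * (1 + ka) * ze /\ prof (t, (j, false)) <= / 2048 * cone_wt m l * ze.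
Proof.
intros Hj Hl. unfold prof; simpl.
assert (H1 := cone_wt_pos l). assert (H2 := cone_wt_step l j ltac:(lia)).
destruct (Z.eq_dec j m) as [E|_]; [contradiction|]. split.
- apply Rmult_le_compat_r; [lra|]. destruct (Z.eq_dec (Z.abs (j - m)) 1) as [E|E].
  + assert (H3 : 8 <= cone_wt m l).
    { destruct (Z.eq_dec l m) as [->|E2]; [rewrite cone_wt_self; lra|]. rewrite cone_wt_2 by lia; lra. }
    nra.
  + nra.
- apply Rmult_le_compat_r; lra.
Qed.

Lemma prof_le t l : l <> m -> prof (t, (l, true)) <= cone_wt m l * (1 + ka) * ze.
Proof.
intros Hl. unfold prof; simpl. destruct (Z.eq_dec l m) as [E|_]; [contradiction|].
assert (H1 := cone_wt_pos l). apply Rmult_le_compat_r; [lra|].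
destruct (Z.eq_dec (Z.abs (l - m)) 1) as [E|E]; [rewrite cone_wt_1 by exact E; lra|nra].
Qed.

Lemma prof_pos i : 0 < prof i.
Proof.
unfold prof. apply Rmult_lt_0_compat; [|exact Hze].
assert (H1 := cone_wt_pos (fst (snd i))).
destruct (snd (snd i)), (Z.eq_dec (fst (snd i)) m); try lra.
destruct (Z.eq_dec (Z.abs (fst (snd i) - m)) 1); lra.
Qed.

Lemma eps_nonneg : 0 <= eps.
Proof.
unfold eps, epsm; apply Rdiv_le_0_compat; [apply Rmult_le_pos; [lra|apply pow2_ge_0]|apply pow_lt, tm_pos].
Qed.

(** A neighbour of m may be of size [ka]; its flux is small because it also carries p_j <= [eps].
    This is why [Heps] bounds the product [eps] (1 + [ka]). *)
Lemma step_nonres_small N t l j : 0 <= N -> a <= t <= T -> (forall i, dom i -> val i <= N * prof i) ->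
  j <> m -> (Z.abs (l - j) = 1)%Z ->
  RInt (flux j) a t <= 1e-5 * (cone_wt m l * N * ze) /\
  RInt (wflux l j) a t <= 1e-10 * (cone_wt m l * N * ze).
Proof.
intros HN Ht Hb Hj Hl.
destruct (prof_neighbor t l j Hj Hl) as [P1 P2].
assert (Q1 := prof_pos (t, (j, true))). assert (Q2 := prof_pos (t, (j, false))).
destruct (step_flux_nonres j t (N * prof (t, (j, true))) (N * prof (t, (j, false))) Hj Ht) as [F1 F2].
- apply Rmult_le_pos; lra.
- apply Rmult_le_pos; lra.
- intros s Hs; split; [apply (Hb (s, (j, true)))|apply (Hb (s, (j, false)))]; unfold dom; simpl; lra.
- specialize (F2 l ltac:(lia)).
  assert (He := eps_nonneg). assert (H1 := cone_wt_pos l).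
  set (w := cone_wt m l) in *; clearbody w.
  assert (HNw : 0 <= w * N * ze) by (apply Rmult_le_pos; [apply Rmult_le_pos; lra|lra]).
  assert (HV : 2 * eps * (N * prof (t, (j, true))) + N * prof (t, (j, false)) <= (8e-6 + / 2048) * (w * N * ze)).
  { assert (E1 : eps * (N * prof (t, (j, true))) <= eps * (N * (4 * w * (1 + ka) * ze))).
    { apply Rmult_le_compat_l; [exact He|]. apply Rmult_le_compat_l; lra. }
    assert (E2 : N * prof (t, (j, false)) <= N * (/ 2048 * w * ze)) by (apply Rmult_le_compat_l; lra).
    replace (eps * (N * (4 * w * (1 + ka) * ze))) with (4 * (eps * (1 + ka)) * (w * N * ze)) in E1 by ring.
    assert (E3 : 4 * (eps * (1 + ka)) * (w * N * ze) <= 4e-6 * (w * N * ze)) by (apply Rmult_le_compat_r; lra). lra. }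
  assert (HV0 : 0 <= 2 * eps * (N * prof (t, (j, true))) + N * prof (t, (j, false))).
  { apply Rplus_le_le_0_compat; [apply Rmult_le_pos; [lra|]|]; apply Rmult_le_pos; lra. }
  set (V := 2 * eps * _ + _) in *; clearbody V.
  assert (HcV : 6 * c * V <= 1e-5 * (w * N * ze)) by nra.
  split; [lra|]. assert (0 <= 2 / a ^ 2) by (apply Rdiv_le_0_compat; [lra|apply pow_lt, tm_pos]).
  assert (0 <= 6 * c * V) by (apply Rmult_le_pos; lra). nra.
Qed.

Lemma step_res_small N t l : 0 <= N -> a <= t <= T -> (forall i, dom i -> val i <= N * prof i) ->
  (Z.abs (l - m) = 1)%Z ->
  RInt (flux m) a t <= 10 * ka * N * ze /\ RInt (wflux l m) a t <= 5e-6 * N * ze.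
Proof.
intros HN Ht Hb Hl.
assert (Q1 := prof_pos (t, (m, true))). assert (Q2 := prof_pos (t, (m, false))).
destruct (step_flux_res t (N * ze) (N * (3 * ze)) Ht) as [F1 F2].
- apply Rmult_le_pos; lra.
- apply Rmult_le_pos; lra.
- intros s Hs; split; [eapply Rle_trans; [apply (Hb (s, (m, true)))|]|eapply Rle_trans; [apply (Hb (s, (m, false)))|]];
  unfold dom, prof; simpl; try lra; destruct (Z.eq_dec m m); try contradiction; lra.
- specialize (F2 l ltac:(lia)). split; [lra|].
  eapply Rle_trans; [exact F2|].
  replace (2 * IZR m / a ^ 2 * (2 * ka * (2 * (N * ze) + N * (3 * ze)))) with (2 * IZR m / a ^ 2 * (2 * ka) * (5 * (N * ze))) by ring.
  assert (0 <= N * ze) by (apply Rmult_le_pos; lra).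
  apply Rle_trans with (1e-6 * (5 * (N * ze))); [apply Rmult_le_compat_r; lra|lra].
Qed.

(** theta_l moves by the fluxes of its two neighbours, and [good] follows its target p theta_l up to
    the shear flux. Only m - 1 and m + 1 receive the resonant flux, 10 [ka] N against the available
    12 [ka] N; every other input carries a small factor. *)
Lemma step_bootstrap : forall i, dom i -> val i <= 2 * prof i.
Proof.
apply bootstrap.
- intros i _; left; apply prof_pos.
(* The least value of the profile, relative to [ze], is [wt] / 64, so 100 is enough. *)
- destruct Hprior as [M HM]. exists (Rabs M / ze * 100). intros [t [l b]] Hi. unfold dom in Hi; simpl in Hi.
  destruct (HM t l Hi) as [M1 M2].
  assert (Hw := wt_pos 4 m l ltac:(lra)).
  assert (Hmain : M * wt 4 m l <= Rabs M / ze * 100 * prof (t, (l, b))).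
  { assert (H1 : Rabs M * wt 4 m l <= Rabs M * (100 * (prof (t, (l, b)) / ze))).
    { apply Rmult_le_compat_l; [apply Rabs_pos|].
      assert (E : prof (t, (l, b)) / ze >= wt 4 m l / 100).
      { unfold prof; simpl. unfold Rdiv at 1; rewrite Rmult_assoc, Rinv_r, Rmult_1_r by lra.
        assert (W1 := wt_le1 4 m l ltac:(lra)). unfold cone_wt.
        destruct b, (Z.eq_dec l m); try lra. destruct (Z.eq_dec (Z.abs (l - m)) 1); lra. }
      lra. }
    apply Rle_trans with (Rabs M * wt 4 m l); [apply Rmult_le_compat_r; [lra|apply Rle_abs]|].
    eapply Rle_trans; [exact H1|]. right; field; lra. }
  unfold val; simpl; destruct b; lra.
- intros N HN Hb [t [l b]] Hi.
  unfold dom in Hi; simpl in Hi. assert (Ha := tm_pos).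
  destruct (Hcone l) as [C1 C2].
  assert (Hl0 : l = 0%Z -> val (t, (l, b)) = 0).
  { intros ->. destruct (ode_zero _ _ _ _ _ _ Hsol t ltac:(lra)) as [Z1 Z2]. unfold val; simpl. unfold H, good.
    rewrite Z1, Z2. destruct b; [apply Cmod_0|]. replace (Cminus (RtoC 0) (Cmult (RtoC (pcf eta 0 t)) (RtoC 0))) with (RtoC 0)
      by (unfold Cminus; ring). apply Cmod_0. }
  destruct (Z.eq_dec l 0) as [El|El].
  { rewrite (Hl0 El). assert (Q := prof_pos (t, (l, b))). apply Rmult_le_pos; lra. }
  assert (Hw := cone_wt_pos l). 
  assert (HNw : 0 <= cone_wt m l * N * ze) by (apply Rmult_le_pos; [apply Rmult_le_pos; lra|lra]).
  assert (HNz : 0 <= N * ze) by (apply Rmult_le_pos; lra).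
  assert (HkN : 0 <= ka * N * ze) by (rewrite Rmult_assoc; apply Rmult_le_pos; lra).
  assert (Hflux : forall j, (Z.abs (l - j) = 1)%Z ->
    RInt (flux j) a t <= 1e-5 * (cone_wt m l * N * ze) + (if Z.eq_dec j m then 10 * ka * N * ze else 0) /\
    RInt (wflux l j) a t <= 1e-10 * (cone_wt m l * N * ze) + (if Z.eq_dec j m then 5e-6 * N * ze else 0)).
  { intros j Hj. destruct (Z.eq_dec j m) as [->|E].
    - destruct (step_res_small N t l HN Hi Hb Hj). lra.
    - destruct (step_nonres_small N t l j HN Hi Hb E Hj). lra. }
  destruct (Hflux (l + 1)%Z ltac:(lia)) as [F1 F2]. destruct (Hflux (l - 1)%Z ltac:(lia)) as [F3 F4]. clear Hflux.
  destruct b.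
  +
    assert (Hth : Cmod (th t l) <= Cmod (th a l) + (RInt (flux (l + 1)) a t + RInt (flux (l - 1)) a t)).
    { assert (H1 := theta_variation nu c f eta th G Hsol l a t El ltac:(lra)).
      assert (H2 := Cmod_triangle (Cminus (th t l) (th a l)) (th a l)).
      replace (Cplus (Cminus (th t l) (th a l)) (th a l)) with (th t l) in H2 by (unfold Cminus; ring).
      fold flux in H1. lra. }
    unfold val, prof; simpl fst; simpl snd; cbv iota.
    destruct (Z.eq_dec l m) as [->|Elm].
    * destruct (Z.eq_dec (m + 1) m); [lia|]. destruct (Z.eq_dec (m - 1) m); [lia|].
      rewrite cone_wt_self in *. fold ze in Hth. nra.
    * destruct (Z.eq_dec (Z.abs (l - m)) 1) as [E1|E1].
      -- rewrite (cone_wt_1 l E1) in *. fold ze in Hth.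
         assert (Hres : (if Z.eq_dec (l + 1) m then 10 * ka * N * ze else 0) + (if Z.eq_dec (l - 1) m then 10 * ka * N * ze else 0) <= 10 * ka * N * ze).
         { destruct (Z.eq_dec (l + 1) m), (Z.eq_dec (l - 1) m); try lia; lra. }
         assert (E : (1 + N / 2) * ((32 + 24 * ka) * ze) = 32 * ze + 24 * (ka * ze) + 16 * (N * ze) + 12 * (ka * N * ze)) by field.
         assert (0 <= ka * ze) by (apply Rmult_le_pos; lra). lra.
      -- destruct (Z.eq_dec (l + 1) m); [lia|]. destruct (Z.eq_dec (l - 1) m); [lia|].
         replace ((1 + N / 2) * (cone_wt m l * ze)) with (cone_wt m l * ze + / 2 * (cone_wt m l * N * ze)) by field. lra.
  +
    assert (HP : forall s, a < s < t -> pcf eta l s * Cmod (th s l) <=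
       if Z.eq_dec l m then N * ze else 1e-6 * (cone_wt m l * N * ze)).
    { intros s Hs. assert (Hp := pcf_bounds eta l s). assert (Hv := Hb (s, (l, true)) ltac:(unfold dom; simpl; lra)).
      unfold val in Hv; simpl fst in Hv; simpl snd in Hv; cbv iota in Hv. assert (Hcm := Cmod_ge_0 (th s l)).
      destruct (Z.eq_dec l m) as [Elm|Elm].
      - unfold prof in Hv; simpl in Hv. destruct (Z.eq_dec l m); [|contradiction]. rewrite Rmult_1_l in Hv. nra.
      - assert (Hp2 := step_pcf l s Elm El ltac:(lra)). assert (Hpl := prof_le s l Elm). assert (He := eps_nonneg).
        apply Rle_trans with (eps * (N * (cone_wt m l * (1 + ka) * ze))).
        + apply Rmult_le_compat; [lra|exact Hcm|exact Hp2|]. eapply Rle_trans; [exact Hv|]. apply Rmult_le_compat_l; lra.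
        + replace (eps * (N * (cone_wt m l * (1 + ka) * ze))) with (eps * (1 + ka) * (cone_wt m l * N * ze)) by ring.
          apply Rmult_le_compat_r; lra. }
    assert (Hgd := good_bound nu c f eta th G Hnu ltac:(lra) Hf3 Hsol l a t _ El ltac:(lra) HP). fold H in Hgd. fold wflux in Hgd.
    assert (Hmax : forall x y, 0 <= x -> 0 <= y -> Rmax x y <= x + y) by (intros; apply Rmax_lub; lra).
    assert (HP0 : 0 <= if Z.eq_dec l m then N * ze else 1e-6 * (cone_wt m l * N * ze)) by (destruct (Z.eq_dec l m); lra).
    assert (Hmx := Hmax (Cmod (H a l)) _ (Cmod_ge_0 _) HP0).
    assert (Hres : (if Z.eq_dec (l + 1) m then 5e-6 * N * ze else 0) + (if Z.eq_dec (l - 1) m then 5e-6 * N * ze else 0)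
       <= if Z.eq_dec (Z.abs (l - m)) 1 then 5e-6 * N * ze else 0).
    { destruct (Z.eq_dec (l + 1) m), (Z.eq_dec (l - 1) m), (Z.eq_dec (Z.abs (l - m)) 1); try lia; lra. }
    unfold val, prof; simpl fst; simpl snd; cbv iota.
    destruct (Z.eq_dec l m) as [->|Elm].
    * rewrite cone_wt_self in *. destruct (Z.eq_dec (Z.abs (m - m)) 1); [lia|]. lra.
    * replace ((1 + N / 2) * (/ 8192 * cone_wt m l * ze)) with (/ 8192 * cone_wt m l * ze + / 16384 * (cone_wt m l * N * ze)) by field.
      destruct (Z.eq_dec (Z.abs (l - m)) 1) as [E1|E1]; [rewrite (cone_wt_1 l E1) in *|]; lra.
Qed.

(** A second pass with the constant N = 2 now known. The freezing of theta_m to 0.006 bounds [good]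
    by 1.01, and the resonant input becomes 2 [ka] (2 * 1.006 + 1.01) < 6.1 [ka]. *)
Lemma step_upper t : a <= t <= T ->
  Cmod (Cminus (th t m) (th a m)) <= 0.006 * ze /\
  Cmod (H t m) <= 1.01 * ze /\
  (forall l, Z.abs (l - m) = 1%Z -> Cmod (th t l) <= (33 + 6.1 * ka) * ze) /\
  (forall l, Z.abs (l - m) <> 1%Z -> Cmod (th t l) <= 2 * cone_wt m l * ze) /\
  (forall l, l <> m -> Cmod (H t l) <= / 4096 * cone_wt m l * ze).
Proof.
assert (Hb := step_bootstrap). assert (Ha := tm_pos).
assert (Hvar : forall t, a <= t <= T -> Cmod (Cminus (th t m) (th a m)) <= 0.006 * ze).
{ intros s Hs. assert (H1 := theta_variation nu c f eta th G Hsol m a s ltac:(lia) ltac:(lra)). fold flux in H1.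
  destruct (step_nonres_small 2 s m (m + 1) ltac:(lra) Hs Hb ltac:(lia) ltac:(lia)) as [F1 _].
  destruct (step_nonres_small 2 s m (m - 1) ltac:(lra) Hs Hb ltac:(lia) ltac:(lia)) as [F2 _].
  rewrite cone_wt_self in *. lra. }
assert (Hm1 : forall t, a <= t <= T -> Cmod (th t m) <= 1.006 * ze).
{ intros s Hs. specialize (Hvar s Hs).
  assert (H2 := Cmod_triangle (Cminus (th s m) (th a m)) (th a m)).
  replace (Cplus (Cminus (th s m) (th a m)) (th a m)) with (th s m) in H2 by (unfold Cminus; ring). fold ze in H2. lra. }
assert (Hgm : forall t, a <= t <= T -> Cmod (H t m) <= 1.01 * ze).
{ intros s Hs.
  assert (Hgd := good_bound nu c f eta th G Hnu ltac:(lra) Hf3 Hsol m a s (1.006 * ze) ltac:(lia) ltac:(lra)).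
  fold H in Hgd. fold wflux in Hgd.
  destruct (step_nonres_small 2 s m (m + 1) ltac:(lra) Hs Hb ltac:(lia) ltac:(lia)) as [_ F1].
  destruct (step_nonres_small 2 s m (m - 1) ltac:(lra) Hs Hb ltac:(lia) ltac:(lia)) as [_ F2].
  destruct (Hcone m) as [_ C2]. rewrite cone_wt_self in *.
  assert (Hmx : Rmax (Cmod (H a m)) (1.006 * ze) <= 1.006 * ze) by (apply Rmax_lub; lra).
  eapply Rle_trans; [apply Hgd|lra].
  intros r Hr. assert (Hp := pcf_bounds eta m r). specialize (Hm1 r ltac:(lra)). assert (Hcm := Cmod_ge_0 (th r m)). nra. }
intros Ht. split; [apply Hvar, Ht|split; [apply Hgm, Ht|split; [|split]]].
- intros l Hl. destruct (Z.eq_dec l 0) as [->|El].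
  { destruct (ode_zero _ _ _ _ _ _ Hsol t ltac:(lra)) as [Z1 _]. rewrite Z1, Cmod_0. apply Rmult_le_pos; lra. }
  assert (Hth : Cmod (th t l) <= Cmod (th a l) + (RInt (flux (l + 1)) a t + RInt (flux (l - 1)) a t)).
  { assert (H1 := theta_variation nu c f eta th G Hsol l a t El ltac:(lra)).
    assert (H2 := Cmod_triangle (Cminus (th t l) (th a l)) (th a l)).
    replace (Cplus (Cminus (th t l) (th a l)) (th a l)) with (th t l) in H2 by (unfold Cminus; ring).
    fold flux in H1. lra. }
  destruct (Hcone l) as [C1 _]. rewrite (cone_wt_1 l Hl) in C1.
  destruct (step_flux_res t (1.006 * ze) (1.01 * ze) Ht ltac:(lra) ltac:(lra)) as [F1 _].
  { intros s Hs; split; [apply Hm1; lra|apply Hgm; lra]. }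
  assert (Hcases : l = (m + 1)%Z \/ l = (m - 1)%Z) by lia.
  destruct Hcases as [E|E].
  + destruct (step_nonres_small 2 t l (l + 1) ltac:(lra) Ht Hb ltac:(lia) ltac:(lia)) as [F2 _].
    rewrite (cone_wt_1 l Hl) in F2. replace (l - 1)%Z with m in Hth by lia. nra.
  + destruct (step_nonres_small 2 t l (l - 1) ltac:(lra) Ht Hb ltac:(lia) ltac:(lia)) as [F2 _].
    rewrite (cone_wt_1 l Hl) in F2. replace (l + 1)%Z with m in Hth by lia. nra.
- intros l Hl. specialize (Hb (t, (l, true)) ltac:(unfold dom; simpl; lra)).
  unfold val, prof in Hb; simpl fst in Hb; simpl snd in Hb; cbv iota in Hb.
  destruct (Z.eq_dec l m) as [->|]; [rewrite cone_wt_self; lra|].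
  destruct (Z.eq_dec (Z.abs (l - m)) 1); [contradiction|]. lra.
- intros l Hl. specialize (Hb (t, (l, false)) ltac:(unfold dom; simpl; lra)).
  unfold val, prof in Hb; simpl fst in Hb; simpl snd in Hb; cbv iota in Hb.
  destruct (Z.eq_dec l m) as [->|]; [contradiction|]. lra.
Qed.

(** [eps] is the square of 2 (m + 1) / a, and eta/m - a = a / (2m): smallness of [eps] says that the
    half window is long compared with the unit width of the resonance. *)
Lemma step_core_wide : 2 / (eta / IZR m - a) <= 0.002 /\ a < eta / IZR m.
Proof.
assert (H1 := IZR_m_ge1). assert (Ha := tm_pos).
assert (E : eta / IZR m - a = a / (2 * IZR m)) by (unfold a, tm; field; lra).
assert (HR : 0 < a / (2 * IZR m)) by (apply Rdiv_lt_0_compat; lra).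
split; [|lra]. rewrite E.
replace (2 / (a / (2 * IZR m))) with (2 * (2 * IZR m / a)) by (field; lra).
assert (H2 : (2 * (IZR m + 1) / a) ^ 2 <= 0.001 ^ 2).
{ replace ((2 * (IZR m + 1) / a) ^ 2) with eps by (unfold eps, epsm; fold a; field; lra).
  assert (He := eps_nonneg). nra. }
assert (H3 : 2 * (IZR m + 1) / a <= 0.001).
{ apply Rnot_lt_le; intros Hlt. assert (H4 := pow_incr 0.001 (2 * (IZR m + 1) / a) 2 ltac:(lra)). nra. }
assert (H4 : 2 * IZR m / a <= 2 * (IZR m + 1) / a).
{ apply Rmult_le_compat_r; [left; apply Rinv_0_lt_compat; lra|lra]. }
lra.
Qed.

(* With [theta_m] frozen at [z], [H_m = - W z] up to a small error, and the neighbours receive [gain]. *)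
Lemma step_lower t l : Z.abs (l - m) = 1%Z -> l <> 0%Z -> 2 * (eta / IZR m) - a <= t <= T ->
  0.9 * ka * ze <= Cmod (th t l).
Proof.
intros Hlm Hl Ht.
assert (Hb := step_bootstrap). assert (Ha := tm_pos). assert (H1 := IZR_m_ge1).
destruct step_core_wide as [HR Hax].
set (x0 := eta / IZR m) in *.
set (n := nu * IZR m ^ 2).
assert (Hn : 0 < n) by (apply Rmult_lt_0_compat; [exact Hnu|apply pow_lt; lra]).
set (z := th a m).
assert (Hd : forall s, mdamp n x0 s = damp nu eta (m, false) s).
{ intros s. unfold mdamp, n, x0, damp; simpl. field. lra. }
assert (Hp : forall s, / (1 + (x0 - s) ^ 2) = pcf eta m s) by reflexivity.
pose (E := fun s => Cplus (H s m) (Cmult (RtoC (W n x0 a s)) z)).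
assert (HE : forall s, a <= s <= T -> Cmod (E s) <= 0.016 * ze).
{ intros b Hs.
  assert (Hdu := duhamel E
    (fun s => Cplus (Cmult (RtoC (- (damp nu eta (m, false) s * pcf eta m s))) (Cminus (th s m) z))
       (Cmult (Cmult (RtoC (f s / (2 * c))) (Cmult Ci (RtoC (IZR m)))) (coupling c eta (th s) (G s) m s)))
    (damp nu eta (m, false)) (damp_int nu eta (m, false))
    (fun s => wflux m (m + 1) s + wflux m (m - 1) s) (fun s => RInt (wflux m (m + 1)) a s + RInt (wflux m (m - 1)) a s)
    (0.006 * ze) a b ltac:(lra)).
  cbv beta in Hdu. rewrite !RInt_point in Hdu. change (@zero R_CompleteNormedModule) with 0 in Hdu.
  replace (E a) with (H a m) in Hdu by (unfold E; rewrite W_a; ring).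
  destruct (Hcone m) as [_ C2]. rewrite cone_wt_self in C2.
  destruct (step_nonres_small 2 b m (m + 1) ltac:(lra) Hs Hb ltac:(lia) ltac:(lia)) as [_ F1].
  destruct (step_nonres_small 2 b m (m - 1) ltac:(lra) Hs Hb ltac:(lia) ltac:(lia)) as [_ F2].
  rewrite cone_wt_self in F1, F2.
  assert (Hmx : Rmax (Cmod (H a m)) (0.006 * ze) <= / 64 * ze) by (apply Rmax_lub; lra).
  assert (Hwc : forall l j t, continuous (wflux l j) t) by (intros; apply (wflux_cont nu c f eta th G Hsol)).
  eapply Rle_trans; [apply Hdu; clear Hdu|lra].
  - intros s _. apply continuous_Cplus; [apply (good_cont nu c f eta th G Hsol)|].
    apply continuous_Cmult; [apply continuous_RtoC, W_cont|apply continuous_const].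
  - intros s _. eapply continuous_of_derive, derive_plus; apply is_derive_RInt_cont; intros; apply Hwc.
  - intros; eapply continuous_of_derive, damp_int_derive.
  - intros s Hs2.
    assert (D1 := good_derive nu c f eta th G Hsol m s ltac:(lra) ltac:(lia)). fold H in D1.
    assert (D2 := is_derive_RtoC_mult (W n x0 a) (fun _ => z) s _ _ (W_derive n x0 a s)
       (@is_derive_const R_AbsRing (prod_NormedModule R_AbsRing R_NormedModule R_NormedModule) z s)).
    assert (D3 := is_derive_plus (V := prod_NormedModule R_AbsRing R_NormedModule R_NormedModule) _ _ _ _ _ D1 D2).
    unfold E. eapply is_derive_value_C; [exact D3|].
    change (@zero (prod_NormedModule R_AbsRing R_NormedModule R_NormedModule)) with (RtoC 0).
    match goal with |- plus ?u ?v = _ => change (plus u v) with (Cplus u v) end.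
    assert (En : n = damp nu eta (m, false) s * pcf eta m s) by (rewrite <- Hd, <- Hp; symmetry; apply mdamp_p).
    rewrite Hd. rewrite En at 2. set (dd := damp nu eta (m, false) s) in *. set (pp := pcf eta m s) in *.
    rewrite !RtoC_opp, RtoC_plus, !RtoC_mult, RtoC_opp. unfold Cminus. ring.
  - intros; apply damp_int_derive.
  - intros s Hs2. apply derive_plus; apply is_derive_RInt_cont; intros; apply Hwc.
  - intros; apply damp_nonneg; exact Hnu.
  - intros s Hs2. assert (G1 := wflux_nonneg c eta th G m (m + 1) s). assert (G2 := wflux_nonneg c eta th G m (m - 1) s).
    fold wflux in G1, G2. lra.
  - intros s Hs2.
    eapply Rle_trans; [apply Cmod_triangle|]. apply Rplus_le_compat.
    + assert (Hdn := damp_nonneg nu eta Hnu (m, false) s). assert (Hpb := pcf_bounds eta m s).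
      rewrite Cmod_mult, Cmod_R, Rabs_Ropp, Rabs_pos_eq by (apply Rmult_le_pos; lra).
      rewrite Rmult_assoc. apply Rmult_le_compat_l; [exact Hdn|].
      destruct (step_upper s ltac:(lra)) as [Hv _]. fold z in Hv. assert (Hcm := Cmod_ge_0 (Cminus (th s m) z)). nra.
    + apply (shear_forcing_le c f eta th G ltac:(lra) Hf3); lra. }
set (K := c * eta / IZR m ^ 3).
assert (Hce : 0 < c * eta) by (apply Rmult_lt_0_compat; lra).
assert (HK : 0 < K) by (apply Rdiv_lt_0_compat; [exact Hce|apply pow_lt; lra]).
assert (EK : K * PI = 2 * ka) by (unfold K, ka, kap; field; lra).
assert (HdK : forall s, dcoef c eta m s = K * pcf eta m s).
{ intros s. unfold dcoef, pcf, K. destruct (Z.eq_dec m 0); [lia|]. reflexivity. }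
(* The other neighbour of l, on the side opposite to m. *)
set (j := (2 * l - m)%Z).
assert (Hj : j <> m) by (unfold j; lia). assert (Hlj : Z.abs (l - j) = 1%Z) by (unfold j; lia).
pose (trm := fun (i : Z) s => Cmult (RtoC (dcoef c eta i s)) (Cplus (Cmult (RtoC (2 * pcf eta i s)) (th s i)) (H s i))).
assert (Hcoup : forall s, 0 <= s -> coupling c eta (th s) (G s) l s = Cplus (trm m s) (trm j s)).
{ intros s Hs. rewrite coupling_good by exact Hs. fold H.
  assert (Hcases : l = (m + 1)%Z \/ l = (m - 1)%Z) by lia.
  unfold trm, j. destruct Hcases as [->| ->].
  - replace (m + 1 - 1)%Z with m by lia. replace (2 * (m + 1) - m)%Z with (m + 1 + 1)%Z by lia. ring.
  - replace (m - 1 + 1)%Z with m by lia. replace (2 * (m - 1) - m)%Z with (m - 1 - 1)%Z by lia. ring. }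
assert (Htj : forall s, Cmod (trm j s) <= flux j s).
{ intros s. unfold trm, flux, input_flux. rewrite Cmod_mult, Cmod_R. apply Rmult_le_compat_l; [apply Rabs_pos|].
  eapply Rle_trans; [apply Cmod_triangle|]. rewrite Cmod_mult, Cmod_R, Rabs_pos_eq; [unfold H; lra|].
  assert (Hpb := pcf_bounds eta j s); lra. }
pose (Y := fun s => RInt (gain n x0 a) a s).
assert (HYd : forall s, is_derive (fun s => K * Y s) s (K * gain n x0 a s)).
{ intros s. eapply is_derive_value; [apply derive_mult; [apply derive_const|apply is_derive_RInt_cont; intros; apply gain_cont; exact Hn]|].
  cbv beta; ring. }
assert (Hfc : forall i t, continuous (flux i) t) by (intros; apply (flux_cont nu c f eta th G Hsol)).
(* Here 0.028 = 2 * 0.006 + 0.016 combines the error on 2 p theta_m with the bound on [E]. *)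
assert (Hinc := Cmod_incr (fun s => Cminus (th s l) (Cmult (RtoC (K * Y s)) z))
   (fun s => Cminus (rhs_theta c eta (th s) (G s) l s) (Cmult (RtoC (K * gain n x0 a s)) z))
   (fun s => K * 0.028 * ze * / (1 + (x0 - s) ^ 2) + flux j s)
   (fun s => K * 0.028 * ze * atan (s - x0) + RInt (flux j) a s) a t ltac:(lra)).
cbv beta in Hinc. rewrite RInt_point in Hinc. change (@zero R_CompleteNormedModule) with 0 in Hinc.
assert (EY : Y a = 0) by (unfold Y; rewrite RInt_point; reflexivity).
rewrite EY, Rmult_0_r in Hinc.
destruct (step_nonres_small 2 t l j ltac:(lra) ltac:(lra) Hb Hj Hlj) as [F1 _].
rewrite (cone_wt_1 l Hlm) in F1.
destruct (Hcone l) as [C1 _]. rewrite (cone_wt_1 l Hlm) in C1.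
assert (HYt := gain_total n x0 a Hn Hax t ltac:(lra)). fold (Y t) in HYt.
assert (Hat := atan_diff_le (t - x0) (a - x0)).
assert (Hfin : Cmod (Cminus (Cminus (th t l) (Cmult (RtoC (K * Y t)) z)) (Cminus (th a l) (Cmult (RtoC 0) z)))
   <= 0.056 * ka * ze + 0.01 * ze).
{ eapply Rle_trans; [apply Hinc; clear Hinc|].
  - intros s _. apply continuous_Cminus; [apply (ode_cont_th _ _ _ _ _ _ Hsol)|].
    apply continuous_Cmult; [apply continuous_RtoC|apply continuous_const].
    eapply continuous_of_derive, HYd.
  - intros s _. eapply continuous_of_derive. apply derive_plus; [|apply is_derive_RInt_cont; intros; apply Hfc].
    apply derive_mult; [apply derive_const|apply is_derive_atan_shift].
  - intros s Hs. apply is_derive_Cminus; [apply (ode_th _ _ _ _ _ _ Hsol); [lra|exact Hl]|].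
    assert (D2 := is_derive_RtoC_mult (fun s => K * Y s) (fun _ => z) s _ _ (HYd s)
       (@is_derive_const R_AbsRing (prod_NormedModule R_AbsRing R_NormedModule R_NormedModule) z s)).
    eapply is_derive_value_C; [exact D2|].
    change (@zero (prod_NormedModule R_AbsRing R_NormedModule R_NormedModule)) with (RtoC 0). cbv beta. ring.
  - intros s Hs. apply derive_plus; [|apply is_derive_RInt_cont; intros; apply Hfc].
    eapply is_derive_value; [apply derive_mult; [apply derive_const|apply is_derive_atan_shift]|]. cbv beta; ring.
  - intros s Hs. unfold rhs_theta. rewrite Hcoup by lra.
    assert (Hpb := pcf_bounds eta m s).
    replace (Cminus (Cplus (trm m s) (trm j s)) (Cmult (RtoC (K * gain n x0 a s)) z)) with
      (Cplus (Cmult (RtoC (K * pcf eta m s)) (Cplus (Cmult (RtoC (2 * pcf eta m s)) (Cminus (th s m) z)) (E s))) (trm j s)).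
    2: { unfold trm, gain, E. rewrite HdK, Hp. unfold Rminus. rewrite !RtoC_mult, RtoC_plus, RtoC_opp, RtoC_mult. unfold Cminus. ring. }
    eapply Rle_trans; [apply Cmod_triangle|]. apply Rplus_le_compat; [|apply Htj].
    rewrite Hp, Cmod_mult, Cmod_R, Rabs_pos_eq by (apply Rmult_le_pos; lra).
    replace (K * 0.028 * ze * pcf eta m s) with (K * pcf eta m s * (0.028 * ze)) by ring.
    apply Rmult_le_compat_l; [apply Rmult_le_pos; lra|].
    eapply Rle_trans; [apply Cmod_triangle|]. rewrite Cmod_mult, Cmod_R, Rabs_pos_eq by lra.
    destruct (step_upper s ltac:(lra)) as [Hv _]. fold z in Hv. assert (Hcm := Cmod_ge_0 (Cminus (th s m) z)).
    specialize (HE s ltac:(lra)). nra.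
  - assert (K * 0.028 * ze * (atan (t - x0) - atan (a - x0)) <= K * 0.028 * ze * PI).
    { apply Rmult_le_compat_l; [|exact Hat]. apply Rmult_le_pos; [lra|lra]. }
    replace (K * 0.028 * ze * PI) with (0.028 * (K * PI) * ze) in * by ring. rewrite EK in *. lra. }
assert (Tr : Cmod (Cmult (RtoC (K * Y t)) z) <= Cmod (th t l) + (0.056 * ka * ze + 0.01 * ze) + Cmod (th a l)).
{ set (u := Cminus (Cminus (th t l) (Cmult (RtoC (K * Y t)) z)) (Cminus (th a l) (Cmult (RtoC 0) z))) in *.
  replace (Cmult (RtoC (K * Y t)) z) with (Cplus (Cplus (th t l) (Copp u)) (Copp (th a l))) by (unfold u, Cminus; ring).
  eapply Rle_trans; [apply Cmod_triangle|]. rewrite Cmod_opp. apply Rplus_le_compat_r.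
  eapply Rle_trans; [apply Cmod_triangle|]. rewrite Cmod_opp. apply Rplus_le_compat_l. exact Hfin. }
rewrite Cmod_mult, Cmod_R in Tr. fold z in ze.
assert (HPI : 2 < PI) by (assert (HP := PI2_1); lra).
assert (HKY : 0.998 * ka <= K * Y t).
{ assert (HKk : K <= ka) by nra.
  assert (K * (PI / 2 - 2 / (x0 - a)) <= K * Y t) by (apply Rmult_le_compat_l; lra).
  assert (K * (2 / (x0 - a)) <= ka * 0.002).
  { apply Rmult_le_compat; [lra| |exact HKk|exact HR]. apply Rdiv_le_0_compat; lra. }
  lra. }
rewrite Rabs_pos_eq in Tr by lra.
assert (H9 : 0.998 * ka * ze <= K * Y t * ze) by (apply Rmult_le_compat_r; lra).
change (Cmod z) with ze in Tr.
(* The cone lets theta_l start with modulus 32 [ze] and the opposite phase; this is paid by the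
   margin between 0.998 - 0.056 and 0.9, since [ka] >= 1000. *)
assert (42 * ze <= 0.042 * ka * ze) by (apply Rmult_le_compat_r; lra). lra.
Qed.

End Step.

(** * Before the first resonance *)

Section Initial.
Variables (nu c : R) (f : R -> R) (eta : R) (th G : R -> Z -> C) (k : Z).
Hypothesis Hnu : 0 < nu.
Hypothesis Hc : 0 < c < 0.001.
Hypothesis Heta : 1e12 <= eta.
Hypothesis Hf3 : forall t, 0 <= t -> Rabs (f t) <= 2 * c / (1 + t ^ 2).
Hypothesis Hsol : ode_sol nu c f eta th G.
Hypothesis Hk : (1 <= k)%Z.
Hypothesis Hth0 : th 0 = delta_seq k.
Hypothesis HG0 : G 0 = (fun _ => RtoC 0).
Hypothesis Hkap : c * eta * PI / IZR (k + 1) ^ 3 <= 2000.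
Let H := good eta th G.
Let flux := input_flux c eta th G.
Let wflux := weighted_flux c eta th G.
Let a := tm eta k.
Let K (j : Z) := c * eta / Rabs (IZR j) ^ 3.
Definition epsl (j : Z) : R := / (1 + (eta / (3 * IZR j ^ 2)) ^ 2).

Lemma sqrt_eta : exists s, 1e6 <= s /\ s * s = eta.
Proof.
exists (sqrt eta). split; [|apply sqrt_sqrt; lra].
rewrite <- (sqrt_pow2 1e6) by lra. apply sqrt_le_1_alt. lra.
Qed.

Lemma K_pos j : j <> 0%Z -> 0 < K j.
Proof.
intros Hj. unfold K. apply Rdiv_lt_0_compat; [apply Rmult_lt_0_compat; lra|].
apply pow_lt, Rabs_pos_lt, not_0_IZR, Hj.
Qed.

Lemma Rabs_IZR_ge1 j : j <> 0%Z -> 1 <= Rabs (IZR j).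
Proof. intros Hj. rewrite <- abs_IZR. apply IZR_le. lia. Qed.

Lemma epsl_bounds j : 0 < epsl j <= 1.
Proof. unfold epsl. split; [apply Rinv_0_lt_compat, coef_den_pos|apply pcoef_le]. Qed.

(* Uniform in [j]: weighted AM-GM, [9 j^4 + eta^2 >= 3 j eta^(3/2)]. *)
Lemma K_epsl j : j <> 0%Z -> K j * PI * epsl j <= 1.3e-8.
Proof.
intros Hj. destruct sqrt_eta as [s [Hs1 Hs2]].
assert (HJ := Rabs_IZR_ge1 j Hj).
unfold K, epsl. rewrite <- (pow2_abs (IZR j)). set (J := Rabs (IZR j)) in *. clearbody J.
assert (Hmain : 3 * J * (eta * s) <= 9 * J ^ 4 + eta ^ 2).
{ rewrite <- Hs2. 
  assert (Hy : forall y, 0 <= 9 * y ^ 4 - 3 * y + 1).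
  { intros y. assert (0 <= (3 * y ^ 2 - / 2) ^ 2) by apply pow2_ge_0. assert (0 <= (3 * y ^ 2 - 3 * y / 2 + 0) ^ 2) by apply pow2_ge_0.
    assert (0 <= 3 * (y - / 2) ^ 2) by (apply Rmult_le_pos; [lra|apply pow2_ge_0]). nra. }
  specialize (Hy (J / s)).
  assert (E : 9 * J ^ 4 - 3 * J * (s * s * s) + (s * s) ^ 2 = s ^ 4 * (9 * (J / s) ^ 4 - 3 * (J / s) + 1)) by (field; lra).
  assert (0 <= s ^ 4 * (9 * (J / s) ^ 4 - 3 * (J / s) + 1)) by (apply Rmult_le_pos; [apply pow_le; lra|exact Hy]). lra. }
assert (HJ4 : 0 < J ^ 4) by (apply pow_lt; lra).
assert (He2 : 0 < eta ^ 2) by (apply pow_lt; lra).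
replace (1 + (eta / (3 * J ^ 2)) ^ 2) with ((9 * J ^ 4 + eta ^ 2) / (9 * J ^ 4)) by (field; lra).
replace (c * eta / J ^ 3 * PI * / ((9 * J ^ 4 + eta ^ 2) / (9 * J ^ 4))) with (c * PI * (9 * J * eta / (9 * J ^ 4 + eta ^ 2)))
  by (field; lra).
assert (HPI : PI <= 4) by apply PI_4. assert (HPI0 := PI_RGT_0).
assert (Hfrac : 9 * J * eta / (9 * J ^ 4 + eta ^ 2) <= 3 / s).
{ apply Rmult_le_reg_r with (9 * J ^ 4 + eta ^ 2); [lra|].
  unfold Rdiv at 1. rewrite Rmult_assoc, Rinv_l, Rmult_1_r by lra.
  apply Rmult_le_reg_l with s; [lra|].
  replace (s * (3 / s * (9 * J ^ 4 + eta ^ 2))) with (3 * (9 * J ^ 4 + eta ^ 2)) by (field; lra).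
  lra. }
assert (Hs3 : 3 / s <= 3e-6).
{ apply Rmult_le_reg_r with s; [lra|]. unfold Rdiv. rewrite Rmult_assoc, Rinv_l, Rmult_1_r by lra. lra. }
assert (0 <= 9 * J * eta / (9 * J ^ 4 + eta ^ 2)) by (apply Rdiv_le_0_compat; nra).
apply Rle_trans with (0.001 * 4 * 3e-6); [|lra].
apply Rmult_le_compat; [apply Rmult_le_pos; lra|assumption| |lra].
apply Rmult_le_compat; lra.
Qed.

(* Away from its own resonance time, mode [j] is at distance at least [eta / (3 j^2)]. *)
Definition away (j : Z) (t : R) : Prop :=
  (IZR j + / 2) * t <= eta \/ ((1 <= j)%Z /\ eta <= (IZR j - / 2) * t).

Lemma pcf_away j t : j <> 0%Z -> 0 <= t -> away j t -> pcf eta j t <= epsl j.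
Proof.
intros Hj Ht Haw. unfold pcf, epsl.
assert (Hj0 : IZR j <> 0) by (apply not_0_IZR; exact Hj).
assert (Hj2 : 0 < IZR j ^ 2) by (apply pow2_gt_0; exact Hj0).
apply Rinv_le_contravar; [apply coef_den_pos|]. apply Rplus_le_compat_l.
rewrite <- (pow2_abs (eta / IZR j - t)), <- (pow2_abs (eta / (3 * IZR j ^ 2))). apply pow_incr. split; [apply Rabs_pos|].
rewrite (Rabs_pos_eq (eta / (3 * IZR j ^ 2))) by (apply Rdiv_le_0_compat; lra).
assert (HJ := Rabs_IZR_ge1 j Hj).
assert (E : eta / IZR j - t = (eta - IZR j * t) * / IZR j) by (field; exact Hj0).
rewrite E, Rabs_mult, Rabs_inv. rewrite <- (pow2_abs (IZR j)) in *.
apply Rmult_le_reg_r with (3 * Rabs (IZR j) ^ 2); [lra|].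
unfold Rdiv. rewrite Rmult_assoc, Rinv_l, Rmult_1_r by lra.
replace (Rabs (eta - IZR j * t) * / Rabs (IZR j) * (3 * Rabs (IZR j) ^ 2)) with (3 * (Rabs (IZR j) * Rabs (eta - IZR j * t)))
  by (field; lra).
destruct (Z_lt_le_dec j 0) as [Hn|Hp].
- assert (Hjm : IZR j <= -1) by (apply IZR_le; lia).
  rewrite (Rabs_left (IZR j)), Rabs_pos_eq by nra. nra.
- assert (Hjp : 1 <= IZR j) by (apply IZR_le; lia).
  rewrite (Rabs_pos_eq (IZR j)) by lra.
  destruct Haw as [Haw|[_ Haw]].
  + rewrite Rabs_pos_eq by nra. nra.
  + rewrite Rabs_left1 by nra. nra.
Qed.

Lemma recip_derive x K' t : x - t <> 0 -> is_derive (fun u => K' * / (x - u)) t (K' * / (x - t) ^ 2).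
Proof. intros Hx. auto_derive; [exact Hx|]. field. exact Hx. Qed.

(** [K j] / (eta/j - u)^2 dominates the Lorentzian and has an explicit primitive. While eta/j - u is
    at least eta / (3 j^2) in modulus, this primitive varies by at most 3 c / |j|: the nonresonant
    flux is O(c) uniformly in j. *)
Lemma away_tail j s t : j <> 0%Z -> 0 <= s <= t ->
  ((IZR j + / 2) * t <= eta \/ ((1 <= j)%Z /\ eta <= (IZR j - / 2) * s)) ->
  (forall u, s <= u <= t -> away j u /\ eta / IZR j - u <> 0) /\
  K j * / (eta / IZR j - t) - K j * / (eta / IZR j - s) <= 3 * c.
Proof.
intros Hj Hst Haw.
assert (Hj0 : IZR j <> 0) by (apply not_0_IZR; exact Hj).
assert (HJ := Rabs_IZR_ge1 j Hj). assert (HK := K_pos j Hj).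
assert (HK3 : K j * (3 * Rabs (IZR j) ^ 2 / eta) <= 3 * c).
{ unfold K. replace (c * eta / Rabs (IZR j) ^ 3 * (3 * Rabs (IZR j) ^ 2 / eta)) with (3 * c * / Rabs (IZR j)) by (field; lra).
  rewrite <- (Rmult_1_r (3 * c)) at 2. apply Rmult_le_compat_l; [lra|]. rewrite <- Rinv_1. apply Rinv_le_contravar; lra. }
assert (Haw2 : forall u, s <= u <= t -> away j u).
{ intros u Hu. unfold away. destruct Haw as [Haw|[Hj1 Haw]].
  - left. destruct (Rle_dec 0 (IZR j + / 2)); [|nra]. eapply Rle_trans; [|exact Haw]. apply Rmult_le_compat_l; lra.
  - right; split; [exact Hj1|]. assert (1 <= IZR j) by (apply IZR_le; exact Hj1). nra. }
assert (Hne : forall u, s <= u <= t -> eta / IZR j - u <> 0).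
{ intros u Hu E. assert (Haw3 := pcf_away j u Hj ltac:(lra) (Haw2 u Hu)). unfold pcf in Haw3. rewrite E in Haw3.
  replace (1 + 0 ^ 2) with 1 in Haw3 by ring. rewrite Rinv_1 in Haw3.
  assert (epsl j < 1); [|lra]. unfold epsl. rewrite <- Rinv_1. apply Rinv_lt_contravar; [|].
  - assert (Hcd := coef_den_pos (eta / (3 * IZR j ^ 2))). lra.
  - assert (0 < (eta / (3 * IZR j ^ 2)) ^ 2); [|lra]. apply pow_lt, Rdiv_lt_0_compat; [lra|].
    assert (0 < IZR j ^ 2) by (apply pow2_gt_0; exact Hj0). lra. }
split; [intros u Hu; split; [apply Haw2, Hu|apply Hne, Hu]|].
assert (Hx : forall u, eta / IZR j - u = (eta - IZR j * u) / IZR j) by (intros; field; exact Hj0).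
assert (Hinv : forall u, s <= u <= t -> / (eta / IZR j - u) = IZR j / (eta - IZR j * u)).
{ intros u Hu. assert (Hn := Hne u Hu). rewrite Hx in *. assert (eta - IZR j * u <> 0).
  { intros E. apply Hn. rewrite E. unfold Rdiv. ring. } field. split; assumption. }
rewrite !Hinv by lra.
assert (Hgoal : IZR j / (eta - IZR j * t) - IZR j / (eta - IZR j * s) <= 3 * Rabs (IZR j) ^ 2 / eta).
2: { assert (K j * (IZR j / (eta - IZR j * t) - IZR j / (eta - IZR j * s)) <= K j * (3 * Rabs (IZR j) ^ 2 / eta))
       by (apply Rmult_le_compat_l; lra). lra. }
assert (Hfr : forall x y B, 0 < y -> x * eta <= B * y -> x / y <= B / eta).
{ intros x y B Hy Hxy. apply Rmult_le_reg_r with (y * eta); [apply Rmult_lt_0_compat; lra|].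
  replace (x / y * (y * eta)) with (x * eta) by (field; lra). replace (B / eta * (y * eta)) with (B * y) by (field; lra). exact Hxy. }
destruct (Z_lt_le_dec j 0) as [Hn|Hp].
- assert (Hjm : IZR j <= -1) by (apply IZR_le; lia).
  rewrite (Rabs_left (IZR j)) in * by lra.
  assert (H1 : IZR j / (eta - IZR j * t) <= 0).
  { unfold Rdiv. assert (0 < / (eta - IZR j * t)) by (apply Rinv_0_lt_compat; nra). nra. }
  assert (H2 : (- IZR j) / (eta - IZR j * s) <= 3 * (- IZR j) ^ 2 / eta).
  { set (X := - IZR j) in *. assert (HX : 1 <= X) by (unfold X; lra). replace (IZR j) with (- X) by (unfold X; ring).
    assert (HXs : 0 <= X * s) by (apply Rmult_le_pos; lra). clearbody X.
    apply Hfr; [lra|]. assert (X * eta <= X ^ 2 * eta) by (apply Rmult_le_compat_r; nra).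
    assert (0 <= X ^ 2 * (X * s)) by (apply Rmult_le_pos; [apply pow2_ge_0|exact HXs]).
    assert (0 <= X ^ 2 * eta) by (apply Rmult_le_pos; [apply pow2_ge_0|lra]). lra. }
  replace (IZR j / (eta - IZR j * s)) with (- (- IZR j / (eta - IZR j * s))) by (field; nra). lra.
- assert (Hjp : 1 <= IZR j) by (apply IZR_le; lia).
  rewrite (Rabs_pos_eq (IZR j)) in * by lra.
  destruct Haw as [Haw|[_ Haw]].
  + assert (H1 : IZR j / (eta - IZR j * t) <= 3 * IZR j ^ 2 / eta).
    { assert (Hpos : 0 < eta - IZR j * t) by nra.
      apply Hfr; [exact Hpos|].
      assert (Ht2 : t * (2 * IZR j + 1) <= 2 * eta) by nra.
      assert (E1 : 3 * IZR j ^ 2 * (eta - IZR j * t) - IZR j * eta = IZR j * ((3 * IZR j - 1) * eta - 3 * IZR j * (IZR j * t))) by ring.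
      assert (E2 : 0 <= (3 * IZR j - 1) * eta - 3 * IZR j * (IZR j * t)).
      { apply Rmult_le_reg_l with (2 * IZR j + 1); [lra|]. rewrite Rmult_0_r.
        replace ((2 * IZR j + 1) * ((3 * IZR j - 1) * eta - 3 * IZR j * (IZR j * t))) with
          ((2 * IZR j + 1) * (3 * IZR j - 1) * eta - 3 * IZR j ^ 2 * (t * (2 * IZR j + 1))) by ring.
        assert (3 * IZR j ^ 2 * (t * (2 * IZR j + 1)) <= 3 * IZR j ^ 2 * (2 * eta)) by (apply Rmult_le_compat_l; nra). nra. }
      assert (0 <= IZR j * ((3 * IZR j - 1) * eta - 3 * IZR j * (IZR j * t))) by (apply Rmult_le_pos; lra). lra. }
    assert (H2 : 0 <= IZR j / (eta - IZR j * s)) by (apply Rdiv_le_0_compat; nra). lra.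
  + assert (Hst2 : (IZR j - / 2) * s <= (IZR j - / 2) * t) by (apply Rmult_le_compat_l; lra).
    assert (H1 : IZR j / (eta - IZR j * t) <= 0).
    { replace (IZR j / (eta - IZR j * t)) with (- (IZR j / (IZR j * t - eta))) by (field; nra).
      assert (0 <= IZR j / (IZR j * t - eta)) by (apply Rdiv_le_0_compat; nra). lra. }
    replace (IZR j / (eta - IZR j * s)) with (- (IZR j / (IZR j * s - eta))) by (field; nra).
    assert (H2 : IZR j / (IZR j * s - eta) <= 3 * IZR j ^ 2 / eta); [|lra].
    assert (Hpos : 0 < IZR j * s - eta) by nra.
    apply Hfr; [exact Hpos|].
    assert (Ht2 : 2 * eta <= s * (2 * IZR j - 1)) by nra.
    assert (E2 : 0 <= 3 * IZR j * (IZR j * s) - (3 * IZR j + 1) * eta).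
    { apply Rmult_le_reg_l with (2 * IZR j - 1); [lra|]. rewrite Rmult_0_r.
      replace ((2 * IZR j - 1) * (3 * IZR j * (IZR j * s) - (3 * IZR j + 1) * eta)) with
        (3 * IZR j ^ 2 * (s * (2 * IZR j - 1)) - (2 * IZR j - 1) * (3 * IZR j + 1) * eta) by ring.
      assert (3 * IZR j ^ 2 * (2 * eta) <= 3 * IZR j ^ 2 * (s * (2 * IZR j - 1))) by (apply Rmult_le_compat_l; nra). nra. }
    assert (0 <= IZR j * (3 * IZR j * (IZR j * s) - (3 * IZR j + 1) * eta)) by (apply Rmult_le_pos; lra). nra.
Qed.

(** V1 is charged the whole mass of the Lorentzian, V2 only its nonresonant tail. Either V1 is of
    order [epsl j], so that [K_epsl] applies, or the piece is the resonant one and V2 = 0. *)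
Lemma flux_piece j s t V1 V2 : j <> 0%Z -> 0 <= s <= t -> 0 <= V1 -> 0 <= V2 ->
  (V2 = 0 \/ (IZR j + / 2) * t <= eta \/ ((1 <= j)%Z /\ eta <= (IZR j - / 2) * s)) ->
  (forall u, s < u < t -> 2 * pcf eta j u * Cmod (th u j) + Cmod (H u j) <= V1 + V2) ->
  RInt (flux j) s t <= K j * PI * V1 + 3 * c * V2.
Proof.
intros Hj Hst HV1 HV2 Haw Hb. assert (HK := K_pos j Hj).
assert (Hflx : forall u, s < u < t -> flux j u <= K j * V1 * pcf eta j u + K j * V2 * pcf eta j u).
{ intros u Hu. unfold flux, input_flux. rewrite dcoef_pcf by (assumption || lra). fold (K j).
  assert (Hp := pcf_bounds eta j u).
  replace (K j * V1 * pcf eta j u + K j * V2 * pcf eta j u) with (K j * pcf eta j u * (V1 + V2)) by ring.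
  apply Rmult_le_compat_l; [apply Rmult_le_pos; lra|apply Hb, Hu]. }
assert (Hat := atan_diff_le (t - eta / IZR j) (s - eta / IZR j)).
assert (HKV : 0 <= K j * V1) by (apply Rmult_le_pos; lra).
assert (HKV2 : 0 <= K j * V2) by (apply Rmult_le_pos; lra).
assert (Hder : forall u, is_derive (fun u => K j * V1 * atan (u - eta / IZR j)) u (K j * V1 * pcf eta j u)).
{ intros u. eapply is_derive_value; [apply derive_mult; [apply derive_const|apply is_derive_atan_shift]|].
  cbv beta. unfold pcf. ring. }
assert (Hprod : K j * V1 * (atan (t - eta / IZR j) - atan (s - eta / IZR j)) <= K j * V1 * PI) by (apply Rmult_le_compat_l; lra).
destruct Haw as [HV0|Haw].
- eapply Rle_trans; [apply (RInt_le_deriv _ (fun u => K j * V1 * atan (u - eta / IZR j)) (fun u => K j * V1 * pcf eta j u))|].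
  + lra.
  + intros; apply (flux_cont nu c f eta th G Hsol).
  + intros; apply Hder.
  + intros u Hu. specialize (Hflx u Hu). rewrite HV0 in Hflx. lra.
  + rewrite HV0. lra.
- destruct (away_tail j s t Hj Hst Haw) as [A1 A2].
  eapply Rle_trans; [apply (RInt_le_deriv _ (fun u => K j * V1 * atan (u - eta / IZR j) + K j * V2 * / (eta / IZR j - u))
     (fun u => K j * V1 * pcf eta j u + K j * V2 * / (eta / IZR j - u) ^ 2))|].
  + lra.
  + intros; apply (flux_cont nu c f eta th G Hsol).
  + intros u Hu. apply derive_plus; [apply Hder|apply recip_derive, A1, Hu].
  + intros u Hu. eapply Rle_trans; [apply Hflx, Hu|]. apply Rplus_le_compat_l. apply Rmult_le_compat_l; [exact HKV2|].
    unfold pcf. assert (Hne := proj2 (A1 u ltac:(lra))). apply Rinv_le_contravar; [apply pow2_gt_0, Hne|lra].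
  + assert (V2 * (K j * / (eta / IZR j - t) - K j * / (eta / IZR j - s)) <= V2 * (3 * c)) by (apply Rmult_le_compat_l; lra). lra.
Qed.

(** With x = eta/j, |j| [K j] = (c/eta) x^2, and x^2 <= 2 (1 + u^2) + 2 (1 + (x - u)^2) splits the
    product of the two Lorentzians, centred at 0 and x, into a sum. The factor c/eta makes the
    result tiny, uniformly in j. *)
Lemma wflux_total l j t V : j <> 0%Z -> (Z.abs (l - j) <= 1)%Z -> 0 <= t -> 0 <= V ->
  (forall u, 0 < u < t -> 2 * pcf eta j u * Cmod (th u j) + Cmod (H u j) <= V) ->
  RInt (wflux l j) 0 t <= 3.2e-14 * V.
Proof.
intros Hj Hl Ht HV Hb.
assert (Hj0 : IZR j <> 0) by (apply not_0_IZR; exact Hj).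
assert (HJ := Rabs_IZR_ge1 j Hj). assert (HK := K_pos j Hj). assert (HPI : PI <= 4) by apply PI_4.
assert (Hlj := IZR_neighbor_le l j Hj Hl).
set (x := eta / IZR j).
assert (Hce : 0 <= c / eta * V) by (apply Rmult_le_pos; [apply Rdiv_le_0_compat; lra|exact HV]).
eapply Rle_trans; [apply (RInt_le_deriv _ (fun u => 4 * (c / eta * V) * atan (u - 0) + 4 * (c / eta * V) * atan (u - x))
   (fun u => 4 * (c / eta * V) * / (1 + (0 - u) ^ 2) + 4 * (c / eta * V) * / (1 + (x - u) ^ 2)))|].
- exact Ht.
- intros; apply (wflux_cont nu c f eta th G Hsol).
- intros u Hu. apply derive_plus; (eapply is_derive_value; [apply derive_mult; [apply derive_const|apply is_derive_atan_shift]|cbv beta; ring]).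
- intros u Hu. unfold wflux, weighted_flux, input_flux. rewrite dcoef_pcf by (assumption || lra). fold (K j).
  assert (Hp := pcf_bounds eta j u). unfold pcf in Hp. fold x in Hp.
  assert (Hq := coef_den_pos (x - u)). assert (Hq2 := coef_den_pos u).
  replace ((0 - u) ^ 2) with (u ^ 2) by ring.
  apply Rle_trans with (2 * Rabs (IZR j) / (1 + u ^ 2) * (K j * pcf eta j u * V)).
  + apply Rmult_le_compat.
    * apply Rdiv_le_0_compat; [apply Rabs_pos|lra].
    * apply Rmult_le_pos; [apply Rmult_le_pos; [lra|left; apply pcf_bounds]|].
      assert (Hpb := pcf_bounds eta j u). assert (C1 := Cmod_ge_0 (th u j)). assert (C2 := Cmod_ge_0 (good eta th G u j)).
      assert (0 <= pcf eta j u * Cmod (th u j)) by (apply Rmult_le_pos; lra). lra.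
    * apply Rmult_le_compat_r; [left; apply Rinv_0_lt_compat; lra|exact Hlj].
    * apply Rmult_le_compat_l; [apply Rmult_le_pos; [lra|left; apply pcf_bounds]|]. apply Hb, Hu.
  + unfold pcf. fold x.
    assert (EKx : 2 * Rabs (IZR j) * K j = 2 * (c / eta) * x ^ 2).
    { unfold K, x. assert (Er : Rabs (eta / IZR j) = eta / Rabs (IZR j)).
      { unfold Rdiv. rewrite Rabs_mult, Rabs_inv, (Rabs_pos_eq eta) by lra. reflexivity. }
      rewrite <- (pow2_abs (eta / IZR j)), Er. field. lra. }
    replace (2 * Rabs (IZR j) / (1 + u ^ 2) * (K j * / (1 + (x - u) ^ 2) * V)) with
      (2 * Rabs (IZR j) * K j * V * (/ (1 + u ^ 2) * / (1 + (x - u) ^ 2))) by (field; lra).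
    rewrite EKx.
    replace (2 * (c / eta) * x ^ 2 * V * (/ (1 + u ^ 2) * / (1 + (x - u) ^ 2))) with
      (2 * (c / eta * V) * (x ^ 2 * (/ (1 + u ^ 2) * / (1 + (x - u) ^ 2)))) by (field; lra).
    replace (4 * (c / eta * V) * / (1 + u ^ 2) + 4 * (c / eta * V) * / (1 + (x - u) ^ 2)) with
      (2 * (c / eta * V) * (2 * ((1 + u ^ 2) + (1 + (x - u) ^ 2)) * (/ (1 + u ^ 2) * / (1 + (x - u) ^ 2)))) by (field; lra).
    apply Rmult_le_compat_l; [lra|]. apply Rmult_le_compat_r.
    * apply Rmult_le_pos; left; apply Rinv_0_lt_compat; lra.
    * assert (0 <= (x - 2 * u) ^ 2) by apply pow2_ge_0. nra.
- assert (Hat1 := atan_diff_le (t - 0) (0 - 0)). assert (Hat2 := atan_diff_le (t - x) (0 - x)).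
  assert (Hce2 : c / eta <= 1e-15).
  { apply Rmult_le_reg_r with eta; [lra|]. unfold Rdiv. rewrite Rmult_assoc, Rinv_l, Rmult_1_r by lra. lra. }
  assert (c / eta * V <= 1e-15 * V) by (apply Rmult_le_compat_r; lra).
  assert (4 * (c / eta * V) * ((atan (t - 0) - atan (0 - 0)) + (atan (t - x) - atan (0 - x))) <= 4 * (c / eta * V) * 8)
    by (apply Rmult_le_compat_l; lra).
  lra.
Qed.

(* Before its resonance a mode [l > k] is reached only through non-resonant couplings, hence has size
   [50000^-(l - k)]; the resonance of [l - 1] then lifts it by at most [50000^2]. *)
Let mw (l : Z) : R := wt 50000 k l.
Let Aw (l : Z) (t : R) : R := if Rle_dec ((IZR l - / 2) * t) eta then 1 else 2.5e9.
(** Tiers before, during and after the window of l. As [good] relaxes towards p theta_l, the last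
    tier contains [epsl l] times the size 2.5e9 = 50000^2 that [Aw] allows, doubled for the
    iteration; 1e-7 and 50000 leave room for the other inputs. *)
Let Bw (l : Z) (t : R) : R :=
  if Rle_dec ((IZR l + / 2) * t) eta then 2 * epsl l + 1e-7
  else if Rle_dec ((IZR l - / 2) * t) eta then 3 else 50000 + 5e9 * epsl l.

Hypothesis Hprior : exists M, forall t l, 0 <= t <= a ->
  Cmod (th t l) <= M * wt 50000 k l /\ Cmod (H t l) <= M * wt 50000 k l.

Lemma tier_mono x u t : 0 <= u <= t -> x * t <= eta -> x * u <= eta.
Proof. intros Hu Hx. destruct (Rle_dec 0 x); [|nra]. eapply Rle_trans; [|exact Hx]. apply Rmult_le_compat_l; lra. Qed.

Lemma IZR_k_ge1 : 1 <= IZR k.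
Proof. apply IZR_le; exact Hk. Qed.

Lemma initial_time t : 0 <= t <= a -> (IZR k + / 2) * t <= eta.
Proof.
intros Ht. assert (Hk1 := IZR_k_ge1). apply (tier_mono _ _ a Ht). unfold a, tm. right; field. lra.
Qed.

Lemma late_gt l t : 0 <= t <= a -> ~ (IZR l + / 2) * t <= eta -> (k < l)%Z.
Proof.
intros Ht Hn. apply Rnot_le_lt in Hn. assert (H1 := initial_time t Ht). apply lt_IZR. nra.
Qed.

Lemma late_gt2 l t : 0 <= t <= a -> ~ (IZR l - / 2) * t <= eta -> (k + 1 < l)%Z.
Proof.
intros Ht Hn. apply Rnot_le_lt in Hn. assert (H1 := initial_time t Ht). apply lt_IZR. rewrite plus_IZR. nra.
Qed.

Lemma mw_pos l : 0 < mw l <= 1.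
Proof. split; [apply wt_pos; lra|apply wt_le1; lra]. Qed.

Lemma mw_neighbor l j : (Z.abs (l - j) = 1)%Z -> mw j <= 50000 * mw l.
Proof. intros E. apply wt_step; [lra|lia]. Qed.

Lemma mw_up l : (k <= l)%Z -> mw (l + 1) = mw l / 50000.
Proof.
intros Hl. unfold mw, wt. replace (Z.abs_nat (l + 1 - k)) with (S (Z.abs_nat (l - k))) by lia. simpl. field.
Qed.

Section Iterate.
Variable N : R.
Hypothesis HN : 0 <= N.
Hypothesis Hb : forall t l, 0 <= t <= a ->
  Cmod (th t l) <= N * (Aw l t * mw l) /\ Cmod (H t l) <= N * (Bw l t * mw l).

Lemma Nmw_nonneg l : 0 <= N * mw l.
Proof. assert (H1 := mw_pos l). apply Rmult_le_pos; lra. Qed.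

Lemma flux_early j t : j <> 0%Z -> 0 <= t <= a -> (IZR j + / 2) * t <= eta ->
  RInt (flux j) 0 t <= 6e-8 * (N * mw j).
Proof.
intros Hj Ht Hjt. assert (He := epsl_bounds j). assert (Hm := Nmw_nonneg j). assert (HKe := K_epsl j Hj).
eapply Rle_trans; [apply (flux_piece j 0 t (4 * epsl j * (N * mw j)) (1e-7 * (N * mw j)) Hj)|].
- lra.
- apply Rmult_le_pos; lra.
- lra.
- right; left; exact Hjt.
- intros u Hu. assert (Hju := tier_mono _ u t ltac:(lra) Hjt). destruct (Hb u j ltac:(lra)) as [B1 B2].
  assert (Hpe := pcf_away j u Hj ltac:(lra) (or_introl Hju)). assert (Hp := pcf_bounds eta j u).
  assert (Hju2 : (IZR j - / 2) * u <= eta) by lra.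
  unfold Aw in B1. unfold Bw in B2. destruct (Rle_dec ((IZR j + / 2) * u) eta); [|contradiction].
  destruct (Rle_dec ((IZR j - / 2) * u) eta); [|contradiction].
  assert (Hc1 := Cmod_ge_0 (th u j)).
  assert (pcf eta j u * Cmod (th u j) <= epsl j * (N * mw j)) by (apply Rmult_le_compat; lra). lra.
- assert (K j * PI * (4 * epsl j * (N * mw j)) <= 5.2e-8 * (N * mw j)).
  { replace (K j * PI * (4 * epsl j * (N * mw j))) with (4 * (K j * PI * epsl j) * (N * mw j)) by ring. apply Rmult_le_compat_r; lra. }
  assert (3 * c * (1e-7 * (N * mw j)) <= 3e-10 * (N * mw j)).
  { replace (3 * c * (1e-7 * (N * mw j))) with (3e-7 * c * (N * mw j)) by field. apply Rmult_le_compat_r; lra. }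
  lra.
Qed.

(** [K j] PI is twice the amplification of the resonance of j, which for j > k is at most that of k
    + 1: the resonances that precede that of k multiply by a bounded factor only. *)
Lemma K_large j : (k < j)%Z -> K j * PI <= 2000.
Proof.
intros Hj. eapply Rle_trans; [|exact Hkap]. assert (Hk1 := IZR_k_ge1).
assert (H1 : IZR (k + 1) <= IZR j) by (apply IZR_le; lia). rewrite plus_IZR in *.
unfold K. rewrite Rabs_pos_eq by lra. assert (HPI := PI_RGT_0).
assert (Hce : 0 < c * eta) by (apply Rmult_lt_0_compat; lra).
assert (H2 : (IZR k + 1) ^ 3 <= IZR j ^ 3) by (apply pow_incr; lra).
assert (H3 : 0 < (IZR k + 1) ^ 3) by (apply pow_lt; lra).
replace (c * eta / IZR j ^ 3 * PI) with (c * eta * PI * / IZR j ^ 3) by (field; lra).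
apply Rmult_le_compat_l; [apply Rmult_le_pos; lra|]. apply Rinv_le_contravar; lra.
Qed.

(** The interval is cut at the ends of the window of j. The resonant piece dominates with 2000 * 5,
    where 5 = 2 + 3 comes from theta_j and [good]; the two nonresonant pieces fit into 300. *)
Lemma flux_full j t : (k < j)%Z -> 0 <= t <= a -> RInt (flux j) 0 t <= 10300 * (N * mw j).
Proof.
intros Hj Ht. assert (Hk1 := IZR_k_ge1). assert (Hjk : IZR k + 1 <= IZR j) by (rewrite <- plus_IZR; apply IZR_le; lia).
assert (Hj0 : j <> 0%Z) by lia. assert (He := epsl_bounds j). assert (Hm := Nmw_nonneg j). assert (HKe := K_epsl j Hj0).
assert (HKl := K_large j Hj).
set (s1 := Rmin t (eta / (IZR j + / 2))). set (s2 := Rmin t (eta / (IZR j - / 2))).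
assert (E1 : (IZR j + / 2) * (eta / (IZR j + / 2)) = eta) by (field; lra).
assert (E2 : (IZR j - / 2) * (eta / (IZR j - / 2)) = eta) by (field; lra).
assert (P1 : 0 < eta / (IZR j + / 2)) by (apply Rdiv_lt_0_compat; lra).
assert (P2 : eta / (IZR j + / 2) <= eta / (IZR j - / 2)).
{ apply Rmult_le_compat_l; [lra|]. apply Rinv_le_contravar; lra. }
assert (Hs1 : 0 <= s1 <= t) by (unfold s1; split; [apply Rmin_glb; lra|apply Rmin_l]).
assert (Hs12 : s1 <= s2) by (unfold s1, s2; apply Rmin_glb; [apply Rmin_l|eapply Rle_trans; [apply Rmin_r|exact P2]]).
assert (Hs2 : s2 <= t) by apply Rmin_l.
assert (Hs1e : (IZR j + / 2) * s1 <= eta) by (eapply Rle_trans; [apply Rmult_le_compat_l; [lra|apply Rmin_r]|right; exact E1]).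
assert (Hs2e : (IZR j - / 2) * s2 <= eta) by (eapply Rle_trans; [apply Rmult_le_compat_l; [lra|apply Rmin_r]|right; exact E2]).
assert (Hfc : forall u, continuous (flux j) u) by (intros; apply (flux_cont nu c f eta th G Hsol)).
rewrite <- (RInt_split (flux j) 0 s1 t Hfc), <- (RInt_split (flux j) s1 s2 t Hfc).
assert (F1 := flux_early j s1 Hj0 ltac:(lra) Hs1e).
assert (F2 : RInt (flux j) s1 s2 <= 10000 * (N * mw j)).
{ eapply Rle_trans; [apply (flux_piece j s1 s2 (5 * (N * mw j)) 0 Hj0)|].
  - lra.
  - lra.
  - lra.
  - left; reflexivity.
  - intros u Hu. assert (Hju2 := tier_mono _ u s2 ltac:(lra) Hs2e). destruct (Hb u j ltac:(lra)) as [B1 B2].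
    assert (Hp := pcf_bounds eta j u). unfold Aw in B1. unfold Bw in B2.
    destruct (Rle_dec ((IZR j - / 2) * u) eta); [|contradiction].
    assert (Hc1 := Cmod_ge_0 (th u j)).
    assert (pcf eta j u * Cmod (th u j) <= 1 * (N * mw j)) by (apply Rmult_le_compat; lra).
    assert (Cmod (H u j) <= 3 * (N * mw j)); [|lra].
    eapply Rle_trans; [exact B2|]. destruct (Rle_dec ((IZR j + / 2) * u) eta); [|lra].
    replace (N * ((2 * epsl j + 1e-7) * mw j)) with ((2 * epsl j + 1e-7) * (N * mw j)) by ring.
    apply Rmult_le_compat_r; lra.
  - assert (K j * PI * (5 * (N * mw j)) <= 2000 * (5 * (N * mw j))) by (apply Rmult_le_compat_r; lra). lra. }
assert (F3 : RInt (flux j) s2 t <= 290 * (N * mw j)).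
{ destruct (Rle_dec t (eta / (IZR j - / 2))) as [Hle|Hlt].
  - assert (E : s2 = t) by (apply Rmin_left; exact Hle). rewrite E, RInt_point. change (@zero R_CompleteNormedModule) with 0. lra.
  - assert (E : s2 = eta / (IZR j - / 2)) by (apply Rmin_right; lra).
    eapply Rle_trans; [apply (flux_piece j s2 t (1e10 * epsl j * (N * mw j)) (50000 * (N * mw j)) Hj0)|].
    + lra.
    + apply Rmult_le_pos; lra.
    + lra.
    + right; right; split; [lia|]. rewrite E, E2. lra.
    + intros u Hu. assert (Hju : eta < (IZR j - / 2) * u) by (eapply Rle_lt_trans; [right; symmetry; exact E2|apply Rmult_lt_compat_l; lra]).
      destruct (Hb u j ltac:(lra)) as [B1 B2].
      assert (Haw : away j u) by (right; split; [lia|lra]).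
      assert (Hpe := pcf_away j u Hj0 ltac:(lra) Haw).
      assert (Hp := pcf_bounds eta j u). unfold Aw in B1. unfold Bw in B2.
      destruct (Rle_dec ((IZR j + / 2) * u) eta); [exfalso; lra|].
      destruct (Rle_dec ((IZR j - / 2) * u) eta); [exfalso; lra|].
      assert (Hc1 := Cmod_ge_0 (th u j)).
      assert (pcf eta j u * Cmod (th u j) <= epsl j * (N * (2.5e9 * mw j))) by (apply Rmult_le_compat; lra).
      replace (epsl j * (N * (2.5e9 * mw j))) with (2.5e9 * (epsl j * (N * mw j))) in * by ring.
      replace (N * ((50000 + 5e9 * epsl j) * mw j)) with (50000 * (N * mw j) + 5e9 * (epsl j * (N * mw j))) in B2 by ring. lra.
    + assert (K j * PI * (1e10 * epsl j * (N * mw j)) <= 130 * (N * mw j)).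
      { replace (K j * PI * (1e10 * epsl j * (N * mw j))) with (1e10 * (K j * PI * epsl j) * (N * mw j)) by ring. apply Rmult_le_compat_r; lra. }
      assert (3 * c * (50000 * (N * mw j)) <= 150 * (N * mw j)).
      { replace (3 * c * (50000 * (N * mw j))) with (150000 * c * (N * mw j)) by ring. apply Rmult_le_compat_r; lra. }
      lra. }
lra.
Qed.

Lemma wflux_early l j t : (Z.abs (l - j) = 1)%Z -> 0 <= t <= a -> (IZR j - / 2) * t <= eta ->
  RInt (wflux l j) 0 t <= 2e-13 * (N * mw j).
Proof.
intros Hlj Ht Hjt. assert (He := epsl_bounds j). assert (Hm := Nmw_nonneg j).
destruct (Z.eq_dec j 0) as [Hj|Hj].
{ eapply Rle_trans; [apply (RInt_le_deriv _ (fun _ => 0) (fun _ => 0))|]; [lra| | | |lra].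
  - intros; apply (wflux_cont nu c f eta th G Hsol).
  - intros; apply derive_const.
  - intros; unfold wflux, weighted_flux; rewrite Hj, flux_0; lra. }
eapply Rle_trans; [apply (wflux_total l j t (5 * (N * mw j)) Hj ltac:(lia))|]; try lra.
intros u Hu. assert (Hju2 := tier_mono _ u t ltac:(lra) Hjt). destruct (Hb u j ltac:(lra)) as [B1 B2].
assert (Hp := pcf_bounds eta j u). unfold Aw in B1. unfold Bw in B2.
destruct (Rle_dec ((IZR j - / 2) * u) eta); [|contradiction].
assert (Hc1 := Cmod_ge_0 (th u j)).
assert (pcf eta j u * Cmod (th u j) <= 1 * (N * mw j)) by (apply Rmult_le_compat; lra).
assert (Cmod (H u j) <= 3 * (N * mw j)); [|lra].
eapply Rle_trans; [exact B2|]. destruct (Rle_dec ((IZR j + / 2) * u) eta); [|lra].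
replace (N * ((2 * epsl j + 1e-7) * mw j)) with ((2 * epsl j + 1e-7) * (N * mw j)) by ring.
apply Rmult_le_compat_r; lra.
Qed.

Lemma wflux_any l j t : (Z.abs (l - j) = 1)%Z -> 0 <= t <= a ->
  RInt (wflux l j) 0 t <= 3.6e-4 * (N * mw j).
Proof.
intros Hlj Ht. assert (He := epsl_bounds j). assert (Hm := Nmw_nonneg j).
destruct (Z.eq_dec j 0) as [Hj|Hj].
{ eapply Rle_trans; [apply (RInt_le_deriv _ (fun _ => 0) (fun _ => 0))|]; [lra| | | |lra].
  - intros; apply (wflux_cont nu c f eta th G Hsol).
  - intros; apply derive_const.
  - intros; unfold wflux, weighted_flux; rewrite Hj, flux_0; lra. }
eapply Rle_trans; [apply (wflux_total l j t (1.1e10 * (N * mw j)) Hj ltac:(lia))|]; try lra.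
intros u Hu. destruct (Hb u j ltac:(lra)) as [B1 B2].
assert (Hp := pcf_bounds eta j u).
assert (HA : Aw j u <= 2.5e9) by (unfold Aw; destruct (Rle_dec ((IZR j - / 2) * u) eta); lra).
assert (HB : Bw j u <= 5.1e9).
{ unfold Bw; destruct (Rle_dec ((IZR j + / 2) * u) eta); [lra|]. destruct (Rle_dec ((IZR j - / 2) * u) eta); lra. }
assert (Hc1 := Cmod_ge_0 (th u j)).
assert (X1 : N * (Aw j u * mw j) <= 2.5e9 * (N * mw j)).
{ replace (N * (Aw j u * mw j)) with (Aw j u * (N * mw j)) by ring. apply Rmult_le_compat_r; lra. }
assert (X2 : N * (Bw j u * mw j) <= 5.1e9 * (N * mw j)).
{ replace (N * (Bw j u * mw j)) with (Bw j u * (N * mw j)) by ring. apply Rmult_le_compat_r; lra. }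
assert (pcf eta j u * Cmod (th u j) <= 1 * (2.5e9 * (N * mw j))) by (apply Rmult_le_compat; lra).
lra.
Qed.

Lemma flux_early0 j t : 0 <= t <= a -> (IZR j + / 2) * t <= eta -> RInt (flux j) 0 t <= 6e-8 * (N * mw j).
Proof.
intros Ht Hj. destruct (Z.eq_dec j 0) as [E|E]; [|apply flux_early; assumption].
assert (Hm := Nmw_nonneg j).
eapply Rle_trans; [apply (RInt_le_deriv _ (fun _ => 0) (fun _ => 0))|]; [lra| | | |lra].
- intros; apply (flux_cont nu c f eta th G Hsol).
- intros; apply derive_const.
- intros; unfold flux; rewrite E, flux_0; lra.
Qed.

(** This fixes the ratio 50000. Until l - 1 resonates, l receives resonant flux at most from l + 1,
    and only if l >= k; there the weight is 50000 times smaller, and 10300 / 50000 < 0.21. Once l -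
    1 has resonated, both neighbours count in full. *)
Lemma theta_flux l t : 0 <= t <= a ->
  RInt (flux (l + 1)) 0 t + RInt (flux (l - 1)) 0 t <= (if Rle_dec ((IZR l - / 2) * t) eta then 0.21 else 1.1e9) * (N * mw l).
Proof.
intros Ht. assert (Hm := Nmw_nonneg l).
assert (M1 := mw_neighbor l (l + 1) ltac:(lia)). assert (M2 := mw_neighbor l (l - 1) ltac:(lia)).
assert (M1' : N * mw (l + 1) <= 50000 * (N * mw l)).
{ replace (50000 * (N * mw l)) with (N * (50000 * mw l)) by ring. apply Rmult_le_compat_l; assumption. }
assert (M2' : N * mw (l - 1) <= 50000 * (N * mw l)).
{ replace (50000 * (N * mw l)) with (N * (50000 * mw l)) by ring. apply Rmult_le_compat_l; assumption. }
destruct (Rle_dec ((IZR l - / 2) * t) eta) as [Hl|Hl].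
- assert (F1 : RInt (flux (l - 1)) 0 t <= 6e-8 * (N * mw (l - 1))).
  { apply flux_early0; [exact Ht|]. rewrite minus_IZR. lra. }
  destruct (Z_lt_le_dec l k) as [Hlk|Hlk].
  + assert (F2 : RInt (flux (l + 1)) 0 t <= 6e-8 * (N * mw (l + 1))).
    { apply flux_early0; [exact Ht|]. assert (H1 := initial_time t Ht).
      assert (IZR (l + 1) <= IZR k) by (apply IZR_le; lia). nra. }
    lra.
  + assert (F2 := flux_full (l + 1) t ltac:(lia) Ht). rewrite mw_up in F2 by exact Hlk.
    replace (N * (mw l / 50000)) with (/ 50000 * (N * mw l)) in F2 by field. lra.
- assert (Hlk := late_gt2 l t Ht Hl).
  assert (F1 := flux_full (l + 1) t ltac:(lia) Ht). assert (F2 := flux_full (l - 1) t ltac:(lia) Ht). lra.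
Qed.

Lemma initial_theta l t : 0 <= t <= a -> l <> 0%Z ->
  Cmod (Cminus (th t l) (delta_seq k l)) <= (if Rle_dec ((IZR l - / 2) * t) eta then 0.21 else 1.1e9) * (N * mw l).
Proof.
intros Ht Hl. eapply Rle_trans; [|apply theta_flux, Ht].
rewrite <- Hth0. apply (theta_variation nu c f eta th G Hsol l 0 t Hl). lra.
Qed.

Lemma delta_le l : Cmod (delta_seq k l) <= mw l.
Proof.
unfold delta_seq. destruct (Z.eq_dec l k) as [->|]; [|rewrite Cmod_0; left; apply mw_pos].
rewrite Cmod_1. unfold mw. rewrite wt_self. lra.
Qed.

Lemma good_0 l : l <> 0%Z -> Cmod (H 0 l) <= epsl l * mw l.
Proof.
intros Hl. unfold H, good. rewrite Hth0, HG0.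
replace (Cminus (RtoC 0) (Cmult (RtoC (pcf eta l 0)) (delta_seq k l))) with (Copp (Cmult (RtoC (pcf eta l 0)) (delta_seq k l)))
  by (unfold Cminus; ring).
rewrite Cmod_opp, Cmod_mult, Cmod_R. assert (Hp := pcf_bounds eta l 0). rewrite Rabs_pos_eq by lra.
apply Rmult_le_compat; [lra|apply Cmod_ge_0| |apply delta_le].
apply pcf_away; [exact Hl|lra|]. left. lra.
Qed.

Lemma initial_step l t : 0 <= t <= a ->
  Cmod (th t l) <= (1 + N / 2) * (Aw l t * mw l) /\ Cmod (H t l) <= (1 + N / 2) * (Bw l t * mw l).
Proof.
intros Ht. assert (Hm := Nmw_nonneg l). assert (Hm1 := mw_pos l). assert (He := epsl_bounds l).
assert (HeN : 0 <= epsl l * (N * mw l)) by (apply Rmult_le_pos; lra).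
assert (Hem : 0 <= epsl l * mw l) by (apply Rmult_le_pos; lra).
destruct (Z.eq_dec l 0) as [El|El].
{ subst l. destruct (ode_zero _ _ _ _ _ _ Hsol t ltac:(lra)) as [Z1 Z2].
  assert (EH : H t 0 = RtoC 0) by (unfold H, good; rewrite Z1, Z2; unfold Cminus; ring).
  rewrite EH, Z1, Cmod_0. 
  assert (0 <= Aw 0 t) by (unfold Aw; destruct (Rle_dec ((0 - / 2) * t) eta); lra).
  assert (0 <= Bw 0 t).
  { unfold Bw; destruct (Rle_dec ((0 + / 2) * t) eta); [lra|]. destruct (Rle_dec ((0 - / 2) * t) eta); lra. }
  split; (apply Rmult_le_pos; [lra|apply Rmult_le_pos; lra]). }
split.
- assert (H1 := initial_theta l t Ht El). assert (H2 := delta_le l).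
  assert (H3 := Cmod_triangle (Cminus (th t l) (delta_seq k l)) (delta_seq k l)).
  replace (Cplus (Cminus (th t l) (delta_seq k l)) (delta_seq k l)) with (th t l) in H3 by (unfold Cminus; ring).
  unfold Aw. destruct (Rle_dec ((IZR l - / 2) * t) eta); lra.
- assert (M1 := mw_neighbor l (l + 1) ltac:(lia)). assert (M2 := mw_neighbor l (l - 1) ltac:(lia)).
  assert (M1' : N * mw (l + 1) <= 50000 * (N * mw l)).
  { replace (50000 * (N * mw l)) with (N * (50000 * mw l)) by ring. apply Rmult_le_compat_l; assumption. }
  assert (M2' : N * mw (l - 1) <= 50000 * (N * mw l)).
  { replace (50000 * (N * mw l)) with (N * (50000 * mw l)) by ring. apply Rmult_le_compat_l; assumption. }
  assert (H0 := good_0 l El).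
  assert (Hgb := fun P => good_bound nu c f eta th G Hnu ltac:(lra) Hf3 Hsol l 0 t P El ltac:(lra)).
  fold H in Hgb. fold wflux in Hgb.
  assert (Hmax : forall x y, 0 <= x -> 0 <= y -> Rmax x y <= x + y) by (intros; apply Rmax_lub; lra).
  unfold Bw. destruct (Rle_dec ((IZR l + / 2) * t) eta) as [T0|T0]; [|destruct (Rle_dec ((IZR l - / 2) * t) eta) as [T1|T1]].
  + assert (F1 := wflux_early l (l + 1) t ltac:(lia) Ht ltac:(rewrite plus_IZR; lra)).
    assert (F2 := wflux_early l (l - 1) t ltac:(lia) Ht ltac:(rewrite minus_IZR; lra)).
    specialize (Hgb (epsl l * (N * mw l))).
    assert (Hmx := Hmax (Cmod (H 0 l)) (epsl l * (N * mw l)) (Cmod_ge_0 _) HeN).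
    replace ((1 + N / 2) * ((2 * epsl l + 1e-7) * mw l)) with (2 * (epsl l * mw l) + 1e-7 * mw l + epsl l * (N * mw l) + 5e-8 * (N * mw l)) by lra.
    eapply Rle_trans; [apply Hgb; clear Hgb|lra].
    intros u Hu. assert (Hju := tier_mono _ u t ltac:(lra) T0). destruct (Hb u l ltac:(lra)) as [B1 _].
    assert (Hpe := pcf_away l u El ltac:(lra) (or_introl Hju)). assert (Hp := pcf_bounds eta l u).
    unfold Aw in B1. destruct (Rle_dec ((IZR l - / 2) * u) eta); [|exfalso; lra].
    assert (Hc1 := Cmod_ge_0 (th u l)). apply Rmult_le_compat; lra.
  + assert (Hlk := late_gt l t Ht T0).
    assert (F1 := wflux_any l (l + 1) t ltac:(lia) Ht). rewrite mw_up in F1 by lia.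
    assert (F2 := wflux_early l (l - 1) t ltac:(lia) Ht ltac:(rewrite minus_IZR; lra)).
    specialize (Hgb (N * mw l)).
    assert (Hmx := Hmax (Cmod (H 0 l)) (N * mw l) (Cmod_ge_0 _) Hm).
    replace (N * (mw l / 50000)) with (/ 50000 * (N * mw l)) in F1 by field.
    assert (epsl l * mw l <= 1 * mw l) by (apply Rmult_le_compat_r; lra).
    eapply Rle_trans; [apply Hgb; clear Hgb|lra].
    intros u Hu. assert (Hju := tier_mono _ u t ltac:(lra) T1). destruct (Hb u l ltac:(lra)) as [B1 _].
    assert (Hp := pcf_bounds eta l u).
    unfold Aw in B1. destruct (Rle_dec ((IZR l - / 2) * u) eta); [|exfalso; lra].
    assert (Hc1 := Cmod_ge_0 (th u l)). replace (N * mw l) with (1 * (N * (1 * mw l))) by ring. apply Rmult_le_compat; lra.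
  + assert (Hlk := late_gt2 l t Ht T1).
    assert (F1 := wflux_any l (l + 1) t ltac:(lia) Ht). assert (F2 := wflux_any l (l - 1) t ltac:(lia) Ht).
    specialize (Hgb (N * mw l + 2.5e9 * (epsl l * (N * mw l)))).
    assert (Hmx := Hmax (Cmod (H 0 l)) (N * mw l + 2.5e9 * (epsl l * (N * mw l))) (Cmod_ge_0 _) ltac:(lra)).
    assert (epsl l * mw l <= 1 * mw l) by (apply Rmult_le_compat_r; lra).
    replace ((1 + N / 2) * ((50000 + 5e9 * epsl l) * mw l)) with
      (50000 * mw l + 5e9 * (epsl l * mw l) + 25000 * (N * mw l) + 2.5e9 * (epsl l * (N * mw l))) by lra.
    eapply Rle_trans; [apply Hgb; clear Hgb|lra].
    intros u Hu. destruct (Hb u l ltac:(lra)) as [B1 _].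
    assert (Hp := pcf_bounds eta l u). assert (Hc1 := Cmod_ge_0 (th u l)).
    unfold Aw in B1. destruct (Rle_dec ((IZR l - / 2) * u) eta) as [T|T].
    * assert (pcf eta l u * Cmod (th u l) <= 1 * (N * (1 * mw l))) by (apply Rmult_le_compat; lra). lra.
    * assert (Haw : away l u) by (right; split; [lia|lra]).
      assert (Hpe := pcf_away l u El ltac:(lra) Haw).
      assert (pcf eta l u * Cmod (th u l) <= epsl l * (N * (2.5e9 * mw l))) by (apply Rmult_le_compat; lra). lra.
Qed.

End Iterate.

Lemma initial_bounds t l : 0 <= t <= a ->
  Cmod (th t l) <= 2 * (Aw l t * mw l) /\ Cmod (H t l) <= 2 * (Bw l t * mw l).
Proof.
pose (X := fun i : R * (Z * bool) => if snd (snd i) then Cmod (th (fst i) (fst (snd i))) else Cmod (H (fst i) (fst (snd i)))).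
pose (P := fun i : R * (Z * bool) => (if snd (snd i) then Aw (fst (snd i)) (fst i) else Bw (fst (snd i)) (fst i)) * mw (fst (snd i))).
assert (HPp : forall i, 1e-7 * mw (fst (snd i)) <= P i).
{ intros [u [j b]]. unfold P; simpl. assert (Hm1 := mw_pos j). assert (He := epsl_bounds j). apply Rmult_le_compat_r; [lra|].
  unfold Aw, Bw. destruct b, (Rle_dec ((IZR j + / 2) * u) eta), (Rle_dec ((IZR j - / 2) * u) eta); lra. }
assert (Hall : forall i, 0 <= fst i <= a -> X i <= 2 * P i).
{ apply bootstrap.
  - intros i _. assert (Hm1 := mw_pos (fst (snd i))). assert (Hp := HPp i). lra.
  - destruct Hprior as [M HM]. exists (Rabs M * 1e7). intros [u [j b]] Hu; simpl in Hu.
    destruct (HM u j Hu) as [M1 M2]. assert (Hp := HPp (u, (j, b))). simpl in Hp. fold (mw j) in M1, M2.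
    assert (Hm1 := mw_pos j). assert (HMa := Rle_abs M). assert (HM0 := Rabs_pos M).
    assert (E1 : M * mw j <= Rabs M * mw j) by (apply Rmult_le_compat_r; lra).
    assert (E2 : Rabs M * 1e7 * (1e-7 * mw j) <= Rabs M * 1e7 * P (u, (j, b))) by (apply Rmult_le_compat_l; lra).
    unfold X; simpl. destruct b; lra.
  - intros N HN Hb [u [j b]] Hu; simpl in Hu.
    assert (Hst := initial_step N HN (fun t l Ht => conj (Hb (t, (l, true)) Ht) (Hb (t, (l, false)) Ht)) j u Hu).
    unfold X, P; simpl. destruct b; apply Hst. }
intros Ht. split; [apply (Hall (t, (l, true)) Ht)|apply (Hall (t, (l, false)) Ht)].
Qed.

(** Each step away from k gains 8e-5 = 4 / 50000 when the ratio 50000 is relaxed to 4; the gains pay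
    for the large constants of [Aw] and [Bw], which occur only away from k. *)
Lemma mw_wt4 i l : (i <= Z.abs_nat (l - k))%nat -> mw l <= 8e-5 ^ i * wt 4 k l.
Proof.
intros Hi. unfold mw, wt. set (n := Z.abs_nat (l - k)) in *.
replace (/ 50000) with (8e-5 * / 4) by field. rewrite Rpow_mult_distr.
apply Rmult_le_compat_r; [left; apply pow_lt; lra|].
replace n with (i + (n - i))%nat by lia. rewrite pow_add.
rewrite <- (Rmult_1_r (8e-5 ^ i)) at 2. apply Rmult_le_compat_l; [left; apply pow_lt; lra|].
rewrite <- (pow1 (n - i)). apply pow_incr. lra.
Qed.

Lemma initial_theta_bound t l : 0 <= t <= a -> Cmod (th t l) <= 32 * wt 4 k l.
Proof.
intros Ht. destruct (initial_bounds t l Ht) as [H1 _]. assert (Hw := wt_pos 4 k l ltac:(lra)).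
unfold Aw in H1. destruct (Rle_dec ((IZR l - / 2) * t) eta) as [T|T].
- assert (H2 := mw_wt4 0 l ltac:(lia)). simpl in H2. lra.
- assert (Hlk := late_gt2 l t Ht T). assert (H2 := mw_wt4 2 l ltac:(lia)). simpl in H2. lra.
Qed.

Hypothesis Hek : epsl k <= 1e-6.
Hypothesis Hek2 : epsl (k + 2) <= 1e-6.

Lemma initial_phase :
  0.58 <= Cmod (th a k) <= 1.42 /\
  forall l, Cmod (th a l) <= cone_wt k l * Cmod (th a k) /\ Cmod (H a l) <= / 8192 * cone_wt k l * Cmod (th a k).
Proof.
assert (Hk1 := IZR_k_ge1).
assert (Ha0 : 0 < a) by (unfold a, tm; apply Rdiv_lt_0_compat; lra).
assert (Haa : (IZR k + / 2) * a <= eta) by (apply initial_time; lra).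
assert (Ht : 0 <= a <= a) by lra.
assert (H1 := initial_theta 2 ltac:(lra) (fun t l Ht => initial_bounds t l Ht) k a Ht ltac:(lia)).
destruct (Rle_dec ((IZR k - / 2) * a) eta) as [_|Hn]; [|exfalso; lra].
unfold mw in H1. rewrite wt_self in H1. unfold delta_seq in H1. destruct (Z.eq_dec k k) as [_|]; [|contradiction].
(* The deviation from the initial value 1 is at most 2 * 0.21. *)
assert (Hz : 0.58 <= Cmod (th a k) <= 1.42).
{ assert (T1 := Cmod_triangle (Cminus (th a k) (RtoC 1)) (RtoC 1)).
  assert (T2 := Cmod_triangle (th a k) (Copp (Cminus (th a k) (RtoC 1)))). rewrite Cmod_opp in T2.
  replace (Cplus (Cminus (th a k) (RtoC 1)) (RtoC 1)) with (th a k) in T1 by (unfold Cminus; ring).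
  replace (Cplus (th a k) (Copp (Cminus (th a k) (RtoC 1)))) with (RtoC 1) in T2 by (unfold Cminus; ring).
  rewrite Cmod_1 in T1, T2. lra. }
split; [exact Hz|]. intros l. set (ze := Cmod (th a k)) in *. unfold cone_wt.
assert (Hw := wt_pos 4 k l ltac:(lra)). assert (He := epsl_bounds l). assert (Hm1 := mw_pos l).
assert (Hwz : 0.58 * wt 4 k l <= wt 4 k l * ze) by (rewrite Rmult_comm; apply Rmult_le_compat_l; lra).
split.
- assert (H2 := initial_theta_bound a l Ht). lra.
- destruct (initial_bounds a l Ht) as [_ H2]. unfold Bw in H2.
  assert (Hgoal : Cmod (H a l) <= 0.009 * wt 4 k l); [|lra].
  destruct (Rle_dec ((IZR l + / 2) * a) eta) as [T0|T0]; [|destruct (Rle_dec ((IZR l - / 2) * a) eta) as [T1|T1]].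
  + destruct (Z.eq_dec l k) as [->|Hlk].
    * assert (M0 := mw_wt4 0 k ltac:(lia)). simpl in M0. 
      assert ((2 * epsl k + 1e-7) * mw k <= 3e-6 * mw k) by (apply Rmult_le_compat_r; lra). lra.
    * assert (M1 := mw_wt4 1 l ltac:(lia)). simpl in M1.
      assert ((2 * epsl l + 1e-7) * mw l <= 3 * mw l) by (apply Rmult_le_compat_r; lra). lra.
  + assert (Hlk := late_gt l a Ht T0). assert (M1 := mw_wt4 1 l ltac:(lia)). simpl in M1. lra.
  (* At distance 2 the gain leaves 5e9 * 8e-5^2 = 32, which only the smallness of [epsl (k + 2)] can
     absorb; from distance 3 on the gain is enough. *)
  + assert (Hlk := late_gt2 l a Ht T1). destruct (Z.eq_dec l (k + 2)) as [->|Hl2].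
    * assert (M2 := mw_wt4 2 (k + 2) ltac:(lia)). simpl in M2.
      assert ((50000 + 5e9 * epsl (k + 2)) * mw (k + 2) <= 55000 * mw (k + 2)) by (apply Rmult_le_compat_r; lra). lra.
    * assert (M3 := mw_wt4 3 l ltac:(lia)). simpl in M3.
      assert ((50000 + 5e9 * epsl l) * mw l <= 5.00005e9 * mw l) by (apply Rmult_le_compat_r; lra). lra.
Qed.

End Initial.

(** * The chain of resonances *)

Section Chain.
Variables (nu c : R) (f : R -> R) (eta x : R) (kn : nat) (th G : R -> Z -> C).
Let k := Z.of_nat kn.
Hypothesis Hnu : 0 < nu.
Hypothesis Hc : 0 < c < 0.001.
Hypothesis Heta : 1e12 <= eta.
Hypothesis Hf3 : forall t, 0 <= t -> Rabs (f t) <= 2 * c / (1 + t ^ 2).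
Hypothesis Hx : x ^ 3 = c * eta * PI / 2.
Hypothesis Hkx : 10 * INR kn <= x < 10 * (INR kn + 1).
Hypothesis Hk114 : (114 <= kn)%nat.
Hypothesis Hsol : ode_sol nu c f eta th G.
Hypothesis Hth0 : th 0 = delta_seq k.
Hypothesis HG0 : G 0 = (fun _ => RtoC 0).
Hypothesis Hprior : forall T, exists M, 0 <= M /\ forall t l, 0 <= t <= T ->
  Cmod (th t l) <= M * wt 50000 k l /\ Cmod (G t l) <= M * wt 50000 k l.
Let H := good eta th G.

Lemma x_pos : 1140 <= x.
Proof. assert (H1 : INR 114 <= INR kn) by (apply le_INR; exact Hk114). simpl in H1. lra. Qed.

Lemma kap_x m : IZR m <> 0 -> kap c eta m = (x / IZR m) ^ 3.
Proof. intros Hm. unfold kap. replace ((x / IZR m) ^ 3) with (x ^ 3 / IZR m ^ 3) by (field; exact Hm). rewrite Hx. field. exact Hm. Qed.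

(** 1000 m <= 1000 m^3 <= x^3 <= 0.002 eta, the last step by c < 0.001 and PI <= 4. *)
Lemma mode_small m : 1 <= m -> 10 * m <= x -> m <= 2e-6 * eta.
Proof.
intros Hm Hmx. assert (HPI := PI_4).
assert (H1 : (10 * m) ^ 3 <= x ^ 3) by (apply pow_incr; lra). rewrite Hx in H1.
assert (H2 : c * eta * PI / 2 <= 0.002 * eta).
{ assert (c * eta <= 0.001 * eta) by (apply Rmult_le_compat_r; lra). assert (0 < PI) by apply PI_RGT_0.
  assert (c * eta * PI <= 0.001 * eta * 4) by (apply Rmult_le_compat; try lra; apply Rmult_le_pos; lra). lra. }
assert (m <= m ^ 3) by nra. nra.
Qed.

(** 10 m <= x gives kap_m = (x/m)^3 >= 1000. The smallness conditions follow from 1/[tm] <= 3m / (2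
    eta), [mode_small], and kap_m (m/eta)^2 = c PI / (2 m eta). *)
Lemma step_params m : (1 <= m <= k)%Z ->
  1000 <= kap c eta m /\ epsm eta m * (1 + kap c eta m) <= 1e-6 /\ 2 / tm eta m ^ 2 <= 1e-6 /\
  2 * IZR m / tm eta m ^ 2 * (2 * kap c eta m) <= 1e-6.
Proof.
intros [Hm1 Hmk].
assert (M1 : 1 <= IZR m) by (apply IZR_le; exact Hm1).
assert (Mk : IZR m <= INR kn) by (rewrite INR_IZR_INZ; apply IZR_le; exact Hmk).
assert (Hms := mode_small (IZR m) M1 ltac:(lra)).
assert (Hka : 1000 <= kap c eta m).
{ rewrite kap_x by lra. replace 1000 with (10 ^ 3) by ring. apply pow_incr. split; [lra|].
  apply Rmult_le_reg_r with (IZR m); [lra|]. unfold Rdiv. rewrite Rmult_assoc, Rinv_l, Rmult_1_r by lra. lra. }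
assert (HPI := PI_4). assert (HPI0 := PI_RGT_0).
set (M := IZR m) in *.
assert (Hinv : / tm eta m <= 3 / 2 * M / eta).
{ unfold tm. fold M. rewrite Rinv_div. apply Rmult_le_compat_r; [left; apply Rinv_0_lt_compat; lra|lra]. }
assert (Htm : 0 < / tm eta m) by (apply Rinv_0_lt_compat, Rdiv_lt_0_compat; fold M; lra).
assert (Htm0 : 0 < tm eta m) by (apply Rdiv_lt_0_compat; fold M; lra).
assert (Hinv2 : / tm eta m ^ 2 <= 9 / 4 * (M / eta) ^ 2).
{ rewrite <- pow_inv. replace (9 / 4 * (M / eta) ^ 2) with ((3 / 2 * M / eta) ^ 2) by (field; lra). apply pow_incr. lra. }
assert (Hme : 0 < M / eta <= 2e-6).
{ split; [apply Rdiv_lt_0_compat; lra|]. apply Rmult_le_reg_r with eta; [lra|]. unfold Rdiv. rewrite Rmult_assoc, Rinv_l, Rmult_1_r; lra. }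
assert (Hinv20 : 0 < / tm eta m ^ 2) by (apply Rinv_0_lt_compat, pow_lt; exact Htm0).
assert (Hkk : kap c eta m * (M / eta) ^ 2 <= 4e-9 / M).
{ unfold kap. fold M. replace (c * eta * PI / (2 * M ^ 3) * (M / eta) ^ 2) with (c * PI / 2 * / eta * / M) by (field; lra).
  apply Rmult_le_compat_r; [left; apply Rinv_0_lt_compat; lra|].
  assert (/ eta <= / 1e12) by (apply Rinv_le_contravar; lra). assert (0 < / eta) by (apply Rinv_0_lt_compat; lra).
  assert (c * PI <= 0.001 * 4) by (apply Rmult_le_compat; lra). assert (0 < c * PI) by (apply Rmult_lt_0_compat; lra). nra. }
assert (Hkk2 : kap c eta m * (M / eta) ^ 2 * M <= 4e-9).
{ replace 4e-9 with (4e-9 / M * M) by (unfold Rdiv; rewrite Rmult_assoc, Rinv_l by lra; ring). apply Rmult_le_compat_r; lra. }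
split; [exact Hka|split; [|split]].
- unfold epsm. fold M.
  assert (E1 : 4 * (M + 1) ^ 2 / tm eta m ^ 2 * (1 + kap c eta m) <= (16 * M ^ 2) * (9 / 4 * (M / eta) ^ 2) * (1001 / 1000 * kap c eta m)).
  { apply Rmult_le_compat.
    - apply Rmult_le_pos; [apply Rmult_le_pos; [lra|apply pow2_ge_0]|left; exact Hinv20].
    - lra.
    - assert (Hpm : 0 <= 4 * (M + 1) ^ 2) by (apply Rmult_le_pos; [lra|apply pow2_ge_0]).
      assert (Hpm2 : 4 * (M + 1) ^ 2 <= 16 * M ^ 2) by nra.
      apply Rmult_le_compat; [exact Hpm|left; exact Hinv20|exact Hpm2|exact Hinv2].
    - lra. }
  eapply Rle_trans; [exact E1|].
  assert (E2 : kap c eta m * M ^ 2 * (M / eta) ^ 2 = c * PI / 2 * (M / eta)).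
  { unfold kap; fold M. field. lra. }
  replace (16 * M ^ 2 * (9 / 4 * (M / eta) ^ 2) * (1001 / 1000 * kap c eta m)) with (36036 / 1000 * (kap c eta m * M ^ 2 * (M / eta) ^ 2)) by (field; lra).
  rewrite E2. assert (c * PI <= 0.001 * 4) by (apply Rmult_le_compat; lra). assert (0 < c * PI) by (apply Rmult_lt_0_compat; lra). nra.
- unfold Rdiv. nra.
- unfold Rdiv at 1. replace (2 * M * / tm eta m ^ 2 * (2 * kap c eta m)) with (4 * M * kap c eta m * / tm eta m ^ 2) by ring.
  apply Rle_trans with (4 * M * kap c eta m * (9 / 4 * (M / eta) ^ 2)); [|lra].
  apply Rmult_le_compat_l; [|exact Hinv2]. apply Rmult_le_pos; lra.
Qed.

Lemma prior_good T : exists M, 0 <= M /\ forall t l, 0 <= t <= T ->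
  Cmod (th t l) <= M * wt 50000 k l /\ Cmod (H t l) <= M * wt 50000 k l.
Proof.
destruct (Hprior T) as [M [HM Hb]]. exists (2 * M). split; [lra|]. intros t l Ht. destruct (Hb t l Ht) as [B1 B2].
assert (Hw := wt_pos 50000 k l ltac:(lra)). assert (HMw : 0 <= M * wt 50000 k l) by (apply Rmult_le_pos; lra).
split; [lra|]. unfold H, good, Cminus.
eapply Rle_trans; [apply Cmod_triangle|]. rewrite Cmod_opp, Cmod_mult, Cmod_R.
assert (Hp := pcf_bounds eta l t). rewrite Rabs_pos_eq by lra. assert (Hcm := Cmod_ge_0 (th t l)). nra.
Qed.

(** Recentres the a priori bound at m. The constant, exponential in |m - k|, is harmless:
    [bootstrap] asks only for finiteness. *)
Lemma wt_change m l : wt 50000 k l <= 4 ^ Z.abs_nat (m - k) * wt 4 m l.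
Proof.
unfold wt. apply Rle_trans with ((/ 4) ^ Z.abs_nat (l - k)).
{ apply pow_incr. lra. }
apply Rmult_le_reg_l with (4 ^ Z.abs_nat (l - k)); [apply pow_lt; lra|].
rewrite <- Rpow_mult_distr, Rinv_r, pow1 by lra.
replace (4 ^ Z.abs_nat (l - k) * (4 ^ Z.abs_nat (m - k) * (/ 4) ^ Z.abs_nat (l - m))) with
  ((4 ^ (Z.abs_nat (l - k) + Z.abs_nat (m - k))) * (/ 4) ^ Z.abs_nat (l - m)) by (rewrite pow_add; ring).
replace (Z.abs_nat (l - k) + Z.abs_nat (m - k))%nat with (Z.abs_nat (l - m) + (Z.abs_nat (l - k) + Z.abs_nat (m - k) - Z.abs_nat (l - m)))%nat by lia.
rewrite pow_add, (Rmult_comm (4 ^ Z.abs_nat (l - m))), Rmult_assoc, <- Rpow_mult_distr, Rinv_r, pow1 by lra.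
rewrite Rmult_1_r. apply pow_R1_Rle. lra.
Qed.

Lemma prior_step m T : 0 < tm eta m -> exists M, forall t l, tm eta m <= t <= T ->
  Cmod (th t l) <= M * wt 4 m l /\ Cmod (H t l) <= M * wt 4 m l.
Proof.
intros Htm. destruct (prior_good T) as [M [HM Hb]]. exists (M * 4 ^ Z.abs_nat (m - k)). intros t l Ht.
destruct (Hb t l ltac:(lra)) as [B1 B2]. assert (Hw := wt_change m l).
assert (M * wt 50000 k l <= M * (4 ^ Z.abs_nat (m - k) * wt 4 m l)) by (apply Rmult_le_compat_l; lra). lra.
Qed.

(** The product of x/j over 1 <= j <= m, so that ([amp_prod] kn / [amp_prod] m)^3 is the product of
    kap_j over m < j <= kn. *)
Definition amp_prod (m : nat) : R := x ^ m / INR (fact m).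

Lemma amp_prod_pos m : 0 < amp_prod m.
Proof. assert (Hxp := x_pos). apply Rdiv_lt_0_compat; [apply pow_lt; lra|apply INR_fact_lt_0]. Qed.

Lemma amp_prod_S m : amp_prod (S m) = amp_prod m * (x / INR (S m)).
Proof.
unfold amp_prod. rewrite fact_simpl, mult_INR. simpl pow. field. split; [apply not_0_INR; lia|apply INR_fact_neq_0].
Qed.

Definition cone_at (m : Z) : Prop := forall l,
  Cmod (th (tm eta m) l) <= cone_wt m l * Cmod (th (tm eta m) m) /\
  Cmod (H (tm eta m) l) <= / 8192 * cone_wt m l * Cmod (th (tm eta m) m).

Definition lam_ok (lam : Z -> R) : Prop :=
  (forall l, 0 < lam l) /\ forall l j, lam l <= lam j * 2 ^ Z.abs_nat (l - j).

(** State on entering the window of m: the initial spread 0.58 to 1.42, a factor between 0.9 kap and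
    6.2 kap per resonance, the cone, and a bound in X for all earlier times. The centre p of that
    bound depends on time, because the dominant mode does. *)
Definition chain_state (m : nat) : Prop :=
  let z := Z.of_nat m in let ze := Cmod (th (tm eta z) z) in
  0.58 * 0.9 ^ (kn - m) * (amp_prod kn / amp_prod m) ^ 3 <= ze /\
  ze <= 1.42 * 6.2 ^ (kn - m) * (amp_prod kn / amp_prod m) ^ 3 /\
  cone_at z /\
  forall lam, lam_ok lam -> forall t, 0 <= t <= tm eta z -> exists p, forall l,
    lam l * Cmod (th t l) <= 64 * (lam z * ze) * wt 2 p l.

(** Of the ratio 4, one factor 2 per mode pays for the variation of [lam], the other remains for
    summation. *)
Lemma wt_lam lam m l : lam_ok lam -> lam l * wt 4 m l <= lam m * wt 2 m l.
Proof.
intros [Hl1 Hl2]. unfold wt. replace (/ 4) with (/ 2 * / 2) by field. rewrite Rpow_mult_distr.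
rewrite <- Rmult_assoc. apply Rmult_le_compat_r; [left; apply pow_lt; lra|].
apply Rmult_le_reg_r with (2 ^ Z.abs_nat (l - m)); [apply pow_lt; lra|].
rewrite Rmult_assoc, <- Rpow_mult_distr, Rinv_l, pow1, Rmult_1_r by lra. apply Hl2.
Qed.

Lemma k_ge1 : (1 <= k)%Z.
Proof. unfold k. lia. Qed.

Lemma tm_mono_pos m : (1 <= m)%Z -> 0 < tm eta m.
Proof. intros Hm. assert (1 <= IZR m) by (apply IZR_le; exact Hm). apply Rdiv_lt_0_compat; lra. Qed.

Lemma initial_params : c * eta * PI / IZR (k + 1) ^ 3 <= 2000 /\ epsl eta k <= 1e-6 /\ epsl eta (k + 2) <= 1e-6.
Proof.
assert (Hk1 := k_ge1). assert (Hx1 := x_pos).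
assert (EK : IZR k = INR kn) by (unfold k; symmetry; apply INR_IZR_INZ).
assert (H114 : INR 114 <= INR kn) by (apply le_INR; exact Hk114). simpl in H114.
split.
- rewrite plus_IZR, EK. replace (c * eta * PI) with (2 * x ^ 3) by (rewrite Hx; field).
  assert (x ^ 3 <= (10 * (INR kn + 1)) ^ 3) by (apply pow_incr; lra).
  assert (0 < (INR kn + 1) ^ 3) by (apply pow_lt; lra).
  apply Rmult_le_reg_r with ((INR kn + 1) ^ 3); [assumption|]. unfold Rdiv. rewrite Rmult_assoc, Rinv_l, Rmult_1_r by lra. nra.
- assert (Hms := mode_small (INR kn) ltac:(lra) ltac:(lra)).
  assert (Hmx : (10 * INR kn) ^ 3 <= x ^ 3) by (apply pow_incr; lra). rewrite Hx in Hmx.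
  assert (HPI := PI_4). assert (HPI0 := PI_RGT_0).
  assert (H2 : c * eta * PI / 2 <= 0.002 * eta).
  { assert (c * eta <= 0.001 * eta) by (apply Rmult_le_compat_r; lra).
    assert (c * eta * PI <= 0.001 * eta * 4) by (apply Rmult_le_compat; try lra; apply Rmult_le_pos; lra). lra. }
  assert (Hgen : forall j, INR kn <= IZR j <= 2 * INR kn -> epsl eta j <= 1e-6).
  { intros j Hj. unfold epsl.
    assert (Hbig : 1000 <= eta / (3 * IZR j ^ 2)).
    { assert (0 < IZR j ^ 2) by (apply pow_lt; lra).
      apply Rmult_le_reg_r with (3 * IZR j ^ 2); [lra|]. unfold Rdiv. rewrite Rmult_assoc, Rinv_l, Rmult_1_r by lra.
      assert (IZR j ^ 2 <= 4 * INR kn ^ 2) by nra. assert (114 * INR kn ^ 2 <= INR kn ^ 3) by nra. nra. }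
    apply Rle_trans with (/ (1000 ^ 2)); [|lra]. apply Rinv_le_contravar; [lra|].
    assert (1000 ^ 2 <= (eta / (3 * IZR j ^ 2)) ^ 2) by (apply pow_incr; lra). lra. }
  split; apply Hgen; rewrite ?plus_IZR, EK; lra.
Qed.

Lemma chain_start : chain_state kn.
Proof.
destruct initial_params as [P1 [P2 P3]]. assert (Hk1 := k_ge1).
assert (Hpr : exists M, forall t l, 0 <= t <= tm eta k -> Cmod (th t l) <= M * wt 50000 k l /\ Cmod (H t l) <= M * wt 50000 k l).
{ destruct (prior_good (tm eta k)) as [M [_ HM]]. exists M. exact HM. }
destruct (initial_phase nu c f eta th G k Hnu Hc Heta Hf3 Hsol Hk1 Hth0 HG0 P1 Hpr P2 P3) as [I1 I2].
unfold chain_state. fold k. rewrite Nat.sub_diag. simpl pow at 1 3.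
assert (Hap := amp_prod_pos kn).
replace (amp_prod kn / amp_prod kn) with 1 by (field; lra). rewrite pow1.
split; [lra|split; [lra|split; [exact I2|]]].
intros lam Hlam t Ht. exists k. intros l.
assert (Hb := initial_theta_bound nu c f eta th G k Hnu Hc Heta Hf3 Hsol Hk1 Hth0 HG0 P1 Hpr t l Ht).
assert (Hw := wt_lam lam k l Hlam). assert (Hl := proj1 Hlam).
assert (Hl1 := Hl l). assert (Hl2 := Hl k). assert (Hw2 := wt_pos 2 k l ltac:(lra)).
apply Rle_trans with (lam l * (32 * wt 4 k l)); [apply Rmult_le_compat_l; lra|].
assert (0 < lam k * wt 2 k l) by (apply Rmult_lt_0_compat; lra). nra.
Qed.

Lemma window_bound m T t l : (1 <= m <= k)%Z -> cone_at m -> 0 < Cmod (th (tm eta m) m) ->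
  (m = 1%Z \/ (IZR m - / 2) * T <= eta) -> tm eta m <= t <= T ->
  Cmod (th t l) <= 25 * (kap c eta m * Cmod (th (tm eta m) m)) * wt 4 m l /\
  Cmod (H t l) <= 2 * Cmod (th (tm eta m) m) * wt 4 m l.
Proof.
intros Hm Hcone Hz HT Ht. destruct (step_params m Hm) as [S1 [S2 [S3 S4]]].
assert (Htm := tm_mono_pos m ltac:(lia)).
destruct (step_upper nu c f eta th G Hnu Hc ltac:(lra) Hf3 Hsol m T ltac:(lia) ltac:(lra) HT S1 S2 S3 S4 Hz Hcone (prior_step m T Htm) t Ht)
  as [U1 [U2 [U3 [U4 U5]]]]. fold H in U2, U5.
set (ze := Cmod (th (tm eta m) m)) in *. assert (Hw := wt_pos 4 m l ltac:(lra)).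
assert (Hkz : 1000 * ze <= kap c eta m * ze) by (apply Rmult_le_compat_r; lra).
assert (Hwz : 0 < wt 4 m l * ze) by (apply Rmult_lt_0_compat; lra).
assert (Hwkz : 1000 * (wt 4 m l * ze) <= kap c eta m * ze * wt 4 m l).
{ replace (1000 * (wt 4 m l * ze)) with (1000 * ze * wt 4 m l) by ring. apply Rmult_le_compat_r; lra. }
split.
- destruct (Z.eq_dec (Z.abs (l - m)) 1) as [E|E].
  + specialize (U3 l E). assert (W := cone_wt_1 m l E). unfold cone_wt in W. nra.
  + specialize (U4 l E). unfold cone_wt in U4. lra.
- destruct (Z.eq_dec l m) as [->|E].
  + rewrite wt_self in *. lra.
  + specialize (U5 l E). unfold cone_wt in U5. lra.
Qed.

Lemma chain_step m : (1 <= m)%nat -> (S m <= kn)%nat -> chain_state (S m) -> chain_state m.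
Proof.
intros Hm1 Hmk [C1 [C2 [C3 C4]]].
set (z := Z.of_nat (S m)) in *. set (ze := Cmod (th (tm eta z) z)) in *.
assert (Hz : (1 <= z <= k)%Z) by (unfold z, k; lia).
assert (Ez : IZR z = INR (S m)) by (unfold z; symmetry; apply INR_IZR_INZ).
assert (Hz2 : 2 <= IZR z) by (apply IZR_le; unfold z; lia).
destruct (step_params z Hz) as [S1 [S2 [S3 S4]]].
assert (A1 := amp_prod_pos kn). assert (A2 := amp_prod_pos m). assert (A3 := amp_prod_pos (S m)). assert (Hxp := x_pos).
assert (Hzep : 0 < ze).
{ eapply Rlt_le_trans; [|exact C1]. apply Rmult_lt_0_compat; [apply Rmult_lt_0_compat; [lra|apply pow_lt; lra]|].
  apply pow_lt, Rdiv_lt_0_compat; assumption. }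
assert (Htm := tm_mono_pos z ltac:(lia)).
set (z' := Z.of_nat m) in *.
assert (Ez' : IZR z' = IZR z - 1) by (unfold z', z; rewrite Nat2Z.inj_succ, succ_IZR; ring).
set (T := tm eta z').
assert (ET : (IZR z - / 2) * T = eta) by (unfold T, tm; rewrite Ez'; field; lra).
assert (Htm' : 0 < T) by (apply tm_mono_pos; unfold z'; lia).
assert (HTle : (IZR z - / 2) * T <= eta) by lra.
assert (HaT : tm eta z <= T).
{ unfold T, tm. rewrite Ez'. apply Rmult_le_compat_l; [lra|]. apply Rinv_le_contravar; lra. }
(* The right half of the window is longer than the left one, so it contains the symmetric core
   required by [step_lower]. *)
assert (Hcore : 2 * (eta / IZR z) - tm eta z <= T <= T).
{ split; [|lra]. unfold T, tm. rewrite Ez'.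
  apply Rmult_le_reg_r with (IZR z * (IZR z + / 2) * (IZR z - / 2)); [repeat apply Rmult_lt_0_compat; lra|].
  replace ((2 * (eta / IZR z) - eta / (IZR z + / 2)) * (IZR z * (IZR z + / 2) * (IZR z - / 2)))
    with (eta * ((IZR z + 1) * (IZR z - / 2))) by (field; lra).
  replace (eta / (IZR z - 1 + / 2) * (IZR z * (IZR z + / 2) * (IZR z - / 2))) with (eta * (IZR z * (IZR z + / 2))) by (field; lra).
  apply Rmult_le_compat_l; lra. }
assert (Hlow := step_lower nu c f eta th G Hnu Hc ltac:(lra) Hf3 Hsol z T ltac:(lia) HaT (or_intror HTle) S1 S2 S3 S4
   Hzep C3 (prior_step z T Htm) T z' ltac:(unfold z', z; lia) ltac:(unfold z'; lia) Hcore).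
destruct (step_upper nu c f eta th G Hnu Hc ltac:(lra) Hf3 Hsol z T ltac:(lia) HaT (or_intror HTle) S1 S2 S3 S4
   Hzep C3 (prior_step z T Htm) T ltac:(lra)) as [U1 [U2 [U3 [U4 U5]]]].
fold ze in U1, U2, U3, U4, U5, Hlow. fold H in U2, U5. set (ka := kap c eta z) in *. set (ze' := Cmod (th T z')) in *.
assert (Hkz : 1000 * ze <= ka * ze) by (apply Rmult_le_compat_r; lra).
assert (Eka : ka = (amp_prod (S m) / amp_prod m) ^ 3).
{ unfold ka. rewrite kap_x by lra. rewrite amp_prod_S, Ez. f_equal. field. split; [|lra]. apply not_0_INR; lia. }
assert (Epow : forall b, b ^ (kn - m) = b * b ^ (kn - S m)).
{ intros b. replace (kn - m)%nat with (S (kn - S m)) by lia. reflexivity. }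
assert (Eprod : (amp_prod kn / amp_prod m) ^ 3 = ka * (amp_prod kn / amp_prod (S m)) ^ 3).
{ rewrite Eka. field. lra. }
assert (Hze'up : ze' <= 6.2 * (ka * ze)) by (assert (U := U3 z' ltac:(unfold z', z; lia)); fold ze' in U; lra).
unfold chain_state. fold z' T ze'. rewrite !Epow, Eprod.
split; [|split; [|split]].
- assert (ka * (0.58 * 0.9 ^ (kn - S m) * (amp_prod kn / amp_prod (S m)) ^ 3) <= ka * ze) by (apply Rmult_le_compat_l; lra). lra.
- assert (ka * ze <= ka * (1.42 * 6.2 ^ (kn - S m) * (amp_prod kn / amp_prod (S m)) ^ 3)) by (apply Rmult_le_compat_l; lra). lra.
- intros l. fold T ze'. assert (W0 := cone_wt_pos z l).
  assert (W1 := cone_wt_step z' l l ltac:(lia)).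
  assert (W2 : cone_wt z l <= 4 * cone_wt z' l).
  { unfold cone_wt, wt. assert (Hs := wt_step 4 l z' z ltac:(lra) ltac:(unfold z', z; lia)). unfold wt in Hs.
    replace (Z.abs_nat (z - l)) with (Z.abs_nat (l - z)) in Hs by lia. replace (Z.abs_nat (z' - l)) with (Z.abs_nat (l - z')) in Hs by lia. lra. }
  assert (Hw' := cone_wt_pos z' l).
  assert (Hze'1 : 900 * ze <= ze') by lra.
  assert (Hwz : cone_wt z l * ze <= 4 * cone_wt z' l * ze) by (apply Rmult_le_compat_r; lra).
  assert (Hwz' : 900 * (cone_wt z' l * ze) <= cone_wt z' l * ze').
  { replace (900 * (cone_wt z' l * ze)) with (cone_wt z' l * (900 * ze)) by ring. apply Rmult_le_compat_l; lra. }
  split.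
  + destruct (Z.eq_dec (Z.abs (l - z)) 1) as [E|E].
    * assert (U := U3 l E). assert (E2 : l = z' \/ Z.abs (l - z') = 2%Z) by (unfold z', z in *; lia).
      destruct E2 as [->|E2].
      -- rewrite cone_wt_self. fold ze'. assert (0 <= ze') by apply Cmod_ge_0. lra.
      -- rewrite (cone_wt_2 z' l E2). lra.
    * assert (U := U4 l E). assert (0 < cone_wt z' l * ze) by (apply Rmult_lt_0_compat; lra). lra.
  + destruct (Z.eq_dec l z) as [->|E].
    * rewrite (cone_wt_1 z' z) by (unfold z', z; lia). lra.
    * assert (U := U5 l E). assert (0 < cone_wt z' l * ze) by (apply Rmult_lt_0_compat; lra). lra.
- intros lam Hlam t Ht. assert (Hl := proj1 Hlam).
  assert (Hlz : lam z <= 2 * lam z').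
  { assert (H2 := proj2 Hlam z z'). replace (Z.abs_nat (z - z')) with 1%nat in H2 by (unfold z', z; lia). simpl in H2. lra. }
  assert (L1 := Hl z). assert (L2 := Hl z').
  (* 2 / 0.9 < 2.3, with the 2 from the change of weight; then 25 * 2.3 < 64 propagates the bound in
     X. *)
  assert (Hlze : lam z * (ka * ze) <= 2.3 * (lam z' * ze')).
  { assert (lam z * (ka * ze) <= 2 * lam z' * (ka * ze)) by (apply Rmult_le_compat_r; lra).
    assert (H1 : lam z' * (0.9 * ka * ze) <= lam z' * ze') by (apply Rmult_le_compat_l; [left; exact L2|exact Hlow]).
    assert (E1 : lam z' * (0.9 * ka * ze) = 0.9 * (lam z' * (ka * ze))) by ring.
    set (X := lam z' * (ka * ze)) in *. set (Y := lam z' * ze') in *. replace (2 * lam z' * (ka * ze)) with (2 * X) in * by (unfold X; ring).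
    assert (0 < X) by (unfold X; apply Rmult_lt_0_compat; lra). lra. }
  assert (Hlze2 : 1000 * (lam z * ze) <= lam z * (ka * ze)).
  { replace (1000 * (lam z * ze)) with (lam z * (1000 * ze)) by ring. apply Rmult_le_compat_l; lra. }
  destruct (Rle_dec t (tm eta z)) as [Hte|Hte].
  + destruct (C4 lam Hlam t ltac:(lra)) as [p Hp]. exists p. intros l. specialize (Hp l).
    assert (Hwp := wt_pos 2 p l ltac:(lra)).
    eapply Rle_trans; [exact Hp|]. apply Rmult_le_compat_r; [lra|].
    assert (0 < lam z * ze) by (apply Rmult_lt_0_compat; lra). lra.
  + exists z. intros l. destruct (window_bound z T t l Hz C3 Hzep (or_intror HTle) ltac:(lra)) as [B _]. fold ze ka in B.
    assert (Hw := wt_lam lam z l Hlam). assert (Hw2 := wt_pos 2 z l ltac:(lra)).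
    apply Rle_trans with (lam l * (25 * (ka * ze) * wt 4 z l)); [apply Rmult_le_compat_l; [left; apply Hl|exact B]|].
    apply Rle_trans with (25 * (ka * ze) * (lam z * wt 2 z l)).
    * replace (lam l * (25 * (ka * ze) * wt 4 z l)) with (25 * (ka * ze) * (lam l * wt 4 z l)) by ring.
      apply Rmult_le_compat_l; [lra|exact Hw].
    * replace (25 * (ka * ze) * (lam z * wt 2 z l)) with (25 * (lam z * (ka * ze)) * wt 2 z l) by ring.
      apply Rmult_le_compat_r; [lra|]. assert (0 < lam z' * ze') by (apply Rmult_lt_0_compat; lra). lra.
Qed.

Lemma chain_end : chain_state 1.
Proof.
assert (Hi : forall i, (i < kn)%nat -> chain_state (kn - i)).
{ induction i; intros Hik.
  - rewrite Nat.sub_0_r. apply chain_start.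
  - apply chain_step; [lia|lia|]. replace (S (kn - S i)) with (kn - i)%nat by lia. apply IHi. lia. }
replace 1%nat with (kn - (kn - 1))%nat by lia. apply Hi. lia.
Qed.

(* [A] is the amplitude received by mode [2] at the last resonance. *)
Lemma chain_final : exists A, 0 < A /\
  0.58 * 0.9 ^ kn * amp_prod kn ^ 3 <= A <= 1.42 * 6.2 ^ kn * amp_prod kn ^ 3 /\
  (forall t, 2 * eta <= t -> 0.9 * A <= Cmod (th t 2%Z) <= 6.2 * A) /\
  (forall lam, lam_ok lam -> forall t, 0 <= t -> exists p, forall l, lam l * Cmod (th t l) <= 64 * (lam 2%Z * A) * wt 2 p l) /\
  (forall t l, 2 * eta <= t -> Cmod (th t l) <= 25 * A * wt 4 1 l /\ Cmod (G t l) <= 26 * A * wt 4 1 l) /\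
  (forall s t l, 2 * eta <= s <= t -> Cmod (Cminus (th t l) (th s l)) <= 2 * A * (eta / s) * wt 4 1 l).
Proof.
destruct chain_end as [C1 [C2 [C3 C4]]]. change (Z.of_nat 1) with 1%Z in *.
set (ze := Cmod (th (tm eta 1) 1%Z)) in *.
assert (Hk1 := k_ge1). assert (H1k : (1 <= 1 <= k)%Z) by lia.
destruct (step_params 1 H1k) as [S1 [S2 [S3 S4]]].
assert (A1 := amp_prod_pos kn). assert (A2 := amp_prod_pos 1). assert (Hxp := x_pos).
assert (Hzep : 0 < ze).
{ eapply Rlt_le_trans; [|exact C1]. apply Rmult_lt_0_compat; [apply Rmult_lt_0_compat; [lra|apply pow_lt; lra]|].
  apply pow_lt, Rdiv_lt_0_compat; assumption. }
assert (Htm := tm_mono_pos 1 ltac:(lia)).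
assert (Etm : tm eta 1 = eta / 1.5) by (unfold tm; f_equal; lra).
assert (Htm2 : tm eta 1 <= 2 * eta) by (rewrite Etm; lra).
set (ka := kap c eta 1) in *.
assert (Hkz : 1000 * ze <= ka * ze) by (apply Rmult_le_compat_r; lra).
assert (Eka : ka = amp_prod 1 ^ 3).
{ unfold ka. rewrite kap_x by lra. unfold amp_prod. f_equal. simpl. field. }
(* The window of the mode 1 never ends, so its bounds hold for all later times. *)
assert (Hwin : forall t l, tm eta 1 <= t -> Cmod (th t l) <= 25 * (ka * ze) * wt 4 1 l /\ Cmod (H t l) <= 2 * ze * wt 4 1 l).
{ intros t l Ht. apply (window_bound 1 t t l H1k C3 Hzep (or_introl eq_refl)). lra. }
assert (HG : forall t l, 2 * eta <= t -> Cmod (th t l) <= 25 * (ka * ze) * wt 4 1 l /\ Cmod (G t l) <= 26 * (ka * ze) * wt 4 1 l).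
{ intros t l Ht. destruct (Hwin t l ltac:(lra)) as [W1 W2]. split; [exact W1|].
  assert (HGg := G_le_good eta th G t l). fold H in HGg. assert (Hp := pcf_bounds eta l t).
  assert (Hcm := Cmod_ge_0 (th t l)). assert (pcf eta l t * Cmod (th t l) <= 1 * Cmod (th t l)) by (apply Rmult_le_compat_r; lra).
  assert (Hw := wt_pos 4 1 l ltac:(lra)).
  assert (1000 * ze * wt 4 1 l <= ka * ze * wt 4 1 l) by (apply Rmult_le_compat_r; lra).
  assert (0 < ze * wt 4 1 l) by (apply Rmult_lt_0_compat; lra). lra. }
assert (Epow : forall b, b ^ kn = b * b ^ (kn - 1)).
{ intros b. replace kn with (S (kn - 1)) at 1 by lia. reflexivity. }
assert (E3 : ka * (amp_prod kn / amp_prod 1) ^ 3 = amp_prod kn ^ 3) by (rewrite Eka; field; lra).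
assert (Hap3 : 0 < amp_prod kn ^ 3) by (apply pow_lt; exact A1).
exists (ka * ze). split; [lra|]. split; [|split; [|split; [|split]]].
- rewrite !Epow. assert (P9 : 0 < 0.9 ^ (kn - 1)) by (apply pow_lt; lra). assert (P6 : 0 < 6.2 ^ (kn - 1)) by (apply pow_lt; lra).
  assert (L : ka * (0.58 * 0.9 ^ (kn - 1) * (amp_prod kn / amp_prod 1) ^ 3) <= ka * ze) by (apply Rmult_le_compat_l; lra).
  assert (U : ka * ze <= ka * (1.42 * 6.2 ^ (kn - 1) * (amp_prod kn / amp_prod 1) ^ 3)) by (apply Rmult_le_compat_l; lra).
  replace (ka * (0.58 * 0.9 ^ (kn - 1) * (amp_prod kn / amp_prod 1) ^ 3)) with (0.58 * 0.9 ^ (kn - 1) * (ka * (amp_prod kn / amp_prod 1) ^ 3)) in L by ring.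
  replace (ka * (1.42 * 6.2 ^ (kn - 1) * (amp_prod kn / amp_prod 1) ^ 3)) with (1.42 * 6.2 ^ (kn - 1) * (ka * (amp_prod kn / amp_prod 1) ^ 3)) in U by ring.
  rewrite E3 in L, U.
  assert (0 < 0.9 ^ (kn - 1) * amp_prod kn ^ 3) by (apply Rmult_lt_0_compat; assumption).
  assert (0 < 6.2 ^ (kn - 1) * amp_prod kn ^ 3) by (apply Rmult_lt_0_compat; assumption). lra.
- intros t Ht. split.
  + assert (Hlow := step_lower nu c f eta th G Hnu Hc ltac:(lra) Hf3 Hsol 1 t ltac:(lia) ltac:(lra) (or_introl eq_refl) S1 S2 S3 S4
      Hzep C3 (prior_step 1 t Htm) t 2 ltac:(lia) ltac:(lia)). fold ze ka in Hlow. rewrite <- Rmult_assoc. apply Hlow.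
    split; [|lra]. rewrite Rdiv_1_r. lra.
  + destruct (step_upper nu c f eta th G Hnu Hc ltac:(lra) Hf3 Hsol 1 t ltac:(lia) ltac:(lra) (or_introl eq_refl) S1 S2 S3 S4
      Hzep C3 (prior_step 1 t Htm) t ltac:(lra)) as [_ [_ [U3 _]]]. specialize (U3 2%Z ltac:(lia)). fold ze ka in U3. lra.
- intros lam Hlam t Ht. assert (Hl := proj1 Hlam).
  assert (Hl12 : lam 1%Z <= 2 * lam 2%Z).
  { assert (H2 := proj2 Hlam 1%Z 2%Z). simpl in H2. lra. }
  assert (L1 := Hl 1%Z). assert (L2 := Hl 2%Z).
  assert (Hlk : lam 1%Z * (ka * ze) <= 2 * (lam 2%Z * (ka * ze))).
  { replace (2 * (lam 2%Z * (ka * ze))) with (2 * lam 2%Z * (ka * ze)) by ring. apply Rmult_le_compat_r; lra. }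
  assert (Hlk2 : 1000 * (lam 1%Z * ze) <= lam 1%Z * (ka * ze)).
  { replace (1000 * (lam 1%Z * ze)) with (lam 1%Z * (1000 * ze)) by ring. apply Rmult_le_compat_l; lra. }
  destruct (Rle_dec t (tm eta 1)) as [Hte|Hte].
  + destruct (C4 lam Hlam t ltac:(lra)) as [p Hp]. exists p. intros l. specialize (Hp l).
    assert (Hwp := wt_pos 2 p l ltac:(lra)).
    eapply Rle_trans; [exact Hp|]. apply Rmult_le_compat_r; [lra|].
    assert (0 < lam 1%Z * ze) by (apply Rmult_lt_0_compat; lra). lra.
  + exists 1%Z. intros l. destruct (Hwin t l ltac:(lra)) as [B _].
    assert (Hw := wt_lam lam 1 l Hlam). assert (Hw2 := wt_pos 2 1 l ltac:(lra)).
    apply Rle_trans with (lam l * (25 * (ka * ze) * wt 4 1 l)); [apply Rmult_le_compat_l; [left; apply Hl|exact B]|].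
    apply Rle_trans with (25 * (ka * ze) * (lam 1%Z * wt 2 1 l)).
    * replace (lam l * (25 * (ka * ze) * wt 4 1 l)) with (25 * (ka * ze) * (lam l * wt 4 1 l)) by ring.
      apply Rmult_le_compat_l; [lra|exact Hw].
    * replace (25 * (ka * ze) * (lam 1%Z * wt 2 1 l)) with (25 * (lam 1%Z * (ka * ze)) * wt 2 1 l) by ring.
      apply Rmult_le_compat_r; [lra|]. assert (0 < lam 2%Z * (ka * ze)) by (apply Rmult_lt_0_compat; lra). lra.
- exact HG.
- intros s t l Hst. set (A := ka * ze) in *. assert (HA : 0 < A) by lra.
  assert (Hw := wt_pos 4 1 l ltac:(lra)).
  assert (HAs : 0 < A * (eta / s) * wt 4 1 l).
  { apply Rmult_lt_0_compat; [apply Rmult_lt_0_compat; [lra|apply Rdiv_lt_0_compat; lra]|lra]. }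
  destruct (Z.eq_dec l 0) as [->|El].
  { destruct (ode_zero _ _ _ _ _ _ Hsol s ltac:(lra)) as [Z1 _]. destruct (ode_zero _ _ _ _ _ _ Hsol t ltac:(lra)) as [Z2 _].
    rewrite Z1, Z2. replace (Cminus (RtoC 0) (RtoC 0)) with (RtoC 0) by (unfold Cminus; ring). rewrite Cmod_0. lra. }
  (* Past 2 eta no mode resonates, |eta - j u| >= |j| u / 2, hence p_j <= 4 / u^2. The flux is
     integrable in time with tail O(eta / s), and 204 c * 4 < 1 gives the constant. *)
  assert (Hfl : forall j, (Z.abs (l - j) = 1)%Z -> RInt (input_flux c eta th G j) s t <= A * (eta / s) * wt 4 1 l).
  { intros j Hlj. assert (Hwj := wt_pos 4 1 j ltac:(lra)).
    assert (Hwlj := wt_step 4 1 l j ltac:(lra) ltac:(lia)).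
    set (B := 4 * (c * eta) * (51 * A * wt 4 1 j)).
    assert (Hce : 0 < c * eta) by (apply Rmult_lt_0_compat; lra).
    assert (HAw : 0 < A * wt 4 1 j) by (apply Rmult_lt_0_compat; lra).
    assert (HB : 0 < B) by (unfold B; apply Rmult_lt_0_compat; lra).
    eapply Rle_trans; [apply (RInt_le_deriv _ (fun u => - (B * / u)) (fun u => B / u ^ 2))|].
    - lra.
    - intros; apply (flux_cont nu c f eta th G Hsol).
    - intros; apply inv_derive; lra.
    - intros u Hu. destruct (Hwin u j ltac:(lra)) as [W1 W2].
      destruct (Z.eq_dec j 0) as [->|Ej]; [rewrite flux_0; apply Rdiv_le_0_compat; [lra|apply pow_lt; lra]|].
      assert (Hfx := flux_le c eta th G j u _ _ W1 W2). rewrite dcoef_pcf in Hfx by (assumption || lra).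
      assert (HJ := Rabs_IZR_ge1 j Ej). assert (Hp := pcf_bounds eta j u).
      assert (Hpj : pcf eta j u * u ^ 2 <= 2 ^ 2).
      { apply pcf_le; [exact Ej|lra|lra|].
        destruct (Z_lt_le_dec j 0).
        - assert (IZR j <= -1) by (apply IZR_le; lia). rewrite (Rabs_left (IZR j)), Rabs_pos_eq by nra. nra.
        - assert (1 <= IZR j) by (apply IZR_le; lia). rewrite (Rabs_pos_eq (IZR j)), Rabs_left1 by nra. nra. }
      assert (HJ3 : c * eta / Rabs (IZR j) ^ 3 <= c * eta).
      { unfold Rdiv. rewrite <- (Rmult_1_r (c * eta)) at 2. apply Rmult_le_compat_l; [lra|].
        rewrite <- Rinv_1. apply Rinv_le_contravar; [lra|]. apply pow_R1_Rle; lra. }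
      assert (HJ30 : 0 < c * eta / Rabs (IZR j) ^ 3) by (apply Rdiv_lt_0_compat; [lra|apply pow_lt; lra]).
      assert (Hpu : pcf eta j u <= 4 / u ^ 2).
      { apply Rmult_le_reg_r with (u ^ 2); [apply pow_lt; lra|]. unfold Rdiv. rewrite Rmult_assoc, Rinv_l, Rmult_1_r by (apply pow_nonzero; lra). lra. }
      eapply Rle_trans; [exact Hfx|].
      assert (Hzw : 1000 * ze * wt 4 1 j <= A * wt 4 1 j) by (apply Rmult_le_compat_r; lra).
      assert (HV : 2 * pcf eta j u * (25 * A * wt 4 1 j) + 2 * ze * wt 4 1 j <= 51 * A * wt 4 1 j).
      { assert (pcf eta j u * (25 * A * wt 4 1 j) <= 1 * (25 * A * wt 4 1 j)) by (apply Rmult_le_compat_r; lra).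
        assert (0 < ze * wt 4 1 j) by (apply Rmult_lt_0_compat; lra). lra. }
      apply Rle_trans with (c * eta * (4 / u ^ 2) * (51 * A * wt 4 1 j)).
      + apply Rmult_le_compat.
        * apply Rmult_le_pos; lra.
        * apply Rplus_le_le_0_compat; [apply Rmult_le_pos; [lra|]; apply Rmult_le_pos; lra|].
          apply Rmult_le_pos; lra.
        * apply Rmult_le_compat; lra.
        * exact HV.
      + right. unfold B. field. lra.
    - replace (- (B * / t) - - (B * / s)) with (B * / s - B * / t) by ring.
      assert (0 < B * / t) by (apply Rmult_lt_0_compat; [lra|apply Rinv_0_lt_compat; lra]).
      apply Rle_trans with (B * / s); [lra|].
      unfold B. replace (4 * (c * eta) * (51 * A * wt 4 1 j) * / s) with (204 * c * (A * (eta / s) * wt 4 1 j)) by (field; lra).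
      assert (HAs2 : 0 < A * (eta / s)) by (apply Rmult_lt_0_compat; [lra|apply Rdiv_lt_0_compat; lra]).
      assert (A * (eta / s) * wt 4 1 j <= A * (eta / s) * (4 * wt 4 1 l)) by (apply Rmult_le_compat_l; lra).
      assert (0 < A * (eta / s) * wt 4 1 j) by (apply Rmult_lt_0_compat; lra). nra. }
  assert (F1 := Hfl (l + 1)%Z ltac:(lia)). assert (F2 := Hfl (l - 1)%Z ltac:(lia)).
  assert (Hv := theta_variation nu c f eta th G Hsol l s t El ltac:(lra)). lra.
Qed.

End Chain.

(** * Weighted norms and total amplification *)

Lemma series_bounded (a : nat -> R) B : (forall n, 0 <= a n) -> (forall n, sum_n a n <= B) ->
  ex_series a /\ Series a <= B.
Proof.
intros Hp HB.
destruct (ex_finite_lim_seq_incr (sum_n a) B) as [l Hl].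
- intros n. rewrite sum_Sn. unfold plus; simpl. specialize (Hp (S n)). lra.
- exact HB.
- split; [exists l; exact Hl|].
  unfold Series. rewrite (is_lim_seq_unique _ _ Hl). simpl.
  exact (is_lim_seq_le _ _ (Finite l) (Finite B) HB Hl (is_lim_seq_const B)).
Qed.

(** A discrete primitive of [wt 4 p], increasing from 0 to 5/3. It telescopes along the enumeration
    [Zterm], whose partial sums run over the interval from - n - 1 to n. *)
Definition wt4_sum (p z : Z) : R :=
  if Z_le_dec z p then / 3 * (/ 4) ^ Z.abs_nat (p - z) else 5 / 3 - / 3 * (/ 4) ^ Z.abs_nat (z - 1 - p).

Lemma wt4_sum_step p z : wt4_sum p (z + 1) - wt4_sum p z = wt 4 p z.
Proof.
unfold wt4_sum, wt. destruct (Z_le_dec (z + 1) p), (Z_le_dec z p); try lia.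
- replace (Z.abs_nat (p - z)) with (S (Z.abs_nat (p - (z + 1)))) by lia.
  replace (Z.abs_nat (z - p)) with (S (Z.abs_nat (p - (z + 1)))) by lia. simpl. lra.
- replace z with p by lia. replace (p + 1 - 1 - p)%Z with 0%Z by lia. rewrite Z.sub_diag. simpl. lra.
- replace (Z.abs_nat (z + 1 - 1 - p)) with (S (Z.abs_nat (z - 1 - p))) by lia.
  replace (Z.abs_nat (z - p)) with (S (Z.abs_nat (z - 1 - p))) by lia. simpl. lra.
Qed.

Lemma wt4_sum_bounds p z : 0 <= wt4_sum p z <= 5 / 3.
Proof.
unfold wt4_sum. assert (Hn : forall n, 0 < (/ 4) ^ n <= 1).
{ intros n. split; [apply pow_lt; lra|]. rewrite <- (pow1 n). apply pow_incr. lra. }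
destruct (Z_le_dec z p).
- specialize (Hn (Z.abs_nat (p - z))). lra.
- specialize (Hn (Z.abs_nat (z - 1 - p))). lra.
Qed.

Lemma Zterm_wt4 p n : sum_n (Zterm (wt 4 p)) n = wt4_sum p (Z.of_nat n + 1) - wt4_sum p (- Z.of_nat n - 1).
Proof.
induction n.
- rewrite sum_O. unfold Zterm. rewrite <- !wt4_sum_step. simpl. lra.
- rewrite sum_Sn, IHn. unfold plus; simpl plus. unfold Zterm. rewrite <- !wt4_sum_step. rewrite Nat2Z.inj_succ.
  replace (- Z.succ (Z.of_nat n) - 1 + 1)%Z with (- Z.of_nat n - 1)%Z by lia.
  replace (Z.succ (Z.of_nat n)) with (Z.of_nat n + 1)%Z by lia.
  change (wt4_sum p (Z.of_nat n + 1) - wt4_sum p (- Z.of_nat n - 1) +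
    (wt4_sum p (Z.of_nat n + 1 + 1) - wt4_sum p (Z.of_nat n + 1) + (wt4_sum p (- Z.of_nat n - 1) - wt4_sum p (- (Z.of_nat n + 1) - 1))) =
    wt4_sum p (Z.of_nat n + 1 + 1) - wt4_sum p (- (Z.of_nat n + 1) - 1)). ring.
Qed.

(** Squaring turns the ratio 2 into 4, and the total mass 5/3 of [wt 4 p] is rounded up to 2. *)
Lemma normX_bound lam u p B : (forall l, 0 <= lam l) -> 0 <= B ->
  (forall l, lam l * Cmod (u l) <= B * wt 2 p l) -> inX lam u /\ normX2 lam u <= 2 * B ^ 2 /\ normX lam u <= 2 * B.
Proof.
intros Hl HB Hb.
assert (Hterm : forall l, Xterm lam u l <= B ^ 2 * wt 4 p l).
{ intros l. unfold Xterm. rewrite <- Rpow_mult_distr.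
  replace (B ^ 2 * wt 4 p l) with ((B * wt 2 p l) ^ 2).
  - apply pow_incr. split; [apply Rmult_le_pos; [apply Hl|apply Cmod_ge_0]|apply Hb].
  - unfold wt. replace (/ 4) with (/ 2 * / 2) by field. rewrite (Rpow_mult_distr (/ 2) (/ 2)). ring. }
destruct (series_bounded (Zterm (Xterm lam u)) (2 * B ^ 2)) as [S1 S2].
- intros n; apply Zterm_nonneg; intros; apply Xterm_nonneg.
- intros n. apply Rle_trans with (sum_n (fun n => scal (B ^ 2) (Zterm (wt 4 p) n)) n).
  + apply sum_n_m_le. intros j. unfold Zterm, scal; simpl; unfold mult; simpl.
    assert (T1 := Hterm (Z.of_nat j)). assert (T2 := Hterm (- Z.of_nat j - 1)%Z). simpl in *. lra.
  + rewrite sum_n_scal_l, Zterm_wt4. unfold scal; simpl; unfold mult; simpl.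
    assert (W1 := wt4_sum_bounds p (Z.of_nat n + 1)). assert (W2 := wt4_sum_bounds p (- Z.of_nat n - 1)).
    assert (0 <= B * (B * 1)) by nra. nra.
- split; [exact S1|split; [exact S2|]]. unfold normX, normX2.
  rewrite <- (sqrt_pow2 (2 * B)) by lra. apply sqrt_le_1_alt. eapply Rle_trans; [exact S2|]. nra.
Qed.

(** * Explicit bounds for exponentials, powers and factorials *)

Lemma exp_INR_mult y n : exp (y * INR n) = exp y ^ n.
Proof.
induction n; [simpl; rewrite Rmult_0_r; apply exp_0|].
rewrite S_INR, Rmult_plus_distr_l, exp_plus, IHn, Rmult_1_r. simpl. ring.
Qed.

Lemma exp_1_le : exp 1 <= 2.722.
Proof.
(* The Padé bound exp s <= (2 + s) / (2 - s) at s = 1/8, to be raised to the power 8. *)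
assert (H8 : exp (/ 8) <= 17 / 15).
{ assert (Hd : forall t, is_derive (fun s => 2 + s - (2 - s) * exp s) t ((0 + 1) - ((0 - 1) * exp t + (2 - t) * exp t))).
  { intros t. apply derive_minus.
    - apply derive_plus; [apply derive_const|apply derive_id].
    - apply derive_mult; [|apply is_derive_exp]. apply derive_minus; [apply derive_const|apply derive_id]. }
  assert (H := le_of_derive _ _ 0 (/ 8) ltac:(lra) (fun t _ => continuous_of_derive _ _ _ (Hd t)) (fun t _ => Hd t)).
  cbv beta in H. rewrite exp_0 in H.
  assert (H1 : 2 + 0 - (2 - 0) * 1 <= 2 + / 8 - (2 - / 8) * exp (/ 8)); [|lra].
  apply H. intros t Ht. assert (He := exp_ineq1_le (- t)). assert (Hp := exp_pos t).
  assert (E : exp (- t) * exp t = 1) by (rewrite <- exp_plus, Rplus_opp_l; apply exp_0). nra. }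
replace 1 with (/ 8 * INR 8) by (simpl; lra).
rewrite exp_INR_mult. apply Rle_trans with ((17 / 15) ^ 8); [|lra].
apply pow_incr. split; [left; apply exp_pos|exact H8].
Qed.

Lemma exp_le_mono a b : a <= b -> exp a <= exp b.
Proof. intros [H|H]; [left; apply exp_increasing; exact H|rewrite H; lra]. Qed.

Lemma exp_23_4 : exp (23 / 4) <= 321.
Proof.
assert (H : exp (23 / 4) ^ 4 <= 321 ^ 4).
{ rewrite <- exp_INR_mult. replace (23 / 4 * INR 4) with (1 * INR 23) by (simpl; lra). rewrite exp_INR_mult.
  apply Rle_trans with (2.722 ^ 23); [|lra]. apply pow_incr. split; [left; apply exp_pos|apply exp_1_le]. }
apply Rnot_lt_le. intros Hlt. assert (321 ^ 4 < exp (23 / 4) ^ 4); [|lra].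
assert (Hs : 321 * 321 < exp (23 / 4) * exp (23 / 4)) by nra. simpl. nra.
Qed.

(* Stirling from below: [n! <= e n (n/e)^n]. *)
Lemma power_fact_lower n : (1 <= n)%nat -> exp (INR n - 1) <= INR n * (INR n ^ n / INR (fact n)).
Proof.
induction n as [|n IH]; [lia|]. intros _. destruct (Nat.eq_dec n 0) as [->|Hn].
{ simpl. rewrite Rminus_diag, exp_0. lra. }
specialize (IH ltac:(lia)).
assert (Hn1 : 1 <= INR n) by (change 1 with (INR 1); apply le_INR; lia).
assert (Hf := INR_fact_lt_0 n).
set (y := / (INR n + 1)).
assert (Hy0 : 0 < y) by (apply Rinv_0_lt_compat; lra).
assert (E1 : exp y <= 1 + / INR n).
{ assert (He := exp_ineq1_le (- y)). rewrite exp_Ropp in He. assert (Hp := exp_pos y).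
  assert (H1 : 1 - y = INR n / (INR n + 1)) by (unfold y; field; lra).
  assert (H2 : 0 < INR n / (INR n + 1)) by (apply Rdiv_lt_0_compat; lra).
  apply Rmult_le_reg_r with (INR n / (INR n + 1)); [exact H2|].
  replace ((1 + / INR n) * (INR n / (INR n + 1))) with 1 by (field; lra).
  apply Rle_trans with (exp y * / exp y); [apply Rmult_le_compat_l; lra|]. right; field; lra. }
assert (E2 : exp 1 <= (1 + / INR n) ^ S n).
{ replace 1 with (y * INR (S n)) at 1 by (rewrite S_INR; unfold y; field; lra). rewrite exp_INR_mult.
  apply pow_incr. split; [left; apply exp_pos|exact E1]. }
rewrite S_INR. replace (INR n + 1 - 1) with ((INR n - 1) + 1) by ring. rewrite exp_plus.
apply Rle_trans with ((INR n * (INR n ^ n / INR (fact n))) * (1 + / INR n) ^ S n).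
- apply Rmult_le_compat; [left; apply exp_pos|left; apply exp_pos|exact IH|exact E2].
- right. rewrite fact_simpl, mult_INR, S_INR.
  replace ((1 + / INR n) ^ S n) with ((INR n + 1) ^ S n / INR n ^ S n).
  + simpl pow. field. repeat split; try lra. apply pow_nonzero; lra.
  + unfold Rdiv. rewrite <- pow_inv, <- Rpow_mult_distr. f_equal. field; lra.
Qed.

Lemma pow_fact_upper y n : 0 <= y -> y ^ n / INR (fact n) <= exp y.
Proof.
intros Hy. eapply Rle_trans; [|apply (exp_ge_taylor y n Hy)].
assert (Hterm : forall k, 0 <= y ^ k / INR (fact k)).
{ intros k. apply Rdiv_le_0_compat; [apply pow_le; exact Hy|apply INR_fact_lt_0]. }
destruct n; [simpl; lra|]. simpl sum_f_R0.
assert (0 <= sum_f_R0 (fun k => y ^ k / INR (fact k)) n) by (apply cond_pos_sum; exact Hterm). simpl in *. lra.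
Qed.

(** The factor 1.4^n is the surplus of 900 over 2 * 321 in [amplification_lower]; it absorbs the
    cubic loss of the Stirling bound and the constants, from n = 114 on. *)
Lemma pow14_cube n : (114 <= n)%nat -> 1e6 * INR n ^ 3 <= 1.4 ^ n.
Proof.
intros Hn. replace n with (114 + (n - 114))%nat by lia. induction (n - 114)%nat as [|i IH].
- rewrite Nat.add_0_r. replace (INR 114) with 114 by (simpl; lra).
  apply Rle_trans with ((1.4 ^ 6) ^ 19); [|rewrite <- pow_mult; right; reflexivity].
  apply Rle_trans with (7.5 ^ 19); [lra|]. apply pow_incr. lra.
- rewrite Nat.add_succ_r, S_INR. change (1.4 ^ S (114 + i)) with (1.4 * 1.4 ^ (114 + i)).
  assert (H114 : 114 <= INR (114 + i)).
  { replace 114 with (INR 114) by (simpl; lra). apply le_INR. lia. }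
  set (m := INR (114 + i)) in *. assert (H1 : 114 * m <= m ^ 2) by nra. assert (H2 : 114 * m ^ 2 <= m ^ 3) by nra.
  replace ((m + 1) ^ 3) with (m ^ 3 + 3 * m ^ 2 + 3 * m + 1) by ring. lra.
Qed.

(** * Total amplification compared with exp (c eta)^(1/3) *)

Section Numbers.
Variables (K x : R) (n : nat).
Hypothesis HK : 0 <= K.
Hypothesis HKx : K ^ 3 * PI = 2 * x ^ 3.
Hypothesis Hnx : 10 * INR n <= x < 10 * (INR n + 1).
Hypothesis Hn : (114 <= n)%nat.

Lemma n_ge : 114 <= INR n.
Proof. replace 114 with (INR 114) by (simpl; lra). apply le_INR. exact Hn. Qed.

Lemma K_le_x : K <= 0.874 * x.
Proof.
assert (Hn1 := n_ge). assert (HPI : 3 < PI) by (assert (H := PI2_3_2); lra).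
apply Rnot_lt_le. intros Hlt.
assert (H1 : (0.874 * x) ^ 3 <= K ^ 3) by (apply pow_incr; lra).
assert (H2 : 0 < x ^ 3) by (apply pow_lt; lra).
assert (H3 : (0.874 * x) ^ 3 = 0.874 ^ 3 * x ^ 3) by (apply Rpow_mult_distr).
assert (H4 : 0 <= K ^ 3) by (apply pow_le; exact HK). nra.
Qed.

Lemma x_le_K : x <= 1.3 * K.
Proof.
assert (Hn1 := n_ge). assert (HPI := PI_4).
apply Rnot_lt_le. intros Hlt.
assert (H1 : (1.3 * K) ^ 3 <= x ^ 3) by (apply pow_incr; lra).
assert (H2 : 0 < x ^ 3) by (apply pow_lt; lra).
assert (H3 : (1.3 * K) ^ 3 = 1.3 ^ 3 * K ^ 3) by (apply Rpow_mult_distr).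
assert (H4 : 0 <= K ^ 3) by (apply pow_le; exact HK). nra.
Qed.

(** With x >= 10 n, the Stirling bound gives (x^n / n!)^3 >= 1000^n exp (3 n - 3) / n^3. On the
    other side K <= 0.874 x, from PI > 3, and x < 10 (n + 1) give K <= (23/4 + 3) n + 9, so exp K
    costs 321^n beyond exp (3 n - 3). The factor 2^n is reserved for comparing weights of X at
    distant modes. *)
Lemma amplification_lower : exp K * 2 ^ n <= 0.58 * 0.9 ^ n * (x ^ n / INR (fact n)) ^ 3.
Proof.
assert (Hn1 := n_ge). assert (HKl := K_le_x). assert (Hf := INR_fact_lt_0 n).
assert (P1 : exp (INR n - 1) * 10 ^ n <= INR n * (x ^ n / INR (fact n))).
{ assert (H1 := power_fact_lower n ltac:(lia)).
  apply Rle_trans with (INR n * (INR n ^ n / INR (fact n)) * 10 ^ n).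
  - apply Rmult_le_compat_r; [apply pow_le; lra|exact H1].
  - replace (INR n * (INR n ^ n / INR (fact n)) * 10 ^ n) with (INR n * ((10 * INR n) ^ n / INR (fact n))) by (rewrite Rpow_mult_distr; field; lra).
    apply Rmult_le_compat_l; [lra|]. apply Rmult_le_compat_r; [left; apply Rinv_0_lt_compat; exact Hf|]. apply pow_incr. lra. }
set (P := x ^ n / INR (fact n)) in *.
assert (P3 : exp (3 * INR n - 3) * 1000 ^ n <= INR n ^ 3 * P ^ 3).
{ rewrite <- Rpow_mult_distr. replace (exp (3 * INR n - 3) * 1000 ^ n) with ((exp (INR n - 1) * 10 ^ n) ^ 3).
  - apply pow_incr. split; [apply Rmult_le_pos; [left; apply exp_pos|apply pow_le; lra]|exact P1].
  - rewrite Rpow_mult_distr, <- exp_INR_mult. f_equal; [f_equal; simpl; ring|].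
    rewrite <- pow_mult, Nat.mul_comm, pow_mult. f_equal. ring. }
assert (EK : exp K <= exp (23 / 4) ^ n * exp (3 * INR n - 3) * exp 12).
{ rewrite <- exp_INR_mult, <- !exp_plus. apply exp_le_mono. lra. }
assert (H12 : exp 12 <= 531441).
{ replace 12 with (1 * INR 12) by (simpl; lra). rewrite exp_INR_mult. replace 531441 with (3 ^ 12) by lra.
  apply pow_incr. split; [left; apply exp_pos|apply exp_le_3]. }
assert (H321 : exp (23 / 4) ^ n <= 321 ^ n) by (apply pow_incr; split; [left; apply exp_pos|apply exp_23_4]).
assert (H14 := pow14_cube n Hn).
assert (Q0 : 0 < exp (3 * INR n - 3)) by apply exp_pos.
assert (Q1 : 0 < 321 ^ n) by (apply pow_lt; lra).
assert (Q2 : 0 < 2 ^ n) by (apply pow_lt; lra).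
assert (Q3 : 0 < INR n ^ 3) by (apply pow_lt; lra).
assert (Q4 : 0 < 0.9 ^ n) by (apply pow_lt; lra).
assert (E450 : 321 ^ n * 1.4 ^ n <= 450 ^ n) by (rewrite <- Rpow_mult_distr; apply pow_incr; lra).
assert (E900 : 2 ^ n * 450 ^ n = 0.9 ^ n * 1000 ^ n) by (rewrite <- !Rpow_mult_distr; f_equal; lra).
apply Rmult_le_reg_l with (INR n ^ 3); [exact Q3|].
replace (INR n ^ 3 * (0.58 * 0.9 ^ n * P ^ 3)) with (0.58 * 0.9 ^ n * (INR n ^ 3 * P ^ 3)) by ring.
apply Rle_trans with (0.58 * 0.9 ^ n * (exp (3 * INR n - 3) * 1000 ^ n)); [|apply Rmult_le_compat_l; [lra|exact P3]].
replace (0.58 * 0.9 ^ n * (exp (3 * INR n - 3) * 1000 ^ n)) with (0.58 * exp (3 * INR n - 3) * (0.9 ^ n * 1000 ^ n)) by ring.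
rewrite <- E900.
set (E := exp (3 * INR n - 3)) in *.
apply Rle_trans with (INR n ^ 3 * (321 ^ n * E * 531441 * 2 ^ n)).
- apply Rmult_le_compat_l; [lra|]. apply Rmult_le_compat_r; [lra|]. eapply Rle_trans; [exact EK|].
  apply Rmult_le_compat; [|left; apply exp_pos| |exact H12].
  + apply Rmult_le_pos; [apply pow_le; left; apply exp_pos|lra].
  + apply Rmult_le_compat_r; [lra|exact H321].
- apply Rle_trans with (0.58 * E * (2 ^ n * (321 ^ n * (1e6 * INR n ^ 3)))).
  + assert (0 < INR n ^ 3 * (321 ^ n * E * 2 ^ n)) by (apply Rmult_lt_0_compat; [exact Q3|apply Rmult_lt_0_compat; [apply Rmult_lt_0_compat; assumption|exact Q2]]).
    replace (INR n ^ 3 * (321 ^ n * E * 531441 * 2 ^ n)) with (531441 * (INR n ^ 3 * (321 ^ n * E * 2 ^ n))) by ring.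
    replace (0.58 * E * (2 ^ n * (321 ^ n * (1e6 * INR n ^ 3)))) with (0.58 * 1e6 * (INR n ^ 3 * (321 ^ n * E * 2 ^ n))) by ring.
    apply Rmult_le_compat_r; lra.
  + apply Rmult_le_compat_l; [lra|]. apply Rmult_le_compat_l; [lra|].
    apply Rle_trans with (321 ^ n * 1.4 ^ n); [apply Rmult_le_compat_l; lra|exact E450].
Qed.

(** Here x^n / n! <= exp x suffices: as n <= x / 10 and x <= 1.3 K, the exponent 8 + 4 n + 3 x is
    well below 50 K. *)
Lemma amplification_upper : 200 * 6.2 ^ n * (x ^ n / INR (fact n)) ^ 3 * 2 ^ n <= exp (50 * K).
Proof.
assert (Hn1 := n_ge). assert (HxK := x_le_K).
assert (P1 := pow_fact_upper x n ltac:(lra)).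
assert (P0 : 0 <= x ^ n / INR (fact n)) by (apply Rdiv_le_0_compat; [apply pow_le; lra|apply INR_fact_lt_0]).
assert (P3 : (x ^ n / INR (fact n)) ^ 3 <= exp (3 * x)).
{ replace (exp (3 * x)) with (exp x ^ 3) by (rewrite <- exp_INR_mult; f_equal; simpl; ring). apply pow_incr. lra. }
assert (E2 : 2 <= exp 1) by (assert (H := exp_ineq1_le 1); lra).
assert (E124 : 6.2 ^ n * 2 ^ n <= exp (4 * INR n)).
{ rewrite <- Rpow_mult_distr, exp_INR_mult. apply pow_incr. split; [lra|].
  replace 4 with (1 * INR 4) by (simpl; ring). rewrite exp_INR_mult. apply Rle_trans with (2 ^ 4); [lra|]. apply pow_incr. lra. }
assert (E200 : 200 <= exp 8).
{ replace 8 with (1 * INR 8) by (simpl; ring). rewrite exp_INR_mult. apply Rle_trans with (2 ^ 8); [lra|]. apply pow_incr. lra. }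
replace (200 * 6.2 ^ n * (x ^ n / INR (fact n)) ^ 3 * 2 ^ n) with (200 * (6.2 ^ n * 2 ^ n) * (x ^ n / INR (fact n)) ^ 3) by ring.
apply Rle_trans with (exp 8 * exp (4 * INR n) * exp (3 * x)).
- apply Rmult_le_compat; [|apply pow_le; exact P0| |exact P3].
  + apply Rmult_le_pos; [lra|]. apply Rmult_le_pos; apply pow_le; lra.
  + apply Rmult_le_compat; [lra| |exact E200|exact E124]. apply Rmult_le_pos; apply pow_le; lra.
- rewrite <- !exp_plus. apply exp_le_mono. lra.
Qed.

End Numbers.

Lemma cbrt_cube y : 0 < y -> 0 < cbrt y /\ cbrt y ^ 3 = y.
Proof.
intros Hy. unfold cbrt. destruct (Rlt_dec 0 y); [|contradiction]. split; [apply exp_pos|].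
rewrite <- Rpower_pow by apply exp_pos. rewrite Rpower_mult. replace (1 / 3 * INR 3) with 1 by (simpl; field).
apply Rpower_1; exact Hy.
Qed.

(** * Solutions in X *)

Section Bridge.
Variables (nu c : R) (f : R -> R) (lam : Z -> R).
Hypothesis Hst : standing nu c f lam.

Lemma standing_lam_ok : lam_ok lam.
Proof.
destruct Hst as [_ [_ [_ [_ [_ [Hl [q [Hq Hr]]]]]]]]. split; [exact Hl|].
intros l j. apply (lam_ratio lam q Hl Hq Hr).
Qed.

(** Local in time bound by the weight of the initial phase. It implies the conditions in X of
    [is_solution] and supplies the finite constant that starts each bootstrap. *)
Definition growth (k : Z) (u : R -> Z -> C) : Prop :=
  forall T, exists M, 0 <= M /\ forall t l, 0 <= t <= T -> Cmod (u t l) <= M * wt 50000 k l.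

Lemma wt_50000_4 k l : wt 50000 k l <= wt 4 k l.
Proof. apply pow_incr. lra. Qed.

Lemma growth_X k u T : growth k u -> exists B, 0 <= B /\ forall t l, 0 <= t <= T -> lam l * Cmod (u t l) <= B * wt 2 k l.
Proof.
intros Hg. destruct (Hg T) as [M [HM Hb]]. assert (Hl := standing_lam_ok). assert (Hk := proj1 Hl k).
exists (M * lam k). split; [apply Rmult_le_pos; lra|]. intros t l Ht.
assert (H1 := wt_lam lam k l Hl). assert (H2 := wt_50000_4 k l). assert (H3 := proj1 Hl l). specialize (Hb t l Ht).
apply Rle_trans with (lam l * (M * wt 4 k l)).
- apply Rmult_le_compat_l; [lra|]. eapply Rle_trans; [exact Hb|]. apply Rmult_le_compat_l; assumption.
- replace (lam l * (M * wt 4 k l)) with (M * (lam l * wt 4 k l)) by ring.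
  replace (M * lam k * wt 2 k l) with (M * (lam k * wt 2 k l)) by ring. apply Rmult_le_compat_l; assumption.
Qed.

Lemma is_solution_of_ode eta k th G : ode_sol nu c f eta th G -> growth k th -> growth k G -> is_solution nu c f lam eta th G.
Proof.
intros S Gt GG. assert (Hl := standing_lam_ok). assert (Hl0 : forall l, 0 <= lam l) by (intros l; left; apply Hl).
split; [exact (ode_zero _ _ _ _ _ _ S)|]. split; [|split; [|split]].
- intros t l Ht Hln. split; [apply (ode_th _ _ _ _ _ _ S t l Ht Hln)|apply (ode_G _ _ _ _ _ _ S t l Ht Hln)].
- intros l. assert (Hle : filter_le (at_right 0) (locally 0)) by (intros P HP; apply filter_le_within; exact HP).
  split; eapply filterlim_filter_le_1; [exact Hle|apply (ode_cont_th _ _ _ _ _ _ S l 0)|exact Hle|apply (ode_cont_G _ _ _ _ _ _ S l 0)].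
- intros t Ht. destruct (growth_X k th t Gt) as [B1 [HB1 Hb1]]. destruct (growth_X k G t GG) as [B2 [HB2 Hb2]].
  split; [apply (normX_bound lam (th t) k B1 Hl0 HB1)|apply (normX_bound lam (G t) k B2 Hl0 HB2)]; intros l; [apply Hb1|apply Hb2]; lra.
- intros T HT. destruct (growth_X k th T Gt) as [B1 [HB1 Hb1]]. destruct (growth_X k G T GG) as [B2 [HB2 Hb2]].
  exists (2 * B1 + 2 * B2). intros t Ht.
  assert (N1 := proj2 (proj2 (normX_bound lam (th t) k B1 Hl0 HB1 (fun l => Hb1 t l Ht)))).
  assert (N2 := proj2 (proj2 (normX_bound lam (G t) k B2 Hl0 HB2 (fun l => Hb2 t l Ht)))). lra.
Qed.

Lemma ode_of_solution eta th G : is_solution nu c f lam eta th G ->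
  ode_sol nu c f eta (fun t => th (Rmax 0 t)) (fun t => G (Rmax 0 t)).
Proof.
intros [S1 [S2 [S3 _]]].
assert (Hcl : forall (u : R -> Z -> C) l t v, 0 < t -> is_derive (fun s => u s l) t v -> is_derive (fun s => u (Rmax 0 s) l) t v).
{ intros u l t v Ht. apply (is_derive_ext_loc (K := R_AbsRing) (V := prod_NormedModule R_AbsRing R_NormedModule R_NormedModule)
    (fun s => u s l)).
  generalize (locally_pos t Ht). apply filter_imp. intros s Hs. rewrite Rmax_right by lra. reflexivity. }
assert (Hc0 : forall (u : R -> Z -> C) t, (forall s, 0 <= s -> u s 0%Z = RtoC 0) -> continuous (fun s => u (Rmax 0 s) 0%Z) t).
{ intros u t Hu. apply (continuous_ext (fun _ => RtoC 0)); [|apply continuous_const].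
  intros s. symmetry. apply Hu, Rmax_l. }
constructor.
- intros l t. destruct (Z.eq_dec l 0) as [->|Hl]; [apply Hc0; intros; apply S1; assumption|].
  apply (continuous_clamp (V := C_UniformSpace) (fun s => th s l) t); [|exact (proj1 (S3 l))]. intros s Hs.
  apply (ex_derive_continuous (V := prod_NormedModule R_AbsRing R_NormedModule R_NormedModule)). eexists. apply (proj1 (S2 s l Hs Hl)).
- intros l t. destruct (Z.eq_dec l 0) as [->|Hl]; [apply Hc0; intros; apply S1; assumption|].
  apply (continuous_clamp (V := C_UniformSpace) (fun s => G s l) t); [|exact (proj2 (S3 l))]. intros s Hs.
  apply (ex_derive_continuous (V := prod_NormedModule R_AbsRing R_NormedModule R_NormedModule)). eexists. apply (proj2 (S2 s l Hs Hl)).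
- intros t Ht. rewrite Rmax_right by lra. apply S1, Ht.
- intros t l Ht Hl. rewrite (Rmax_right 0 t) by lra. apply Hcl; [exact Ht|]. exact (proj1 (S2 t l Ht Hl)).
- intros t l Ht Hl. rewrite (Rmax_right 0 t) by lra. apply Hcl; [exact Ht|]. exact (proj2 (S2 t l Ht Hl)).
Qed.

(** A bound M in X gives |u_l| <= (M / [lam 0]) 2^|l|, which is the uniqueness class of
    [ode_unique]. *)
Lemma solution_unique eta k th G th' G' : is_solution nu c f lam eta th G ->
  ode_sol nu c f eta th' G' -> growth k th' -> growth k G' -> th 0 = th' 0 -> G 0 = G' 0 ->
  forall t, 0 <= t -> th t = th' t /\ G t = G' t.
Proof.
intros S S' Gt GG E1 E2 t Ht.
assert (So := ode_of_solution eta th G S). destruct S as [_ [_ [_ [S4 S5]]]].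
destruct Hst as [Hnu [Hc [_ [_ [Hf3 _]]]]]. assert (Hl := standing_lam_ok). assert (Hl0 := proj1 Hl 0%Z).
destruct (S5 t Ht) as [M HM]. destruct (Gt t) as [M1 [HM1 Hb1]]. destruct (GG t) as [M2 [HM2 Hb2]].
assert (HM0 : 0 <= M).
{ eapply Rle_trans; [|apply (HM 0); lra]. apply Rplus_le_le_0_compat; apply sqrt_pos. }
assert (Hpow : forall l, 1 <= 2 ^ Z.abs_nat l) by (intros; apply pow_R1_Rle; lra).
assert (HMl : 0 <= M / lam 0%Z) by (apply Rdiv_le_0_compat; lra).
assert (Hun : forall s l, 0 <= s <= t -> th (Rmax 0 s) l = th' s l /\ G (Rmax 0 s) l = G' s l).
{ apply (ode_unique nu c f eta Hnu (proj1 Hc) Hf3 _ _ th' G' t (M / lam 0%Z + M1 + M2)).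
  - lra.
  - exact So.
  - exact S'.
  - rewrite Rmax_left by lra. exact E1.
  - rewrite Rmax_left by lra. exact E2.
  - intros s l Hs. rewrite Rmax_right by lra. specialize (HM s Hs). destruct (S4 s ltac:(lra)) as [I1 I2].
    assert (N1 := normX_term lam (th s) l I1 (Rlt_le _ _ (proj1 Hl l))).
    assert (N2 := normX_term lam (G s) l I2 (Rlt_le _ _ (proj1 Hl l))).
    assert (P1 : 0 <= normX lam (th s)) by apply sqrt_pos. assert (P2 : 0 <= normX lam (G s)) by apply sqrt_pos.
    assert (Hll := proj2 Hl 0%Z l). replace (Z.abs_nat (0 - l)) with (Z.abs_nat l) in Hll by lia.
    assert (Hlp := proj1 Hl l). specialize (Hpow l).
    assert (Hgen : forall u, lam l * u <= M -> 0 <= u -> u <= (M / lam 0%Z + M1 + M2) * 2 ^ Z.abs_nat l).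
    { intros u Hu Hu0. apply Rle_trans with (M / lam 0%Z * 2 ^ Z.abs_nat l).
      - apply Rmult_le_reg_l with (lam 0%Z); [exact Hl0|].
        replace (lam 0%Z * (M / lam 0%Z * 2 ^ Z.abs_nat l)) with (M * 2 ^ Z.abs_nat l) by (field; lra).
        apply Rle_trans with (lam l * 2 ^ Z.abs_nat l * u); [apply Rmult_le_compat_r; lra|].
        replace (lam l * 2 ^ Z.abs_nat l * u) with (lam l * u * 2 ^ Z.abs_nat l) by ring. apply Rmult_le_compat_r; lra.
      - apply Rmult_le_compat_r; lra. }
    split; apply Hgen; try apply Cmod_ge_0; lra.
  - intros s l Hs. specialize (Hb1 s l Hs). specialize (Hb2 s l Hs). specialize (Hpow l).
    assert (W1 := wt_le1 50000 k l ltac:(lra)). assert (W0 := wt_pos 50000 k l ltac:(lra)).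
    assert (M1 * wt 50000 k l <= M1 * 1) by (apply Rmult_le_compat_l; lra).
    assert (M2 * wt 50000 k l <= M2 * 1) by (apply Rmult_le_compat_l; lra).
    assert ((M / lam 0%Z + M1 + M2) * 1 <= (M / lam 0%Z + M1 + M2) * 2 ^ Z.abs_nat l) by (apply Rmult_le_compat_l; lra). lra. }
split; apply functional_extensionality; intros l; destruct (Hun t l ltac:(lra)) as [U1 U2]; rewrite Rmax_right in U1, U2 by lra; assumption.
Qed.

Lemma ode_scale eta th G a : ode_sol nu c f eta th G ->
  ode_sol nu c f eta (fun t l => Cmult (RtoC a) (th t l)) (fun t l => Cmult (RtoC a) (G t l)).
Proof.
intros S.
assert (Hd : forall (u : R -> C) t v v', is_derive u t v -> v' = Cmult (RtoC a) v -> is_derive (fun s => Cmult (RtoC a) (u s)) t v').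
{ intros u t v v' Hu ->. eapply is_derive_value_C; [apply is_derive_RtoC_mult; [apply derive_const|exact Hu]|].
  cbv beta. ring. }
constructor.
- intros l t. apply continuous_Cmult; [apply continuous_const|apply (ode_cont_th _ _ _ _ _ _ S)].
- intros l t. apply continuous_Cmult; [apply continuous_const|apply (ode_cont_G _ _ _ _ _ _ S)].
- intros t Ht. destruct (ode_zero _ _ _ _ _ _ S t Ht) as [Z1 Z2]. rewrite Z1, Z2. split; ring.
- intros t l Ht Hl. eapply Hd; [apply (ode_th _ _ _ _ _ _ S t l Ht Hl)|]. unfold rhs_theta, coupling. ring.
- intros t l Ht Hl. eapply Hd; [apply (ode_G _ _ _ _ _ _ S t l Ht Hl)|]. unfold rhs_G, coupling. ring.
Qed.

Lemma growth_scale k u a : growth k u -> growth k (fun t l => Cmult (RtoC a) (u t l)).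
Proof.
intros Hg T. destruct (Hg T) as [M [HM Hb]]. exists (Rabs a * M). split; [apply Rmult_le_pos; [apply Rabs_pos|exact HM]|].
intros t l Ht. rewrite Cmod_mult, Cmod_R, Rmult_assoc. apply Rmult_le_compat_l; [apply Rabs_pos|apply Hb, Ht].
Qed.

End Bridge.

Definition echo_mode (c eta : R) : Z := Int_part (/ 10 * cbrt (c * eta * PI / 2)).
Definition echo_theta (nu c : R) (f : R -> R) (eta t : R) (l : Z) : C := flow nu c f eta (delta_seq (echo_mode c eta)) t (l, true).
Definition echo_G (nu c : R) (f : R -> R) (eta t : R) (l : Z) : C := flow nu c f eta (delta_seq (echo_mode c eta)) t (l, false).

Section Echo.
Variables (nu c : R) (f : R -> R) (lam : Z -> R) (eta : R).
Hypothesis Hst : standing nu c f lam.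
Hypothesis Heta : 0 < eta.
Hypothesis HK : 1000 <= cbrt (c * eta).
Let k := echo_mode c eta.
Let K := cbrt (c * eta).
Let x := cbrt (c * eta * PI / 2).
Let th := echo_theta nu c f eta.
Let G := echo_G nu c f eta.

(** x^3 = K^3 PI / 2 >= 1.5e9 > 1140^3 gives k >= 114, and c eta >= 1e9 with c < 0.001 gives eta >=
    1e12. *)
Lemma echo_numbers : K ^ 3 = c * eta /\ x ^ 3 = c * eta * PI / 2 /\ (114 <= Z.to_nat k)%nat /\ k = Z.of_nat (Z.to_nat k) /\
  10 * INR (Z.to_nat k) <= x < 10 * (INR (Z.to_nat k) + 1) /\ 1e12 <= eta.
Proof.
destruct Hst as [_ [Hc _]].
assert (Hce : 0 < c * eta) by (apply Rmult_lt_0_compat; lra).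
assert (HPI : 3 < PI) by (assert (H := PI2_3_2); lra).
destruct (cbrt_cube (c * eta) Hce) as [K1 K2]. fold K in K1, K2, HK.
destruct (cbrt_cube (c * eta * PI / 2)) as [X1 X2].
{ assert (0 < c * eta * PI) by (apply Rmult_lt_0_compat; lra). lra. }
fold x in X1, X2.
assert (HX : 1140 <= x).
{ apply Rnot_lt_le. intros Hlt. assert (H1 : x ^ 3 <= 1140 ^ 3) by (apply pow_incr; lra).
  assert (H2 : 1000 ^ 3 <= K ^ 3) by (apply pow_incr; lra). rewrite K2 in H2. rewrite X2 in H1.
  assert (1000 ^ 3 * 3 <= c * eta * PI) by (apply Rmult_le_compat; lra). lra. }
destruct (base_Int_part (/ 10 * x)) as [I1 I2]. fold (echo_mode c eta) in I1, I2. fold x in I1, I2.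
change (Int_part (/ 10 * x)) with k in I1, I2.
assert (Hk114 : (114 <= k)%Z).
{ assert (113 < k)%Z; [|lia]. apply lt_IZR. lra. }
assert (Ek : k = Z.of_nat (Z.to_nat k)) by (rewrite Z2Nat.id; lia).
assert (EI : INR (Z.to_nat k) = IZR k) by (rewrite INR_IZR_INZ, <- Ek; reflexivity).
split; [exact K2|split; [exact X2|split; [lia|split; [exact Ek|split]]]].
- rewrite EI. lra.
- assert (H2 : 1000 ^ 3 <= K ^ 3) by (apply pow_incr; lra). rewrite K2 in H2.
  apply Rnot_lt_le. intros Hlt. assert (c * eta <= 0.001 * 1e12) by (apply Rmult_le_compat; lra).
  assert (c * eta < 1e9); [|lra]. apply Rle_lt_trans with (0.001 * eta); [apply Rmult_le_compat_r; lra|lra].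
Qed.

Lemma echo_ode : ode_sol nu c f eta th G /\ th 0 = delta_seq k /\ G 0 = (fun _ => RtoC 0) /\ growth k th /\ growth k G.
Proof.
destruct echo_numbers as [_ [_ [Hk1 [Hk2 _]]]]. destruct Hst as [Hnu [Hc [Hf1 [Hf2 [Hf3 _]]]]].
destruct (flow_spec nu c f eta Hnu (proj1 Hc) Hf1 Hf2 Hf3 (delta_seq k) (wt 50000 k) 50000 1) as [S1 [S2 [S3 S4]]].
- lra.
- intros; apply wt_pos; lra.
- intros l m Hlm. apply wt_step; [lra|exact Hlm].
- lra.
- unfold delta_seq. destruct (Z.eq_dec 0 k); [exfalso; lia|reflexivity].
- intros l. unfold delta_seq. destruct (Z.eq_dec l k) as [->|]; [rewrite Cmod_1, wt_self; lra|].
  rewrite Cmod_0, Rmult_1_l. left; apply wt_pos; lra.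
- split; [exact S1|split; [exact S2|split; [exact S3|]]].
  assert (Hrate := flow_rate_pos c eta (proj1 Hc) 50000 ltac:(lra)).
  assert (Hmono : forall t T l, 0 <= t <= T -> 13 * 1 * wt 50000 k l * exp (2 * flow_rate c eta 50000 * t) <=
     13 * exp (2 * flow_rate c eta 50000 * T) * wt 50000 k l).
  { intros t T l Ht. assert (Hw := wt_pos 50000 k l ltac:(lra)).
    assert (exp (2 * flow_rate c eta 50000 * t) <= exp (2 * flow_rate c eta 50000 * T)).
    { apply exp_le_mono. apply Rmult_le_compat_l; lra. }
    replace (13 * 1 * wt 50000 k l * exp (2 * flow_rate c eta 50000 * t)) with (13 * wt 50000 k l * exp (2 * flow_rate c eta 50000 * t)) by ring.
    replace (13 * exp (2 * flow_rate c eta 50000 * T) * wt 50000 k l) with (13 * wt 50000 k l * exp (2 * flow_rate c eta 50000 * T)) by ring.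
    apply Rmult_le_compat_l; lra. }
  split; intros T; exists (13 * exp (2 * flow_rate c eta 50000 * T)); (split; [left; apply Rmult_lt_0_compat; [lra|apply exp_pos]|]);
  intros t l Ht; (eapply Rle_trans; [apply S4; lra|apply Hmono, Ht]).
Qed.

(** In A >= 2^n exp K, a factor 2^(n - 2) pays for passing from [lam k] to [lam 2]. The remaining 4
    covers the 2 of the fourth bound, which anticipates the estimate 2 [lam k] for the norm of the
    data. *)
Lemma echo_core : exists A, 0 < A /\
  (forall t, 2 * eta <= t -> 0.9 * A <= Cmod (th t 2%Z) <= 6.2 * A) /\
  (forall t, 0 <= t -> inX lam (th t) /\ normX2 lam (th t) <= 2 * (64 * (lam 2%Z * A)) ^ 2) /\
  (forall t, 2 * eta <= t -> normX lam (th t) + normX lam (G t) <= exp (50 * K) * lam k) /\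
  2 * exp K * lam k <= 0.9 * (lam 2%Z * A) /\
  (forall t l, 2 * eta <= t -> Cmod (th t l) <= 25 * A * wt 4 1 l) /\
  (forall s t l, 2 * eta <= s <= t -> Cmod (Cminus (th t l) (th s l)) <= 2 * A * (eta / s) * wt 4 1 l).
Proof.
destruct echo_numbers as [HK3 [Hx3 [Hk1 [Hk2 [Hkx Heta12]]]]]. destruct echo_ode as [S1 [S2 [S3 [S4 S5]]]].
set (n := Z.to_nat k) in *. assert (Hlam := standing_lam_ok nu c f lam Hst). destruct Hst as [Hnu [Hc [Hf1 [Hf2 [Hf3 _]]]]].
assert (Hprior : forall T, exists M, 0 <= M /\ forall t l, 0 <= t <= T -> Cmod (th t l) <= M * wt 50000 (Z.of_nat n) l /\ Cmod (G t l) <= M * wt 50000 (Z.of_nat n) l).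
{ intros T. destruct (S4 T) as [M1 [HM1 Hb1]]. destruct (S5 T) as [M2 [HM2 Hb2]]. exists (M1 + M2). split; [lra|].
  intros t l Ht. rewrite <- Hk2. specialize (Hb1 t l Ht). specialize (Hb2 t l Ht). assert (Hw := wt_pos 50000 k l ltac:(lra)).
  assert (0 <= M1 * wt 50000 k l) by (apply Rmult_le_pos; lra). assert (0 <= M2 * wt 50000 k l) by (apply Rmult_le_pos; lra). lra. }
rewrite Hk2 in S2.
destruct (chain_final nu c f eta x n th G Hnu Hc Heta12 Hf3 Hx3 Hkx Hk1 S1 S2 S3 Hprior) as [A [HA [[A1 A2] [B1 [B2 [B3 B4]]]]]].
assert (HK0 : 0 <= K) by (unfold K; lra).
assert (HKx : K ^ 3 * PI = 2 * x ^ 3) by (rewrite HK3, Hx3; field).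
assert (L := amplification_lower K x n HK0 HKx Hkx Hk1). assert (U := amplification_upper K x n HK0 HKx Hkx Hk1).
unfold amp_prod in A1, A2.
assert (Hl2 := proj1 Hlam 2%Z). assert (Hlk := proj1 Hlam k). assert (Hl1 := proj1 Hlam 1%Z).
assert (Hl0 : forall l, 0 <= lam l) by (intros l; left; apply Hlam).
assert (HlA : 0 < lam 2%Z * A) by (apply Rmult_lt_0_compat; lra).
exists A. split; [exact HA|split; [exact B1|split; [|split; [|split; [|split]]]]].
- intros t Ht. destruct (B2 lam Hlam t Ht) as [p Hp]. 
  destruct (normX_bound lam (th t) p (64 * (lam 2%Z * A)) Hl0 ltac:(lra) Hp) as [N1 [N2 _]]. split; assumption.
- intros t Ht. 
  assert (Hgen : forall u B, 0 <= B -> (forall l, Cmod (u l) <= B * wt 4 1 l) -> normX lam u <= 2 * (B * lam 1%Z)).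
  { intros u B HB Hu. apply (normX_bound lam u 1 (B * lam 1%Z) Hl0); [apply Rmult_le_pos; lra|].
    intros l. assert (Hw := wt_lam lam 1 l Hlam). apply Rle_trans with (lam l * (B * wt 4 1 l)); [apply Rmult_le_compat_l; [apply Hl0|apply Hu]|].
    replace (lam l * (B * wt 4 1 l)) with (B * (lam l * wt 4 1 l)) by ring. rewrite Rmult_assoc. apply Rmult_le_compat_l; assumption. }
  assert (N1 := Hgen (th t) (25 * A) ltac:(lra) (fun l => proj1 (B3 t l Ht))).
  assert (N2 := Hgen (G t) (26 * A) ltac:(lra) (fun l => proj2 (B3 t l Ht))).
  assert (Hl1k := proj2 Hlam 1%Z k). replace (Z.abs_nat (1 - k)) with (n - 1)%nat in Hl1k by (unfold n; lia).
  assert (E2 : 2 ^ n = 2 * 2 ^ (n - 1)) by (replace n with (S (n - 1)) at 1 by lia; reflexivity).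
  assert (P2 : 0 < 2 ^ (n - 1)) by (apply pow_lt; lra).
  apply Rle_trans with (102 * A * lam 1%Z); [lra|].
  apply Rle_trans with (102 * (1.42 * 6.2 ^ n * (x ^ n / INR (fact n)) ^ 3) * (lam k * 2 ^ (n - 1))).
  + apply Rmult_le_compat; lra.
  + apply Rle_trans with (200 * 6.2 ^ n * (x ^ n / INR (fact n)) ^ 3 * 2 ^ n * lam k); [|apply Rmult_le_compat_r; lra].
    rewrite E2. assert (0 <= 6.2 ^ n * (x ^ n / INR (fact n)) ^ 3) by lra.
    assert (0 <= lam k * 2 ^ (n - 1)) by (apply Rmult_le_pos; lra).
    assert (0 <= 6.2 ^ n * (x ^ n / INR (fact n)) ^ 3 * (lam k * 2 ^ (n - 1))) by (apply Rmult_le_pos; lra). lra.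
- assert (Hlk2 := proj2 Hlam k 2%Z). replace (Z.abs_nat (k - 2)) with (n - 2)%nat in Hlk2 by (unfold n; lia).
  assert (E2 : 2 ^ n = 4 * 2 ^ (n - 2)) by (replace n with (S (S (n - 2))) at 1 by lia; simpl; ring).
  assert (He := exp_pos K).
  apply Rle_trans with (2 * exp K * (lam 2%Z * 2 ^ (n - 2))); [apply Rmult_le_compat_l; lra|].
  assert (lam 2%Z * (exp K * 2 ^ n) <= lam 2%Z * A) by (apply Rmult_le_compat_l; lra). rewrite E2 in *. lra.
- intros t l Ht. apply (B3 t l Ht).
- exact B4.
Qed.

End Echo.

(** * Limits and norm inflation *)

Definition seq_limit (u : nat -> C) : C :=
  (real (Lim_seq (fun n => Re (u n))), real (Lim_seq (fun n => Im (u n)))).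

Lemma lim_seq_rate (u : nat -> R) (B : R) (N : nat) : 0 <= B ->
  (forall m n, (S N <= m <= n)%nat -> Rabs (u n - u m) <= B / INR m) ->
  is_lim_seq u (real (Lim_seq u)).
Proof.
intros HB Hu.
assert (Hc : ex_lim_seq_cauchy u).
{ intros eps.
  destruct (nfloor_ex (2 * B / eps)) as [q [_ Hq]].
  { apply Rdiv_le_0_compat; [lra|apply eps]. }
  set (M := (S N + S q)%nat). exists M.
  assert (HM0 : 0 < INR M) by (apply lt_0_INR; unfold M; lia).
  assert (HMq : INR q + 1 <= INR M) by (rewrite <- S_INR; apply le_INR; unfold M; lia).
  assert (HBM : 2 * (B / INR M) < eps).
  { apply Rmult_lt_reg_r with (INR M / eps); [apply Rdiv_lt_0_compat; [exact HM0|apply eps]|].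
    replace (2 * (B / INR M) * (INR M / eps)) with (2 * B / eps) by (field; split; [apply Rgt_not_eq, eps|lra]).
    replace (eps * (INR M / eps)) with (INR M) by (field; apply Rgt_not_eq, eps). lra. }
  intros n m Hn Hm.
  assert (H1 := Hu M n ltac:(unfold M in *; lia)). assert (H2 := Hu M m ltac:(unfold M in *; lia)).
  replace (u n - u m) with ((u n - u M) - (u m - u M)) by ring.
  eapply Rle_lt_trans; [apply Rabs_triang|]. rewrite Rabs_Ropp. lra. }
apply ex_lim_seq_cauchy_corr in Hc. destruct Hc as [l Hl]. rewrite (is_lim_seq_unique _ _ Hl). exact Hl.
Qed.

Lemma seq_limit_rate (u : nat -> C) (z : C) (B X : R) (N : nat) : 0 <= B ->
  (forall m n, (S N <= m <= n)%nat -> Cmod (Cminus (u n) (u m)) <= B / INR m) ->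
  (forall n, (S N <= n)%nat -> Cmod (Cminus (u n) z) <= X) ->
  Cmod (Cminus (seq_limit u) z) <= 2 * X /\
  is_lim_seq (fun n => Re (u n)) (Re (seq_limit u)) /\ is_lim_seq (fun n => Im (u n)) (Im (seq_limit u)).
Proof.
intros HB Hu Hz.
assert (H1 : is_lim_seq (fun n => Re (u n)) (Re (seq_limit u))).
{ apply (lim_seq_rate _ B N HB). intros m n Hmn. eapply Rle_trans; [|apply Hu, Hmn]. apply (Re_le_Cmod (Cminus (u n) (u m))). }
assert (H2 : is_lim_seq (fun n => Im (u n)) (Im (seq_limit u))).
{ apply (lim_seq_rate _ B N HB). intros m n Hmn. eapply Rle_trans; [|apply Hu, Hmn]. apply (Im_le_Cmod (Cminus (u n) (u m))). }
split; [|split; assumption].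
assert (Hpass : forall (v : nat -> R) (l y : R), is_lim_seq v l -> (forall n, (S N <= n)%nat -> Rabs (v n - y) <= X) -> Rabs (l - y) <= X).
{ intros v l y Hv Hb.
  assert (L : is_lim_seq (fun n => Rabs (v n - y)) (Rabs (l - y))).
  { apply (is_lim_seq_abs _ (Finite (l - y))). apply (is_lim_seq_minus' v (fun _ => y)); [exact Hv|apply is_lim_seq_const]. }
  apply (is_lim_seq_le_loc (fun n => Rabs (v n - y)) (fun _ => X) (Finite (Rabs (l - y))) (Finite X)); [|exact L|apply is_lim_seq_const].
  exists (S N). exact Hb. }
eapply Rle_trans; [apply Cmod_le_abs|]. replace (2 * X) with (X + X) by ring. apply Rplus_le_compat.
- apply (Hpass _ _ (Re z) H1). intros n Hn. eapply Rle_trans; [|apply Hz, Hn]. apply (Re_le_Cmod (Cminus (u n) z)).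
- apply (Hpass _ _ (Im z) H2). intros n Hn. eapply Rle_trans; [|apply Hz, Hn]. apply (Im_le_Cmod (Cminus (u n) z)).
Qed.

(** Taken along integer times, so that it is a countable limit of measurable functions of eta; the
    rate O(eta / s) extends the convergence to all times. *)
Definition echo_limit (nu c : R) (f : R -> R) (eta : R) (l : Z) : C :=
  seq_limit (fun n => echo_theta nu c f eta (INR n) l).

Section EchoLimit.
Variables (nu c : R) (f : R -> R) (lam : Z -> R) (eta A : R).
Hypothesis Hst : standing nu c f lam.
Hypothesis Heta : 0 < eta.
Hypothesis HA : 0 < A.
Let th := echo_theta nu c f eta.
Let v := echo_limit nu c f eta.
Hypothesis Hrate : forall s t l, 2 * eta <= s <= t -> Cmod (Cminus (th t l) (th s l)) <= 2 * A * (eta / s) * wt 4 1 l.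

Lemma echo_limit_rate l :
  (forall s, 2 * eta <= s -> Cmod (Cminus (v l) (th s l)) <= 4 * A * (eta / s) * wt 4 1 l) /\
  is_lim_seq (fun n => Re (th (INR n) l)) (Re (v l)) /\ is_lim_seq (fun n => Im (th (INR n) l)) (Im (v l)).
Proof.
assert (Hw := wt_pos 4 1 l ltac:(lra)). assert (HAw : 0 < A * wt 4 1 l) by (apply Rmult_lt_0_compat; lra).
assert (Hmain : forall s, 2 * eta <= s -> 
  Cmod (Cminus (v l) (th s l)) <= 2 * (2 * A * (eta / s) * wt 4 1 l) /\
  is_lim_seq (fun n => Re (th (INR n) l)) (Re (v l)) /\ is_lim_seq (fun n => Im (th (INR n) l)) (Im (v l))).
{ intros s Hs. destruct (nfloor_ex s ltac:(lra)) as [N [_ HN]].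
  apply (seq_limit_rate (fun n => th (INR n) l) (th s l) (2 * eta * (A * wt 4 1 l)) _ N).
  - apply Rmult_le_pos; lra.
  - intros m n Hmn. 
    assert (Hm : INR N + 1 <= INR m) by (rewrite <- S_INR; apply le_INR; lia). assert (Hn : INR m <= INR n) by (apply le_INR; lia).
    eapply Rle_trans; [apply Hrate; lra|]. right. field. lra.
  - intros n Hn. assert (Hm : INR N + 1 <= INR n) by (rewrite <- S_INR; apply le_INR; lia). apply Hrate; lra. }
split; [|apply (Hmain (2 * eta)); lra].
intros s Hs. destruct (Hmain s Hs) as [H _]. lra.
Qed.

Lemma echo_limit_diff t : 2 * eta <= t ->
  inX lam (diffseq (th t) v) /\ normX2 lam (diffseq (th t) v) <= 2 * (4 * A * (eta / t) * lam 1%Z) ^ 2 /\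
  normX lam (diffseq (th t) v) <= 8 * A * (eta / t) * lam 1%Z.
Proof.
intros Ht. assert (Hlam := standing_lam_ok nu c f lam Hst). assert (Hl0 : forall l, 0 <= lam l) by (intros l; left; apply Hlam).
assert (Het : 0 < eta / t) by (apply Rdiv_lt_0_compat; lra).
assert (HB : 0 <= 4 * A * (eta / t)) by (apply Rmult_le_pos; lra).
destruct (normX_bound lam (diffseq (th t) v) 1 (4 * A * (eta / t) * lam 1%Z) Hl0) as [N1 [N2 N3]].
- apply Rmult_le_pos; [exact HB|apply Hl0].
- intros l. unfold diffseq. destruct (echo_limit_rate l) as [R1 _]. specialize (R1 t Ht).
  replace (Cmod (Cminus (th t l) (v l))) with (Cmod (Cminus (v l) (th t l))).
  2: { rewrite <- Cmod_opp. f_equal. unfold Cminus. ring. }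
  assert (Hw := wt_lam lam 1 l Hlam).
  apply Rle_trans with (lam l * (4 * A * (eta / t) * wt 4 1 l)); [apply Rmult_le_compat_l; [apply Hl0|exact R1]|].
  replace (lam l * (4 * A * (eta / t) * wt 4 1 l)) with (4 * A * (eta / t) * (lam l * wt 4 1 l)) by ring.
  replace (4 * A * (eta / t) * lam 1%Z * wt 2 1 l) with (4 * A * (eta / t) * (lam 1%Z * wt 2 1 l)) by ring.
  apply Rmult_le_compat_l; assumption.
- split; [exact N1|split; [exact N2|]]. lra.
Qed.

Hypothesis Hfinal : forall t l, 2 * eta <= t -> Cmod (th t l) <= 25 * A * wt 4 1 l.

Lemma echo_limit_inX : inX lam v /\ normX2 lam v <= 2 * (27 * A * lam 1%Z) ^ 2.
Proof.
assert (Hlam := standing_lam_ok nu c f lam Hst). assert (Hl0 : forall l, 0 <= lam l) by (intros l; left; apply Hlam).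
destruct (normX_bound lam v 1 (27 * A * lam 1%Z) Hl0) as [N1 [N2 _]]; [|intros l|split; assumption].
- apply Rmult_le_pos; [lra|apply Hl0].
- destruct (echo_limit_rate l) as [R1 _]. specialize (R1 (2 * eta) ltac:(lra)). assert (F := Hfinal (2 * eta) l ltac:(lra)).
  replace (eta / (2 * eta)) with (/ 2) in R1 by (field; lra).
  assert (Hw := wt_lam lam 1 l Hlam). assert (Hw1 := wt_pos 4 1 l ltac:(lra)).
  assert (T := Cmod_triangle (Cminus (v l) (th (2 * eta) l)) (th (2 * eta) l)).
  replace (Cplus (Cminus (v l) (th (2 * eta) l)) (th (2 * eta) l)) with (v l) in T by (unfold Cminus; ring).
  assert (Hv : Cmod (v l) <= 27 * A * wt 4 1 l) by lra.
  apply Rle_trans with (lam l * (27 * A * wt 4 1 l)); [apply Rmult_le_compat_l; [apply Hl0|exact Hv]|].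
  replace (lam l * (27 * A * wt 4 1 l)) with (27 * A * (lam l * wt 4 1 l)) by ring.
  replace (27 * A * lam 1%Z * wt 2 1 l) with (27 * A * (lam 1%Z * wt 2 1 l)) by ring.
  apply Rmult_le_compat_l; lra.
Qed.

Lemma echo_X_converges : X_converges lam th.
Proof.
exists v. split; [apply echo_limit_inX|].
assert (Hlam := standing_lam_ok nu c f lam Hst). assert (Hl1 := proj1 Hlam 1%Z).
apply is_lim_spec. intros eps. 
set (B := 8 * A * eta * lam 1%Z). assert (HB : 0 < B) by (unfold B; apply Rmult_lt_0_compat; [apply Rmult_lt_0_compat; lra|exact Hl1]).
exists (2 * eta + B / eps). intros t Ht.
assert (Hpe : 0 < B / eps) by (apply Rdiv_lt_0_compat; [exact HB|apply eps]).
destruct (echo_limit_diff t ltac:(lra)) as [_ [_ N]].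
rewrite Rminus_0_r, Rabs_pos_eq by apply sqrt_pos.
eapply Rle_lt_trans; [exact N|]. replace (8 * A * (eta / t) * lam 1%Z) with (B / t) by (unfold B; field; lra).
apply Rmult_lt_reg_r with t; [lra|]. unfold Rdiv. rewrite Rmult_assoc, Rinv_l, Rmult_1_r by lra.
apply Rmult_lt_reg_l with (/ eps); [apply Rinv_0_lt_compat, eps|].
rewrite <- Rmult_assoc, Rinv_l, Rmult_1_l by (apply Rgt_not_eq, eps). unfold Rdiv in Ht, Hpe. lra.
Qed.

End EchoLimit.

Lemma threshold_1000 nu c eta : cbrt (c * eta) > 1000 * Rmax (/ sqrt nu) 1 -> 1000 <= cbrt (c * eta).
Proof. intros H. assert (H1 := Rmax_r (/ sqrt nu) 1). lra. Qed.

Lemma normX2_delta lam k : lam_ok lam -> inX lam (delta_seq k) /\ normX2 lam (delta_seq k) <= 2 * lam k ^ 2 /\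
  lam k <= normX lam (delta_seq k) <= 2 * lam k.
Proof.
intros Hlam. assert (Hl0 : forall l, 0 <= lam l) by (intros l; left; apply Hlam).
destruct (normX_bound lam (delta_seq k) k (lam k) Hl0 (Hl0 k)) as [N1 [N2 N3]].
- intros l. unfold delta_seq. destruct (Z.eq_dec l k) as [->|]; [rewrite Cmod_1, wt_self; lra|].
  rewrite Cmod_0, Rmult_0_r. apply Rmult_le_pos; [apply Hl0|left; apply wt_pos; lra].
- split; [exact N1|split; [exact N2|split; [|exact N3]]].
  assert (H := normX_term lam (delta_seq k) k N1 (Hl0 k)). unfold delta_seq at 1 in H.
  destruct (Z.eq_dec k k); [|contradiction]. rewrite Cmod_1, Rmult_1_r in H. exact H.
Qed.

Lemma echo_chain_norm_inflation (nu c : R) (f : R -> R) (lam : Z -> R) (Hst : standing nu c f lam) (eta : R) :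
  0 < eta -> cbrt (c * eta) > 1000 * Rmax (/ sqrt nu) 1 ->
  let k2 : Z := Int_part (/ 10 * cbrt (c * eta * PI / 2)) in
  (exists th G : R -> Z -> C, is_solution nu c f lam eta th G /\ th 0 = delta_seq k2 /\ G 0 = (fun _ => RtoC 0)) /\
  (forall th G : R -> Z -> C, is_solution nu c f lam eta th G -> th 0 = delta_seq k2 -> G 0 = (fun _ => RtoC 0) ->
     (forall t, t > 2 * eta ->
        exp (cbrt (c * eta)) * normX lam (th 0) <= normX lam (th t) /\
        normX lam (th t) <= normX lam (th t) + normX lam (G t) /\
        normX lam (th t) + normX lam (G t) <= exp (50 * cbrt (c * eta)) * normX lam (th 0)) /\
     X_converges lam th).
Proof.
intros Heta Hthr k2. assert (HK := threshold_1000 nu c eta Hthr).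
change k2 with (echo_mode c eta). set (k := echo_mode c eta).
destruct (echo_ode nu c f lam eta Hst Heta HK) as [S1 [S2 [S3 [S4 S5]]]]. fold k in S2, S4, S5.
destruct (echo_core nu c f lam eta Hst Heta HK) as [A [HA [C1 [C2 [C3 [C4 [C5 C6]]]]]]]. fold k in C3, C4.
assert (Hlam := standing_lam_ok nu c f lam Hst).
split.
{ exists (echo_theta nu c f eta), (echo_G nu c f eta). split; [|split; assumption].
  apply (is_solution_of_ode nu c f lam Hst eta k); assumption. }
intros th G Hs E1 E2.
assert (Hun := solution_unique nu c f lam Hst eta k th G _ _ Hs S1 S4 S5 ltac:(congruence) ltac:(congruence)).
destruct (normX2_delta lam k Hlam) as [_ [_ [D1 D2]]]. rewrite E1. split.
- intros t Ht. destruct (Hun t ltac:(lra)) as [-> ->]. split; [|split].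
  + assert (He := exp_pos (cbrt (c * eta))). destruct (C1 t ltac:(lra)) as [L _]. destruct (C2 t ltac:(lra)) as [I _].
    assert (Hl2 := proj1 Hlam 2%Z).
    assert (N := normX_term lam _ 2%Z I (Rlt_le _ _ Hl2)).
    assert (lam 2%Z * (0.9 * A) <= lam 2%Z * Cmod (echo_theta nu c f eta t 2%Z)) by (apply Rmult_le_compat_l; lra).
    assert (exp (cbrt (c * eta)) * normX lam (delta_seq k) <= exp (cbrt (c * eta)) * (2 * lam k)) by (apply Rmult_le_compat_l; lra). lra.
  + assert (0 <= normX lam (echo_G nu c f eta t)) by apply sqrt_pos. lra.
  + eapply Rle_trans; [apply C3; lra|]. apply Rmult_le_compat_l; [left; apply exp_pos|exact D1].
- destruct (echo_X_converges nu c f lam eta A Hst Heta HA C6 C5) as [v [Hv Hlim]]. exists v. split; [exact Hv|].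
  apply (is_lim_ext_loc (fun t => normX lam (diffseq (echo_theta nu c f eta t) v))); [|exact Hlim].
  exists 0. intros t Ht. destruct (Hun t ltac:(lra)) as [-> _]. reflexivity.
Qed.

(** * Measurability and integration *)

Lemma Rpower_neg_vanishes (B d e : R) : 0 <= B -> 0 < d -> 0 < e ->
  exists M, 0 < M /\ forall x, M < x -> B * Rpower x (- d) < e.
Proof.
intros HB Hd He. set (q := (B + 1) / e).
assert (Hq : 0 < q) by (apply Rdiv_lt_0_compat; lra).
exists (Rpower q (/ d)). split; [apply exp_pos|]. intros x Hx.
assert (H := Rlt_Rpower_l (Rpower q (/ d)) x d Hd (conj (exp_pos _) Hx)).
rewrite Rpower_mult, Rinv_l, Rpower_1 in H by lra.
assert (Hp : 0 < Rpower x d) by apply exp_pos.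
rewrite Rpower_Ropp. apply Rmult_lt_reg_r with (Rpower x d); [exact Hp|].
rewrite Rmult_assoc, Rinv_l, Rmult_1_r by lra.
apply Rlt_le_trans with (q * e); [unfold q; replace ((B + 1) / e * e) with (B + 1) by (field; lra); lra|].
rewrite (Rmult_comm e). apply Rmult_le_compat_r; lra.
Qed.

Module MeasureBridge.
From mathcomp Require Import all_boot all_order all_algebra.
From mathcomp Require Import all_classical all_reals all_analysis.
From mathcomp Require Import measurable_realfun Rstruct Rstruct_topology.
Local Open Scope classical_set_scope.
Import Order.TTheory GRing.Theory Num.Theory numFieldNormedType.Exports.

Lemma measR_const (a : R) : measR (fun _ => a).
Proof. exact: measurable_cst. Qed.

Lemma measR_plus (F G : R -> R) : measR F -> measR G -> measR (fun x => Rplus (F x) (G x)).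
Proof. move=> mF mG; exact: (@measurable_funD _ RR RR setT F G mF mG). Qed.

Lemma measR_mult (F G : R -> R) : measR F -> measR G -> measR (fun x => Rmult (F x) (G x)).
Proof. move=> mF mG; exact: (@measurable_funM _ RR RR setT F G mF mG). Qed.

Lemma measR_continuous (F : R -> R) : (forall x, continuity_pt F x) -> measR F.
Proof.
move=> cF; apply: (@continuous_measurable_fun RR F) => x; exact/(continuity_pt_cvg F x)/cF.
Qed.

Lemma measR_lim (h : nat -> R -> R) (F : R -> R) :
  (forall n, measR (h n)) -> (forall x, is_lim_seq (fun n => h n x) (Rbar.Finite (F x))) -> measR F.
Proof.
move=> mh hF; apply: (@measurable_fun_cvg _ RR RR setT h F mh) => x _.
apply/cvgrPdist_lt => e /RltP e0.
have /is_lim_seq_Reals/(_ e e0) [N HN] := hF x.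
exists N => // n /= Nn.
rewrite distrC; apply/RltP; rewrite -RdistE; apply: HN; exact/ssrnat.leP.
Qed.

Lemma measR_ite (a : R) (g F G : R -> R) : measR g -> measR F -> measR G ->
  measR (fun x => match Rle_dec a (g x) with left _ => F x | right _ => G x end).
Proof.
move=> mg mF mG.
have -> : (fun x => match Rle_dec a (g x) with left _ => F x | right _ => G x end) = (fun x => if (a <= g x)%R then F x else G x).
  by apply: funext => x; case: Rle_dec => H; [rewrite (introT RleP H) | rewrite (introF RleP H)].
apply: (@measurable_fun_ifT _ _ RR RR F G) => //.
exact: (@measurable_fun_ler _ RR RR setT).
Qed.

Lemma measR_exp (F : R -> R) : measR F -> measR (fun x => Rtrigo_def.exp (F x)).
Proof.
move=> mF.
have -> : (fun x => Rtrigo_def.exp (F x)) = (fun x => expR (F x)) by apply: funext => x; rewrite RexpE.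
exact: (measurableT_comp (@measurable_expR RR) (mF : measurable_fun [set: RR] (F : RR -> RR))).
Qed.

Lemma measR_ln (F : R -> R) : measR F -> measR (fun x => Rpower.ln (F x)).
Proof.
move=> mF.
have -> : (fun x => Rpower.ln (F x)) = (fun x => exp.ln (F x)) by apply: funext => x; rewrite RlnE.
exact: (measurableT_comp (@measurable_ln RR) (mF : measurable_fun [set: RR] (F : RR -> RR))).
Qed.

(** For nonnegative functions the integral is a supremum over simple functions below them, hence
    monotone without measurability. Only the explicit majorants and minorants are ever
    integrated. *)
Lemma intR_mono (F G : R -> R) : (forall x, Rle 0 (F x)) -> (forall x, Rle (F x) (G x)) -> (intR F <= intR G)%E.
Proof.
move=> F0 FG; rewrite /intR.
have HF (x : RR) : (0 <= (F x)%:E)%E by rewrite lee_fin; exact/RleP.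
have HG (x : RR) : (0 <= (G x)%:E)%E by rewrite lee_fin; apply/RleP; exact: Rle_trans (F0 x) (FG x).
rewrite !ge0_integralTE //; apply: ereal_sup_le => _ [h hF <-].
exists h => // x; apply: le_trans (hF x) _; rewrite lee_fin; exact/RleP.
Qed.

Lemma int_lt_mono (F G : R -> R) (e : R) :
  (forall x, Rle 0 (F x)) -> (forall x, Rle (F x) (G x)) -> int_lt G e -> int_lt F e.
Proof. by move=> F0 FG; apply: le_lt_trans; exact: intR_mono. Qed.

Lemma int_finite_of_lt (F : R -> R) (e : R) : int_lt F e -> int_finite F.
Proof. by move=> H; apply: lt_trans H _; rewrite ltry. Qed.

Lemma int_gt_mono (F G : R -> R) (M : R) :
  (forall x, Rle 0 (F x)) -> (forall x, Rle (F x) (G x)) -> int_gt F M -> int_gt G M.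
Proof. by move=> F0 FG H; apply: lt_le_trans H _; exact: intR_mono. Qed.

Lemma Rpower_powR (x y : R) : Rlt 0 x -> Rpower x y = (x `^ y)%R.
Proof. by move=> /RltP x0; rewrite /Rpower RexpE RlnE /powR gt_eqF. Qed.

Lemma int_power_tail (a d B e : R) : Rlt 0 a -> Rlt 0 d -> Rle 0 B ->
  Rlt (Rmult B (Rdiv (Rpower a (Ropp d)) d)) e ->
  int_lt (fun x => match Rle_dec a x with left _ => Rmult B (Rpower x (Rminus (Ropp 1) d)) | right _ => 0 end) e.
Proof.
move=> a0 d0 B0 He; rewrite /int_lt /intR.
have -> : (fun x : RR => (match Rle_dec a x with left _ => Rmult B (Rpower x (Rminus (Ropp 1) d)) | right _ => 0 end)%:E) =
  ((fun x : RR => (B * x `^ (- 1 - d))%:E) \_ (`[a, +oo[%classic))%R.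
  apply: funext => x; rewrite patchE; case: Rle_dec => H.
  - rewrite mem_set /= ?in_itv /= ?andbT; last exact/RleP.
    by rewrite Rpower_powR //; exact: Rlt_le_trans H.
  - rewrite memNset //= in_itv /= andbT; by move/RleP.
rewrite -integral_mkcond.
have a0' : (0 < a)%R by exact/RltP.
have d0' : (0 < d)%R by exact/RltP.
have B0' : (0 <= B)%R by exact/RleP.
have pos (x : RR) : (a <= x)%R -> (0 < x)%R by apply: lt_le_trans.
have der (x : RR) : (0 < x)%R -> derivable (fun x : RR => - (B / d) * x `^ (- d) : RR)%R x 1%R.
  by move=> x0; apply: derivableM => //; apply: derivable_powR; rewrite in_itv /= andbT.
have cont (x : RR) : (0 < x)%R -> {for x, continuous (fun x : RR => - (B / d) * x `^ (- d) : RR)%R}.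
  by move=> x0; apply: differentiable_continuous; apply/derivable1_diffP; exact: der.
rewrite (@ge0_continuous_FTC2y RR (fun x => B * x `^ (- 1 - d))%R (fun x => - (B / d) * x `^ (- d))%R a 0%R).
- rewrite -EFinB lte_fin sub0r mulNr opprK. apply/RltP; apply: Rle_lt_trans He; apply/RleP.
  by rewrite Rpower_powR // RdivE RmultE mulrAC mulrA.
- by move=> x ax; rewrite mulr_ge0 // powR_ge0.
- apply: derivable_within_continuous => x; rewrite in_itv /= andbT => ax.
  apply: derivableM => //; apply: derivable_powR; by rewrite in_itv /= andbT pos.
- apply/cvgrPdist_lt => e' /RltP e0.
  have Bd : Rle 0 (Rdiv B d) by apply: Rdiv_le_0_compat.
  have [M [M0 HM]] := Rpower_neg_vanishes _ _ _ Bd d0 e0.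
  exists M; split; first exact: num_real.
  move=> x /RltP Mx; rewrite sub0r mulNr opprK ger0_norm; last by rewrite mulr_ge0 ?powR_ge0 ?divr_ge0 // ltW.
  apply/RltP; rewrite -Rpower_powR; last exact: Rlt_trans Mx.
  exact: HM.
- by move=> x ax; apply: der; rewrite pos // ltW.
- apply: cvg_at_right_filter; exact: cont.
- move=> x; rewrite in_itv /= andbT => ax.
  have x0 : (0 < x)%R by apply: pos; exact: ltW.
  rewrite derive1Ml; last by apply: derivable_powR; rewrite in_itv /= andbT.
  rewrite powR_derive1 ?in_itv /= ?andbT // mulNr mulrA mulrN mulNr opprK divfK ?gt_eqF //.
  by rewrite addrC.
Qed.

Lemma int_reciprocal_log (a b B M : R) : Rlt 0 a -> Rlt a b -> Rle 0 B ->
  Rlt M (Rmult B (Rminus (Rpower.ln b) (Rpower.ln a))) ->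
  int_gt (fun x => match Rle_dec a x with left _ => match Rle_dec x b with left _ => Rdiv B x | right _ => 0 end | right _ => 0 end) M.
Proof.
move=> a0 ab B0 HM; rewrite /int_gt /intR.
have -> : (fun x : RR => (match Rle_dec a x with left _ => match Rle_dec x b with left _ => Rdiv B x | right _ => 0 end | right _ => 0 end)%:E) =
  ((fun x : RR => (B * x^-1)%:E) \_ (`[a, b]%classic))%R.
  apply: funext => x; rewrite patchE; case: Rle_dec => H; [case: Rle_dec => H'|].
  - by rewrite mem_set //= in_itv /=; apply/andP; split; apply/RleP.
  - by rewrite memNset //= in_itv /= => /andP[_ /RleP].
  - by rewrite memNset //= in_itv /= => /andP[/RleP].
rewrite -integral_mkcond.
have a0' : (0 < a)%R by exact/RltP.
have ab' : (a < b)%R by exact/RltP.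
have der (x : RR) : (0 < x)%R -> derivable (fun x : RR => B * exp.ln x : RR)%R x 1%R.
  by move=> x0; apply: derivableM => //; apply: ex_derive; exact: is_derive1_ln.
have cont (x : RR) : (0 < x)%R -> {for x, continuous (fun x : RR => B * exp.ln x : RR)%R}.
  by move=> x0; apply: differentiable_continuous; apply/derivable1_diffP; exact: der.
rewrite (@continuous_FTC2 RR (fun x => B * x^-1)%R (fun x => B * exp.ln x)%R a b) //.
- rewrite -EFinB lte_fin -mulrBr -!RlnE; exact/RltP.
- apply: continuous_in_subspaceT => x /set_mem /=; rewrite in_itv /= => /andP[ax _].
  apply: continuousM; first exact: cvg_cst. apply: inv_continuous; rewrite gt_eqF //; exact: lt_le_trans ax.
- split.
  + move=> x; rewrite in_itv /= => /andP[ax _]; apply: der; exact: lt_trans ax.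
  + apply: cvg_at_right_filter; exact: cont.
  + apply: cvg_at_left_filter; apply: cont; exact: lt_trans ab'.
- move=> x; rewrite in_itv /= => /andP[ax _].
  have x0 : (0 < x)%R by exact: lt_trans ax.
  have D := is_derive1_ln x0.
  rewrite derive1Ml; last by apply: ex_derive.
  by rewrite derive1E derive_val.
Qed.
End MeasureBridge.

Import MeasureBridge.

Opaque measR.

Lemma measR_ext (F G : R -> R) : (forall x, F x = G x) -> measR F -> measR G.
Proof. intros H HF. replace G with F; [exact HF|]. apply functional_extensionality, H. Qed.

Lemma measR_smooth (F : R -> R) : (forall x, ex_derive F x) -> measR F.
Proof.
intros H. apply measR_continuous. intros x. apply continuity_pt_filterlim.
apply (ex_derive_continuous (K := R_AbsRing) (V := R_NormedModule)), H.
Qed.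

Lemma measR_minus (F G : R -> R) : measR F -> measR G -> measR (fun x => F x - G x).
Proof.
intros HF HG. apply (measR_ext (fun x => F x + (-1) * G x)); [intros; ring|].
apply measR_plus; [exact HF|]. apply measR_mult; [apply measR_const|exact HG].
Qed.

Lemma measR_Riemann_sum (g : R -> R -> R) (p : SF_seq) : (forall s, measR (fun x => g x s)) ->
  measR (fun x => Riemann_sum (V := R_NormedModule) (g x) p).
Proof.
intros Hg. induction p as [s|h p IH] using SF_cons_ind.
- apply (measR_ext (fun _ => 0)); [reflexivity|apply measR_const].
- apply (measR_ext (fun x => (SF_h p - fst h) * g x (snd h) + Riemann_sum (V := R_NormedModule) (g x) p)).
  + intros x. rewrite (Riemann_sum_cons (V := R_NormedModule)). reflexivity.
  + apply measR_plus; [|exact IH]. apply measR_mult; [apply measR_const|apply Hg].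
Qed.

(** The integral is the limit of Riemann sums over uniform partitions, each a finite combination of
    measurable functions of the parameter; no joint measurability is involved. *)
Lemma measR_RInt (g : R -> R -> R) (a b : R) : a <= b ->
  (forall s, measR (fun x => g x s)) -> (forall x s, continuous (g x) s) -> measR (fun x => RInt (g x) a b).
Proof.
intros Hab Hm Hc. destruct Hab as [Hab|<-].
2: { apply (measR_ext (fun _ => 0)); [|apply measR_const]. intros x. symmetry. apply (RInt_point (V := R_CompleteNormedModule)). }
set (p := fun n => SF_seq_f2 (fun x y : R => x) (unif_part a b n)).
apply (measR_lim (fun n x => Riemann_sum (V := R_NormedModule) (g x) (p n))); [intros n; apply measR_Riemann_sum, Hm|].
intros x. assert (HI := RInt_correct (V := R_CompleteNormedModule) (g x) a b (ex_RInt_cont _ a b (Hc x))).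
unfold is_RInt in HI.
apply (is_lim_seq_ext (fun n => scal (V := R_NormedModule) (sign (b - a)) (Riemann_sum (V := R_NormedModule) (g x) (p n)))).
{ intros n. rewrite sign_eq_1 by lra. apply (scal_one (K := R_Ring) (V := R_ModuleSpace)). }
apply (filterlim_comp _ _ _ p (fun q => scal (V := R_NormedModule) (sign (b - a)) (Riemann_sum (V := R_NormedModule) (g x) q))
  eventually (Riemann_fine a b) (locally (RInt (g x) a b))); [|exact HI].
intros P [eps HP]. destruct (nfloor_ex ((b - a) / eps)) as [N [_ HN]].
{ apply Rdiv_le_0_compat; [lra|apply eps]. }
exists N. intros n Hn.
destruct (Riemann_fine_unif_part (fun x y : R => x) a b n (fun u v H => conj (Rle_refl u) H) (Rlt_le _ _ Hab)) as [R1 [R2 [R3 R4]]].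
apply HP.
- eapply Rle_lt_trans; [exact R1|]. assert (HnN : INR N <= INR n) by (apply le_INR; lia).
  assert (0 <= INR N) by apply pos_INR. apply Rmult_lt_reg_r with ((INR n + 1) / eps).
  { apply Rdiv_lt_0_compat; [lra|apply eps]. }
  replace ((b - a) / (INR n + 1) * ((INR n + 1) / eps)) with ((b - a) / eps) by (field; split; [apply Rgt_not_eq, eps|lra]).
  replace (eps * ((INR n + 1) / eps)) with (INR n + 1) by (field; apply Rgt_not_eq, eps). lra.
- rewrite Rmin_left, Rmax_right by lra. split; [exact R2|split; [exact R3|exact R4]].
Qed.

Definition measC (F : R -> C) : Prop := measR (fun x => Re (F x)) /\ measR (fun x => Im (F x)).

Lemma measC_ext (F G : R -> C) : (forall x, F x = G x) -> measC F -> measC G.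
Proof. intros H HF. replace G with F; [exact HF|]. apply functional_extensionality, H. Qed.

Lemma measC_pair (F G : R -> R) : measR F -> measR G -> measC (fun x => (F x, G x)).
Proof. intros HF HG. split; [apply (measR_ext F)|apply (measR_ext G)]; auto. Qed.

Lemma measC_RtoC (F : R -> R) : measR F -> measC (fun x => RtoC (F x)).
Proof. intros H. apply measC_pair; [exact H|apply measR_const]. Qed.

Lemma measC_plus (F G : R -> C) : measC F -> measC G -> measC (fun x => Cplus (F x) (G x)).
Proof. intros [F1 F2] [G1 G2]. apply measC_pair; apply measR_plus; assumption. Qed.

Lemma measC_mult (F G : R -> C) : measC F -> measC G -> measC (fun x => Cmult (F x) (G x)).
Proof.
intros [F1 F2] [G1 G2]. apply measC_pair.
- apply measR_minus; apply measR_mult; assumption.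
- apply measR_plus; apply measR_mult; assumption.
Qed.

Lemma measC_CInt (u : R -> R -> C) (a b : R) : a <= b ->
  (forall s, measC (fun x => u x s)) -> (forall x s, continuous (u x) s) -> measC (fun x => CInt (u x) a b).
Proof.
intros Hab Hm Hc. apply measC_pair; apply (measR_RInt _ a b Hab).
- intros s; exact (proj1 (Hm s)).
- intros x s. apply continuous_Re, Hc.
- intros s; exact (proj2 (Hm s)).
- intros x s. apply continuous_Im, Hc.
Qed.

Lemma measR_id : measR (fun x => x).
Proof. apply measR_smooth. intros x. auto_derive. exact Logic.I. Qed.

Lemma measC_ite (a : R) (F G : R -> C) : measC F -> measC G -> measC (fun x => if Rle_dec a x then F x else G x).
Proof.
intros [F1 F2] [G1 G2]. 
apply (measC_ext (fun x => (if Rle_dec a x then Re (F x) else Re (G x), if Rle_dec a x then Im (F x) else Im (G x)))).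
{ intros x. destruct (Rle_dec a x); symmetry; apply surjective_pairing. }
apply measC_pair; apply (measR_ite a (fun x => x)); auto; apply measR_id.
Qed.

Lemma measR_Rpower (F : R -> R) y : measR F -> measR (fun x => Rpower (F x) y).
Proof.
intros HF. apply (measR_ext (fun x => exp (y * ln (F x)))); [reflexivity|].
apply measR_exp, measR_mult; [apply measR_const|apply measR_ln, HF].
Qed.

Lemma measR_cbrt (F : R -> R) : measR F -> measR (fun x => cbrt (F x)).
Proof.
intros HF. assert (HN : measR (fun x => - F x)).
{ apply (measR_ext (fun x => (-1) * F x)); [intros; ring|]. apply measR_mult; [apply measR_const|exact HF]. }
apply (measR_ext (fun x => if Rle_dec 0 (- F x) then if Rle_dec 0 (F x) then 0 else (-1) * Rpower (- F x) (1 / 3) else Rpower (F x) (1 / 3))).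
- intros x. unfold cbrt. destruct (Rle_dec 0 (- F x)), (Rlt_dec 0 (F x)); try lra; destruct (Rle_dec 0 (F x)); try lra;
  destruct (Rlt_dec (F x) 0); lra.
- apply measR_ite; [exact HN| |apply measR_Rpower, HF].
  apply measR_ite; [exact HF|apply measR_const|]. apply measR_mult; [apply measR_const|apply measR_Rpower, HN].
Qed.

(** * Measurable dependence on the frequency *)

Section FlowMeasurable.
Variables (nu c : R) (f : R -> R).
Hypothesis Hnu : 0 < nu.
Hypothesis Hc : 0 < c.
Hypothesis Hf1 : forall t, 0 < t -> continuous f t.
Hypothesis Hf2 : filterlim f (at_right 0) (locally (f 0)).
Hypothesis Hf3 : forall t, 0 <= t -> Rabs (f t) <= 2 * c / (1 + t ^ 2).

Lemma measR_ccoef m t : measR (fun eta => ccoef c eta m t).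
Proof.
unfold ccoef. destruct (Z.eq_dec m 0); [apply measR_const|]. assert (Hm : IZR m <> 0) by (apply not_0_IZR; assumption).
apply measR_smooth. intros eta. assert (H := coef_den_pos (eta / IZR m - t)). auto_derive.
repeat split; try (apply Rgt_not_eq; apply Rmult_lt_0_compat; unfold Rdiv in *; lra).
all: try exact Logic.I.
all: try (apply Rgt_not_eq; apply pow_lt; unfold Rdiv in *; simpl in *; lra).
all: unfold Rdiv, Rminus in *; simpl in *; nra.
Qed.

Lemma measR_dcoef m t : measR (fun eta => dcoef c eta m t).
Proof.
unfold dcoef. destruct (Z.eq_dec m 0); [apply measR_const|]. assert (Hm : IZR m <> 0) by (apply not_0_IZR; assumption).
apply measR_smooth. intros eta. assert (H := coef_den_pos (eta / IZR m - t)). auto_derive.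
unfold Rdiv, Rminus in *; simpl in *. lra.
Qed.

Lemma measC_coupling (th G : R -> Z -> C) l t : (forall j, measC (fun eta => th eta j)) -> (forall j, measC (fun eta => G eta j)) ->
  measC (fun eta => coupling c eta (th eta) (G eta) l t).
Proof.
intros Ht HG. unfold coupling. 
apply measC_plus; apply measC_plus; apply measC_mult; auto; apply measC_RtoC; first [apply measR_ccoef|apply measR_dcoef].
Qed.

Lemma measC_forcing (y : R -> Z * bool -> C) i t : (forall j, measC (fun eta => y eta j)) ->
  measC (fun eta => forcing c f eta t (y eta) i).
Proof.
intros Hy. unfold forcing. destruct i as [l b]. simpl fst. simpl snd.
destruct (Z.eq_dec l 0); [apply measC_RtoC, measR_const|]. assert (Hl : IZR l <> 0) by (apply not_0_IZR; assumption).
assert (HA : measC (fun eta => coupling c eta (fun j => y eta (j, true)) (fun j => y eta (j, false)) l t)).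
{ apply (measC_coupling (fun eta j => y eta (j, true)) (fun eta j => y eta (j, false))); intros j; apply Hy. }
destruct b; [exact HA|].
apply measC_plus; [|apply measC_plus]; apply measC_mult; auto.
- apply measC_mult; [apply measC_RtoC, measR_const|]. apply measC_pair; apply measR_const.
- apply measC_RtoC, measR_smooth. intros eta. assert (H := coef_den_pos (eta / IZR l - t)). auto_derive.
  unfold Rdiv, Rminus in *; simpl in *; nra.
- apply measC_RtoC, measR_smooth. intros eta. assert (H := coef_den_pos (eta / IZR l - t)). auto_derive.
  unfold Rdiv, Rminus in *; simpl in *; lra.
Qed.

Lemma measR_damp_int i t : measR (fun eta => damp_int nu eta i t).
Proof.
unfold damp_int. destruct (snd i); [apply measR_const|]. apply measR_smooth. intros eta. auto_derive. exact Logic.I.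
Qed.

Lemma measC_init (u : R -> Z -> C) i : (forall l, measC (fun eta => u eta l)) -> measC (fun eta => init_state (u eta) i).
Proof.
intros Hu. unfold init_state. destruct (Z.eq_dec (fst i) 0); [apply measC_RtoC, measR_const|].
destruct (snd i); [apply Hu|apply measC_RtoC, measR_const].
Qed.

(** The coefficients are smooth in eta at fixed time, and each iterate adds one time integral of a
    function continuous in time. *)
Lemma measC_picard_iter (u : R -> Z -> C) n t i : (forall l, measC (fun eta => u eta l)) ->
  measC (fun eta => picard_iter (Z * bool) (damp_int nu eta) (forcing c f eta) (init_state (u eta)) n t i).
Proof.
intros Hu. revert t i; induction n; intros t i; simpl; [apply measC_init, Hu|].
unfold picard_step. apply measC_mult.
- apply measC_RtoC. apply measR_exp. apply (measR_ext (fun eta => (-1) * damp_int nu eta i (Rmax 0 t))); [intros; ring|].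
  apply measR_mult; [apply measR_const|apply measR_damp_int].
- apply measC_plus; [apply measC_init, Hu|]. apply measC_CInt; [apply Rmax_l| |].
  + intros s. apply measC_mult; [apply measC_RtoC, measR_exp, measR_damp_int|].
    apply (measC_forcing (fun eta => picard_iter (Z * bool) (damp_int nu eta) (forcing c f eta) (init_state (u eta)) n s)).
    intros j. apply IHn.
  + intros eta s. apply (continuous_Cmult (fun r => RtoC (exp (damp_int nu eta i r)))).
    * apply (continuous_RtoC (fun r => exp (damp_int nu eta i r))), continuous_exp_comp.
      eapply continuous_of_derive, damp_int_derive.
    * apply (forcing_cont c f eta Hf1 Hf2). intros j r.
      apply (picard_iter_cont _ (damp nu eta)); [intros; apply damp_int_derive|intros; apply damp_int_0|].
      intros v Hv; apply (forcing_cont c f eta Hf1 Hf2 v Hv).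
Qed.

Lemma measC_lim_on (a : R) (h : nat -> R -> C) (F : R -> C) : (forall n, measC (h n)) ->
  (forall x, a <= x -> is_lim_seq (fun n => Re (h n x)) (Re (F x)) /\ is_lim_seq (fun n => Im (h n x)) (Im (F x))) ->
  measC (fun x => if Rle_dec a x then F x else RtoC 0).
Proof.
intros Hh HF.
assert (Hgen : forall p : C -> R, p (RtoC 0) = 0 -> (forall n, measR (fun x => p (h n x))) ->
  (forall x, a <= x -> is_lim_seq (fun n => p (h n x)) (p (F x))) -> measR (fun x => p (if Rle_dec a x then F x else RtoC 0))).
{ intros p Hp Hm Hl. apply (measR_lim (fun n x => if Rle_dec a x then p (h n x) else 0)).
  - intros n. apply measR_ite; [apply measR_id|apply Hm|apply measR_const].
  - intros x. destruct (Rle_dec a x) as [Hx|Hx]; [apply Hl, Hx|rewrite Hp; apply is_lim_seq_const]. }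
split.
- apply (Hgen Re eq_refl); [intros n; exact (proj1 (Hh n))|intros x Hx; apply HF, Hx].
- apply (Hgen Im eq_refl); [intros n; exact (proj2 (Hh n))|intros x Hx; apply HF, Hx].
Qed.

(** The weight and its constants may depend on eta: they serve only for the pointwise convergence of
    the iterates. *)
Lemma measC_flow (u : R -> Z -> C) (a : R) t i : (forall l, measC (fun eta => u eta l)) ->
  (forall eta, a <= eta -> exists w r M0, 1 <= r /\ (forall l, 0 < w l) /\
     (forall l m, (Z.abs (l - m) <= 1)%Z -> w m <= r * w l) /\ 0 <= M0 /\ (forall l, Cmod (u eta l) <= M0 * w l)) ->
  measC (fun eta => if Rle_dec a eta then flow nu c f eta (u eta) t i else RtoC 0).
Proof.
intros Hu Hb.
apply (measC_lim_on a (fun n eta => picard_iter (Z * bool) (damp_int nu eta) (forcing c f eta) (init_state (u eta)) n t i)).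
{ intros n. apply measC_picard_iter, Hu. }
intros eta Heta. destruct (Hb eta Heta) as [w [r [M0 [Hr [Hw [Hstep [HM0 Hu0]]]]]]].
assert (Hy0 : forall j, Cmod (init_state (u eta) j) <= M0 * w (fst j)).
{ intros [l b]; unfold init_state; simpl. assert (0 <= M0 * w l) by (apply Rmult_le_pos; [lra|left; auto]).
  destruct (Z.eq_dec l 0), b; rewrite ?Cmod_0; auto. }
destruct (picard_sol_approx _ (damp nu eta) (damp_int nu eta) (forcing c f eta) (init_state (u eta)) (damp_int_derive nu eta) (damp_int_0 nu eta)
  (fun i t _ => damp_nonneg nu eta Hnu i t) (forcing_minus c f eta) (forcing_cont c f eta Hf1 Hf2) (fun i => w (fst i)) (flow_rate c eta r) M0
  (flow_rate_pos c eta Hc r Hr) (fun i => Hw (fst i)) (forcing_bound c f eta Hc Hf3 w r Hr Hw Hstep) HM0 Hy0 O t i) as [L1 [L2 _]].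
split; assumption.
Qed.

End FlowMeasurable.

(** The integer part of g equals l exactly when l <= g and not l + 1 <= g, a difference of two
    superlevel sets. *)
Lemma measC_delta_echo_mode c l : measC (fun eta => delta_seq (echo_mode c eta) l).
Proof.
set (g := fun eta => / 10 * cbrt (c * eta * PI / 2)).
assert (Hg : measR g).
{ apply measR_mult; [apply measR_const|apply measR_cbrt]. apply measR_smooth. intros x. auto_derive. exact Logic.I. }
apply (measC_ext (fun eta => RtoC (if Rle_dec (IZR l) (g eta) then if Rle_dec (IZR l + 1) (g eta) then 0 else 1 else 0))).
- intros eta. unfold delta_seq, echo_mode. fold (g eta).
  destruct (base_Int_part (g eta)) as [B1 B2]. 
  destruct (Z.eq_dec l (Int_part (g eta))) as [->|E].
  + destruct (Rle_dec (IZR (Int_part (g eta))) (g eta)); [|lra].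
    destruct (Rle_dec (IZR (Int_part (g eta)) + 1) (g eta)); [lra|reflexivity].
  + destruct (Rle_dec (IZR l) (g eta)); [|reflexivity]. destruct (Rle_dec (IZR l + 1) (g eta)) as [|H2]; [reflexivity|].
    exfalso. apply E. apply Z.le_antisymm.
    * apply Z.lt_succ_r, lt_IZR. rewrite succ_IZR. lra.
    * apply Z.lt_succ_r, lt_IZR. rewrite succ_IZR. lra.
- apply measC_RtoC. apply measR_ite; [exact Hg| |apply measR_const].
  apply measR_ite; [exact Hg|apply measR_const|apply measR_const].
Qed.

(** From this frequency on c eta >= 10^9, so (c eta)^(1/3) >= 1000 and the chain of resonances
    applies. *)
Definition eta_min (c : R) : R := 1000000000 / c.

Section EchoFamily.
Variables (nu c : R) (f : R -> R) (lam : Z -> R).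
Hypothesis Hst : standing nu c f lam.

Lemma eta_min_large eta : eta_min c <= eta -> 1e9 <= eta /\ 1000 <= cbrt (c * eta).
Proof.
destruct Hst as [_ [Hc _]]. intros H. unfold eta_min in H.
assert (H1 : 1000000000 <= c * eta).
{ replace 1000000000 with (c * (1000000000 / c)) by (field; lra). apply Rmult_le_compat_l; lra. }
assert (H2 : 1000000000 * 1 <= 1000000000 / c).
{ apply Rmult_le_compat_l; [lra|]. rewrite <- Rinv_1. apply Rinv_le_contravar; lra. }
split; [lra|]. destruct (cbrt_cube (c * eta) ltac:(lra)) as [K1 K2].
apply Rnot_lt_le. intros Hlt. 
set (K := cbrt (c * eta)) in *.
assert (K * K <= 1000 * K) by (apply Rmult_le_compat_r; lra).
assert (K * (K * K) <= K * (1000 * K)) by (apply Rmult_le_compat_l; lra).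
replace (K ^ 3) with (K * (K * K)) in K2 by ring. lra.
Qed.

Lemma measC_echo_theta t l : measC (fun eta => if Rle_dec (eta_min c) eta then echo_theta nu c f eta t l else RtoC 0).
Proof.
assert (Hs := Hst). destruct Hs as [Hnu [Hc [Hf1 [Hf2 [Hf3 _]]]]].
apply (measC_flow nu c f Hnu (proj1 Hc) Hf1 Hf2 Hf3 (fun eta => delta_seq (echo_mode c eta))).
- intros j. apply measC_delta_echo_mode.
- intros eta _. exists (wt 50000 (echo_mode c eta)), 50000, 1. split; [lra|split; [|split; [|split; [lra|]]]].
  + intros; apply wt_pos; lra.
  + intros j m Hjm. apply wt_step; [lra|exact Hjm].
  + intros j. unfold delta_seq. destruct (Z.eq_dec j (echo_mode c eta)) as [->|]; [rewrite Cmod_1, wt_self; lra|].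
    rewrite Cmod_0, Rmult_1_l. left; apply wt_pos; lra.
Qed.

Lemma measC_echo_limit l : measC (fun eta => if Rle_dec (eta_min c) eta then echo_limit nu c f eta l else RtoC 0).
Proof.
apply (measC_lim_on (eta_min c) (fun n eta => if Rle_dec (eta_min c) eta then echo_theta nu c f eta (INR n) l else RtoC 0)).
{ intros n. apply measC_echo_theta. }
intros eta Heta. destruct (eta_min_large eta Heta) as [He HK]. assert (He0 : 0 < eta) by lra.
destruct (echo_core nu c f lam eta Hst He0 HK) as [A [HA [_ [_ [_ [_ [_ C6]]]]]]].
destruct (echo_limit_rate nu c f eta A He0 HA C6 l) as [_ [L1 L2]].
split; [apply (is_lim_seq_ext (fun n => Re (echo_theta nu c f eta (INR n) l)))|apply (is_lim_seq_ext (fun n => Im (echo_theta nu c f eta (INR n) l)))]; 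
  try assumption; intros n; destruct (Rle_dec (eta_min c) eta); [reflexivity|contradiction|reflexivity|contradiction].
Qed.

Definition spectral_weight (sigma eta : R) : R := Rpower (1 + eta ^ 2) (- sigma) / eta.

(* Normalised so that the final amplitude of the mode 2 is the square root of the spectral weight. *)
Definition echo_amplitude (sigma eta : R) : R :=
  let z := echo_limit nu c f eta 2 in
  exp (/ 2 * (- sigma * ln (1 + eta ^ 2) - ln eta - ln (Re z ^ 2 + Im z ^ 2))).

(** The amplitude is an exponential of logarithms of the limit, so its measurability reduces to that
    of the limit cut off below [eta_min]. *)
Lemma measC_echo_amplitude sigma (F : R -> C) : measC F ->
  measC (fun eta => if Rle_dec (eta_min c) eta then Cmult (RtoC (echo_amplitude sigma eta)) (F eta) else RtoC 0).
Proof.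
intros HF.
set (z := fun eta => if Rle_dec (eta_min c) eta then echo_limit nu c f eta 2 else RtoC 0).
assert (Hz : measC z) by apply measC_echo_limit. destruct Hz as [Z1 Z2].
set (a := fun eta => exp (/ 2 * (- sigma * ln (1 + eta ^ 2) - ln eta - ln (Re (z eta) ^ 2 + Im (z eta) ^ 2)))).
assert (Hsq : forall g, measR g -> measR (fun x => g x ^ 2)).
{ intros g Hg. apply (measR_ext (fun x => g x * g x)); [intros; ring|]. apply measR_mult; exact Hg. }
assert (Ha : measR a).
{ apply measR_exp, measR_mult; [apply measR_const|]. apply measR_minus; [apply measR_minus|].
  - apply measR_mult; [apply measR_const|apply measR_ln]. apply measR_plus; [apply measR_const|apply Hsq, measR_id].
  - apply measR_ln, measR_id.
  - apply measR_ln, measR_plus; apply Hsq; assumption. }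
apply (measC_ext (fun eta => if Rle_dec (eta_min c) eta then Cmult (RtoC (a eta)) (F eta) else RtoC 0)).
- intros eta. destruct (Rle_dec (eta_min c) eta) as [H|H]; [|reflexivity]. unfold a, echo_amplitude, z.
  destruct (Rle_dec (eta_min c) eta); [reflexivity|contradiction].
- apply measC_ite; [|apply measC_RtoC, measR_const]. apply measC_mult; [apply measC_RtoC, Ha|exact HF].
Qed.

End EchoFamily.

(** * Bounds for the normalised solutions at each frequency *)

Lemma normX2_nonneg lam u : inX lam u -> 0 <= normX2 lam u.
Proof.
intros H. replace 0 with (Series (fun _ => 0)).
- apply Series_le; [|exact H]. intros n. split; [lra|]. unfold Zterm, Xterm.
  apply Rplus_le_le_0_compat; apply Rmult_le_pos; apply pow2_ge_0.
- rewrite (Series_ext (fun _ => 0) (fun n => 0 * 0)) by (intros; ring). rewrite Series_scal_l. ring.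
Qed.

Definition cscale (a : R) (u : Z -> C) : Z -> C := fun l => Cmult (RtoC a) (u l).

Lemma normX2_scale lam a u :
  (inX lam u -> inX lam (cscale a u)) /\ normX2 lam (cscale a u) = a ^ 2 * normX2 lam u.
Proof.
assert (E : forall n, Zterm (Xterm lam (cscale a u)) n = a ^ 2 * Zterm (Xterm lam u) n).
{ intros n. unfold Zterm, Xterm, cscale. rewrite !Cmod_mult, !Cmod_R, !Rpow_mult_distr, !pow2_abs. ring. }
split.
- intros H. apply (ex_series_ext (fun n => a ^ 2 * Zterm (Xterm lam u) n)); [intros n; symmetry; apply E|].
  apply (ex_series_scal_l (K := R_AbsRing) (a ^ 2) (Zterm (Xterm lam u))), H.
- unfold normX2. rewrite (Series_ext _ _ E). apply Series_scal_l.
Qed.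

Lemma normX2_diff lam u v : inX lam u -> inX lam v ->
  inX lam (diffseq u v) /\ normX2 lam (diffseq u v) <= 2 * (normX2 lam u + normX2 lam v).
Proof.
intros Hu Hv.
assert (Hsum : ex_series (fun n => 2 * (Zterm (Xterm lam u) n + Zterm (Xterm lam v) n))).
{ apply (ex_series_scal_l (K := R_AbsRing) 2 (fun n => Zterm (Xterm lam u) n + Zterm (Xterm lam v) n)).
  apply (ex_series_plus (K := R_AbsRing) (V := R_NormedModule) (Zterm (Xterm lam u)) (Zterm (Xterm lam v))); assumption. }
assert (Hle : forall n, 0 <= Zterm (Xterm lam (diffseq u v)) n <= 2 * (Zterm (Xterm lam u) n + Zterm (Xterm lam v) n)).
{ assert (Hx : forall l, Xterm lam (diffseq u v) l <= 2 * (Xterm lam u l + Xterm lam v l)).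
  { intros l. unfold Xterm, diffseq.
    assert (T := Cmod_triangle (u l) (Copp (v l))). rewrite Cmod_opp in T. fold (Cminus (u l) (v l)) in T.
    assert (Cmod (Cminus (u l) (v l)) ^ 2 <= (Cmod (u l) + Cmod (v l)) ^ 2) by (apply pow_incr; split; [apply Cmod_ge_0|exact T]).
    assert (H2 := pow2_ge_0 (Cmod (u l) - Cmod (v l))). assert (H3 := pow2_ge_0 (lam l)).
    apply Rle_trans with (lam l ^ 2 * (2 * (Cmod (u l) ^ 2 + Cmod (v l) ^ 2))); [|right; ring].
    apply Rmult_le_compat_l; [exact H3|]. lra. }
  intros n. split.
  - unfold Zterm, Xterm. apply Rplus_le_le_0_compat; apply Rmult_le_pos; apply pow2_ge_0.
  - unfold Zterm. assert (H1 := Hx (Z.of_nat n)). assert (H2 := Hx (- Z.of_nat n - 1)%Z). lra. }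
split.
- apply (ex_series_le (K := R_AbsRing) (V := R_CompleteNormedModule) _ (fun n => 2 * (Zterm (Xterm lam u) n + Zterm (Xterm lam v) n))); [|exact Hsum].
  intros n. change (norm (Zterm (Xterm lam (diffseq u v)) n)) with (Rabs (Zterm (Xterm lam (diffseq u v)) n)).
  rewrite Rabs_pos_eq; apply Hle.
- unfold normX2. rewrite <- Series_plus by assumption. rewrite <- Series_scal_l. apply Series_le; [exact Hle|exact Hsum].
Qed.

Section EchoFamilyBounds.
Variables (nu c : R) (f : R -> R) (lam : Z -> R) (sigma : R).
Hypothesis Hst : standing nu c f lam.
Let w := spectral_weight sigma.
Let a := echo_amplitude nu c f sigma.
Let th := echo_theta nu c f.
Let v := echo_limit nu c f.

Lemma spectral_weight_pos eta : 0 < eta -> 0 < w eta.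
Proof. intros H. apply Rdiv_lt_0_compat; [apply exp_pos|exact H]. Qed.

Lemma echo_amplitude_sq eta : 0 < eta -> v eta 2%Z <> RtoC 0 -> a eta ^ 2 * Cmod (v eta 2%Z) ^ 2 = w eta.
Proof.
intros He Hz. unfold a, echo_amplitude, w, spectral_weight. fold v. set (z := v eta 2%Z) in *.
assert (Hm : Cmod z ^ 2 = Re z ^ 2 + Im z ^ 2).
{ unfold Cmod. rewrite pow2_sqrt; [reflexivity|]. apply Rplus_le_le_0_compat; apply pow2_ge_0. }
assert (Hp : 0 < Cmod z ^ 2) by (apply pow_lt, Cmod_gt_0, Hz).
rewrite <- Hm. cbv zeta.
replace (exp (/ 2 * (- sigma * ln (1 + eta ^ 2) - ln eta - ln (Cmod z ^ 2))) ^ 2) with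
  (exp (- sigma * ln (1 + eta ^ 2) - ln eta - ln (Cmod z ^ 2))).
2: { set (y := - sigma * ln (1 + eta ^ 2) - ln eta - ln (Cmod z ^ 2)).
  replace (exp (/ 2 * y) ^ 2) with (exp (/ 2 * y) * exp (/ 2 * y)) by ring. rewrite <- exp_plus. f_equal. field. }
unfold Rminus. rewrite !exp_plus, !exp_Ropp, !exp_ln by assumption. unfold Rpower. field. split; [lra|].
intros E. rewrite E in Hp. lra.
Qed.

(** The limit of mode 2 is comparable with A and is normalised to the square root of the spectral
    weight, so a^2 A^2 is comparable with that weight. Every bound of [echo_core] in terms of A
    becomes one in terms of the weight; the data gain exp (- 2 K) from the amplification. *)
Lemma echo_family_bounds : exists B b, 0 < B /\ 0 < b /\ forall eta, eta_min c <= eta ->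
  inX lam (v eta) /\ a eta ^ 2 * normX2 lam (v eta) <= B * w eta /\
  (forall t, 0 <= t -> inX lam (th eta t) /\ inX lam (diffseq (th eta t) (v eta)) /\
                       a eta ^ 2 * normX2 lam (diffseq (th eta t) (v eta)) <= B * w eta) /\
  (forall t, 2 * eta <= t -> a eta ^ 2 * normX2 lam (diffseq (th eta t) (v eta)) <= B * w eta * (eta / t) ^ 2) /\
  (forall t, 2 * eta <= t -> b * w eta <= a eta ^ 2 * normX2 lam (th eta t)) /\
  a eta ^ 2 * normX2 lam (delta_seq (echo_mode c eta)) <= B * w eta * exp (- 2 * cbrt (c * eta)).
Proof.
assert (Hlam := standing_lam_ok nu c f lam Hst). assert (Hl2 := proj1 Hlam 2%Z). assert (Hl1 := proj1 Hlam 1%Z).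
set (X := lam 2%Z ^ 2). set (Y := lam 1%Z ^ 2). assert (HX : 0 < X) by (apply pow_lt; exact Hl2). assert (HY : 0 < Y) by (apply pow_lt; exact Hl1).
exists (400000 * (X + Y)), (X / 100). split; [lra|split; [lra|]].
intros eta Heta. destruct (eta_min_large nu c f lam Hst eta Heta) as [He HK]. assert (He0 : 0 < eta) by lra.
destruct (echo_core nu c f lam eta Hst He0 HK) as [A [HA [C1 [C2 [_ [C4 [C5 C6]]]]]]]. fold (th eta) in C1, C2, C5, C6.
destruct (echo_limit_inX nu c f lam eta A Hst He0 HA C6 C5) as [V1 V2]. fold (v eta) in V1, V2.
assert (Hdiff := echo_limit_diff nu c f lam eta A Hst He0 HA C6). cbv zeta in Hdiff. fold (th eta) (v eta) in Hdiff.
(* At s = 2 eta the distance of mode 2 to its limit is at most 4 A * 1/2 * 1/4 = A / 2, to be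
   compared with the bounds 0.9 A and 6.2 A. *)
assert (Hz : 0.4 * A <= Cmod (v eta 2%Z) <= 6.7 * A).
{ destruct (echo_limit_rate nu c f eta A He0 HA C6 2%Z) as [R1 _]. specialize (R1 (2 * eta) ltac:(lra)). fold (th eta) (v eta) in R1.
  replace (eta / (2 * eta)) with (/ 2) in R1 by (field; lra). replace (wt 4 1 2) with (/ 4) in R1 by (unfold wt; simpl; field).
  destruct (C1 (2 * eta) ltac:(lra)) as [L U].
  assert (T1 := Cmod_triangle (Cminus (v eta 2%Z) (th eta (2 * eta) 2%Z)) (th eta (2 * eta) 2%Z)).
  replace (Cplus (Cminus (v eta 2%Z) (th eta (2 * eta) 2%Z)) (th eta (2 * eta) 2%Z)) with (v eta 2%Z) in T1 by (unfold Cminus; ring).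
  assert (T2 := Cmod_triangle (v eta 2%Z) (Copp (Cminus (v eta 2%Z) (th eta (2 * eta) 2%Z)))).
  replace (Cplus (v eta 2%Z) (Copp (Cminus (v eta 2%Z) (th eta (2 * eta) 2%Z)))) with (th eta (2 * eta) 2%Z) in T2 by (unfold Cminus; ring).
  rewrite Cmod_opp in T2. lra. }
assert (Hw := spectral_weight_pos eta He0).
assert (Ha : a eta ^ 2 * Cmod (v eta 2%Z) ^ 2 = w eta).
{ apply echo_amplitude_sq; [exact He0|]. intros E. rewrite E, Cmod_0 in Hz. lra. }
assert (Ha0 : 0 <= a eta ^ 2) by apply pow2_ge_0.
set (q := a eta ^ 2 * A ^ 2).
assert (Hq : w eta / 45 <= q <= 6.25 * w eta).
{ assert (M1 : (0.4 * A) ^ 2 <= Cmod (v eta 2%Z) ^ 2) by (apply pow_incr; lra).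
  assert (M2 : Cmod (v eta 2%Z) ^ 2 <= (6.7 * A) ^ 2) by (apply pow_incr; lra).
  assert (N1 := Rmult_le_compat_l _ _ _ Ha0 M1). assert (N2 := Rmult_le_compat_l _ _ _ Ha0 M2).
  replace (a eta ^ 2 * (0.4 * A) ^ 2) with (0.16 * q) in N1 by (unfold q; lra).
  replace (a eta ^ 2 * (6.7 * A) ^ 2) with (44.89 * q) in N2 by (unfold q; lra). lra. }
assert (Hscale : forall N K, 0 <= K -> N <= K * A ^ 2 -> a eta ^ 2 * N <= 6.25 * K * w eta).
{ intros N K HK0 HN. apply Rle_trans with (K * q); [unfold q; replace (K * (a eta ^ 2 * A ^ 2)) with (a eta ^ 2 * (K * A ^ 2)) by ring; apply Rmult_le_compat_l; assumption|].
  replace (6.25 * K * w eta) with (K * (6.25 * w eta)) by ring. apply Rmult_le_compat_l; lra. }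
assert (HXw : 0 < X * w eta) by (apply Rmult_lt_0_compat; assumption). assert (HYw : 0 < Y * w eta) by (apply Rmult_lt_0_compat; assumption).
assert (V3 : normX2 lam (v eta) <= 1458 * Y * A ^ 2) by (replace (1458 * Y * A ^ 2) with (2 * (27 * A * lam 1%Z) ^ 2) by (unfold Y; ring); exact V2).
assert (T3 : forall t, 0 <= t -> normX2 lam (th eta t) <= 8192 * X * A ^ 2).
{ intros t Ht. replace (8192 * X * A ^ 2) with (2 * (64 * (lam 2%Z * A)) ^ 2) by (unfold X; ring). apply C2, Ht. }
split; [exact V1|split; [|split; [|split; [|split]]]].
- eapply Rle_trans; [apply (Hscale _ (1458 * Y)); [lra|exact V3]|]. lra.
- intros t Ht. destruct (C2 t Ht) as [I1 _]. destruct (normX2_diff lam _ _ I1 V1) as [I2 I3]. split; [exact I1|split; [exact I2|]].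
  specialize (T3 t Ht).
  eapply Rle_trans; [apply (Hscale _ (2 * (8192 * X + 1458 * Y))); [lra|]|]; lra.
- intros t Ht. destruct (Hdiff t Ht) as [_ [D _]].
  set (r := (eta / t) ^ 2). assert (Hr : 0 <= r) by apply pow2_ge_0.
  assert (0 <= Y * w eta * r) by (apply Rmult_le_pos; lra). assert (0 <= X * w eta * r) by (apply Rmult_le_pos; lra).
  apply Rle_trans with (6.25 * (32 * Y * r) * w eta); [|lra].
  apply Hscale; [apply Rmult_le_pos; lra|]. eapply Rle_trans; [exact D|]. right. unfold Y, r. ring.
- intros t Ht. destruct (C1 t Ht) as [L _]. destruct (C2 t ltac:(lra)) as [I1 _].
  assert (N := normX_term lam _ 2%Z I1 (Rlt_le _ _ Hl2)).
  assert (N2 : lam 2%Z * (0.9 * A) <= normX lam (th eta t)).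
  { eapply Rle_trans; [apply Rmult_le_compat_l; [lra|exact L]|exact N]. }
  assert (N3 : (lam 2%Z * (0.9 * A)) ^ 2 <= normX lam (th eta t) ^ 2) by (apply pow_incr; split; [apply Rmult_le_pos; lra|exact N2]).
  unfold normX in N3. rewrite pow2_sqrt in N3 by (apply normX2_nonneg, I1).
  apply Rle_trans with (a eta ^ 2 * (lam 2%Z * (0.9 * A)) ^ 2); [|apply Rmult_le_compat_l; assumption].
  replace (a eta ^ 2 * (lam 2%Z * (0.9 * A)) ^ 2) with (0.81 * (X * q)) by (unfold X, q; lra).
  assert (X * (w eta / 45) <= X * q) by (apply Rmult_le_compat_l; lra). lra.
- destruct (normX2_delta lam (echo_mode c eta) Hlam) as [_ [D _]]. set (K := cbrt (c * eta)) in *.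
  assert (Hk := proj1 Hlam (echo_mode c eta)). assert (HeK := exp_pos K).
  replace (-2 * K) with (- K + - K) by ring. rewrite exp_plus, exp_Ropp. 
  set (E := exp K) in *. set (lk := lam (echo_mode c eta)) in *.
  assert (Hlk : lk <= lam 2%Z * A * / E).
  { apply Rmult_le_reg_r with E; [exact HeK|]. rewrite Rmult_assoc, Rinv_l, Rmult_1_r by lra. assert (0 < lam 2%Z * A) by (apply Rmult_lt_0_compat; lra). lra. }
  assert (Hlk2 : lk ^ 2 <= (lam 2%Z * A * / E) ^ 2) by (apply pow_incr; lra).
  assert (HiE : 0 < / E * / E) by (apply Rmult_lt_0_compat; apply Rinv_0_lt_compat; exact HeK).
  assert (0 < X * w eta * (/ E * / E)) by (apply Rmult_lt_0_compat; lra). assert (0 < Y * w eta * (/ E * / E)) by (apply Rmult_lt_0_compat; lra).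
  apply Rle_trans with (6.25 * (2 * X * (/ E * / E)) * w eta); [|lra].
  apply Hscale; [apply Rmult_le_pos; lra|]. eapply Rle_trans; [exact D|].
  replace (2 * X * (/ E * / E) * A ^ 2) with (2 * (lam 2%Z * A * / E) ^ 2) by (unfold X; ring). lra.
Qed.

End EchoFamilyBounds.

(** * Superposition over frequencies *)

Lemma Rpower_le_1 x p : 0 < x <= 1 -> 0 <= p -> Rpower x p <= 1.
Proof.
intros Hx Hp. unfold Rpower. rewrite <- exp_0. apply exp_le_mono.
assert (H : ln x <= ln 1) by (apply ln_le; lra). rewrite ln_1 in H.
assert (0 <= p * (- ln x)) by (apply Rmult_le_pos; lra). lra.
Qed.

(** Weakens the rate (eta / t)^2 to (eta / t)^p, with p so small that eta^p stays integrable against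
    the spectral weight. *)
Lemma square_le_Rpower x p : 0 < x <= 1 -> 0 < p <= 2 -> x ^ 2 <= Rpower x p.
Proof.
intros Hx Hp. rewrite <- (Rpower_pow 2) by lra. replace (INR 2) with (p + (2 - p)) by (simpl; ring).
rewrite Rpower_plus. assert (H := Rpower_le_1 x (2 - p) Hx ltac:(lra)). assert (H2 : 0 < Rpower x p) by apply exp_pos.
rewrite <- (Rmult_1_r (Rpower x p)) at 2. apply Rmult_le_compat_l; lra.
Qed.

Lemma Rpower_half_lower x p : / 2 <= x -> 0 < p <= 2 -> 1 <= 4 * Rpower x p.
Proof.
intros Hx Hp. assert (H1 := square_le_Rpower (/ 2) p ltac:(lra) Hp).
assert (H2 : Rpower (/ 2) p <= Rpower x p) by (apply Rle_Rpower_l; lra). lra.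
Qed.

Lemma spectral_weight_shift sigma s eta : 0 < eta ->
  Rpower (1 + eta ^ 2) s * spectral_weight sigma eta = Rpower (1 + eta ^ 2) (s - sigma) / eta.
Proof. intros H. unfold spectral_weight, Rminus. rewrite Rpower_plus. field. lra. Qed.

Lemma spectral_weight_decay sigma s p eta : 1 <= eta -> s < sigma -> p <= sigma - s ->
  Rpower (1 + eta ^ 2) s * spectral_weight sigma eta * Rpower eta p <= Rpower eta (- 1 - (sigma - s)).
Proof.
intros He Hs Hp. rewrite spectral_weight_shift by lra. set (d := sigma - s) in *.
replace (s - sigma) with (- d) by (unfold d; ring).
assert (H1 : Rpower (1 + eta ^ 2) (- d) <= Rpower eta (- (2 * d))).
{ rewrite !Rpower_Ropp. apply Rinv_le_contravar; [apply exp_pos|].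
  replace (2 * d) with (INR 2 * d) by (simpl; ring). rewrite <- Rpower_mult, Rpower_pow by lra.
  apply Rle_Rpower_l; [unfold d; lra|]. split; [apply pow_lt; lra|lra]. }
(* With d = sigma - s, of the decay eta^(- 2 d) one half pays for eta^p and the other half stays for
   integrability. *)
assert (H2 : 0 < Rpower eta p) by apply exp_pos. assert (H3 : 0 < / eta) by (apply Rinv_0_lt_compat; lra).
apply Rle_trans with (Rpower eta (- (2 * d)) * (/ eta) * Rpower eta p).
{ apply Rmult_le_compat_r; [lra|]. apply Rmult_le_compat_r; lra. }
rewrite <- (Rpower_1 eta) at 2 by lra. rewrite <- Rpower_Ropp, <- !Rpower_plus. apply Rle_Rpower; lra.
Qed.

(* With K = (c eta)^(1/3), a power of eta is a power of K and is absorbed by exp K. *)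
Lemma spectral_weight_exp c sigma : 0 < c -> exists D, 0 < D /\ forall eta, 1 <= eta ->
  spectral_weight sigma eta * exp (- cbrt (c * eta)) <= D * Rpower eta (- 1 - 1).
Proof.
intros Hc. destruct (nfloor_ex (Rabs sigma) (Rabs_pos sigma)) as [m' [_ Hm']]. set (m := S m').
assert (Hm : - sigma <= INR m).
{ unfold m. rewrite S_INR. assert (H := Rle_abs (- sigma)). rewrite Rabs_Ropp in H. lra. }
set (n := (2 * m + 2)%nat).
exists (2 ^ m / c ^ n * INR (fact (3 * n))).
assert (HF : 0 < INR (fact (3 * n))) by apply INR_fact_lt_0. assert (Hcn : 0 < c ^ n) by (apply pow_lt; lra). assert (H2m : 0 < 2 ^ m) by (apply pow_lt; lra).
assert (HD : 0 < 2 ^ m / c ^ n) by (apply Rdiv_lt_0_compat; assumption).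
split; [apply Rmult_lt_0_compat; assumption|]. intros eta He.
destruct (cbrt_cube (c * eta)) as [K0 K3]; [apply Rmult_lt_0_compat; lra|]. set (K := cbrt (c * eta)) in *.
assert (Hpow : 1 <= eta ^ 2) by (replace 1 with (1 ^ 2) by ring; apply pow_incr; lra).
assert (H1 : Rpower (1 + eta ^ 2) (- sigma) <= 2 ^ m * (eta ^ 2) ^ m).
{ rewrite <- Rpow_mult_distr. apply Rle_trans with (Rpower (1 + eta ^ 2) (INR m)); [apply Rle_Rpower; lra|].
  rewrite Rpower_pow by lra. apply pow_incr; lra. }
assert (H2 : K ^ (3 * n) <= INR (fact (3 * n)) * exp K).
{ assert (U := pow_fact_upper K (3 * n) (Rlt_le _ _ K0)).
  apply Rmult_le_reg_r with (/ INR (fact (3 * n))); [apply Rinv_0_lt_compat, HF|].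
  replace (INR (fact (3 * n)) * exp K * / INR (fact (3 * n))) with (exp K) by (field; lra). exact U. }
rewrite pow_mult, K3, Rpow_mult_distr in H2.
assert (He2 : Rpower eta (- 1 - 1) = / eta ^ 2).
{ replace (- 1 - 1) with (- INR 2) by (simpl; ring). rewrite Rpower_Ropp, Rpower_pow by lra. reflexivity. }
rewrite He2, exp_Ropp. assert (HE := exp_pos K). set (E := exp K) in *.
assert (He0 : 0 < eta ^ 2) by lra.
apply Rmult_le_reg_r with (eta ^ 2 * E); [apply Rmult_lt_0_compat; lra|].
replace (2 ^ m / c ^ n * INR (fact (3 * n)) * / eta ^ 2 * (eta ^ 2 * E)) with (2 ^ m / c ^ n * (INR (fact (3 * n)) * E)) by (field; lra).
apply Rle_trans with (2 ^ m / c ^ n * (c ^ n * eta ^ n)); [|apply Rmult_le_compat_l; lra].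
replace (2 ^ m / c ^ n * (c ^ n * eta ^ n)) with (2 ^ m * eta ^ n) by (field; lra).
replace (spectral_weight sigma eta * / E * (eta ^ 2 * E)) with (Rpower (1 + eta ^ 2) (- sigma) * eta) by (unfold spectral_weight; field; lra).
apply Rle_trans with (2 ^ m * (eta ^ 2) ^ m * eta ^ 2).
- apply Rmult_le_compat; [left; apply exp_pos|lra|exact H1|]. replace (eta ^ 2) with (eta * eta) by ring. 
  rewrite <- (Rmult_1_r eta) at 1. apply Rmult_le_compat_l; lra.
- right. unfold n. rewrite pow_add, pow_mult. ring.
Qed.

Lemma diffseq_scale a u v : diffseq (cscale a u) (cscale a v) = cscale a (diffseq u v).
Proof. apply functional_extensionality; intros l. unfold diffseq, cscale, Cminus. ring. Qed.

Definition zero_seq : Z -> C := fun _ => RtoC 0.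

Lemma zero_seq_scale : zero_seq = cscale 0 zero_seq.
Proof. apply functional_extensionality; intros l. unfold cscale, zero_seq. ring. Qed.

Lemma zero_seq_X lam : (forall l, 0 <= lam l) -> inX lam zero_seq /\ normX2 lam zero_seq = 0.
Proof.
intros Hl. split.
- apply (normX_bound lam zero_seq 0 0 Hl (Rle_refl 0)). intros l. unfold zero_seq. rewrite Cmod_0. lra.
- rewrite zero_seq_scale, (proj2 (normX2_scale lam 0 zero_seq)). ring.
Qed.

Lemma zero_ode nu c f eta : ode_sol nu c f eta (fun _ => zero_seq) (fun _ => zero_seq).
Proof.
constructor; unfold zero_seq.
- intros; apply continuous_const.
- intros; apply continuous_const.
- intros; split; reflexivity.
- intros t l _ _. eapply is_derive_value_C; [apply (@is_derive_const R_AbsRing (prod_NormedModule R_AbsRing R_NormedModule R_NormedModule))|].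
  symmetry. change (rhs_theta c eta (fun _ => RtoC 0) (fun _ => RtoC 0) l t = RtoC 0). unfold rhs_theta, coupling. ring.
- intros t l _ _. eapply is_derive_value_C; [apply (@is_derive_const R_AbsRing (prod_NormedModule R_AbsRing R_NormedModule R_NormedModule))|].
  symmetry. change (rhs_G nu c f eta (fun _ => RtoC 0) (fun _ => RtoC 0) l t = RtoC 0). unfold rhs_G, coupling. ring.
Qed.

Section FrequencyFamily.
Variables (nu c : R) (f : R -> R) (lam : Z -> R) (sigma : R).
Hypothesis Hst : standing nu c f lam.

Definition high_freq (eta : R) (u : Z -> C) : Z -> C := if Rle_dec (eta_min c) eta then u else zero_seq.

Definition family_init (eta : R) : Z -> C :=
  high_freq eta (cscale (echo_amplitude nu c f sigma eta) (delta_seq (echo_mode c eta))).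

Definition family_theta (eta t : R) : Z -> C :=
  high_freq eta (cscale (echo_amplitude nu c f sigma eta) (echo_theta nu c f eta t)).

Definition family_limit (eta : R) : Z -> C :=
  high_freq eta (cscale (echo_amplitude nu c f sigma eta) (echo_limit nu c f eta)).

Lemma family_solution eta : exists th G, is_solution nu c f lam eta th G /\ th 0 = family_init eta /\ G 0 = (fun _ => RtoC 0) /\
  (forall th' G', is_solution nu c f lam eta th' G' -> th' 0 = family_init eta -> G' 0 = (fun _ => RtoC 0) ->
     forall t, 0 <= t -> th' t = family_theta eta t).
Proof.
assert (Hgen : forall k th G, ode_sol nu c f eta th G -> growth k th -> growth k G -> th 0 = family_init eta -> G 0 = (fun _ => RtoC 0) ->
  (forall t, 0 <= t -> th t = family_theta eta t) ->
  exists th G, is_solution nu c f lam eta th G /\ th 0 = family_init eta /\ G 0 = (fun _ => RtoC 0) /\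
  (forall th' G', is_solution nu c f lam eta th' G' -> th' 0 = family_init eta -> G' 0 = (fun _ => RtoC 0) ->
     forall t, 0 <= t -> th' t = family_theta eta t)).
{ intros k th G S Gt GG E1 E2 E3. exists th, G. split; [apply (is_solution_of_ode nu c f lam Hst eta k); assumption|].
  split; [exact E1|split; [exact E2|]]. intros th' G' S' F1 F2 t Ht. rewrite <- E3 by exact Ht.
  apply (solution_unique nu c f lam Hst eta k th' G' th G S' S Gt GG ltac:(congruence) ltac:(congruence) t Ht). }
unfold family_init, family_theta, high_freq in *. destruct (Rle_dec (eta_min c) eta) as [H|H].
- destruct (eta_min_large nu c f lam Hst eta H) as [He HK]. assert (He0 : 0 < eta) by lra.
  destruct (echo_ode nu c f lam eta Hst He0 HK) as [S1 [S2 [S3 [S4 S5]]]].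
  set (a := echo_amplitude nu c f sigma eta) in *.
  apply (Hgen (echo_mode c eta) (fun t => cscale a (echo_theta nu c f eta t)) (fun t => cscale a (echo_G nu c f eta t))).
  + apply ode_scale, S1.
  + apply growth_scale, S4.
  + apply growth_scale, S5.
  + rewrite S2. reflexivity.
  + rewrite S3. apply functional_extensionality; intros l. unfold cscale. ring.
  + intros; reflexivity.
- assert (Hz : growth 0 (fun _ => zero_seq)).
  { intros T. exists 0. split; [lra|]. intros t l _. unfold zero_seq. rewrite Cmod_0. lra. }
  apply (Hgen 0%Z (fun _ => zero_seq) (fun _ => zero_seq)); auto. apply zero_ode.
Qed.

Lemma high_freq_X eta u : (eta_min c <= eta -> inX lam u) -> inX lam (high_freq eta u) /\ 0 <= normX2 lam (high_freq eta u).
Proof.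
assert (Hlam := standing_lam_ok nu c f lam Hst). assert (Hl0 : forall l, 0 <= lam l) by (intros l; left; apply Hlam).
intros H. assert (Hin : inX lam (high_freq eta u)).
{ unfold high_freq. destruct (Rle_dec (eta_min c) eta); [auto|apply zero_seq_X, Hl0]. }
split; [exact Hin|apply normX2_nonneg, Hin].
Qed.

Lemma high_freq_integrand (g G : R -> R) (u : R -> Z -> C) : (forall eta, eta_min c <= eta -> inX lam (u eta)) ->
  (forall eta, 0 <= g eta) -> (forall eta, eta_min c <= eta -> g eta * normX2 lam (u eta) <= G eta) ->
  forall eta, 0 <= g eta * normX2 lam (high_freq eta (u eta)) <= if Rle_dec (eta_min c) eta then G eta else 0.
Proof.
assert (Hlam := standing_lam_ok nu c f lam Hst). assert (Hl0 : forall l, 0 <= lam l) by (intros l; left; apply Hlam).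
intros Hu Hg HG eta. split; [apply Rmult_le_pos; [apply Hg|apply high_freq_X, Hu]|].
unfold high_freq. destruct (Rle_dec (eta_min c) eta) as [H|H]; [apply HG, H|].
rewrite (proj2 (zero_seq_X lam Hl0)). lra.
Qed.

Lemma high_freq_diff eta u v : diffseq (high_freq eta u) (high_freq eta v) = high_freq eta (diffseq u v).
Proof.
unfold high_freq. destruct (Rle_dec (eta_min c) eta); [reflexivity|].
apply functional_extensionality; intros l. unfold diffseq, zero_seq, Cminus. ring.
Qed.

Lemma family_init_meas : meas_family family_init.
Proof.
intros l. apply (measC_ext (fun eta => if Rle_dec (eta_min c) eta then
  Cmult (RtoC (echo_amplitude nu c f sigma eta)) (delta_seq (echo_mode c eta) l) else RtoC 0)).
- intros eta. unfold family_init, high_freq. destruct (Rle_dec (eta_min c) eta); reflexivity.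
- apply (measC_echo_amplitude nu c f lam Hst), measC_delta_echo_mode.
Qed.

Lemma family_limit_meas : meas_family family_limit.
Proof.
intros l. apply (measC_ext (fun eta => if Rle_dec (eta_min c) eta then
  Cmult (RtoC (echo_amplitude nu c f sigma eta)) (if Rle_dec (eta_min c) eta then echo_limit nu c f eta l else RtoC 0) else RtoC 0)).
- intros eta. unfold family_limit, high_freq. destruct (Rle_dec (eta_min c) eta); reflexivity.
- apply (measC_echo_amplitude nu c f lam Hst), (measC_echo_limit nu c f lam Hst).
Qed.

Lemma eta_min_ge1 : 1 <= eta_min c.
Proof. destruct Hst as [_ [Hc _]]. unfold eta_min. apply Rmult_le_reg_r with c; [lra|]. unfold Rdiv. rewrite Rmult_assoc, Rinv_l by lra. lra. Qed.

(** With C' = c^(1/3) the exponential weight is exp K for K = (c eta)^(1/3). Against exp (- 2 K) in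
    the data, exp (- K) is left over and absorbs the spectral weight, which may grow polynomially
    when sigma is negative. *)
Lemma family_init_finite : int_finite (fun eta => exp (cbrt c * cbrt (Rabs eta)) * normX2 lam (family_init eta)).
Proof.
destruct (echo_family_bounds nu c f lam sigma Hst) as [B [b [HB [Hb Hbd]]]]. assert (H1 := eta_min_ge1).
destruct (spectral_weight_exp c sigma ltac:(apply Hst)) as [D [HD HDw]].
apply (int_finite_of_lt _ (B * D * (Rpower (eta_min c) (- (1)) / 1) + 1)).
assert (Hpt := high_freq_integrand (fun eta => exp (cbrt c * cbrt (Rabs eta))) (fun eta => B * D * Rpower eta (- 1 - 1))
  (fun eta => cscale (echo_amplitude nu c f sigma eta) (delta_seq (echo_mode c eta)))).
assert (Hpt' : forall eta, 0 <= exp (cbrt c * cbrt (Rabs eta)) * normX2 lam (family_init eta) <=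
  if Rle_dec (eta_min c) eta then B * D * Rpower eta (- 1 - 1) else 0).
{ apply Hpt; clear Hpt.
  - intros eta Heta. apply (proj1 (normX2_scale lam _ _)). apply normX2_delta, (standing_lam_ok nu c f lam Hst).
  - intros eta. left; apply exp_pos.
  - intros eta Heta. destruct (Hbd eta Heta) as [_ [_ [_ [_ [_ HN]]]]]. rewrite (proj2 (normX2_scale lam _ _)).
    assert (He : 0 < eta) by lra.
    replace (cbrt c * cbrt (Rabs eta)) with (cbrt (c * eta)).
    2: { destruct Hst as [_ [Hc _]]. rewrite Rabs_pos_eq by lra. unfold cbrt.
         destruct (Rlt_dec 0 (c * eta)) as [_|Hn]; [|exfalso; apply Hn, Rmult_lt_0_compat; lra].
         destruct (Rlt_dec 0 c); [|lra]. destruct (Rlt_dec 0 eta); [|lra]. symmetry. apply Rpower_mult_distr; lra. }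
    set (K := cbrt (c * eta)) in *. specialize (HDw eta ltac:(lra)). fold K in HDw.
    apply Rle_trans with (exp K * (B * spectral_weight sigma eta * exp (-2 * K))).
    + apply Rmult_le_compat_l; [left; apply exp_pos|exact HN].
    + replace (-2 * K) with (- K + - K) by ring. rewrite exp_plus, Rmult_assoc.
      replace (exp K * (B * (spectral_weight sigma eta * (exp (- K) * exp (- K))))) with
        (B * (spectral_weight sigma eta * exp (- K)) * (exp K * exp (- K))) by ring.
      rewrite <- exp_plus, Rplus_opp_r, exp_0, Rmult_1_r, Rmult_assoc. apply Rmult_le_compat_l; lra. }
apply (int_lt_mono _ (fun eta => if Rle_dec (eta_min c) eta then B * D * Rpower eta (- 1 - 1) else 0)).
- intros eta; apply Hpt'.
- intros eta; apply Hpt'.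
- apply int_power_tail; [lra|lra|apply Rmult_le_pos; lra|lra].
Qed.

Lemma family_converges s : s < sigma -> 
  (forall eta, inX lam (family_limit eta)) /\ int_finite (HsX_integrand lam s family_limit) /\
  forall e, 0 < e -> exists T, 0 <= T /\ forall t, T < t ->
    int_lt (HsX_integrand lam s (fun eta => diffseq (family_theta eta t) (family_limit eta))) e.
Proof.
intros Hs. destruct (echo_family_bounds nu c f lam sigma Hst) as [B [b [HB [Hb Hbd]]]]. assert (H1 := eta_min_ge1).
set (d := sigma - s). assert (Hd : 0 < d) by (unfold d; lra).
set (a := echo_amplitude nu c f sigma) in *.
assert (HVin : forall eta, eta_min c <= eta -> inX lam (cscale (a eta) (echo_limit nu c f eta))).
{ intros eta Heta. apply (proj1 (normX2_scale lam _ _)). exact (proj1 (Hbd eta Heta)). }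
assert (Hg : forall eta, 0 <= Rpower (1 + eta ^ 2) s) by (intros eta; left; apply exp_pos).
split; [|split].
- intros eta. apply high_freq_X, HVin.
- apply (int_finite_of_lt _ (B * (Rpower (eta_min c) (- d) / d) + 1)).
  assert (Hpt := high_freq_integrand (fun eta => Rpower (1 + eta ^ 2) s) (fun eta => B * Rpower eta (- 1 - d)) _ HVin Hg).
  apply (int_lt_mono _ (fun eta => if Rle_dec (eta_min c) eta then B * Rpower eta (- 1 - d) else 0)).
  3: apply int_power_tail; lra.
  1, 2: intros eta; unfold HsX_integrand; apply Hpt; clear eta.
  1, 2: intros eta Heta; rewrite (proj2 (normX2_scale lam _ _)); destruct (Hbd eta Heta) as [_ [HN _]];
    assert (W := spectral_weight_decay sigma s 0 eta ltac:(lra) Hs ltac:(fold d; lra)); fold d in W; rewrite Rpower_O, Rmult_1_r in W by lra;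
    apply Rle_trans with (Rpower (1 + eta ^ 2) s * (B * spectral_weight sigma eta)); [apply Rmult_le_compat_l; [apply Hg|exact HN]|];
    replace (Rpower (1 + eta ^ 2) s * (B * spectral_weight sigma eta)) with (B * (Rpower (1 + eta ^ 2) s * spectral_weight sigma eta)) by ring;
    apply Rmult_le_compat_l; lra.
(* One majorant serves all eta: for 2 eta <= t the rate gives (eta / t)^2 <= (eta / t)^p, and
   otherwise eta / t > 1/2, so that the uniform bound is below 4 (eta / t)^p. The factor t^(- p)
   comes out of the integral. *)
- intros e He. set (p := Rmin d 2). assert (Hp : 0 < p <= 2) by (unfold p; split; [apply Rmin_glb_lt; lra|apply Rmin_r]).
  assert (Hpd : p <= d) by apply Rmin_l.
  set (Q := Rpower (eta_min c) (- d) / d). assert (HQ : 0 < Q) by (apply Rdiv_lt_0_compat; [apply exp_pos|exact Hd]).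
  destruct (Rpower_neg_vanishes (4 * B * Q) p e) as [T [HT HTe]]; [apply Rmult_le_pos; lra|lra|exact He|].
  exists T. split; [lra|]. intros t Ht. specialize (HTe t Ht).
  set (r := Rpower t (- p)) in *. assert (Hr : 0 < r) by apply exp_pos.
  assert (Hin : forall eta, eta_min c <= eta -> inX lam (cscale (a eta) (diffseq (echo_theta nu c f eta t) (echo_limit nu c f eta)))).
  { intros eta Heta. apply (proj1 (normX2_scale lam _ _)). destruct (Hbd eta Heta) as [_ [_ [N _]]]. exact (proj1 (proj2 (N t ltac:(lra)))). }
  assert (Hpt := high_freq_integrand (fun eta => Rpower (1 + eta ^ 2) s) (fun eta => 4 * B * r * Rpower eta (- 1 - d)) _ Hin Hg).
  assert (Hbound : forall eta, eta_min c <= eta -> 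
    Rpower (1 + eta ^ 2) s * normX2 lam (cscale (a eta) (diffseq (echo_theta nu c f eta t) (echo_limit nu c f eta))) <= 4 * B * r * Rpower eta (- 1 - d)).
  { intros eta Heta. rewrite (proj2 (normX2_scale lam _ _)). destruct (Hbd eta Heta) as [_ [_ [N1 [N2 _]]]].
    assert (W := spectral_weight_decay sigma s p eta ltac:(lra) Hs Hpd). fold d in W.
    assert (Hw := spectral_weight_pos sigma eta ltac:(lra)). set (w := spectral_weight sigma eta) in *.
    assert (Hx : 0 < eta / t) by (apply Rdiv_lt_0_compat; lra).
    assert (Ex : Rpower (eta / t) p = Rpower eta p * r).
    { unfold Rdiv, r. rewrite <- Rpower_mult_distr by (try apply Rinv_0_lt_compat; lra). f_equal.
      unfold Rpower. rewrite ln_Rinv by lra. f_equal. ring. }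
    assert (HBw : 0 < B * w) by (apply Rmult_lt_0_compat; lra).
    assert (HN : a eta ^ 2 * normX2 lam (diffseq (echo_theta nu c f eta t) (echo_limit nu c f eta)) <= B * w * (4 * (Rpower eta p * r))).
    { rewrite <- Ex. destruct (Rle_dec (2 * eta) t) as [Hle|Hgt].
      - eapply Rle_trans; [apply (N2 t Hle)|]. apply Rmult_le_compat_l; [lra|].
        assert (Hx1 : eta / t <= 1).
        { apply Rmult_le_reg_r with t; [lra|]. unfold Rdiv. rewrite Rmult_assoc, Rinv_l; lra. }
        assert (S := square_le_Rpower (eta / t) p (conj Hx Hx1) Hp). assert (0 < Rpower (eta / t) p) by apply exp_pos. lra.
      - eapply Rle_trans; [apply (N1 t); lra|]. rewrite <- (Rmult_1_r (B * w)) at 1. apply Rmult_le_compat_l; [lra|].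
        apply Rpower_half_lower; [|exact Hp]. apply Rmult_le_reg_r with t; [lra|]. unfold Rdiv. rewrite Rmult_assoc, Rinv_l; lra. }
    apply Rle_trans with (Rpower (1 + eta ^ 2) s * (B * w * (4 * (Rpower eta p * r)))); [apply Rmult_le_compat_l; [apply Hg|exact HN]|].
    replace (Rpower (1 + eta ^ 2) s * (B * w * (4 * (Rpower eta p * r)))) with (4 * B * r * (Rpower (1 + eta ^ 2) s * w * Rpower eta p)) by ring.
    apply Rmult_le_compat_l; [|exact W]. apply Rmult_le_pos; lra. }
  assert (Ed : forall eta, diffseq (family_theta eta t) (family_limit eta) =
     high_freq eta (cscale (a eta) (diffseq (echo_theta nu c f eta t) (echo_limit nu c f eta)))).
  { intros eta. unfold family_theta, family_limit. rewrite high_freq_diff, diffseq_scale. reflexivity. }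
  apply (int_lt_mono _ (fun eta => if Rle_dec (eta_min c) eta then 4 * B * r * Rpower eta (- 1 - d) else 0)).
  + intros eta; unfold HsX_integrand; rewrite Ed; apply (Hpt Hbound eta).
  + intros eta; unfold HsX_integrand; rewrite Ed; apply (Hpt Hbound eta).
  + apply int_power_tail; [lra|lra|apply Rmult_le_pos; lra|]. fold Q. lra.
Qed.

Lemma family_diverges s : sigma < s -> forall M, exists T, 0 <= T /\ forall t, T < t ->
  int_gt (HsX_integrand lam s (fun eta => family_theta eta t)) M.
Proof.
intros Hs M. destruct (echo_family_bounds nu c f lam sigma Hst) as [B [b [HB [Hb Hbd]]]]. assert (H1 := eta_min_ge1).
(* For t > 2 [eta_min] exp Y the integral of b / eta up to t / 2 exceeds b Y = |M| + 1. *)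
set (Y := (Rabs M + 1) / b). assert (HM := Rle_abs M). assert (HM0 := Rabs_pos M).
assert (HY : 0 < Y) by (apply Rdiv_lt_0_compat; lra).
assert (HeY : 1 < exp Y) by (rewrite <- exp_0; apply exp_increasing, HY).
exists (2 * (eta_min c * exp Y)). split; [apply Rmult_le_pos; [lra|apply Rmult_le_pos; lra]|]. intros t Ht.
assert (Hlt : eta_min c < t / 2).
{ assert (eta_min c * 1 < eta_min c * exp Y) by (apply Rmult_lt_compat_l; lra). lra. }
apply (int_gt_mono (fun x => if Rle_dec (eta_min c) x then if Rle_dec x (t / 2) then b / x else 0 else 0)).
- intros eta. destruct (Rle_dec (eta_min c) eta); [|lra]. destruct (Rle_dec eta (t / 2)); [|lra]. 
  apply Rdiv_le_0_compat; lra.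
- intros eta. unfold HsX_integrand, family_theta.
  assert (Hp : 0 < Rpower (1 + eta ^ 2) s) by apply exp_pos.
  assert (Hin : eta_min c <= eta -> inX lam (cscale (echo_amplitude nu c f sigma eta) (echo_theta nu c f eta t))).
  { intros Heta. apply (proj1 (normX2_scale lam _ _)). destruct (Hbd eta Heta) as [_ [_ [N _]]]. exact (proj1 (N t ltac:(lra))). }
  assert (H0 : 0 <= Rpower (1 + eta ^ 2) s * normX2 lam (high_freq eta (cscale (echo_amplitude nu c f sigma eta) (echo_theta nu c f eta t)))).
  { apply Rmult_le_pos; [lra|apply high_freq_X, Hin]. }
  destruct (Rle_dec (eta_min c) eta) as [Heta|]; [|exact H0]. destruct (Rle_dec eta (t / 2)) as [Het|]; [|exact H0].
  unfold high_freq. destruct (Rle_dec (eta_min c) eta); [|contradiction].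
  rewrite (proj2 (normX2_scale lam _ _)). destruct (Hbd eta Heta) as [_ [_ [_ [_ [N _]]]]].
  specialize (N t ltac:(lra)).
  apply Rle_trans with (Rpower (1 + eta ^ 2) s * (b * spectral_weight sigma eta)); [|apply Rmult_le_compat_l; [lra|exact N]].
  replace (Rpower (1 + eta ^ 2) s * (b * spectral_weight sigma eta)) with (b * (Rpower (1 + eta ^ 2) s * spectral_weight sigma eta)) by ring.
  apply Rmult_le_compat_l; [lra|]. rewrite spectral_weight_shift by lra.
  assert (Hpow := pow2_ge_0 eta).
  assert (HR : 1 <= Rpower (1 + eta ^ 2) (s - sigma)).
  { apply Rle_trans with (Rpower (1 + eta ^ 2) 0); [rewrite Rpower_O; lra|apply Rle_Rpower; lra]. }
  unfold Rdiv. rewrite <- (Rmult_1_l (/ eta)) at 1. apply Rmult_le_compat_r; [left; apply Rinv_0_lt_compat; lra|exact HR].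
- apply int_reciprocal_log; [lra|exact Hlt|lra|].
  assert (HL : ln (eta_min c) + Y < ln (t / 2)).
  { rewrite <- (ln_exp Y) at 1. rewrite <- ln_mult by (try apply exp_pos; lra). apply ln_increasing; [apply Rmult_lt_0_compat; [lra|apply exp_pos]|lra]. }
  apply Rle_lt_trans with (b * Y); [replace (b * Y) with (Rabs M + 1) by (unfold Y; field; lra); lra|].
  apply Rmult_lt_compat_l; lra.
Qed.

Lemma sobolev_threshold : exists C' : R, 0 < C' /\
  exists th0 : R -> Z -> C,
    (forall eta, inX lam (th0 eta)) /\ meas_family th0 /\
    int_finite (fun eta => exp (C' * cbrt (Rabs eta)) * normX2 lam (th0 eta)) /\
    (forall eta, exists th G : R -> Z -> C,
       is_solution nu c f lam eta th G /\ th 0 = th0 eta /\ G 0 = (fun _ => RtoC 0)) /\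
    (forall Th GG : R -> R -> Z -> C,
       (forall eta, is_solution nu c f lam eta (Th eta) (GG eta) /\ Th eta 0 = th0 eta /\ GG eta 0 = (fun _ => RtoC 0)) ->
       (forall s, s < sigma -> HsX_converges lam s (fun t eta => Th eta t)) /\
       (forall s, s > sigma -> HsX_diverges lam s (fun t eta => Th eta t))).
Proof.
exists (cbrt c). split; [apply cbrt_cube, Hst|]. exists family_init. split; [|split; [|split; [|split]]].
- intros eta. apply high_freq_X. intros _. apply (normX2_scale lam _ (delta_seq (echo_mode c eta))).
  apply normX2_delta, (standing_lam_ok nu c f lam Hst).
- exact family_init_meas.
- exact family_init_finite.
- intros eta. destruct (family_solution eta) as [th [G [S1 [S2 [S3 _]]]]]. exists th, G. split; [exact S1|split; assumption].
- intros Th GG HS.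
  assert (HTh : forall t, 0 <= t -> (fun eta => Th eta t) = (fun eta => family_theta eta t)).
  { intros t Ht. apply functional_extensionality; intros eta. destruct (HS eta) as [S1 [S2 S3]].
    destruct (family_solution eta) as [th [G [_ [_ [_ Hun]]]]]. exact (Hun _ _ S1 S2 S3 t Ht). }
  split; intros s Hs.
  + destruct (family_converges s Hs) as [C1 [C2 C3]]. exists family_limit. split; [exact C1|split; [exact family_limit_meas|split; [exact C2|]]].
    intros e He. destruct (C3 e He) as [T [HT C4]]. exists T. intros t Ht. specialize (C4 t Ht).
    replace (fun eta => diffseq (Th eta t) (family_limit eta)) with (fun eta => diffseq (family_theta eta t) (family_limit eta)); [exact C4|].
    apply functional_extensionality; intros eta. assert (E := equal_f (HTh t ltac:(lra)) eta). cbv beta in E. rewrite E. reflexivity.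
  + intros M. destruct (family_diverges s Hs M) as [T [HT C4]]. exists T. intros t Ht. rewrite HTh by lra. exact (C4 t Ht).
Qed.

End FrequencyFamily.

Theorem theorem4p1 (nu c : R) (f : R -> R) (lam : Z -> R)
  (Hst : standing nu c f lam) :
  (* (a) *)
  (forall eta : R, 0 < eta ->
     cbrt (c * eta) > 1000 * Rmax (/ sqrt nu) 1 ->
     let k2 : Z := Int_part (/ 10 * cbrt (c * eta * PI / 2)) in
     (exists th G : R -> Z -> C,
        is_solution nu c f lam eta th G /\
        th 0 = delta_seq k2 /\ G 0 = (fun _ => RtoC 0)) /\
     (forall th G : R -> Z -> C,
        is_solution nu c f lam eta th G ->
        th 0 = delta_seq k2 -> G 0 = (fun _ => RtoC 0) ->
        (forall t, t > 2 * eta ->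
           exp (cbrt (c * eta)) * normX lam (th 0) <= normX lam (th t) /\
           normX lam (th t) <= normX lam (th t) + normX lam (G t) /\
           normX lam (th t) + normX lam (G t)
             <= exp (50 * cbrt (c * eta)) * normX lam (th 0)) /\
        X_converges lam th)) /\
  (* (b) *)
  (forall sigma : R, exists C' : R, 0 < C' /\
     exists th0 : R -> Z -> C,
       (forall eta, inX lam (th0 eta)) /\ meas_family th0 /\
       int_finite (fun eta => exp (C' * cbrt (Rabs eta)) * normX2 lam (th0 eta)) /\
       (forall eta, exists th G : R -> Z -> C,
          is_solution nu c f lam eta th G /\
          th 0 = th0 eta /\ G 0 = (fun _ => RtoC 0)) /\
       (forall Th GG : R -> R -> Z -> C,
          (forall eta, is_solution nu c f lam eta (Th eta) (GG eta) /\
                       Th eta 0 = th0 eta /\ GG eta 0 = (fun _ => RtoC 0)) ->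
          (forall s, s < sigma ->
             HsX_converges lam s (fun t eta => Th eta t)) /\
          (forall s, s > sigma ->
             HsX_diverges lam s (fun t eta => Th eta t)))).
Proof.
split.
- intros eta. apply (echo_chain_norm_inflation nu c f lam Hst eta).
- intros sigma. apply (sobolev_threshold nu c f lam sigma Hst).
Qed.
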